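(* Let $\varphi\colon R\to S$ be a local homomorphism of commutative Noetherian local rings with $\operatorname{fd}_R(S)$ finite, let $\mathfrak n$ be the maximal ideal of $S$, and let $X$ be a homologically finite $R$-complex. Assume that $\varphi$ admits Gorenstein factorizations $R\xrightarrow{\dot\varphi_1}R_1\xrightarrow{\varphi_1'}S$ and $R\xrightarrow{\dot\varphi_2}R_2\xrightarrow{\varphi_2'}S$. Set $d=\operatorname{depth}(\varphi)$ and $d_i=\operatorname{depth}(\dot\varphi_i)$ for $i=1,2$. (a) The $S$-complexes $\mathsf\Sigma^{d_1}\mathbf R\mathrm{Hom}_{R_1}(S,X\otimes^{\mathbf L}_R R_1)$ and $\mathsf\Sigma^{d_2}\mathbf R\mathrm{Hom}_{R_2}(S,X\otimes^{\mathbf L}_R R_2)$ are isomorphic. (b) When $\varphi$ is Gorenstein at $\mathfrak n$, the $S$-complexes $\mathsf\Sigma^{d_i}\mathbf R\mathrm{Hom}_{R_i}(S,X\otimes^{\mathbf L}_R R_i)$ and $\mathsf\Sigma^{d}X\otimes^{\mathbf L}_R S$ are isomorphic. (c) When $\varphi$ is module-finite, the $S$-complexes $\mathsf\Sigma^{d_i}\mathbf R\mathrm{Hom}_{R_i}(S,X\otimes^{\mathbf L}_R R_i)$ and $\mathbf R\mathrm{Hom}_R(S,X)$ are isomorphic. (Here isomorphic means isomorphic in the derived category $\mathsf D(S)$.)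
   Context: Complexes are indexed homologically; $(\mathsf\Sigma^nX)_i=X_{i-n}$. A complex is homologically finite if its total homology is finitely generated. A ring homomorphism $\varphi\colon R\to S$ of local rings with maximal ideals $\mathfrak m,\mathfrak n$ is local if $\varphi(\mathfrak m)\subseteq\mathfrak n$; $\varphi$ is module-finite if $S$ is a finitely generated $R$-module. For a local homomorphism $\varphi$, $\operatorname{depth}(\varphi)=\operatorname{depth}(S)-\operatorname{depth}(R)$. A Gorenstein factorization of a local homomorphism $\varphi$ is a pair of local homomorphisms $R\xrightarrow{\dot\varphi}R'\xrightarrow{\varphi'}S$ of Noetherian local rings with $\varphi=\varphi'\dot\varphi$, $\varphi'$ surjective, and $\dot\varphi$ flat with Gorenstein closed fibre $R'/\mathfrak mR'$. For a local ring $R$ with residue field $k$, the Bass series of a homologically finite complex $X$ is $I_R^X(t)=\sum_{i\in\mathbb Z}\operatorname{rank}_k(\operatorname{H}_{-i}(\mathbf R\mathrm{Hom}_R(k,X)))\,t^i$. For a local homomorphism $\varphi$ with $\operatorname{fd}_R(S)<\infty$ there is a formal Laurent series $I_\varphi(t)$ with nonnegative integer coefficients satisfying $I_S^S(t)=I_R^R(t)I_\varphi(t)$; $\varphi$ is Gorenstein at $\mathfrak n$ if $I_\varphi(t)=t^e$ for some integer $e$ (in which case $e=\operatorname{depth}(\varphi)$). *)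

(* Defs.v *)
From Stdlib Require Import Relations.
From HB Require Import structures.
From mathcomp Require Import all_boot all_order all_algebra.
From mathcomp Require Import boolp classical_sets functions cardinality fsbigop.

Set Implicit Arguments.
Unset Strict Implicit.
Unset Printing Implicit Defensive.

Import Order.TTheory GRing.Theory Num.Theory.
Local Open Scope classical_set_scope.
Local Open Scope quotient_scope.
Local Open Scope ring_scope.

(* Restriction of scalars: the B-module N seen as an A-module along phi. *)
Definition restr (A B : comUnitRingType) (phi : {rmorphism A -> B})
  (N : lmodType B) : Type := N.

Section Restriction.
Variables (A B : comUnitRingType) (phi : {rmorphism A -> B}) (N : lmodType B).
Local Notation T := (restr phi N).

HB.instance Definition _ := GRing.Zmodule.copy T N.

Definition restr_scale (a : A) (x : T) : T := phi a *: (x : N).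

Fact restr_scaleA a b x :
  restr_scale a (restr_scale b x) = restr_scale (a * b) x.
Proof. by rewrite /restr_scale rmorphM scalerA. Qed.

Fact restr_scale1 : left_id 1 restr_scale.
Proof. by move=> x; rewrite /restr_scale rmorph1 scale1r. Qed.

Fact restr_scaleDr : right_distributive restr_scale +%R.
Proof. by move=> a x y; rewrite /restr_scale scalerDr. Qed.

Fact restr_scaleDl x : {morph restr_scale^~ x : a b / a + b}.
Proof. by move=> a b; rewrite /restr_scale rmorphD scalerDl. Qed.

HB.instance Definition _ := GRing.Zmodule_isLmodule.Build A T
  restr_scaleA restr_scale1 restr_scaleDr restr_scaleDl.
End Restriction.

(* [coext psi M] is Hom_A(B, M), with B acting by (b f)(x) = f (x b). *)
Record coext (A B : comUnitRingType) (psi : {rmorphism A -> B})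
    (M : lmodType A) := Coext {
  coext_fun :> B -> M;
  coextD : {morph coext_fun : x y / x + y};
  coextZ : forall a x, coext_fun (psi a * x) = a *: coext_fun x }.

Section Coextension.
Variables (A B : comUnitRingType) (psi : {rmorphism A -> B}).
Variable M : lmodType A.
Local Notation T := (coext psi M).

Lemma coext_eq (f g : T) : f =1 g -> f = g.
Proof.
case: f g => [f fD fZ] [g gD gZ] /= /funext fg.
rewrite fg in fD fZ *; congr Coext; exact: Prop_irrelevance.
Qed.

HB.instance Definition _ := gen_eqMixin T.
HB.instance Definition _ := gen_choiceMixin T.

Definition coext_zero : T.
Proof.
by exists (fun=> 0) => [x y|a x]; rewrite ?addr0 ?scaler0.
Defined.

Definition coext_opp (f : T) : T.
Proof.
exists (fun x => - f x) => [x y|a x]; first by rewrite coextD opprD.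
by rewrite coextZ scalerN.
Defined.

Definition coext_add (f g : T) : T.
Proof.
exists (fun x => f x + g x) => [x y|a x]; first by rewrite !coextD addrACA.
by rewrite !coextZ scalerDr.
Defined.

Definition coext_scale (b : B) (f : T) : T.
Proof.
exists (fun x => f (x * b)) => [x y|a x]; first by rewrite mulrDl coextD.
by rewrite -mulrA coextZ.
Defined.

Fact coext_addA : associative coext_add.
Proof. by move=> f g h; apply: coext_eq => x /=; rewrite addrA. Qed.
Fact coext_addC : commutative coext_add.
Proof. by move=> f g; apply: coext_eq => x /=; rewrite addrC. Qed.
Fact coext_add0 : left_id coext_zero coext_add.
Proof. by move=> f; apply: coext_eq => x /=; rewrite add0r. Qed.
Fact coext_addN : left_inverse coext_zero coext_opp coext_add.
Proof. by move=> f; apply: coext_eq => x /=; rewrite addNr. Qed.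

HB.instance Definition _ := GRing.isZmodule.Build T
  coext_addA coext_addC coext_add0 coext_addN.

Fact coext_scaleA a b f :
  coext_scale a (coext_scale b f) = coext_scale (a * b) f.
Proof. by apply: coext_eq => x /=; rewrite mulrA. Qed.
Fact coext_scale1 : left_id 1 coext_scale.
Proof. by move=> f; apply: coext_eq => x /=; rewrite mulr1. Qed.
Fact coext_scaleDr : right_distributive coext_scale +%R.
Proof. by move=> a f g; apply: coext_eq. Qed.
Fact coext_scaleDl f : {morph coext_scale^~ f : a b / a + b}.
Proof. by move=> a b; apply: coext_eq => x /=; rewrite mulrDr coextD. Qed.

HB.instance Definition _ := GRing.Zmodule_isLmodule.Build B T
  coext_scaleA coext_scale1 coext_scaleDr coext_scaleDl.
End Coextension.

Section CoextensionMap.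
Variables (A B : comUnitRingType) (psi : {rmorphism A -> B}).
Variables (M M' : lmodType A) (f : {linear M -> M'}).

Definition coext_map (g : coext psi M) : coext psi M'.
Proof.
exists (f \o g) => [x y|a x] /=; first by rewrite coextD linearD.
by rewrite coextZ linearZ.
Defined.

Fact coext_map_linear : linear coext_map.
Proof. by move=> a g h; apply: coext_eq => x /=; rewrite linearD. Qed.

HB.instance Definition _ :=
  GRing.isLinear.Build B _ _ _ coext_map coext_map_linear.
End CoextensionMap.

(* Formal sums of pure tensors, modulo the relations defining the tensor
   product over A of M with N restricted along phi; nil is the zero tensor. *)
Inductive tens_eq (A B : comUnitRingType) (phi : {rmorphism A -> B})
    (M : lmodType A) (N : lmodType B) : seq (M * N) -> seq (M * N) -> Prop :=
| tens_refl s : tens_eq phi s s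
| tens_sym s t : tens_eq phi s t -> tens_eq phi t s
| tens_trans s t u : tens_eq phi s t -> tens_eq phi t u -> tens_eq phi s u
| tens_cat s s' t t' : tens_eq phi s s' -> tens_eq phi t t' ->
    tens_eq phi (s ++ t) (s' ++ t')
| tens_catC s t : tens_eq phi (s ++ t) (t ++ s)
| tens_0 n : tens_eq phi [:: (0, n)] [::]
| tens_Dl m m' n : tens_eq phi [:: (m + m', n)] [:: (m, n); (m', n)]
| tens_Dr m n n' : tens_eq phi [:: (m, n + n')] [:: (m, n); (m, n')]
| tens_Z a m n : tens_eq phi [:: (a *: m, n)] [:: (m, phi a *: n)].

Section Tensor.
Variables (A B : comUnitRingType) (phi : {rmorphism A -> B}).
Variables (M : lmodType A) (N : lmodType B).

Definition tens_rel (s t : seq (M * N)) : bool := `[< tens_eq phi s t >].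

Fact tens_rel_equiv : equiv_class_of tens_rel.
Proof.
split=> [s|s t|t s u]; first exact/asboolP/tens_refl.
  by apply/asboolP/asboolP; apply: tens_sym.
by move=> /asboolP st /asboolP tu; apply/asboolP; apply: tens_trans st tu.
Qed.

Canonical tens_equiv : equiv_rel _ := EquivRelPack tens_rel_equiv.

Definition tens := {eq_quot tens_equiv}.

HB.instance Definition _ := Choice.on tens.

Lemma tens_eqP (s t : seq (M * N)) :
  \pi_tens s = \pi_tens t <-> tens_eq phi s t.
Proof.
split=> [/eqmodP/asboolP //|st]; apply/eqmodP; exact/asboolP.
Qed.

Lemma tens_repr (s : seq (M * N)) : tens_eq phi (repr (\pi_tens s)) s.
Proof. by apply/tens_eqP; rewrite reprK. Qed.

Lemma tens_surj (x : tens) : exists s, x = \pi_tens s.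
Proof. by exists (repr x); rewrite reprK. Qed.

Definition tens_zero : tens := \pi_tens [::].
Definition tens_add (x y : tens) : tens := \pi_tens (repr x ++ repr y).
Definition tens_opp (x : tens) : tens := \pi_tens [seq (- p.1, p.2) | p <- repr x].
Definition tens_scale (b : B) (x : tens) : tens :=
  \pi_tens [seq (p.1, b *: p.2) | p <- repr x].

Lemma tens_addE s t :
  tens_add (\pi_tens s) (\pi_tens t) = \pi_tens (s ++ t).
Proof. by apply/tens_eqP/tens_cat; apply: tens_repr. Qed.

Lemma tens_eq_scale b (s t : seq (M * N)) : tens_eq phi s t ->
  tens_eq phi [seq (p.1, b *: p.2) | p <- s] [seq (p.1, b *: p.2) | p <- t].
Proof.
elim=> {s t} /=.
- by move=> s; apply: tens_refl.
- by move=> s t _; apply: tens_sym.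
- by move=> s t u _ + _; apply: tens_trans.
- by move=> s s' t t' _ + _; rewrite !map_cat; apply: tens_cat.
- by move=> s t; rewrite !map_cat; apply: tens_catC.
- by move=> n; apply: tens_0.
- by move=> m m' n; apply: tens_Dl.
- by move=> m n n'; rewrite scalerDr; apply: tens_Dr.
- by move=> a m n; rewrite scalerA mulrC -scalerA; apply: tens_Z.
Qed.

Lemma tens_scaleE b s :
  tens_scale b (\pi_tens s) = \pi_tens [seq (p.1, b *: p.2) | p <- s].
Proof. by apply/tens_eqP/tens_eq_scale/tens_repr. Qed.

Fact tens_addA : associative tens_add.
Proof.
move=> x y z; have [[[s ->] [t ->]] [u ->]] := (tens_surj x, tens_surj y, tens_surj z).
by rewrite !tens_addE catA.
Qed.

Fact tens_addC : commutative tens_add.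
Proof. by move=> x y; apply/tens_eqP/tens_catC. Qed.

Fact tens_add0 : left_id tens_zero tens_add.
Proof. by move=> x; have [s ->] := tens_surj x; rewrite tens_addE. Qed.

Fact tens_addN : left_inverse tens_zero tens_opp tens_add.
Proof.
move=> x; rewrite /tens_opp.
have {2}<- : \pi_tens (repr x) = x by rewrite reprK.
rewrite tens_addE; apply/tens_eqP; elim: (repr x) => [|[m n] s IH] /=; first exact: tens_refl.
set s' := map _ _ in IH *.
apply: (@tens_trans _ _ _ _ _ _ ([:: (- m, n); (m, n)] ++ (s' ++ s))).
  rewrite -[_ :: _ ++ _]/([:: (- m, n)] ++ (s' ++ ([:: (m, n)] ++ s))).
  rewrite -[[:: _; _] ++ _]/([:: (- m, n)] ++ ([:: (m, n)] ++ (s' ++ s))).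
  apply: tens_cat; first exact: tens_refl.
  by rewrite !catA; apply: tens_cat; [apply: tens_catC | apply: tens_refl].
rewrite -[X in tens_eq _ _ X]/([::] ++ [::]); apply: tens_cat => //.
apply: tens_trans (tens_sym (tens_Dl _ _ _ _)) _.
by rewrite addNr; apply: tens_0.
Qed.

HB.instance Definition _ := GRing.isZmodule.Build tens
  tens_addA tens_addC tens_add0 tens_addN.

Fact tens_scaleA a b x : tens_scale a (tens_scale b x) = tens_scale (a * b) x.
Proof.
have [s ->] := tens_surj x; rewrite !tens_scaleE -map_comp; congr (\pi_tens _).
by apply: eq_map => p /=; rewrite scalerA.
Qed.

Fact tens_scale1 : left_id 1 tens_scale.
Proof.
move=> x; have [s ->] := tens_surj x; rewrite tens_scaleE; congr (\pi_tens _).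
by rewrite -[RHS]map_id; apply: eq_map => -[m n] /=; rewrite scale1r.
Qed.

Fact tens_scaleDr : right_distributive tens_scale +%R.
Proof.
move=> a x y; have [[s ->] [t ->]] := (tens_surj x, tens_surj y).
rewrite -[_ + _]/(tens_add _ _) -[RHS]/(tens_add _ _).
by rewrite !(tens_addE, tens_scaleE) map_cat.
Qed.

Fact tens_scaleDl x : {morph tens_scale^~ x : a b / a + b}.
Proof.
move=> a b; have [s ->] := tens_surj x; rewrite -[RHS]/(tens_add _ _).
rewrite !(tens_scaleE, tens_addE); apply/tens_eqP; elim: s => [|[m n] s IH] /=; first exact: tens_refl.
rewrite scalerDl; set sab := map _ _ in IH *.
set sa := map _ _ in IH *; set sb := map _ _ in IH *.
apply: (@tens_trans _ _ _ _ _ _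
  ([:: (m, a *: n)] ++ ([:: (m, b *: n)] ++ (sa ++ sb)))).
  rewrite -[X in tens_eq _ X]/([:: (m, a *: n + b *: n)] ++ sab) catA.
  by apply: tens_cat => //; apply: tens_Dr.
rewrite -[X in tens_eq _ _ X]/([:: (m, a *: n)] ++ (sa ++ ([:: (m, b *: n)] ++ sb))).
apply: tens_cat; first exact: tens_refl.
by rewrite !catA; apply: tens_cat; [apply: tens_catC | apply: tens_refl].
Qed.

HB.instance Definition _ := GRing.Zmodule_isLmodule.Build B tens
  tens_scaleA tens_scale1 tens_scaleDr tens_scaleDl.
End Tensor.
Arguments tens {A B} phi M N.

Section TensorMap.
Variables (A B : comUnitRingType) (phi : {rmorphism A -> B}).
Variables (N : lmodType B) (M M' : lmodType A) (f : {linear M -> M'}).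
Local Notation T := (tens phi M N).
Local Notation T' := (tens phi M' N).

Definition tens_map (x : T) : T' := \pi_T' [seq (f p.1, p.2) | p <- repr x].

Lemma tens_eq_map (s t : seq (M * N)) : tens_eq phi s t ->
  tens_eq phi [seq (f p.1, p.2) | p <- s] [seq (f p.1, p.2) | p <- t].
Proof.
elim=> {s t} /=.
- by move=> s; apply: tens_refl.
- by move=> s t _; apply: tens_sym.
- by move=> s t u _ + _; apply: tens_trans.
- by move=> s s' t t' _ + _; rewrite !map_cat; apply: tens_cat.
- by move=> s t; rewrite !map_cat; apply: tens_catC.
- by move=> n; rewrite linear0; apply: tens_0.
- by move=> m m' n; rewrite linearD; apply: tens_Dl.
- by move=> m n n'; apply: tens_Dr.
- by move=> a m n; rewrite linearZ; apply: tens_Z.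
Qed.

Lemma tens_mapE s : tens_map (\pi_T s) = \pi_T' [seq (f p.1, p.2) | p <- s].
Proof. by apply/tens_eqP/tens_eq_map/tens_repr. Qed.

Fact tens_map_linear : linear tens_map.
Proof.
move=> a x y; have [[s ->] [t ->]] := (tens_surj x, tens_surj y).
rewrite -[a *: _]/(tens_scale _ _) -[_ + _ in LHS]/(tens_add _ _).
rewrite -[RHS]/(tens_add (tens_scale _ _) _).
by rewrite !(tens_scaleE, tens_addE, tens_mapE) map_cat -!map_comp.
Qed.

HB.instance Definition _ :=
  GRing.isLinear.Build B _ _ _ tens_map tens_map_linear.
End TensorMap.

(* Complexes, indexed homologically.  [diff i j] is given for all pairs of
   degrees and is nonzero only for i = j + 1, so that no transport between
   propositionally equal degrees is ever needed. *)
Record cplx (R : comUnitRingType) := Cplx {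
  obj :> int -> lmodType R;
  diff : forall i j, {linear obj i -> obj j};
  diff_shape : forall i j x, i != j + 1 -> diff i j x = 0;
  diff_diff : forall i j k x, diff j k (diff i j x) = 0 }.
Arguments diff {R} c i j.

Section Complexes.
Variable R : comUnitRingType.
Implicit Types X Y Z : cplx R.

Record chain_map X Y := ChainMap {
  chain_fun :> forall i, {linear X i -> Y i};
  chain_funP : forall i j x, chain_fun j (diff X i j x) = diff Y i j (chain_fun i x) }.

Definition is_cycle X n (x : X n) : Prop := diff X n (n - 1) x = 0.
Definition is_boundary X n (x : X n) : Prop := exists y, diff X (n + 1) n y = x.

(* The two clauses: H_n(f) is injective and surjective for every n. *)
Definition quasi_iso X Y (f : chain_map X Y) : Prop := forall n,
  (forall x : X n, is_cycle x -> is_boundary (f n x) -> is_boundary x) /\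
  (forall y : Y n, is_cycle y -> exists2 x : X n, is_cycle x & is_boundary (y - f n x)).

(* Isomorphism in the derived category: by the calculus of fractions, two
   complexes are isomorphic there iff a zigzag of quasi-isomorphisms joins
   them. *)
Definition diso : cplx R -> cplx R -> Prop :=
  clos_refl_sym_trans _ (fun X Y => exists f : chain_map X Y, quasi_iso f).

Definition acyclic X : Prop := forall n (x : X n), is_cycle x -> is_boundary x.

Definition null_homotopic X Y (f : chain_map X Y) : Prop :=
  exists h : forall i j, {linear X i -> Y j}, forall i x,
    f i x = diff Y (i + 1) i (h i (i + 1) x) + h (i - 1) i (diff X i (i - 1) x).

(* Spaltenstein's K-projective and K-injective complexes; replacing Z by its
   shifts, this says that Hom(P, Z), resp. Hom(Z, I), is acyclic. *)
Definition K_projective (P : cplx R) : Prop :=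
  forall Z, acyclic Z -> forall f : chain_map P Z, null_homotopic f.
Definition K_injective (I : cplx R) : Prop :=
  forall Z, acyclic Z -> forall f : chain_map Z I, null_homotopic f.

Definition shift_diff n X i j : {linear X (i - n) -> X (j - n)} :=
  (-1) ^+ `|n|%N \*: diff X (i - n) (j - n).

Fact shift_shape n X i j x : i != j + 1 -> shift_diff n X i j x = 0.
Proof.
by move=> ij; rewrite /= diff_shape ?scaler0// addrAC (inj_eq (addIr _)).
Qed.

Fact shift_diff_diff n X i j k x :
  shift_diff n X j k (shift_diff n X i j x) = 0.
Proof. by rewrite /= linearZ /= diff_diff !scaler0. Qed.

(* (Sigma^n X)_i = X_(i - n), with differential multiplied by (-1)^n. *)
Definition shift (n : int) X : cplx R :=
  Cplx (@shift_shape n X) (@shift_diff_diff n X).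

Definition trivial_mod (M : lmodType R) : Prop := forall x : M, x = 0.

(* The module M as a complex concentrated in degree 0. *)
Definition stalk_obj (M : lmodType R) (i : int) : lmodType R :=
  if i == 0 then M else 'rV[R]_0.

Definition stalk_diff (M : lmodType R) i j :
  {linear stalk_obj M i -> stalk_obj M j} := \0.

Definition stalk (M : lmodType R) : cplx R :=
  @Cplx R (stalk_obj M) (stalk_diff M)
    (fun _ _ _ _ => erefl) (fun _ _ _ _ => erefl).

(* The total homology of X is generated by the classes of finitely many
   homogeneous cycles; [untag 0 F p] is F p if p lives in degree n, else 0. *)
Definition homologically_finite X : Prop :=
  exists (N : nat) (g : 'I_N -> {n : int & X n}),
    (forall l, is_cycle (tagged (g l))) /\
    forall n (x : X n), is_cycle x -> exists c : 'I_N -> R,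
      is_boundary (x - \sum_(l < N) untag 0 (fun y : X n => c l *: y) (g l)).

End Complexes.

Section DerivedFunctors.
Variables (A B : comUnitRingType) (phi : {rmorphism A -> B}).

Fact coext_shape (I : cplx A) i j (x : coext phi (I i)) :
  i != j + 1 -> coext_map (diff I i j) x = 0.
Proof. by move=> ij; apply: coext_eq => b /=; rewrite diff_shape. Qed.

Fact coext_diff_diff (I : cplx A) i j k (x : coext phi (I i)) :
  coext_map (diff I j k) (coext_map (diff I i j) x) = 0.
Proof. by apply: coext_eq => b /=; rewrite diff_diff. Qed.

(* The complex of B-modules Hom_A(B, I). *)
Definition coext_cplx (I : cplx A) : cplx B :=
  @Cplx B (fun i => coext phi (I i)) (fun i j => coext_map (diff I i j))
    (@coext_shape I) (@coext_diff_diff I).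

Lemma tens_map_zero (N : lmodType B) (M M' : lmodType A)
  (f : {linear M -> M'}) (x : tens phi M N) :
  (forall m, f m = 0) -> tens_map f x = 0.
Proof.
move=> f0; apply/tens_eqP; elim: (repr x) => [|[m n] s IH] /=.
  exact: tens_refl.
rewrite f0 -[X in tens_eq _ X]/([:: (0, n)] ++ _).
by apply: (@tens_cat _ _ _ _ _ _ [::] _ [::]) => //; apply: tens_0.
Qed.

Fact tens_shape (P : cplx A) i j (x : tens phi (P i) B^o) :
  i != j + 1 -> tens_map (diff P i j) x = 0.
Proof. by move=> ij; apply: tens_map_zero => m; rewrite diff_shape. Qed.

Fact tens_diff_diff (P : cplx A) i j k (x : tens phi (P i) B^o) :
  tens_map (diff P j k) (tens_map (diff P i j) x) = 0.
Proof.
have [s ->] := tens_surj x; rewrite !tens_mapE -map_comp.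
have := @tens_map_zero B^o _ _ (diff P j k \o diff P i j) (\pi_(tens phi (P i) B^o) s).
by rewrite tens_mapE; apply=> m /=; rewrite diff_diff.
Qed.

(* The complex of B-modules P (x)_A B. *)
Definition tens_cplx (P : cplx A) : cplx B :=
  @Cplx B (fun i => tens phi (P i) B^o) (fun i j => tens_map (diff P i j))
    (@tens_shape P) (@tens_diff_diff P).

(* Y represents RHom_A(B, X) in D(B). *)
Definition is_RHom (X : cplx A) (Y : cplx B) : Prop :=
  exists I : cplx A, exists f : chain_map X I,
    [/\ K_injective I, quasi_iso f & diso (coext_cplx I) Y].

(* Y represents X (x)^L_A B in D(B). *)
Definition is_LTensor (X : cplx A) (Y : cplx B) : Prop :=
  exists P : cplx A, exists f : chain_map P X,
    [/\ K_projective P, quasi_iso f & diso (tens_cplx P) Y].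

(* The B-module N is flat over A. *)
Definition flat_over (N : lmodType B) : Prop :=
  forall (M M' : lmodType A) (f : {linear M -> M'}),
    injective f -> injective (tens_map f : tens phi M N -> tens phi M' N).

End DerivedFunctors.

Definition flat_module (R : comUnitRingType) (M : lmodType R) : Prop :=
  flat_over (idfun : {rmorphism R -> R}) M.

Definition injective_module (R : comUnitRingType) (E : lmodType R) : Prop :=
  forall (M M' : lmodType R) (f : {linear M -> M'}) (g : {linear M -> E}),
    injective f -> exists h : {linear M' -> E}, forall x, h (f x) = g x.

Definition finite_flat_dim (R : comUnitRingType) (M : lmodType R) : Prop :=
  exists (n : nat) (F : cplx R) (f : chain_map F (stalk M)),
    [/\ forall i, flat_module (F i),
        forall i, ~~ (0 <= i <= n%:Z) -> trivial_mod (F i) & quasi_iso f].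

Definition finite_inj_dim (R : comUnitRingType) (M : lmodType R) : Prop :=
  exists (n : nat) (E : cplx R) (f : chain_map (stalk M) E),
    [/\ forall i, injective_module (E i),
        forall i, ~~ (- n%:Z <= i <= 0) -> trivial_mod (E i) & quasi_iso f].

Section LocalRings.
Variable R : comUnitRingType.

(* The ideal generated by s. *)
Definition ideal_gen (s : seq R) : set R :=
  [set x | exists c : 'I_(size s) -> R, x = \sum_i c i * s`_i].

Definition is_ideal (I : set R) : Prop :=
  [/\ I 0, forall x y, I x -> I y -> I (x + y) & forall a x, I x -> I (a * x)].

Definition noetherian : Prop :=
  forall I : set R, is_ideal I -> exists s : seq R, I = ideal_gen s.

(* For a local ring this is its maximal ideal. *)
Definition max_ideal : set R := [set x | x \isn't a GRing.unit].

Definition local_ring : Prop := is_ideal max_ideal.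

Definition noetherian_local : Prop := noetherian /\ local_ring.

Definition regular_seq (s : seq R) : Prop := forall i, (i < size s)%N ->
  max_ideal s`_i /\
  forall x, ideal_gen (take i s) (s`_i * x) -> ideal_gen (take i s) x.

(* The maximal length of a regular sequence in the maximal ideal; when R is
   Noetherian and local this maximum exists. *)
Definition depth : nat := xget 0%N [set n |
  (exists2 s, regular_seq s & size s = n) /\
  (forall s, regular_seq s -> (size s <= n)%N)].

Definition gorenstein_local : Prop :=
  noetherian_local /\ finite_inj_dim (R^o : lmodType R).

(* pi presents the field k as the residue field of R. *)
Definition residue_field (k : fieldType) (pi : {rmorphism R -> k}) : Prop :=
  (forall y, exists x, pi x = y) /\ (forall x, pi x = 0 <-> max_ideal x).

End LocalRings.

(* H_n(Z) is a k-vector space of rank r: it has a basis of r classes. *)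
Definition homology_rank (k : fieldType) (Z : cplx k) (n : int) (r : nat) :=
  exists z : 'I_r -> Z n, (forall l, is_cycle (z l)) /\
    forall x : Z n, is_cycle x ->
      exists! c : 'rV[k]_r, is_boundary (x - \sum_l c 0 l *: z l).

(* b i is the coefficient of t^i in the Bass series of X. *)
Definition bass_series (R : comUnitRingType) (X : cplx R) (b : int -> nat) :=
  exists (k : fieldType) (pi : {rmorphism R -> k}) (Z : cplx k),
    [/\ residue_field pi, is_RHom pi X Z &
        forall i : int, homology_rank Z (- i) (b i)].

(* Formal Laurent series with coefficients in nat, as functions int -> nat;
   the sum below has finite support for two such series. *)
Definition laurent (a : int -> nat) : Prop :=
  exists N : int, forall i, i < N -> a i = 0%N.

Definition laurent_mul (a b : int -> nat) (n : int) : nat :=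
  (\sum_(i \in [set: int]) (a i * b (n - i)%R))%N.

Definition laurent_monomial (e i : int) : nat := (i == e).

Section LocalHomomorphisms.
Variables (R S : comUnitRingType) (phi : {rmorphism R -> S}).

Definition local_hom : Prop := forall x, max_ideal x -> max_ideal (phi x).

Definition module_finite : Prop := exists s : seq S, forall y,
  exists c : 'I_(size s) -> R, y = \sum_i phi (c i) * s`_i.

Definition finite_fd : Prop := finite_flat_dim (restr phi S^o).

Definition flat_hom : Prop := flat_over phi (S^o : lmodType S).

Definition depth_hom (_ : {rmorphism R -> S}) : int := (depth S)%:Z - (depth R)%:Z.

(* The extension to S of the maximal ideal of R. *)
Definition max_ideal_ext : set S := [set y | exists s : seq (S * R),
  (forall p, p \in s -> max_ideal p.2) /\ y = \sum_(p <- s) p.1 * phi p.2].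

Definition gorenstein_closed_fibre : Prop :=
  exists (F : comUnitRingType) (pi : {rmorphism S -> F}),
    [/\ forall z, exists y, pi y = z,
        forall y, pi y = 0 <-> max_ideal_ext y & gorenstein_local F].

(* L is the Bass series of the homomorphism R -> S; like its depth, it depends
   only on R and S. *)
Definition bass_series_hom (_ : {rmorphism R -> S}) (L : int -> nat) : Prop :=
  laurent L /\ exists bR bS : int -> nat,
    [/\ bass_series (stalk R^o) bR, bass_series (stalk S^o) bS &
        bS =1 laurent_mul bR L].

(* phi is Gorenstein at the maximal ideal of S. *)
Definition gorenstein_at : Prop :=
  exists e : int, bass_series_hom phi (laurent_monomial e).

End LocalHomomorphisms.

Definition gorenstein_factorization (R R' S : comUnitRingType)
    (phi : {rmorphism R -> S}) (phid : {rmorphism R -> R'})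
    (phi' : {rmorphism R' -> S}) : Prop :=
  [/\ noetherian_local R', local_hom phid /\ local_hom phi',
      forall x, phi x = phi' (phid x), forall y, exists x, phi' x = y &
      flat_hom phid /\ gorenstein_closed_fibre phid].

(* Main.v *)
(* Let A be R_1, R_2 or, for module-finite phi, R itself; I an injective
   resolution of A; C = Hom_A(S, I); L a minimal free resolution of C over S.
   (1) RHom_A(S, X (x)_R A) is X (x)_R L. With G an A-free resolution of S, M
   one of L and c : M -> Hom(G, A) the induced map, the cone W of c stays exact
   after tensoring with any finitely generated R-module, because fd_R(S) is
   finite, and hence after tensoring with a free resolution of X.
   (2) The dual of W is exact modulo the maximal ideal of R because the closed
   fibre is Gorenstein, hence exact. So D -> Hom_S(Hom_S(D, C), C) is an
   isomorphism in the derived category for D = S or D = C' coming from another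
   factorization.
   (3) Resolve Hom_S(C', C) by a minimal free complex N; then C' is Hom_S(N, C).
   By flat base change the Bass numbers of C and C' are both shifts of those of
   R, since Ext_F(l, F) is one-dimensional for the Gorenstein fibre F. As N has
   zero differential modulo the maximal ideal, comparing Bass numbers forces N
   to be free of rank one in a single degree, so C' is a shift of C. For phi
   Gorenstein, S itself may take the place of C'.
   (4) The shift is found from depth: depth A is the least n with
   Ext^n_A(k, A) nonzero. *)
Require Import Defs.
From HB Require Import structures.
From mathcomp Require Import all_boot all_order all_algebra.
From mathcomp Require Import boolp classical_sets functions cardinality fsbigop.
From mathcomp Require Import zify ring.
Set Implicit Arguments.
Unset Strict Implicit.
Unset Printing Implicit Defensive.
Import Order.TTheory GRing.Theory Num.Theory.
Local Open Scope ring_scope.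

(** * Signs, submodules and quotients *)

(** Finite flat dimension enters only through the residue field k of R. Since Tor over R of k and S
    vanishes in high degrees, G is exact there on the closed fibre F; F has finite injective
    dimension, so the dual of G is exact on the fibre in very low degrees. There M vanishes, hence
    so far down the cone W is exact on the fibre. Because R -> A is flat and local and all modules
    are finite free over A, exactness on the fibre upgrades to exactness with every finitely
    generated R-module as coefficients (cyclic filtrations, Noetherian induction, Nakayama), and
    dimension shifting carries this upwards, W itself being exact. The main obstacle is the lack of
    bounds: W is unbounded on both sides, and free resolutions and injective resolutions are
    unbounded in opposite directions. Total complexes are products, so they preserve
    quasi-isomorphisms only when a bound lets a recursion start; each use has to produce such a
    bound. No derived functor is formed: maps are lifted out of bounded below free complexes or
    extended into K-injective ones, and two-out-of-three does the rest. *)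

Definition sg (V : zmodType) (n : int) (x : V) : V :=
  if odd (absz (n)) then - x else x.

Section Sign.
Variables (V : zmodType).
Implicit Types (n m : int) (x y : V).

Lemma sg_par n m x : odd (absz (n)) = odd (absz (m)) -> sg n x = sg m x.
Proof. by rewrite /sg => ->. Qed.
Lemma sg_idx0 x : sg 0 x = x. Proof. by []. Qed.
Lemma sg_zero n : sg n (0 : V) = 0. Proof. by rewrite /sg oppr0; case: odd. Qed.
Lemma sg_add n x y : sg n (x + y) = sg n x + sg n y.
Proof. by rewrite /sg opprD; case: odd. Qed.
Lemma sg_opp n x : sg n (- x) = - sg n x.
Proof. by rewrite /sg; case: odd. Qed.
Lemma sg_sub n x y : sg n (x - y) = sg n x - sg n y.
Proof. by rewrite sg_add sg_opp. Qed.
Lemma sg_deg n m x : sg (n + m) x = sg n (sg m x).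
Proof.
rewrite /sg; have -> : odd (absz (n + m)) = odd (absz (n)) (+) odd (absz (m)) by lia.
by case: (odd (absz (n))); case: (odd (absz (m))); rewrite /= ?opprK.
Qed.
Lemma sg_inv n x : sg n (sg n x) = x.
Proof. by rewrite /sg; case: odd; rewrite ?opprK. Qed.
Lemma sg_succ n x : sg (n + 1) x = - sg n x.
Proof. by rewrite addrC sg_deg. Qed.
Lemma sg_pred n x : sg (n - 1) x = - sg n x.
Proof. by rewrite addrC sg_deg. Qed.
Lemma sg_eq0 n x : sg n x = 0 -> x = 0.
Proof. by move=> h; rewrite -(sg_inv n x) h sg_zero. Qed.
End Sign.

Lemma raddf_sg (V W : zmodType) (f : {additive V -> W}) n x :
  f (sg n x) = sg n (f x).
Proof. by rewrite /sg; case: odd; rewrite ?raddfN. Qed.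

Lemma sg_lin (A : pzRingType) (V : lmodType A) n (a : A) (x : V) :
  sg n (a *: x) = a *: sg n x.
Proof. by rewrite /sg; case: odd; rewrite ?scalerN. Qed.

Lemma sg_scale (A : pzRingType) (V : lmodType A) n (x : V) :
  (-1) ^+ absz n *: x = sg n x.
Proof. by rewrite -signr_odd /sg; case: odd; rewrite ?expr0 ?expr1 ?scale1r ?scaleN1r. Qed.

Definition submodule (A : comUnitRingType) (M : lmodType A) (P : M -> Prop) :=
  P 0 /\ forall a x y, P x -> P y -> P (a *: x + y).

Section SubmoduleFacts.
Variables (A : comUnitRingType) (M : lmodType A) (P : M -> Prop).
Hypothesis sP : submodule P.
Lemma subm0 : P 0. Proof. exact: sP.1. Qed.
Lemma submD x y : P x -> P y -> P (x + y).
Proof. by move=> hx hy; rewrite -[x]scale1r; apply: sP.2. Qed.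
Lemma submZ a x : P x -> P (a *: x).
Proof. by move=> hx; rewrite -[_ *: _]addr0; apply: sP.2 => //; exact: sP.1. Qed.
Lemma submN x : P x -> P (- x).
Proof. by move=> hx; rewrite -scaleN1r; apply: submZ. Qed.
Lemma submB x y : P x -> P y -> P (x - y).
Proof. by move=> hx hy; apply: submD => //; apply: submN. Qed.
Lemma subm_sum (I : Type) (r : seq I) (Q : pred I) (F : I -> M) :
  (forall i, Q i -> P (F i)) -> P (\sum_(i <- r | Q i) F i).
Proof. by move=> h; apply: big_ind => //; [exact: subm0|exact: submD]. Qed.
End SubmoduleFacts.

(* The submodule of the elements satisfying [P]; [P] is a record field rather
   than the type index so that closure is part of the data. *)
Record submod_pred (A : comUnitRingType) (M : lmodType A) := SubmodPred {
  sm_pred :> M -> Prop; sm_ax : submodule sm_pred }.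

Record subm (A : comUnitRingType) (M : lmodType A) (P : submod_pred M) :=
  Subm { smval :> M; smvalP : P smval }.

Section SubmoduleType.
Variables (A : comUnitRingType) (M : lmodType A) (P : submod_pred M).
Local Notation T := (subm P).
Lemma subm_eq (x y : T) : smval x = smval y -> x = y.
Proof.
by case: x y => [x hx] [y hy] /= e; subst y; congr Subm; exact: Prop_irrelevance.
Qed.
HB.instance Definition _ := gen_eqMixin T.
HB.instance Definition _ := gen_choiceMixin T.
Definition subm_zero : T := Subm (subm0 (sm_ax P)).
Definition subm_opp (x : T) : T := Subm (submN (sm_ax P) (smvalP x)).
Definition subm_add (x y : T) : T := Subm (submD (sm_ax P) (smvalP x) (smvalP y)).
Definition subm_scale (a : A) (x : T) : T := Subm (submZ (sm_ax P) a (smvalP x)).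
Fact subm_addA : associative subm_add.
Proof. by move=> x y z; apply: subm_eq; rewrite /= addrA. Qed.
Fact subm_addC : commutative subm_add.
Proof. by move=> x y; apply: subm_eq; rewrite /= addrC. Qed.
Fact subm_add0 : left_id subm_zero subm_add.
Proof. by move=> x; apply: subm_eq; rewrite /= add0r. Qed.
Fact subm_addN : left_inverse subm_zero subm_opp subm_add.
Proof. by move=> x; apply: subm_eq; rewrite /= addNr. Qed.
HB.instance Definition _ := GRing.isZmodule.Build T
  subm_addA subm_addC subm_add0 subm_addN.
Fact subm_scaleA a b x : subm_scale a (subm_scale b x) = subm_scale (a * b) x.
Proof. by apply: subm_eq; rewrite /= scalerA. Qed.
Fact subm_scale1 : left_id 1 subm_scale.
Proof. by move=> x; apply: subm_eq; rewrite /= scale1r. Qed.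
Fact subm_scaleDr : right_distributive subm_scale +%R.
Proof. by move=> a x y; apply: subm_eq; rewrite /= scalerDr. Qed.
Fact subm_scaleDl x : {morph subm_scale^~ x : a b / a + b}.
Proof. by move=> a b; apply: subm_eq; rewrite /= scalerDl. Qed.
HB.instance Definition _ := GRing.Zmodule_isLmodule.Build A T
  subm_scaleA subm_scale1 subm_scaleDr subm_scaleDl.
Fact smval_linear : linear (@smval A M P). Proof. by []. Qed.
HB.instance Definition _ := GRing.isLinear.Build A _ _ _ (@smval A M P) smval_linear.
End SubmoduleType.

Section SubmoduleMap.
Variables (A : comUnitRingType) (M N : lmodType A).
Variables (P : submod_pred M) (Q : submod_pred N) (f : {linear M -> N}).
Hypothesis fPQ : forall x, P x -> Q (f x).
Definition subm_map (x : subm P) : subm Q := Subm (fPQ (smvalP x)).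
Fact subm_map_linear : linear subm_map.
Proof. by move=> a x y; apply: subm_eq; rewrite /= linearP. Qed.
HB.instance Definition _ := GRing.isLinear.Build A _ _ _ subm_map subm_map_linear.
End SubmoduleMap.

Section Quotient.
Local Open Scope quotient_scope.
Variables (A : comUnitRingType) (M : lmodType A) (P : submod_pred M).
Let sP := sm_ax P.
Definition quo_rel (x y : M) : bool := `[< P (x - y) >].
Fact quo_rel_equiv : equiv_class_of quo_rel.
Proof.
split=> [x|x y|y x z]; first by apply/asboolP; rewrite subrr; exact: subm0.
  by apply/asboolP/asboolP => h; rewrite -opprB; apply: submN.
move=> /asboolP h /asboolP h'; apply/asboolP.
by rewrite -[x](subrK y) -addrA; apply: submD.
Qed.
Canonical quo_equiv : equiv_rel _ := EquivRelPack quo_rel_equiv.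
Definition quom := {eq_quot quo_equiv}.
HB.instance Definition _ := Choice.on quom.
Definition qpi (x : M) : quom := \pi_quom x.
Lemma qpiP x y : qpi x = qpi y <-> P (x - y).
Proof. by split=> [/eqmodP/asboolP|h] //; apply/eqmodP/asboolP. Qed.
Lemma qpi_surj (x : quom) : exists y, x = qpi y.
Proof. by exists (repr x); rewrite /qpi reprK. Qed.
Lemma qreprK x : qpi (repr x) = x.
Proof. by rewrite /qpi reprK. Qed.
Lemma qpi_repr x : P (repr (qpi x) - x).
Proof. by apply/qpiP; rewrite /qpi reprK. Qed.
Definition quo_zero : quom := qpi 0.
Definition quo_opp (x : quom) : quom := qpi (- repr x).
Definition quo_add (x y : quom) : quom := qpi (repr x + repr y).
Definition quo_scale a (x : quom) : quom := qpi (a *: repr x).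
Lemma quo_oppE x : quo_opp (qpi x) = qpi (- x).
Proof. by apply/qpiP; rewrite -opprD; apply: submN => //; apply: qpi_repr. Qed.
Lemma quo_addE x y : quo_add (qpi x) (qpi y) = qpi (x + y).
Proof. by apply/qpiP; rewrite opprD addrACA; apply: submD => //; apply: qpi_repr. Qed.
Lemma quo_scaleE a x : quo_scale a (qpi x) = qpi (a *: x).
Proof. by apply/qpiP; rewrite -scalerBr; apply: submZ => //; apply: qpi_repr. Qed.
Fact quo_addA : associative quo_add.
Proof.
move=> x y z; have [[[x' ->] [y' ->]] [z' ->]] := (qpi_surj x, qpi_surj y, qpi_surj z).
by rewrite !quo_addE addrA.
Qed.
Fact quo_addC : commutative quo_add.
Proof. by move=> x y; rewrite /quo_add addrC. Qed.
Fact quo_add0 : left_id quo_zero quo_add.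
Proof. by move=> x; have [y ->] := qpi_surj x; rewrite quo_addE add0r. Qed.
Fact quo_addN : left_inverse quo_zero quo_opp quo_add.
Proof. by move=> x; have [y ->] := qpi_surj x; rewrite quo_oppE quo_addE addNr. Qed.
HB.instance Definition _ := GRing.isZmodule.Build quom
  quo_addA quo_addC quo_add0 quo_addN.
Fact quo_scaleA a b x : quo_scale a (quo_scale b x) = quo_scale (a * b) x.
Proof. by have [y ->] := qpi_surj x; rewrite !quo_scaleE scalerA. Qed.
Fact quo_scale1 : left_id 1 quo_scale.
Proof. by move=> x; have [y ->] := qpi_surj x; rewrite quo_scaleE scale1r. Qed.
Fact quo_scaleDr : right_distributive quo_scale +%R.
Proof.
move=> a x y; have [[x' ->] [y' ->]] := (qpi_surj x, qpi_surj y).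
rewrite -[_ + _]/(quo_add _ _) -[RHS]/(quo_add _ _).
by rewrite !(quo_addE, quo_scaleE) scalerDr.
Qed.
Fact quo_scaleDl x : {morph quo_scale^~ x : a b / a + b}.
Proof.
move=> a b; have [y ->] := qpi_surj x; rewrite -[RHS]/(quo_add _ _).
by rewrite !(quo_addE, quo_scaleE) scalerDl.
Qed.
HB.instance Definition _ := GRing.Zmodule_isLmodule.Build A quom
  quo_scaleA quo_scale1 quo_scaleDr quo_scaleDl.
Fact qpi_linear : linear qpi.
Proof.
by move=> a x y; rewrite -[RHS]/(quo_add (quo_scale a _) _) quo_scaleE quo_addE.
Qed.
HB.instance Definition _ := GRing.isLinear.Build A _ _ _ qpi qpi_linear.
Lemma qpi0P x : qpi x = 0 <-> P x.
Proof. by have := qpiP x 0; rewrite subr0 linear0. Qed.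
End Quotient.
Arguments qpi {A M} P x.

Section QuotientMap.
Variables (A : comUnitRingType) (M N : lmodType A) (P : submod_pred M).
Variable f : {linear M -> N}.
Definition quo_lift (_ : forall x, P x -> f x = 0) (x : quom P) : N := f (repr x).
Variable fP : forall x, P x -> f x = 0.
Lemma quo_liftE x : quo_lift fP (qpi P x) = f x.
Proof. by apply/eqP; rewrite -subr_eq0 -linearB fP //; apply: qpi_repr. Qed.
Fact quo_lift_linear : linear (quo_lift fP).
Proof.
move=> a x y; have [[x' ->] [y' ->]] := (qpi_surj x, qpi_surj y).
by rewrite -linearP !quo_liftE linearP.
Qed.
HB.instance Definition _ :=
  GRing.isLinear.Build A _ _ _ (quo_lift fP) quo_lift_linear.
End QuotientMap.

(** * Recursion along the integers and total complexes *)

Section IntRec.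
Variables (T : int -> Type) (dflt : forall i, T i) (b : int).
Variables (Inv : forall i, T i -> Prop) (Rel : forall i j, T i -> T j -> Prop).
Hypothesis inv0 : Inv (dflt b).
Hypothesis step : forall (i j : int) (t : T i), j = i + 1 -> b <= i -> Inv t ->
  exists2 t' : T j, Rel t t' & Inv t'.

(** Dependent choice over the integers: [Inv] is what makes the next step possible, [Rel] is what
    the finished family remembers about neighbours. The recursion runs over natural numbers [k] at
    the integer [b + k], and only its outcome is transported to a family over all integers. *)
Lemma int_rec : exists h : forall i, T i,
  [/\ forall i, i <= b -> h i = dflt i,
      forall i, b <= i -> Inv (h i) &
      forall i j : int, j = i + 1 -> b <= i -> Rel (h i) (h j)].
Proof.
have st (k : nat) (t : {t : T (b + k%:Z) | Inv t}) :
    {t' : {t' : T (b + k.+1%:Z) | Inv t'} | Rel (projT1 t) (projT1 t')}.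
  case: t => t it; apply: cid.
  have [||t' r i] := step (j := b + k.+1%:Z) _ _ it; [lia|lia|].
  by exists (exist _ t' i).
have b0 : b + 0%:Z = b by rewrite addr0.
have i0 : Inv (eq_rect b T (dflt b) _ (esym b0)) by case: _ / (esym b0).
pose s0 : {t : T (b + 0%:Z) | Inv t} := exist _ _ i0.
pose s := nat_rect (fun k => {t : T (b + k%:Z) | Inv t}) s0 (fun k t => projT1 (st k t)).
have e (i : int) : b <= i -> b + (absz (i - b))%:Z = i by lia.
pose h (i : int) : T i := match pselect (is_true (b <= i)) with
  | left p => eq_rect _ T (projT1 (s (absz (i - b)))) _ (e i p)
  | right _ => dflt i end.
have hE k : h (b + k%:Z) = projT1 (s k).
  rewrite /h; case: pselect => [p|]; last by lia.
  move: (e _ p); have -> : absz (b + k%:Z - b)%R = k by lia.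
  by move=> e'; rewrite (eq_irrelevance e' erefl).
have wi (i : int) : b <= i -> exists k, i = b + k%:Z by move=> p; exists (absz (i - b)); lia.
exists h; split.
- move=> i ib; case: (ltgtP i b) ib => [ib _||->]; [|by lia|].
    by rewrite /h; case: pselect => // p; lia.
  have er c (q : b = c) : eq_rect b T (dflt b) c q = dflt c by case: _ / q.
  by move: (hE 0%N); rewrite /= er addr0.
- by move=> i /wi[k ->]; rewrite hE; case: (s k).
- move=> i j -> /wi[k ->]; have -> : b + k%:Z + 1 = b + k.+1%:Z by lia.
  by rewrite !hE /=; case: (st k (s k)).
Qed.
End IntRec.

(** The flag switches between homological and cohomological indexing: [dgn s i] is the homological
    degree of the index [i], and [nx s i] is the index one homological degree higher. *)
Definition dgn (s : bool) (i : int) : int := if s then - i else i.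
Definition nx (s : bool) (i : int) : int := if s then i - 1 else i + 1.
Lemma dgn_nx s i : dgn s (nx s i) = dgn s i + 1.
Proof. by rewrite /dgn /nx; case: s; lia. Qed.

(* Relative acyclicity of total complexes: [T], [T'] are double complexes whose
   columns are quasi-isomorphic along [f], and the total chain [y] (degree [t])
   with [f y = d z] is killed by moving up the columns. *)
Section TotalRelative.
Variables (s : bool) (T T' : int -> int -> zmodType).
Variables (dh : forall (i i' j : int), {additive T i j -> T i' j})
  (dv : forall (i j j' : int), {additive T i j -> T i j'}).
Variables (dh' : forall (i i' j : int), {additive T' i j -> T' i' j})
  (dv' : forall (i j j' : int), {additive T' i j -> T' i j'}).
Variable f : forall (i j : int), {additive T i j -> T' i j}.
Hypothesis anti : forall (i i' j j' : int) x, dv i' j j' (dh i i' j x) = - dh i i' j' (dv i j j' x).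
Hypothesis anti' : forall (i i' j j' : int) x, dv' i' j j' (dh' i i' j x) = - dh' i i' j' (dv' i j j' x).
Hypothesis hh : forall i i' i'' j x, dh i' i'' j (dh i i' j x) = 0.
Hypothesis hh' : forall i i' i'' j x, dh' i' i'' j (dh' i i' j x) = 0.
Hypothesis fh : forall i i' j x, f i' j (dh i i' j x) = dh' i i' j (f i j x).
Variables (t b : int) (y : forall (i j : int), T i j) (z : forall (i j : int), T' i j).
Local Notation dg := (dgn s).
Hypothesis ycyc : forall (i i' j j' : int), i' = nx s i -> j' = j + 1 -> dg i + j = t - 1 ->
  dh i' i j (y i' j) + dv i j' j (y i j') = 0.
Hypothesis zcyc : forall (i i' j j' : int), i' = nx s i -> j' = j + 1 -> dg i + j = t ->
  dh' i' i j (z i' j) + dv' i j' j (z i j') = f i j (y i j).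
Hypothesis y0 : forall (i j : int), j < b -> dg i + j = t -> y i j = 0.
Hypothesis z0 : forall (i j : int), j <= b -> dg i + j = t + 1 -> z i j = 0.
Hypothesis cex : forall (i j j1 j2 : int), j1 = j + 1 -> j2 = j1 + 1 -> dg i + j = t -> b <= j ->
  forall (u : T i j) (v : T' i j1),
  (forall (j0 : int), j = j0 + 1 -> dv i j j0 u = 0) -> dv' i j1 j v = f i j u ->
  exists u' : T i j1, exists w : T' i j2,
    dv i j1 j u' = u /\ v - f i j1 u' = dv' i j2 j1 w.

Let St k := ((forall (i : int), T i k) * (forall (i k' : int), T' i k'))%type.
Let d0 k : St k := (fun=> 0, fun=> fun=> 0).
Let Inv k (st : St k) := forall (i k0 k1 : int), dg i + k = t + 1 -> k = k0 + 1 -> k1 = k + 1 ->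
  (exists w : T (nx s i) k0, dv i k k0 (st.1 i) = y i k0 - dh (nx s i) i k0 w) /\
  (exists w : T' (nx s i) k,
     dv' i k1 k (st.2 i k1) = z i k - f i k (st.1 i) - dh' (nx s i) i k w).
Let Rel k k1 (st : St k) (st1 : St k1) := forall (i k2 : int), dg i + k1 = t + 1 -> k2 = k1 + 1 ->
  y i k = dh (nx s i) i k (st.1 (nx s i)) + dv i k1 k (st1.1 i) /\
  z i k1 - f i k1 (st1.1 i) =
    dh' (nx s i) i k1 (st.2 (nx s i) k1) + dv' i k2 k1 (st1.2 i k2).

Lemma total_rel : exists (y' : forall (i j : int), T i j) (w : forall (i j : int), T' i j),
  [/\ forall (i j : int), dg i + j <> t + 1 -> y' i j = 0,
      forall (i j : int), dg i + j <> t + 2 -> w i j = 0,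
      forall (i i' j j' : int), i' = nx s i -> j' = j + 1 -> dg i + j = t ->
        y i j = dh i' i j (y' i' j) + dv i j' j (y' i j') &
      forall (i i' j j' : int), i' = nx s i -> j' = j + 1 -> dg i + j = t + 1 ->
        z i j - f i j (y' i j) = dh' i' i j (w i' j) + dv' i j' j (w i j')].
Proof.
have inv0 : Inv (d0 b).
  move=> i k0 k1 di e0 e1; split; exists 0; rewrite !raddf0.
    by rewrite y0 ?addr0 //; lia.
  by rewrite z0 ?addr0 //; lia.
have step (k k1 : int) (st : St k) : k1 = k + 1 -> b <= k -> Inv st ->
    exists2 st1 : St k1, Rel st st1 & Inv st1.
  move=> e1 bk ist.
  pose k2 := k1 + 1.
  have ex i : exists q : T i k1 * T' i k2, dg i + k1 = t + 1 ->
      y i k = dh (nx s i) i k (st.1 (nx s i)) + dv i k1 k q.1 /\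
      z i k1 - f i k1 q.1 =
      dh' (nx s i) i k1 (st.2 (nx s i) k1) + dv' i k2 k1 q.2.
    have [di|?] := pselect (dg i + k1 = t + 1); last by exists (0, 0).
    have dn := dgn_nx s i.
    pose u := y i k - dh (nx s i) i k (st.1 (nx s i)).
    pose v := z i k1 - dh' (nx s i) i k1 (st.2 (nx s i) k1).
    (* The [w] that [Inv] leaves unspecified enters only through its horizontal differential, so it
       disappears here and in [hv] because horizontal differentials compose to zero. *)
    have hu j0 : k = j0 + 1 -> dv i k j0 u = 0.
      move=> ej; have [|[w hw] _] := ist (nx s i) j0 k1 _ ej e1; first by lia.
      by rewrite /u raddfB /= anti hw (raddfB (dh (nx s i) i j0)) hh subr0 opprK addrC ycyc//; lia.
    have hv : dv' i k1 k v = f i k u.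
      have [|_ [w hw]] := ist (nx s i) (k - 1) k1 _ (esym (subrK _ _)) e1; first by lia.
      rewrite /v raddfB /= anti' hw !(raddfB (dh' (nx s i) i k)) hh' subr0 opprK.
      rewrite /u raddfB fh addrA.
      by rewrite [dv' _ _ _ _ + _]addrC (zcyc _ e1)//; lia.
    have [|u' [w [h1 h2]]] := cex e1 (erefl k2) _ bk hu hv; first by lia.
    exists (u', w) => _ /=; split; first by rewrite h1 /u addrC subrK.
    by rewrite -h2 /v addrA [X in _ = X - _]addrC subrK.
  pose q i := projT1 (cid (ex i)); have qP i := projT2 (cid (ex i)).
  pose W i k' : T' i k' := match pselect (k2 = k') with
    | left e => eq_rect k2 (T' i) (q i).2 k' e | right _ => 0 end.
  have WE i : W i k2 = (q i).2.
    by rewrite /W; case: pselect => // e; rewrite (eq_irrelevance e erefl).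
  exists (fun i => (q i).1, W).
    move=> i k2' di ->; rewrite /= -/k2 WE; exact: qP.
  move=> i k0 k3 di e0 -> /=; rewrite -/k2 WE.
  have -> : k0 = k by lia.
  have [h1 h2] := qP i di; split.
    by exists (st.1 (nx s i)); rewrite h1 addrC addKr.
  by exists (st.2 (nx s i) k1); rewrite h2 addrC addKr.
have [h [h0 hI hR]] := int_rec inv0 step.
exists (fun i j => if dg i + j == t + 1 then (h j).1 i else 0).
exists (fun i j => if dg i + j == t + 2 then (h (j - 1)).2 i j else 0).
split=> [i j /eqP/negPf->//|i j /eqP/negPf->//||].
  move=> i i' j j' -> e di; have dn := dgn_nx s i.
  rewrite (_ : _ + j == _) 1?(_ : _ + j' == _); [|lia|lia].
  have [bj|jb] := leP b j; first by have [|] := hR j j' e bj i (j' + 1) _ erefl; first lia.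
  by rewrite !h0 /= ?raddf0 ?addr0 ?y0//; lia.
move=> i i' j j' -> e di; have dn := dgn_nx s i.
rewrite (_ : dgn s (nx s i) + j == t + 2) 1?(_ : _ + j' == t + 2) ?di ?eqxx; [|lia|lia].
have ej : j' - 1 = j by lia.
have [bj|jb] := leP j b; last first.
  have bj : b <= j - 1 by lia.
  by have [_] := hR (j - 1) j (esym (subrK 1 j)) bj i j' di e; rewrite ej.
by rewrite !h0 /= ?raddf0 ?addr0 ?z0//; lia.
Qed.
End TotalRelative.

(** * Complexes of free modules given by matrices *)

Section Homology.
Variable A : comUnitRingType.
Implicit Types X Y Z : cplx A.

Lemma is_cycleP X n (x : X n) : is_cycle x <-> forall j, diff X n j x = 0.
Proof.
split=> [h j|h]; last exact: h.
have [->//|/eqP nj] := pselect (j = n - 1).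
by apply: diff_shape; lia.
Qed.

Lemma is_boundaryP X n (x : X n) : is_boundary x <-> exists i y, diff X i n y = x.
Proof.
split=> [[y <-]|[i [y <-]]]; first by exists (n + 1), y.
have [e|/eqP ni] := pselect (i = n + 1); first by subst i; exists y.
by exists 0; rewrite linear0 diff_shape.
Qed.

Lemma bnd_diff X i n (y : X i) : is_boundary (diff X i n y).
Proof. by apply/is_boundaryP; exists i, y. Qed.
Lemma cyc_diff X i n (y : X i) : is_cycle (diff X i n y).
Proof. exact: diff_diff. Qed.
Lemma bnd0 X n : is_boundary (0 : X n).
Proof. by exists 0; rewrite linear0. Qed.
Lemma bndD X n (x y : X n) : is_boundary x -> is_boundary y -> is_boundary (x + y).
Proof. by move=> [u <-] [v <-]; exists (u + v); rewrite linearD. Qed.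
Lemma bndZ X n a (x : X n) : is_boundary x -> is_boundary (a *: x).
Proof. by move=> [u <-]; exists (a *: u); rewrite linearZ. Qed.
Lemma bndN X n (x : X n) : is_boundary x -> is_boundary (- x).
Proof. by move=> [u <-]; exists (- u); rewrite linearN. Qed.
Lemma bndB X n (x y : X n) : is_boundary x -> is_boundary y -> is_boundary (x - y).
Proof. by move=> hx hy; apply: bndD => //; apply: bndN. Qed.
Lemma bndBC X n (x y : X n) : is_boundary (x - y) -> is_boundary (y - x).
Proof. by move=> h; rewrite -opprB; apply: bndN. Qed.
Lemma bnd_trans X n (x y z : X n) :
  is_boundary (x - y) -> is_boundary (y - z) -> is_boundary (x - z).
Proof. by move=> h h'; rewrite -[x](subrK y) -addrA; apply: bndD. Qed.
Lemma bnd_sub X n (x y : X n) : is_boundary (x - y) -> is_boundary y -> is_boundary x.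
Proof. by move=> h h'; rewrite -[x](subrK y); apply: bndD. Qed.
Lemma bnd_cyc X n (x : X n) : is_boundary x -> is_cycle x.
Proof. by move=> [y <-]; exact: cyc_diff. Qed.
Lemma cyc0 X n : is_cycle (0 : X n).
Proof. by rewrite /is_cycle linear0. Qed.
Lemma cycD X n (x y : X n) : is_cycle x -> is_cycle y -> is_cycle (x + y).
Proof. by rewrite /is_cycle linearD => -> ->; rewrite addr0. Qed.
Lemma cycZ X n a (x : X n) : is_cycle x -> is_cycle (a *: x).
Proof. by rewrite /is_cycle linearZ /= => ->; rewrite scaler0. Qed.
Lemma cycN X n (x : X n) : is_cycle x -> is_cycle (- x).
Proof. by rewrite /is_cycle linearN => ->; rewrite oppr0. Qed.
Lemma cycB X n (x y : X n) : is_cycle x -> is_cycle y -> is_cycle (x - y).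
Proof. by move=> hx hy; apply: cycD => //; apply: cycN. Qed.
Lemma cyc_sum X n (I : Type) (r : seq I) (Q : pred I) (F : I -> X n) :
  (forall i, Q i -> is_cycle (F i)) -> is_cycle (\sum_(i <- r | Q i) F i).
Proof. by move=> h; apply: big_ind => //; [exact: cyc0|exact: cycD]. Qed.
Lemma bnd_sum X n (I : Type) (r : seq I) (Q : pred I) (F : I -> X n) :
  (forall i, Q i -> is_boundary (F i)) -> is_boundary (\sum_(i <- r | Q i) F i).
Proof. by move=> h; apply: big_ind => //; [exact: bnd0|exact: bndD]. Qed.

Lemma chain_cyc X Y (f : chain_map X Y) n (x : X n) : is_cycle x -> is_cycle (f n x).
Proof. by rewrite /is_cycle -chain_funP => ->; rewrite linear0. Qed.
Lemma chain_bnd X Y (f : chain_map X Y) n (x : X n) : is_boundary x -> is_boundary (f n x).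
Proof. by move=> [y <-]; rewrite chain_funP; exact: bnd_diff. Qed.

Definition chain_id X : chain_map X X :=
  @ChainMap A X X (fun i => idfun) (fun i j x => erefl).
Fact chain_comp_ax X Y Z (g : chain_map Y Z) (f : chain_map X Y) (i j : int) (x : X i) :
  (g j \o f j) (diff X i j x) = diff Z i j ((g i \o f i) x).
Proof. by rewrite /= !chain_funP. Qed.
Definition chain_comp X Y Z (g : chain_map Y Z) (f : chain_map X Y) : chain_map X Z :=
  @ChainMap A X Z (fun i => g i \o f i) (chain_comp_ax g f).

(** Agreement on homology. It is weaker than being homotopic, and it is all that the
    two-out-of-three lemmas for quasi-isomorphisms below require of a triangle. *)
Definition hom_eq X Y (f g : chain_map X Y) :=
  forall n (x : X n), is_cycle x -> is_boundary (f n x - g n x).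

Lemma qi_id X : quasi_iso (chain_id X).
Proof.
move=> n; split=> [x _ //|y cy]; exists y => //=; rewrite subrr; exact: bnd0.
Qed.

Lemma qi_comp X Y Z (g : chain_map Y Z) (f : chain_map X Y) :
  quasi_iso f -> quasi_iso g -> quasi_iso (chain_comp g f).
Proof.
move=> qf qg n; split=> [x cx h|z cz].
  by apply: (qf n).1 => //; apply: (qg n).1 => //; apply: chain_cyc.
have [y cy hy] := (qg n).2 z cz; have [x cx hx] := (qf n).2 y cy.
exists x => //=; apply: bnd_trans hy _; rewrite -linearB; exact: chain_bnd.
Qed.

Lemma qi_ext X Y (f g : chain_map X Y) : hom_eq f g -> quasi_iso f -> quasi_iso g.
Proof.
move=> fg qf n; split=> [x cx h|y cy].
  by apply: (qf n).1 => //; apply: bnd_sub (fg _ _ cx) h.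
have [x cx hx] := (qf n).2 y cy; exists x => //; apply: bnd_trans hx _; exact: fg.
Qed.

Lemma qi_cancel_left X Y Z (g : chain_map Y Z) (f : chain_map X Y) (h : chain_map X Z) :
  hom_eq h (chain_comp g f) -> quasi_iso g -> quasi_iso h -> quasi_iso f.
Proof.
move=> e qg /(qi_ext e) qh n; split=> [x cx b|y cy].
  by apply: (qh n).1 => //=; apply: chain_bnd.
have [x cx hx] := (qh n).2 _ (chain_cyc g cy).
by exists x => //; apply: (qg n).1; [apply: cycB => //; apply: chain_cyc|rewrite linearB].
Qed.

Lemma qi_cancel_right X Y Z (g : chain_map Y Z) (f : chain_map X Y) (h : chain_map X Z) :
  hom_eq h (chain_comp g f) -> quasi_iso f -> quasi_iso h -> quasi_iso g.
Proof.
move=> e qf /(qi_ext e) qh n; split=> [y cy b|z cz].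
  have [x cx hx] := (qf n).2 _ cy; apply: (bnd_sub hx); apply: chain_bnd.
  apply: (qh n).1 => //=; rewrite -[g n (f n x)](subKr (g n y)) -linearB.
  exact: bndB b (chain_bnd g hx).
have [x cx hx] := (qh n).2 _ cz; exists (f n x) => //; exact: chain_cyc.
Qed.

Lemma qi_inj_surj X Y (f : chain_map X Y) :
  (forall n, injective (f n)) -> (forall n y, exists x, f n x = y) -> quasi_iso f.
Proof.
move=> fi fs n; split=> [x cx [y]|y cy].
  have [z <-] := fs _ y; rewrite -chain_funP => /fi <-; exact: bnd_diff.
have [x xy] := fs n y; exists x; last by rewrite xy subrr; exact: bnd0.
by apply: (fi (n - 1)); rewrite chain_funP xy linear0.
Qed.

(** This is exactness of the mapping cone, spelled out on elements: injectivity on homology kills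
    [x], then surjectivity corrects the remaining cycle of [Y]. The degrees are variables tied by
    equations, so that the result can be used as the column hypothesis of [total_rel]. *)
Lemma qi_cone X Y (f : chain_map X Y) : quasi_iso f -> forall n n1 n2,
  n1 = n + 1 -> n2 = n1 + 1 -> forall (x : X n) (y : Y n1),
  is_cycle x -> diff Y n1 n y = f n x ->
  exists (x' : X n1) (w : Y n2), diff X n1 n x' = x /\ y - f n1 x' = diff Y n2 n1 w.
Proof.
move=> qf n n1 n2 e1 e2 x y cx hy; subst n1 n2.
have [x' hx'] : is_boundary x.
  by apply: (qf n).1 => //; rewrite -hy; exact: bnd_diff.
have cy : is_cycle (y - f _ x').
  rewrite /is_cycle; have -> : n + 1 - 1 = n by lia.
  by rewrite linearB -chain_funP hx' hy subrr.
have [u cu [w hw]] := (qf (n + 1)).2 _ cy.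
exists (x' + u), w; split; last by rewrite hw linearD opprD addrA.
by rewrite linearD hx' ((is_cycleP u).1 cu n) addr0.
Qed.

Lemma diso_refl X : diso X X. Proof. exact: Relation_Operators.rst_refl. Qed.
Lemma diso_sym X Y : diso X Y -> diso Y X.
Proof. exact: Relation_Operators.rst_sym. Qed.
Lemma diso_trans X Y Z : diso X Y -> diso Y Z -> diso X Z.
Proof. exact: Relation_Operators.rst_trans. Qed.
Lemma diso_qi X Y (f : chain_map X Y) : quasi_iso f -> diso X Y.
Proof. by move=> qf; apply: Relation_Operators.rst_step; exists f. Qed.

End Homology.

Section MatrixAction.
Variable A : comUnitRingType.
Definition mact (M : lmodType A) m n (B : 'M[A]_(m, n)) (v : 'I_m -> M) : 'I_n -> M :=
  fun p => \sum_q B q p *: v q.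
Variables (M N : lmodType A).
Lemma mactM m n l (B : 'M[A]_(m, n)) (C : 'M[A]_(n, l)) (v : 'I_m -> M) :
  mact C (mact B v) = mact (B *m C) v.
Proof.
apply/funext => p; rewrite /mact.
under eq_bigr => q _ do rewrite scaler_sumr.
rewrite exchange_big; apply: eq_bigr => r _.
rewrite mxE scaler_suml; apply: eq_bigr => q _; by rewrite scalerA mulrC.
Qed.
Lemma mact0 m n (v : 'I_m -> M) p : mact (0 : 'M_(m, n)) v p = 0.
Proof. by rewrite /mact big1 // => q _; rewrite mxE scale0r. Qed.
Lemma mactr0 m n (B : 'M[A]_(m, n)) p : mact B (fun=> 0 : M) p = 0.
Proof. by rewrite /mact big1 // => q _; rewrite scaler0. Qed.
Lemma mact_eq0 m n (B : 'M[A]_(m, n)) (v : 'I_m -> M) p :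
  (forall q, v q = 0) -> mact B v p = 0.
Proof. by move=> h; rewrite /mact big1 // => q _; rewrite h scaler0. Qed.
Lemma mactD m n (B : 'M[A]_(m, n)) (u v : 'I_m -> M) p :
  mact B (fun q => u q + v q) p = mact B u p + mact B v p.
Proof. by rewrite /mact -big_split; apply: eq_bigr => q _; rewrite scalerDr. Qed.
Lemma mactZ m n (B : 'M[A]_(m, n)) a (u : 'I_m -> M) p :
  mact B (fun q => a *: u q) p = a *: mact B u p.
Proof.
by rewrite /mact scaler_sumr; apply: eq_bigr => q _; rewrite !scalerA mulrC.
Qed.
Lemma mactN m n (B : 'M[A]_(m, n)) (u : 'I_m -> M) p :
  mact B (fun q => - u q) p = - mact B u p.
Proof. by rewrite /mact -sumrN; apply: eq_bigr => q _; rewrite scalerN. Qed.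
Lemma mact_sg m n (B : 'M[A]_(m, n)) k (u : 'I_m -> M) p :
  mact B (fun q => sg k (u q)) p = sg k (mact B u p).
Proof. by rewrite /sg; case: odd; rewrite ?mactN. Qed.
Lemma linear_mact m n (B : 'M[A]_(m, n)) (u : 'I_m -> M) (f : {linear M -> N}) p :
  f (mact B u p) = mact B (fun q => f (u q)) p.
Proof. by rewrite /mact linear_sum; apply: eq_bigr => q _; rewrite linearZ. Qed.
Lemma eq_mact m n (B : 'M[A]_(m, n)) (u v : 'I_m -> M) p :
  u =1 v -> mact B u p = mact B v p.
Proof. by move=> /funext ->. Qed.
End MatrixAction.

(* Graded finitely generated free modules with a differential given by
   matrices acting on rows; in orientation [s = true] the index [i] stands for
   homological degree [- i], so that duals need no reindexing. *)
Record fx (s : bool) (A : comUnitRingType) := Fx {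
  rk : int -> nat;
  mx : forall i j, 'M[A]_(rk i, rk j);
  mx_shape : forall (i j : int), dgn s i <> dgn s j + 1 -> mx i j = 0;
  mx_mx : forall (i j k : int), mx i j *m mx j k = 0 }.

Section FreeComplexes.
Variable A : comUnitRingType.

Section Dual.
Variables (s : bool) (P : fx s A).
Fact dual_shape (i j : int) : dgn (~~ s) i <> dgn (~~ s) j + 1 -> (-1) ^+ absz j *: (mx P j i)^T = 0.
Proof. by move=> h; rewrite mx_shape ?trmx0 ?scaler0 // => e; apply: h; move: e; rewrite /dgn; case: (s) => /=; lia. Qed.
Fact dual_mx (i j k : int) :
  ((-1) ^+ absz j *: (mx P j i)^T) *m ((-1) ^+ absz k *: (mx P k j)^T) = 0.
Proof. by rewrite -scalemxAl -scalemxAr -trmx_mul mx_mx trmx0 !scaler0. Qed.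
(** The sign is chosen so that, combined with the [sg j] of the tensor differential, it yields the
    differential of a Hom complex ([dual_tdiff]): cycles of degree [n] are then the chain maps of
    degree [n], boundaries the null-homotopic ones. *)
Definition dual : fx (~~ s) A := Fx dual_shape dual_mx.
End Dual.

Section BaseChange.
Variables (B : comUnitRingType) (phi : {rmorphism A -> B}) (s : bool) (P : fx s A).
Fact bc_shape (i j : int) : dgn s i <> dgn s j + 1 -> map_mx phi (mx P i j) = 0.
Proof. by move=> h; rewrite mx_shape // map_mx0. Qed.
Fact bc_mx (i j k : int) : map_mx phi (mx P i j) *m map_mx phi (mx P j k) = 0.
Proof. by rewrite -map_mxM mx_mx map_mx0. Qed.
Definition bc : fx s B := Fx bc_shape bc_mx.
End BaseChange.

Section ToComplex.
Variable P : fx false A.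
Fact toc_shape (i j : int) (x : 'rV[A]_(rk P i)) : i != j + 1 -> x *m mx P i j = 0.
Proof. by move=> /eqP h; rewrite mx_shape // mulmx0. Qed.
Fact toc_dd (i j k : int) (x : 'rV[A]_(rk P i)) : x *m mx P i j *m mx P j k = 0.
Proof. by rewrite -mulmxA mx_mx mulmx0. Qed.
Definition toc : cplx A :=
  @Cplx A (fun i => 'rV[A]_(rk P i)) (fun i j => mulmxr (mx P i j)) toc_shape toc_dd.
End ToComplex.
End FreeComplexes.

(* The complex [P (x) Y]; for the dual of [X] in place of [P] it is Hom(X, Y). *)
Definition tfam (s : bool) (A : comUnitRingType) (P : fx s A) (Y : cplx A) :=
  forall a j, 'I_(rk P a) -> Y j.
(** An element of total degree [n] is a family on all pairs of indices that vanishes off the line of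
    degree [n]; this avoids dependent sums over pairs and all transport. No finiteness is imposed,
    so this is the product totalisation: for a dual it is exactly Hom, for a tensor product it is
    the right object once boundedness makes the lines finite. *)
Record ften (s : bool) (A : comUnitRingType) (P : fx s A) (Y : cplx A) (n : int) :=
  Ften { ff :> forall a j, 'I_(rk P a) -> Y j;
         ffP : forall (a j : int) p, dgn s a + j <> n -> @ff a j p = 0 }.
Arguments ff {s A P Y n} f a j p.
Arguments ffP {s A P Y n} f a j p.

Section TensorFree.
Variables (s : bool) (A : comUnitRingType) (P : fx s A) (Y : cplx A).
Local Notation dg := (dgn s).

Lemma tfam_eq (u v : tfam P Y) : (forall a j p, u a j p = v a j p) -> u = v.
Proof.
move=> e; apply: functional_extensionality_dep => a.
by apply: functional_extensionality_dep => j; apply: funext => p; exact: e.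
Qed.

Lemma ften_eq n (u v : ften P Y n) : (forall a j p, u a j p = v a j p) -> u = v.
Proof.
case: u v => [u hu] [v hv] /= /tfam_eq e.
by subst v; congr Ften; exact: Prop_irrelevance.
Qed.

Section Deg.
Variable n : int.
Local Notation T := (ften P Y n).
HB.instance Definition _ := gen_eqMixin T.
HB.instance Definition _ := gen_choiceMixin T.
Definition ften_zero : T := @Ften s A P Y n (fun a j p => 0) (fun _ _ _ _ => erefl).
Definition ften_opp (u : T) : T.
Proof. by exists (fun a j p => - u a j p) => a j p h; rewrite ffP ?oppr0. Defined.
Definition ften_add (u v : T) : T.
Proof. by exists (fun a j p => u a j p + v a j p) => a j p h; rewrite !ffP ?addr0. Defined.
Definition ften_scale (c : A) (u : T) : T.
Proof. by exists (fun a j p => c *: u a j p) => a j p h; rewrite ffP ?scaler0. Defined.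
Fact ften_addA : associative ften_add.
Proof. by move=> u v w; apply: ften_eq => a j p /=; rewrite addrA. Qed.
Fact ften_addC : commutative ften_add.
Proof. by move=> u v; apply: ften_eq => a j p /=; rewrite addrC. Qed.
Fact ften_add0 : left_id ften_zero ften_add.
Proof. by move=> u; apply: ften_eq => a j p /=; rewrite add0r. Qed.
Fact ften_addN : left_inverse ften_zero ften_opp ften_add.
Proof. by move=> u; apply: ften_eq => a j p /=; rewrite addNr. Qed.
HB.instance Definition _ := GRing.isZmodule.Build T
  ften_addA ften_addC ften_add0 ften_addN.
Fact ften_scaleA c d u : ften_scale c (ften_scale d u) = ften_scale (c * d) u.
Proof. by apply: ften_eq => a j p /=; rewrite scalerA. Qed.
Fact ften_scale1 : left_id 1 ften_scale.
Proof. by move=> u; apply: ften_eq => a j p /=; rewrite scale1r. Qed.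
Fact ften_scaleDr : right_distributive ften_scale +%R.
Proof. by move=> c u v; apply: ften_eq => a j p /=; rewrite scalerDr. Qed.
Fact ften_scaleDl u : {morph ften_scale^~ u : c d / c + d}.
Proof. by move=> c d; apply: ften_eq => a j p /=; rewrite scalerDl. Qed.
HB.instance Definition _ := GRing.Zmodule_isLmodule.Build A T
  ften_scaleA ften_scale1 ften_scaleDr ften_scaleDl.
End Deg.

Lemma ftenDE n (u v : ften P Y n) a j p : (u + v) a j p = u a j p + v a j p.
Proof. by []. Qed.
Lemma ftenNE n (u : ften P Y n) a j p : (- u) a j p = - u a j p.
Proof. by []. Qed.
Lemma ftenZE n c (u : ften P Y n) a j p : (c *: u) a j p = c *: u a j p.
Proof. by []. Qed.
Lemma ften0E n a j p : (0 : ften P Y n) a j p = 0.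
Proof. by []. Qed.

Definition tdiff (u : tfam P Y) (a j : int) (p : 'I_(rk P a)) : Y j :=
  sg j (mact (mx P (nx s a) a) (u (nx s a) j) p) + diff Y (j + 1) j (u a (j + 1) p).

Arguments tdiff u a j p : clear implicits.

Definition ften_diff n m (u : ften P Y n) : ften P Y m.
Proof.
exists (fun a j p => if n == m + 1 then tdiff u a j p else 0) => a j p h.
have [e|//] := eqVneq n (m + 1); have dn := dgn_nx s a.
rewrite /tdiff ffP ?linear0 ?addr0; last by lia.
by rewrite mact_eq0 ?sg_zero // => q; rewrite ffP //; lia.
Defined.

Lemma ften_diffE n m (u : ften P Y n) a j p :
  ften_diff m u a j p = if n == m + 1 then tdiff u a j p else 0.
Proof. by []. Qed.

Fact ften_diff_linear n m : linear (@ften_diff n m).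
Proof.
move=> c u v; apply: ften_eq => a j p; rewrite !(ftenDE, ftenZE) !ften_diffE.
case: ifP => _; last by rewrite scaler0 addr0.
rewrite /tdiff /= linearP mactD sg_add mactZ sg_lin scalerDr -!addrA; congr (_ + _).
by rewrite addrCA.
Qed.
HB.instance Definition _ n m :=
  GRing.isLinear.Build A _ _ _ (@ften_diff n m) (@ften_diff_linear n m).

Fact ften_shape (n m : int) (u : ften P Y n) : n != m + 1 -> ften_diff m u = 0.
Proof. by move=> /negPf h; apply: ften_eq => a j p; rewrite ften_diffE h. Qed.

Lemma tdiff_tdiff (u : tfam P Y) a j p :
  tdiff (fun a j p => tdiff u a j p) a j p = 0.
Proof.
rewrite {1}/tdiff /tdiff mactD mact_sg mactM mx_mx mact0 sg_zero add0r linearD diff_diff.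
by rewrite addr0 (raddf_sg (diff Y (j + 1) j)) /= (linear_mact _ _ (diff Y (j + 1) j)) sg_succ subrr.
Qed.

Fact ften_dd (n m k : int) (u : ften P Y n) : ften_diff k (ften_diff m u) = 0.
Proof.
apply: ften_eq => a j p; rewrite ften_diffE; case: ifP => // _.
have [e|/eqP/negPf ne] := pselect (n = m + 1).
  rewrite -[RHS](@tdiff_tdiff u a j p); congr (tdiff _ a j p).
  by apply: tfam_eq => *; rewrite ften_diffE (introT eqP e).
by rewrite /tdiff !ften_diffE ne linear0 addr0 mact_eq0 ?sg_zero // => q; rewrite ften_diffE ne.
Qed.

Definition fte : cplx A :=
  @Cplx A (ften P Y) (fun n m => @ften_diff n m) ften_shape ften_dd.

Lemma fte_diffE n m (u : fte n) a j p :
  diff fte n m u a j p = if n == m + 1 then tdiff u a j p else 0.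
Proof. by []. Qed.

Lemma fte_cycP n (u : fte n) : is_cycle u <-> forall a j p, tdiff u a j p = 0.
Proof.
split=> [h a j p|h].
  by have := congr1 (fun v : ften P Y (n - 1) => v a j p) h; rewrite fte_diffE subrK eqxx.
by apply: ften_eq => a j p; rewrite fte_diffE subrK eqxx h.
Qed.

Lemma fte_bndP n (u : fte n) : is_boundary u <->
  exists v : fte (n + 1), forall a j p, u a j p = tdiff v a j p.
Proof.
split=> -[v hv]; exists v.
  by move=> a j p; rewrite -hv fte_diffE eqxx.
by apply: ften_eq => a j p; rewrite fte_diffE eqxx hv.
Qed.
End TensorFree.
Arguments tdiff {s A P Y} u a j p.
Notation "P ⊙ Y" := (fte P Y) (at level 38, right associativity).
Notation "X ⋔ Y" := (fte (dual X) Y) (at level 38, right associativity).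

Lemma no_ord n : n = 0%N -> 'I_n -> False.
Proof. by move=> -> []. Qed.

Section FteMap.
Variables (s : bool) (A : comUnitRingType) (P : fx s A).
Section Map.
Variables (Y Z : cplx A) (f : chain_map Y Z).
Definition fte_fun n (u : ften P Y n) : ften P Z n.
Proof. by exists (fun a j p => f j (u a j p)) => a j p h; rewrite ffP ?linear0. Defined.
Fact fte_fun_linear n : linear (@fte_fun n).
Proof. by move=> c u v; apply: ften_eq => a j p /=; rewrite linearP. Qed.
HB.instance Definition _ n := GRing.isLinear.Build A _ _ _ (@fte_fun n) (@fte_fun_linear n).
Lemma tdiff_map (u : tfam P Y) a j p :
  f j (tdiff u a j p) = tdiff (fun a j p => f j (u a j p)) a j p.
Proof.
by rewrite /tdiff linearD (raddf_sg (f j)) /= linear_mact chain_funP.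
Qed.
Fact fte_fun_chain (n m : int) (u : (P ⊙ Y) n) :
  fte_fun (diff (P ⊙ Y) n m u) = diff (P ⊙ Z) n m (fte_fun u).
Proof.
apply: ften_eq => a j p /=; case: ifP => _; last by rewrite linear0.
exact: tdiff_map.
Qed.
Definition fte_map : chain_map (P ⊙ Y) (P ⊙ Z) :=
  @ChainMap A (P ⊙ Y) (P ⊙ Z) (fun n => @fte_fun n) fte_fun_chain.
End Map.

Definition hact (M : lmodType A) (i i' j : int) (v : {ffun 'I_(rk P i) -> M}) :
  {ffun 'I_(rk P i') -> M} := [ffun p => sg j (mact (mx P i i') v p)].
Fact hact_linear M i i' j : linear (@hact M i i' j).
Proof.
move=> c u v; apply/ffunP => p; rewrite !ffunE.
rewrite (@eq_mact _ _ _ _ _ _ (fun q => c *: u q + v q)) ?mactD ?mactZ ?sg_add ?sg_lin //.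
by move=> q; rewrite !ffunE.
Qed.
HB.instance Definition _ M i i' j :=
  GRing.isLinear.Build A _ _ _ (@hact M i i' j) (@hact_linear M i i' j).
Definition vact (M N : lmodType A) (g : {linear M -> N}) (i : int)
  (v : {ffun 'I_(rk P i) -> M}) : {ffun 'I_(rk P i) -> N} := [ffun p => g (v p)].
Fact vact_linear M N g i : linear (@vact M N g i).
Proof. by move=> c u v; apply/ffunP => p; rewrite !ffunE linearP. Qed.
HB.instance Definition _ M N g i :=
  GRing.isLinear.Build A _ _ _ (@vact M N g i) (@vact_linear M N g i).

Lemma hactE (M : lmodType A) i i' j (v : 'I_(rk P i) -> M) p :
  hact i' j (finfun v) p = sg j (mact (mx P i i') v p).
Proof. by rewrite ffunE; congr sg; apply: eq_mact => q; rewrite ffunE. Qed.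

Section Qi.
Variables (Y Z : cplx A) (f : chain_map Y Z).
Hypothesis qf : quasi_iso f.
Hypothesis start : forall t : int, exists b : int, forall (a j : int),
  j <= b -> (dgn s a + j = t \/ dgn s a + j = t + 1) ->
  rk P a = 0%N \/ ((forall x : Y j, x = 0) /\ (forall x : Z j, x = 0)).

(** Each column of the double complex is a finite power of [f], whose cone is exact by [qi_cone];
    [total_rel] then solves row by row. The hypothesis [start] supplies the row below which
    everything on the relevant lines is zero, which is where the recursion begins. *)
Lemma fte_cone (t t1 t2 : int) (u : (P ⊙ Y) t) (v : (P ⊙ Z) t1) : t1 = t + 1 -> t2 = t1 + 1 ->
  is_cycle u -> diff (P ⊙ Z) _ t v = fte_map f t u ->
  exists (u' : (P ⊙ Y) t1) (w : (P ⊙ Z) t2),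
    diff (P ⊙ Y) _ t u' = u /\ v - fte_map f _ u' = diff (P ⊙ Z) _ t1 w.
Proof.
move=> e1 e2 /fte_cycP cu hv; have [b hb] := start t.
pose T (X : cplx A) i j : zmodType := {ffun 'I_(rk P i) -> X j}.
pose y i j : T Y i j := [ffun p => u i j p].
pose z i j : T Z i j := [ffun p => v i j p].
have triv (X : cplx A) (w : tfam P X) i j : (rk P i = 0%N \/ forall x : X j, x = 0) ->
    [ffun p => w i j p] = 0.
  move=> h; apply/ffunP => p; rewrite !ffunE; case: h => [e|//].
  by case: (no_ord e p).
have := @total_rel s (T Y) (T Z) (fun i i' j => hact i' j : {additive _ -> _})
  (fun i j j' => vact (diff Y j j') (i := i) : {additive _ -> _})
  (fun i i' j => hact i' j : {additive _ -> _})
  (fun i j j' => vact (diff Z j j') (i := i) : {additive _ -> _})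
  (fun i j => vact (f j) (i := i) : {additive _ -> _}) _ _ _ _ _ t b y z.
have anti (X : cplx A) i i' j j' (x : T X i j) :
    vact (diff X j j') (hact i' j x) = - hact i' j' (vact (diff X j j') x).
  apply/ffunP => p; rewrite !ffunE (raddf_sg (diff X j j')) /= linear_mact.
  rewrite (@eq_mact _ _ _ _ _ (vact (diff X j j') x) (fun q => diff X j j' (x q))); last first.
    by move=> q; rewrite ffunE.
  have [e|ne] := pselect (j = j' + 1); first by subst j; rewrite sg_succ.
  rewrite mact_eq0 ?sg_zero ?oppr0 // => q; rewrite diff_shape //; exact/eqP.
have hh (X : cplx A) i i' i'' j (x : T X i j) : hact i'' j (hact i' j x) = 0.
  apply/ffunP => p; rewrite !ffunE.
  rewrite (@eq_mact _ _ _ _ _ _ (fun q => sg j (mact (mx P i i') x q))) => [|q]; last by rewrite ffunE.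
  by rewrite mact_sg mactM mx_mx mact0 !sg_zero.
have tE (X : cplx A) (w : tfam P X) i i' j j' p : i' = nx s i -> j' = j + 1 ->
   (hact i j [ffun p => w i' j p] + vact (diff X j' j) [ffun p => w i j' p]) p = tdiff w i j p.
  by move=> -> ->; rewrite ffunE hactE !ffunE.
case.
- exact: anti.
- exact: anti.
- exact: hh.
- exact: hh.
- move=> i i' j x; apply/ffunP => p; rewrite !ffunE (raddf_sg (f j)) /= linear_mact.
  by congr sg; apply: eq_mact => q; rewrite ffunE.
- by move=> i i' j j' ei ej _; apply/ffunP => p; rewrite (tE Y u) // cu ffunE.
- move=> i i' j j' ei ej _; apply/ffunP => p; rewrite (tE Z v) // !ffunE.
  by have := congr1 (fun w : ften P Z t => w i j p) hv; rewrite fte_diffE (introT eqP e1).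
- by move=> i j jb di; apply: (triv Y u); case: (hb i j); [lia|left|left|case; right].
- by move=> i j jb di; apply: (triv Z v); case: (hb i j); [lia|right|left|case; right].
- move=> i j j1 j2 e3 e4 di bj uu vv hu hvu.
  have ex p := qi_cone qf e3 e4 (x := uu p) (y := vv p).
  have cy p : is_cycle (uu p).
    by have := congr1 (fun g : {ffun _} => g p) (hu (j - 1) (esym (subrK 1 j))); rewrite !ffunE.
  have hd p : diff Z j1 j (vv p) = f j (uu p).
    by have := congr1 (fun g : {ffun _} => g p) hvu; rewrite !ffunE.
  have {}ex p := ex p (cy p) (hd p).
  pose x' p := projT1 (cid (ex p)); pose w p := projT1 (cid (projT2 (cid (ex p)))).
  exists [ffun p => x' p], [ffun p => w p].
  have h p := projT2 (cid (projT2 (cid (ex p)))).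
  split; apply/ffunP => p; rewrite !ffunE; [exact: (h p).1|exact: (h p).2].
move=> y' [w [y0 w0 hy hw]].
have y'P a j p : dgn s a + j <> t1 -> y' a j p = 0 by move=> h; rewrite y0 ?ffunE // -e1.
have wP a j p : dgn s a + j <> t2 -> w a j p = 0 by move=> h; rewrite w0 ?ffunE //; lia.
pose u' : (P ⊙ Y) t1 := @Ften _ _ P Y t1 (fun a j p => y' a j p) y'P.
pose w' : (P ⊙ Z) t2 := @Ften _ _ P Z t2 (fun a j p => w a j p) wP.
have ffK (X : cplx A) i j (g : T X i j) : [ffun p => g p] = g by apply/ffunP => p; rewrite ffunE.
have offE (X : cplx A) (n m : int) (g : (P ⊙ X) n) a j p : n = m + 1 -> dgn s a + j <> m ->
    tdiff g a j p = 0.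
  move=> e h; have := ffP (diff (P ⊙ X) n m g) a j p h.
  by rewrite fte_diffE (introT eqP e).
exists u', w'; split; apply: ften_eq => a j p.
  rewrite fte_diffE (introT eqP e1).
  have [di|ni] := pselect (dgn s a + j = t); last by rewrite ffP // (offE _ _ t).
  have := congr1 (fun g : {ffun _} => g p) (hy a _ j _ erefl erefl di).
  by rewrite ffunE => ->; rewrite -(tE Y u' a (nx s a) j (j + 1)) // !ffK.
rewrite fte_diffE (introT eqP e2).
have [di|ni] := pselect (dgn s a + j = t1); last by rewrite ffP // (offE _ _ t1).
rewrite e1 in di; have := congr1 (fun g : {ffun _} => g p) (hw a _ j _ erefl erefl di).
by rewrite -(tE Z w' a (nx s a) j (j + 1)) // !ffK => <-; rewrite !ffunE.
Qed.

Lemma fte_map_qi : quasi_iso (fte_map f).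
Proof.
move=> n; split=> [u cu [v hv]|v cv].
  by have [u' [w [<- _]]] := fte_cone erefl erefl cu hv; exact: bnd_diff.
have [|u' [w [h1 h2]]] := @fte_cone (n - 1) n (n + 1) 0 v (esym (subrK 1 n)) erefl (cyc0 _ _).
  by rewrite linear0; exact: cv.
by exists u'; rewrite ?h2 //; exact: bnd_diff.
Qed.
End Qi.
End FteMap.

Definition bdb (A : comUnitRingType) (Y : cplx A) (b : int) :=
  forall j : int, j < b -> forall x : Y j, x = 0.
Definition bda (s : bool) (A : comUnitRingType) (P : fx s A) (c : int) :=
  forall a : int, c < dgn s a -> rk P a = 0%N.

Section BoundedQi.
Variables (s : bool) (A : comUnitRingType) (P : fx s A) (Y Z : cplx A) (f : chain_map Y Z).
Lemma fte_qi_bda c : bda P c -> quasi_iso f -> quasi_iso (fte_map P f).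
Proof.
move=> hc qf; apply: fte_map_qi => // t; exists (t - c - 1) => a j hj ha.
by left; apply: hc; lia.
Qed.
Lemma fte_qi_bdb b : bdb Y b -> bdb Z b -> quasi_iso f -> quasi_iso (fte_map P f).
Proof.
move=> hY hZ qf; apply: fte_map_qi => // t; exists (b - 1) => a j hj ha.
by right; split; [apply: hY|apply: hZ]; lia.
Qed.
End BoundedQi.

(** * Homotopies, Hom complexes and the exchange of factors *)

Section Homotopy.
Variable A : comUnitRingType.
Definition homotopic (X Y : cplx A) (f g : chain_map X Y) :=
  exists h : forall i j, {linear X i -> Y j}, forall (i i1 i0 : int) (x : X i),
    i1 = i + 1 -> i = i0 + 1 ->
    f i x - g i x = diff Y i1 i (h i i1 x) + h i0 i (diff X i i0 x).

Lemma homotopic_hom_eq (X Y : cplx A) (f g : chain_map X Y) : homotopic f g -> hom_eq f g.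
Proof.
move=> [h hh] n x cx; rewrite (hh n (n + 1) (n - 1)) // ?subrK //.
by rewrite cx linear0 addr0; exact: bnd_diff.
Qed.

Lemma homotopic_fte s (P : fx s A) (X Y : cplx A) (f g : chain_map X Y) :
  homotopic f g -> hom_eq (fte_map P f) (fte_map P g).
Proof.
move=> [h hh] n u /fte_cycP cu; apply/fte_bndP.
have wP (a j : int) p : dgn s a + j <> n + 1 -> h (j - 1) j (u a (j - 1) p) = 0.
  by move=> e; rewrite ffP ?linear0 //; lia.
exists (Ften wP) => a j p; rewrite /tdiff /=.
have -> : j + 1 - 1 = j by lia.
rewrite -[LHS]/(f j (u a j p) - g j (u a j p)) (hh j (j + 1) (j - 1)) ?subrK //.
rewrite addrC; congr (_ + _).
have := cu a (j - 1) p; rewrite /tdiff; have -> : j - 1 + 1 = j by lia.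
move/eqP; rewrite addr_eq0 => /eqP; rewrite sg_pred => /oppr_inj <-.
by rewrite (raddf_sg (h (j - 1) j)) /= linear_mact.
Qed.
End Homotopy.

Section LinearFromRow.
Variables (A : comUnitRingType) (M : lmodType A) (r : nat) (v : 'I_r -> M).
Definition linv (x : 'rV[A]_r) : M := \sum_p x 0 p *: v p.
Fact linv_linear : linear linv.
Proof.
move=> c x y; rewrite /linv scaler_sumr -big_split; apply: eq_bigr => p _.
by rewrite !mxE scalerDl scalerA.
Qed.
HB.instance Definition _ := GRing.isLinear.Build A _ _ _ linv linv_linear.
Lemma linv_delta p : linv (delta_mx 0 p) = v p.
Proof.
rewrite /linv (bigD1 p) //= mxE !eqxx scale1r big1 ?addr0 // => q /negPf qp.
by rewrite mxE qp andbF scale0r.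
Qed.
End LinearFromRow.

Lemma linear_row (A : comUnitRingType) (M : lmodType A) r (f : {linear 'rV[A]_r -> M}) x :
  f x = linv (fun p => f (delta_mx 0 p)) x.
Proof.
rewrite {1}(row_sum_delta x) linear_sum; apply: eq_bigr => p _.
by rewrite linearZ.
Qed.

Lemma linv_mul (A : comUnitRingType) (M : lmodType A) m n (x : 'rV[A]_m) (B : 'M_(m, n))
  (v : 'I_n -> M) : linv v (x *m B) = linv (fun p => \sum_q B p q *: v q) x.
Proof.
rewrite /linv; under [RHS]eq_bigr do rewrite scaler_sumr.
rewrite exchange_big; apply: eq_bigr => q _; rewrite mxE scaler_suml.
by apply: eq_bigr => p _; rewrite scalerA.
Qed.

Lemma eq_linv (A : comUnitRingType) (M : lmodType A) r (u v : 'I_r -> M) x :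
  u =1 v -> linv u x = linv v x.
Proof. by move=> /funext ->. Qed.

Lemma linear_linv (A : comUnitRingType) (M N : lmodType A) r (v : 'I_r -> M)
  (f : {linear M -> N}) x : f (linv v x) = linv (fun p => f (v p)) x.
Proof. by rewrite linear_sum; apply: eq_bigr => p _; rewrite linearZ. Qed.

Section HomComplex.
Variables (A : comUnitRingType) (X : fx false A) (Y : cplx A).

Lemma dual_tdiff (u : tfam (dual X) Y) a j p : tdiff u a j p =
  diff Y (j + 1) j (u a (j + 1) p) +
  sg (a + j) (\sum_q mx X a (a - 1) p q *: u (a - 1) j q).
Proof.
rewrite /tdiff addrC; congr (_ + _); rewrite addrC sg_deg; congr sg.
rewrite /mact -sg_scale scaler_sumr; apply: eq_bigr => q _.
by rewrite !mxE scalerA.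
Qed.

Lemma hom_cyc n (u : (X ⋔ Y) n) : is_cycle u -> forall (a a0 j j1 : int) p,
  a = a0 + 1 -> j1 = j + 1 ->
  diff Y j1 j (u a j1 p) = - sg (a + j) (\sum_q mx X a a0 p q *: u a0 j q).
Proof.
move=> /fte_cycP cu a a0 j j1 p e ->; have {e}-> : a0 = a - 1 by lia.
by apply/eqP; rewrite -addr_eq0 -dual_tdiff cu.
Qed.

Section ChainOf.
Variables (u : (X ⋔ Y) 0) (cu : is_cycle u).
Fact chain_of_ax (i j : int) (x : toc X i) :
  linv (u j j) (diff (toc X) i j x) = diff Y i j (linv (u i i) x).
Proof.
rewrite linv_mul linear_linv; apply: eq_linv => p.
have [e|ne] := pselect (i = j + 1); last first.
  rewrite diff_shape; last exact/eqP.
  by rewrite big1 // => q _; rewrite mx_shape ?mxE ?scale0r.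
subst i; rewrite (hom_cyc cu p erefl erefl).
by rewrite sg_deg sg_succ sg_inv opprK.
Qed.
Definition chain_of : chain_map (toc X) Y :=
  @ChainMap A (toc X) Y (fun i => linv (u i i)) chain_of_ax.
End ChainOf.

Lemma homotopic_of_bnd (u v : (X ⋔ Y) 0) (cu : is_cycle u) (cv : is_cycle v) :
  is_boundary (u - v) -> homotopic (chain_of cu) (chain_of cv).
Proof.
move=> /fte_bndP[w hw]; exists (fun i j => linv (w i j)) => i i1 i0 x -> e.
have -> : i0 = i - 1 by lia.
rewrite /= linv_mul linear_linv /linv -sumrB -big_split.
apply: eq_bigr => p _ /=; rewrite -scalerBr -scalerDr; congr (_ *: _).
have := hw i i p; rewrite dual_tdiff sg_deg sg_inv => <-.
by rewrite ftenDE ftenNE.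
Qed.

Section HomOf.
Variable f : chain_map (toc X) Y.
Definition hom_of_fam : tfam (dual X) Y := fun a j p =>
  match pselect (a = j) with
  | left e => eq_rect a (fun k => Y k : Type) (f a (delta_mx 0 p)) j e | right _ => 0 end.
Arguments hom_of_fam a j p : clear implicits.
Lemma hom_of_diag i p : hom_of_fam i i p = f i (delta_mx 0 p).
Proof. by rewrite /hom_of_fam; case: pselect => // e; rewrite (eq_irrelevance e erefl). Qed.
Fact hom_of_supp (a j : int) p : dgn true a + j <> 0 -> hom_of_fam a j p = 0.
Proof. by rewrite /hom_of_fam; case: pselect => // e; rewrite /dgn; lia. Qed.
Definition hom_of : (X ⋔ Y) 0 := @Ften _ _ (dual X) Y 0 hom_of_fam hom_of_supp.
Lemma hom_of_cyc : is_cycle hom_of.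
Proof.
apply/fte_cycP => a j p; rewrite dual_tdiff.
have [e|ne] := pselect (a = j + 1); last first.
  rewrite ffP ?linear0 ?add0r; last by rewrite /dgn /=; lia.
  by rewrite big1 ?sg_zero // => q _; rewrite ffP ?scaler0 // /dgn /=; lia.
subst a; have -> : j + 1 - 1 = j by lia.
rewrite /= hom_of_diag -chain_funP sg_deg sg_succ sg_inv [f j _]linear_row /=.
rewrite linv_mul linv_delta; apply/eqP; rewrite subr_eq0; apply/eqP.
by apply: eq_bigr => q _; rewrite hom_of_diag.
Qed.
Lemma hom_ofK i x : chain_of hom_of_cyc i x = f i x.
Proof. by rewrite (linear_row (f i)); apply: eq_linv => p; rewrite /= hom_of_diag. Qed.
End HomOf.
End HomComplex.

Lemma bda_dual (A : comUnitRingType) (X : fx false A) b :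
  (forall i : int, i < b -> rk X i = 0%N) -> bda (dual X) (- b).
Proof. by move=> h a ha; apply: h; move: ha; rewrite /dgn /=; lia. Qed.

(** Since [X] is bounded below, Hom out of it preserves the quasi-isomorphism [f]; surjectivity on
    homology in degree 0 produces the lift, and the boundary that remains is the homotopy. *)
Lemma lift_chain (A : comUnitRingType) (X : fx false A) (b : int) (Y Z : cplx A)
    (f : chain_map Y Z) (g : chain_map (toc X) Z) :
  (forall i : int, i < b -> rk X i = 0%N) -> quasi_iso f ->
  exists g' : chain_map (toc X) Y, homotopic g (chain_comp f g').
Proof.
move=> hb qf; have /(_ 0)[_ sur] := fte_qi_bda (bda_dual hb) qf.
have [v cv hv] := sur _ (hom_of_cyc g).
exists (chain_of cv).
have [h hh] := homotopic_of_bnd (hom_of_cyc g) (chain_cyc _ cv) hv.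
exists h => i i1 i0 x e1 e0; rewrite -(hh i i1 i0 x e1 e0) hom_ofK.
by congr (_ - _); rewrite /= linear_linv.
Qed.

Section Evaluation.
Variables (A : comUnitRingType) (s : bool) (Q : fx s A) (Y : cplx A).
Variables (b k : int) (q : 'I_(rk Q b)).
Definition ftev n (x : ften Q Y n) : Y k := x b k q.
Fact ftev_linear n : linear (@ftev n). Proof. by []. Qed.
HB.instance Definition _ n := GRing.isLinear.Build A _ _ _ (@ftev n) (@ftev_linear n).
Lemma tdiff_ev s' (P : fx s' A) (u : tfam P (Q ⊙ Y)) a j p :
  (tdiff u a j p : ften Q Y j) b k q =
  sg j (mact (mx P (nx s' a) a) (fun r => (u (nx s' a) j r : ften Q Y j) b k q) p) +
  tdiff (u a (j + 1) p : ften Q Y (j + 1)) b k q.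
Proof.
rewrite -[LHS]/(ftev (tdiff u a j p)) /tdiff linearD (raddf_sg (@ftev j)) /= linear_mact.
congr (_ + _); rewrite /ftev -[LHS]/((diff (Q ⊙ Y) (j + 1) j (u a (j + 1) p)) b k q).
by rewrite fte_diffE eqxx.
Qed.
End Evaluation.

Section Swap.
Variables (A : comUnitRingType) (s s' : bool) (P : fx s A) (Q : fx s' A) (Y : cplx A).
Section Fun.
Variable n : int.
Variable u : (P ⊙ Q ⊙ Y) n.
Definition swap_in b l (q : 'I_(rk Q b)) : tfam P Y := fun a k p =>
  if l == dgn s a + k then sg (a * b) (u a (dgn s' b + k) p b k q) else 0.
Fact swap_in_supp b l q (a k : int) p : dgn s a + k <> l -> @swap_in b l q a k p = 0.
Proof. by move=> h; rewrite /swap_in; case: eqP => // e; case: h. Qed.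
Definition swap_out : tfam Q (P ⊙ Y) := fun b l q => Ften (@swap_in_supp b l q).
Arguments swap_out _ _ _ : clear implicits.
Fact swap_supp (b l : int) q : dgn s' b + l <> n -> swap_out b l q = 0.
Proof.
move=> h; apply: ften_eq => a k p; rewrite /= /swap_in; case: eqP => // e.
by rewrite (ffP u) ?sg_zero //; lia.
Qed.
(** The Koszul sign of the exchange is [(-1)^(a b)]. For two duals this is the isomorphism between
    Hom(N, Hom(X, Y)) and Hom(X, Hom(N, Y)), from which the biduality maps are made. *)
Definition swap : (Q ⊙ P ⊙ Y) n := @Ften _ _ Q (P ⊙ Y) n swap_out swap_supp.
Lemma swapE (b l : int) q (a k : int) p :
  swap b l q a k p = if l == dgn s a + k then sg (a * b) (u a (dgn s' b + k) p b k q) else 0.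
Proof. by []. Qed.
End Fun.
Fact swap_linear n : linear (@swap n).
Proof.
move=> c u v; apply: ften_eq => b l q; apply: ften_eq => a k p.
rewrite !(ftenDE, ftenZE) !swapE; case: eqP => _; last by rewrite scaler0 addr0.
by rewrite -sg_lin -sg_add.
Qed.
HB.instance Definition _ n := GRing.isLinear.Build A _ _ _ (@swap n) (@swap_linear n).


Fact swap_chain (n m : int) (u : (P ⊙ Q ⊙ Y) n) :
  swap (diff _ n m u) = diff (Q ⊙ P ⊙ Y) n m (swap u).
Proof.
apply: ften_eq => b l q; apply: ften_eq => a k p; rewrite swapE.
have ifE (c : bool) i (v w : (Q ⊙ Y) i) : (if c then v else w : ften _ _ _) b k q =
  if c then v b k q else w b k q by case: c.
have ifE' (c : bool) i (v w : (P ⊙ Y) i) : (if c then v else w : ften _ _ _) a k p =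
  if c then v a k p else w a k p by case: c.
rewrite !fte_diffE ifE ifE' !ften0E.
case: (n == m + 1); last by rewrite sg_zero if_same.
rewrite !tdiff_ev /tdiff; have da := dgn_nx s a; have db := dgn_nx s' b.
have [e|ne] := eqVneq l (dgn s a + k); last first.
  rewrite !mact_eq0 ?swapE; last first.
  - by move=> r; rewrite swapE (negPf ne).
  - by move=> r; rewrite swapE; case: eqP => // e; case/eqP: ne; lia.
  rewrite !sg_zero !add0r; case: eqP => [e|_]; last by rewrite linear0.
  by case/eqP: ne; lia.
have -> : (fun r => swap u (nx s' b) l r a k p) =
    fun r => sg (a * nx s' b) (u a (dgn s' b + k + 1) p (nx s' b) k r).
  by apply: funext => r; rewrite swapE e eqxx (_ : dgn s' (nx s' b) + k = dgn s' b + k + 1) //; lia.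
have -> : (swap u b (l + 1) q (nx s a) k : _ -> _) =
    fun r => sg (nx s a * b) (u (nx s a) (dgn s' b + k) r b k q).
  by apply: funext => r; rewrite swapE (_ : l + 1 == _) //; lia.
rewrite swapE (_ : l + 1 == dgn s a + (k + 1)); last by lia.
rewrite (_ : dgn s' b + (k + 1) = dgn s' b + k + 1); last by lia.
rewrite !mact_sg !sg_add (raddf_sg (diff Y (k + 1) k)) /= addrCA; congr (_ + _).
  rewrite -!sg_deg; apply: sg_par; rewrite e /dgn /nx.
  by case: (s); case: (s'); rewrite ?(mulrDl, mulrDr) /=; lia.
congr (_ + _); rewrite -!sg_deg; apply: sg_par; rewrite /dgn /nx.
by case: (s); case: (s'); rewrite ?(mulrDl, mulrDr) /=; lia.
Qed.
Definition swapc : chain_map (P ⊙ Q ⊙ Y) (Q ⊙ P ⊙ Y) :=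
  @ChainMap A (P ⊙ Q ⊙ Y) (Q ⊙ P ⊙ Y) (fun n => @swap n) swap_chain.
End Swap.

Lemma swapK (A : comUnitRingType) (s s' : bool) (P : fx s A) (Q : fx s' A) (Y : cplx A) n
  (u : (P ⊙ Q ⊙ Y) n) : swap (swap u) = u.
Proof.
apply: ften_eq => a l p; apply: ften_eq => b k q; rewrite !swapE.
have [e|ne] := eqVneq l (dgn s' b + k).
  by rewrite eqxx mulrC sg_inv -e.
by rewrite (ffP (u a l p)) // => e; rewrite e eqxx in ne.
Qed.

Lemma swap_qi (A : comUnitRingType) (s s' : bool) (P : fx s A) (Q : fx s' A) (Y : cplx A) :
  quasi_iso (swapc P Q Y).
Proof.
apply: qi_inj_surj => n; first exact: can_inj (@swapK A s s' P Q Y n).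
by move=> y; exists (swap y); exact: swapK.
Qed.

Lemma swap_natural (A : comUnitRingType) (s s' : bool) (P : fx s A) (Q : fx s' A)
  (Y Z : cplx A) (f : chain_map Y Z) n (u : (P ⊙ Q ⊙ Y) n) :
  swap (fte_map P (fte_map Q f) n u) = fte_map Q (fte_map P f) n (swap u).
Proof.
apply: ften_eq => b l q; apply: ften_eq => a k p; rewrite swapE /= /swap_in.
by case: eqP => _; rewrite ?(raddf_sg (f k)) ?linear0.
Qed.

Section Restriction.
Variables (A B : comUnitRingType) (phi : {rmorphism A -> B}).
Definition restr_fun (M N : lmodType B) (f : {linear M -> N}) (x : restr phi M) : restr phi N := f x.
Fact restr_fun_linear M N f : linear (@restr_fun M N f).
Proof. by move=> a x y; rewrite /restr_fun linearP. Qed.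
HB.instance Definition _ M N f :=
  GRing.isLinear.Build A _ _ _ (@restr_fun M N f) (@restr_fun_linear M N f).
Definition restr_cplx (L : cplx B) : cplx A :=
  @Cplx A (fun i => restr phi (L i)) (fun i j => restr_fun (diff L i j))
    (fun i j x h => @diff_shape B L i j x h) (fun i j k x => @diff_diff B L i j k x).
Definition restr_map (L M : cplx B) (f : chain_map L M) : chain_map (restr_cplx L) (restr_cplx M) :=
  @ChainMap A (restr_cplx L) (restr_cplx M) (fun i => restr_fun (f i)) (chain_funP f).
Lemma restr_qi (L M : cplx B) (f : chain_map L M) : quasi_iso f -> quasi_iso (restr_map f).
Proof. by []. Qed.
Lemma restr_qiP (L M : cplx B) (f : chain_map L M) : quasi_iso (restr_map f) -> quasi_iso f.
Proof. by []. Qed.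

Section BcRestr.
Variables (s : bool) (P : fx s A) (L : cplx B).
Definition bc_in n (u : restr_cplx (bc phi P ⊙ L) n) : (P ⊙ restr_cplx L) n :=
  @Ften s A P (restr_cplx L) n (ff (u : ften _ _ _)) (ffP (u : ften _ _ _)).
Fact bc_in_linear n : linear (@bc_in n).
Proof. by move=> a u v; apply: ften_eq. Qed.
HB.instance Definition _ n := GRing.isLinear.Build A _ _ _ (@bc_in n) (@bc_in_linear n).
Lemma bc_tdiff (u : tfam (bc phi P) L) a j p :
  tdiff u a j p = @tdiff s A P (restr_cplx L) u a j p.
Proof.
rewrite /tdiff; congr (sg j _ + _).
by apply: eq_bigr => q _; rewrite mxE.
Qed.
Fact bc_in_chain (n m : int) (u : restr_cplx (bc phi P ⊙ L) n) :
  bc_in (diff _ n m u) = diff (P ⊙ restr_cplx L) n m (bc_in u).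
Proof. by apply: ften_eq => a j p /=; case: ifP => // _; rewrite bc_tdiff. Qed.
Definition bc_restr : chain_map (restr_cplx (bc phi P ⊙ L)) (P ⊙ restr_cplx L) :=
  @ChainMap A (restr_cplx (bc phi P ⊙ L)) (P ⊙ restr_cplx L) (fun n => @bc_in n) bc_in_chain.
Definition bc_restr_inv n (u : (P ⊙ restr_cplx L) n) : (bc phi P ⊙ L) n :=
  @Ften s B (bc phi P) L n (ff (u : ften _ _ _)) (ffP (u : ften _ _ _)).
Lemma bc_restr_qi : quasi_iso bc_restr.
Proof.
apply: qi_inj_surj => n; last by move=> y; exists (bc_restr_inv y); apply: ften_eq.
move=> u v h; apply: ften_eq => a j p.
exact: (congr1 (fun w : ften P (restr_cplx L) n => w a j p) h).
Qed.
End BcRestr.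
End Restriction.

(** * Noetherian local algebra *)

Lemma split_lshift m n (i : 'I_m) : fintype.split (lshift n i) = inl i.
Proof. exact: (unsplitK (inl i)). Qed.
Lemma split_rshift m n (i : 'I_n) : fintype.split (rshift m i) = inr i.
Proof. exact: (unsplitK (inr i)). Qed.

Section FiniteGeneration.
Variable A : comUnitRingType.
Definition fg (M : lmodType A) (P : M -> Prop) := exists (n : nat) (v : 'I_n -> M),
  (forall i, P (v i)) /\ forall x, P x -> exists c : 'I_n -> A, x = \sum_i c i *: v i.

Lemma fg_ext (M N : lmodType A) (f : {linear M -> N}) (P : M -> Prop) : submodule P ->
  fg (fun y => exists2 x, P x & f x = y) -> fg (fun x => P x /\ f x = 0) -> fg P.
Proof.
move=> sP [n [v [hv gv]]] [m [w [hw gw]]].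
pose v' i := projT1 (cid2 (hv i)).
have v'P i : P (v' i) by rewrite /v'; case: cid2.
have v'E i : f (v' i) = v i by rewrite /v'; case: cid2.
exists (n + m)%N, (fun i => match fintype.split i with inl j => v' j | inr j => w j end); split.
  by move=> i; case: fintype.split => j //; have [] := hw j.
move=> x Px; have [|c hc] := gv (f x); first by exists x.
have [|d hd] := gw (x - \sum_i c i *: v' i).
  split; first by apply: submB => //; apply: subm_sum => // i _; apply: submZ.
  rewrite linearB linear_sum hc -sumrB big1 // => i _.
  by rewrite linearZ /= v'E subrr.
exists (fun i => match fintype.split i with inl j => c j | inr j => d j end).
rewrite big_split_ord /= -[LHS](subrK (\sum_i c i *: v' i)) hd addrC.
congr (_ + _); apply: eq_bigr => i _; by rewrite (split_lshift, split_rshift).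
Qed.

(** Induction on the number [k] of coordinates that may be nonzero: the last of them takes its
    values in an ideal, finitely generated by assumption, and the vectors on which it vanishes have
    one coordinate less. *)
Lemma noeth_rV (nA : noetherian A) n (P : 'rV[A]_n -> Prop) : submodule P -> fg P.
Proof.
suff H k : forall P : 'rV[A]_n -> Prop, submodule P ->
    (forall x (j : 'I_n), P x -> (k <= j)%N -> x 0 j = 0) -> fg P.
  by move=> sP; apply: (H n) => // x j _; rewrite leqNgt ltn_ord.
elim: k => {P} [|k IH] P sP hP.
  exists 0%N, (fun=> 0); split=> [[]//|x Px]; exists (fun=> 0).
  by rewrite big_ord0; apply/rowP => j; rewrite (hP x j Px) // mxE.
have [kn|nk] := ltnP k n; last first.
  apply: IH => // x j Px kj; apply: hP => //.
  by have := ltn_ord j; rewrite ltnNge (leq_trans nk).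
pose k' : 'I_n := Ordinal kn.
pose f (x : 'rV[A]_n) : A^o := x 0 k'.
have lf : linear f by move=> a x y; rewrite /f !mxE.
pose fL : {linear 'rV[A]_n -> A^o} := HB.pack f (GRing.isLinear.Build A _ _ _ f lf).
apply: (fg_ext (f := fL)) => //.
  have [|s hs] := nA (fun y => exists2 x, P x & fL x = y).
    split; first by exists 0; [exact: subm0|rewrite linear0].
      by move=> _ _ [x Px <-] [y Py <-]; exists (x + y); [exact: submD|rewrite linearD].
    by move=> a _ [x Px <-]; exists (a *: x); [exact: submZ|rewrite linearZ].
  exists (size s), (fun i => s`_i); split=> [i|x hx].
    have : ideal_gen s s`_i.
      exists (fun j => (j == i)%:R); rewrite (bigD1 i) //= eqxx mul1r big1 ?addr0 //.
      by move=> j /negPf ->; rewrite mul0r.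
    by rewrite -hs.
  by have : ideal_gen s x by rewrite -hs.
apply: IH.
  split; first by split; [exact: subm0|rewrite linear0].
  move=> a x y [Px fx] [Py fy]; split; first by case: sP => _; apply.
  by rewrite linearP fx fy scaler0 addr0.
move=> x j [Px fx]; rewrite leq_eqVlt => /orP[/eqP e|]; last exact: hP.
by rewrite -[RHS]fx /= /f; congr (x 0 _); apply: val_inj.
Qed.

(** A counterexample would give a strictly increasing sequence of submodules; their union is
    finitely generated, and its generators already lie in one member of the sequence. *)
Lemma fg_noeth_ind (M : lmodType A) (Pp : submod_pred M -> Prop) :
  (forall P : M -> Prop, submodule P -> fg P) ->
  (forall K : submod_pred M, (forall K' : submod_pred M, (forall x, K x -> K' x) ->
     (exists2 x, K' x & ~ K x) -> Pp K') -> Pp K) -> forall K, Pp K.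
Proof.
move=> nM ind K0; apply: contrapT => nK0.
have st (K : {K : submod_pred M | ~ Pp K}) : {K' : {K' : submod_pred M | ~ Pp K'} |
    (forall x, projT1 K x -> projT1 K' x) /\ exists2 x, projT1 K' x & ~ projT1 K x}.
  apply: cid; case: K => K nK /=; apply: contrapT => h; apply: nK; apply: ind => K' KK' hx.
  by apply: contrapT => nK'; apply: h; exists (exist _ K' nK').
pose s := nat_rect (fun=> {K : submod_pred M | ~ Pp K}) (exist _ K0 nK0) (fun _ K => projT1 (st K)).
have sS n : s n.+1 = projT1 (st (s n)) by [].
have mono n m x : (n <= m)%N -> projT1 (s n) x -> projT1 (s m) x.
  elim: m => [|m IH]; first by rewrite leqn0 => /eqP ->.
  rewrite leq_eqVlt => /orP[/eqP-> //|nm sx]; rewrite sS.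
  by apply: (projT2 (st (s m))).1; apply: IH.
have [|n [v [hv gv]]] := nM (fun x => exists n, projT1 (s n) x).
  split; first by exists 0%N; apply: subm0; apply: sm_ax.
  move=> a x y [n hx] [m hy]; exists (maxn n m).
  by apply: (sm_ax _).2; [apply: mono hx; apply: leq_maxl|apply: mono hy; apply: leq_maxr].
pose N := \max_i projT1 (cid (hv i)).
have [x hx nx] := (projT2 (st (s N))).2; apply: nx.
have [|c ->] := gv x; first by exists N.+1.
apply: subm_sum => [|i _]; first exact: sm_ax.
apply: submZ; first exact: sm_ax.
apply: mono (projT2 (cid (hv i))); rewrite /N; exact: (leq_bigmax (F := fun i => projT1 (cid (hv i)))).
Qed.
End FiniteGeneration.

Section Local.
Variable A : comUnitRingType.
Hypothesis lA : local_ring A.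
Lemma maxI0 : max_ideal (0 : A). Proof. by case: lA. Qed.
Lemma maxID (x y : A) : max_ideal x -> max_ideal y -> max_ideal (x + y).
Proof. by case: lA => _ + _; apply. Qed.
Lemma maxIM (a x : A) : max_ideal x -> max_ideal (a * x).
Proof. by case: lA => _ _; apply. Qed.
Lemma unit_max (x : A) : x \is a GRing.unit -> ~ max_ideal x.
Proof. by rewrite /max_ideal /= => ->. Qed.
Lemma unit_sub1 (c : A) : max_ideal c -> 1 - c \is a GRing.unit.
Proof.
move=> mc; apply: contrapT => /negP nu.
have /unit_max : (1 : A) \is a GRing.unit by exact: unitr1.
by apply; rewrite -(subrK c 1); apply: maxID.
Qed.
Lemma maxI_sum (I : Type) (r : seq I) (P : pred I) (F : I -> A) :
  (forall i, P i -> max_ideal (F i)) -> max_ideal (\sum_(i <- r | P i) F i).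
Proof. by move=> h; apply: big_ind => //; [exact: maxI0|exact: maxID]. Qed.

(** Elimination instead of determinants: [1 - c] is a unit for the coefficient [c] of the last
    generator in its own relation, so that generator is expressed by the others modulo [Q] and the
    number of generators drops. *)
Lemma nakayama_gen (M : lmodType A) (Q : M -> Prop) n (v : 'I_n -> M) : submodule Q ->
  (forall i, exists2 c : 'I_n -> A, forall j, max_ideal (c j) & Q (v i - \sum_j c j *: v j)) ->
  forall i, Q (v i).
Proof.
move=> sQ; elim: n v => [|n IH] v hv i; first by case: i.
have [c mc hc] := hv ord_max.
have uc := unit_sub1 (mc ord_max); set u := 1 - _ in uc.
pose v' j := v (widen_ord (leqnSn n) j); pose c' j := c (widen_ord (leqnSn n) j).
have hl : Q (v ord_max - \sum_j (u^-1 * c' j) *: v' j).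
  have -> : v ord_max - \sum_j (u^-1 * c' j) *: v' j =
      u^-1 *: (v ord_max - \sum_j c j *: v j).
    have -> : v ord_max - \sum_j c j *: v j = u *: v ord_max - \sum_j c' j *: v' j.
      by rewrite big_ord_recr /= /u scalerBl scale1r opprD addrA addrAC.
    rewrite scalerBr scalerA mulVr // scale1r scaler_sumr; congr (_ - _).
    by apply: eq_bigr => j _; rewrite scalerA.
  exact: submZ.
have hv' j : Q (v' j).
  apply: IH => {}j; have [d md hd] := hv (widen_ord (leqnSn n) j).
  exists (fun l => d (widen_ord (leqnSn n) l) + d ord_max * (u^-1 * c' l)).
    by move=> l; apply: maxID => //; rewrite mulrC; apply: maxIM.
  move: hd; rewrite big_ord_recr /= => /(submD sQ) /(_ (submZ sQ (d ord_max) hl)).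
  congr Q; rewrite scalerBr scaler_sumr opprD !addrA subrK -addrA -opprD; congr (_ - _).
  by rewrite -big_split; apply: eq_bigr => l _; rewrite /= scalerDl scalerA.
have [j ->|->] := unliftP ord_max i.
  by have := hv' j; congr (Q (v _)); apply: val_inj; rewrite /= /bump leqNgt ltn_ord.
rewrite -[v _](subrK (\sum_j (u^-1 * c' j) *: v' j)); apply: submD => //.
by apply: subm_sum => // j _; apply: submZ.
Qed.

Lemma nakayama (M : lmodType A) (P Q : M -> Prop) : submodule Q -> submodule P -> fg P ->
  (forall z, P z -> exists x w, [/\ max_ideal x, P w & Q (z - x *: w)]) ->
  forall z, P z -> Q z.
Proof.
move=> sQ sP [n [v [hv gv]]] h z /gv[c ->].
apply: subm_sum => // i _; apply: submZ => //; apply: (nakayama_gen (v := v)) => // {}i.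
have [x [w [mx Pw hw]]] := h _ (hv i); have [d dw] := gv _ Pw.
exists (fun j => x * d j); first by move=> j; rewrite mulrC; apply: maxIM.
by move: hw; rewrite dw scaler_sumr; congr (Q (_ - _)); apply: eq_bigr => j _; rewrite scalerA.
Qed.
End Local.

(** * Tensor products on elements and the local criterion for exactness *)

Section TensorElements.
Variables (A B : comUnitRingType) (phi : {rmorphism A -> B}).
Variables (M : lmodType A) (N : lmodType B).
Local Open Scope quotient_scope.
Definition tp (m : M) (n : N) : tens phi M N := \pi_(tens phi M N) [:: (m, n)].
Lemma tpDl m m' n : tp (m + m') n = tp m n + tp m' n.
Proof.
rewrite -[RHS]/(tens_add _ _) tens_addE; apply/tens_eqP; exact: tens_Dl.
Qed.
Lemma tpDr m n n' : tp m (n + n') = tp m n + tp m n'.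
Proof.
rewrite -[RHS]/(tens_add _ _) tens_addE; apply/tens_eqP; exact: tens_Dr.
Qed.
Lemma tpZ a m n : tp (a *: m) n = tp m (phi a *: n).
Proof. by apply/tens_eqP; exact: tens_Z. Qed.
Lemma scale_tp b m n : b *: tp m n = tp m (b *: n).
Proof. by rewrite -[LHS]/(tens_scale _ _) tens_scaleE. Qed.
Lemma tp0l n : tp 0 n = 0. Proof. by apply/tens_eqP; exact: tens_0. Qed.
Lemma tp0r m : tp m 0 = 0.
Proof. by rewrite -(scale0r (0 : N)) -scale_tp scale0r. Qed.
Lemma tp_suml (I : Type) (r : seq I) (F : I -> M) n :
  tp (\sum_(i <- r) F i) n = \sum_(i <- r) tp (F i) n.
Proof. by apply: (big_morph (fun m => tp m n)) => [x y|]; rewrite ?tpDl ?tp0l. Qed.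
Lemma tp_sumr (I : Type) (r : seq I) m (F : I -> N) :
  tp m (\sum_(i <- r) F i) = \sum_(i <- r) tp m (F i).
Proof. by apply: (big_morph (tp m)) => [x y|]; rewrite ?tpDr ?tp0r. Qed.
Lemma pi_tp s : \pi_(tens phi M N) s = \sum_(p <- s) tp p.1 p.2.
Proof.
elim: s => [|[m n] s IH]; first by rewrite big_nil.
by rewrite big_cons -IH -[RHS]/(tens_add _ _) tens_addE.
Qed.
Lemma tens_span (x : tens phi M N) : exists s : seq (M * N), x = \sum_(p <- s) tp p.1 p.2.
Proof. by have [s ->] := tens_surj x; exists s; rewrite pi_tp. Qed.
End TensorElements.

Lemma tens_map_tp (A B : comUnitRingType) (phi : {rmorphism A -> B}) (M M' : lmodType A)
  (N : lmodType B) (f : {linear M -> M'}) m (n : N) :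
  tens_map f (tp phi m n) = tp phi (f m) n.
Proof. by rewrite tens_mapE. Qed.

(* Base change along [phi] of the quotient of [R ^ s] by [K], elementwise:
   [extc K c] says that the vector [c] of [A ^ s] vanishes there. *)
Section Extension.
Variables (R A : comUnitRingType) (phi : {rmorphism R -> A}).
Section Def.
Variables (N : lmodType A) (s : nat) (K : 'rV[R]_s -> Prop).
Definition extc (c : 'I_s -> N) := exists (n : nat) (k : 'I_n -> 'rV[R]_s) (a : 'I_n -> N),
  (forall l, K (k l)) /\ forall i, c i = \sum_l phi (k l 0 i) *: a l.
Lemma extc0 : extc (fun=> 0).
Proof. by exists 0%N, (fun=> 0), (fun=> 0); split=> [[]//|i]; rewrite big_ord0. Qed.
Lemma extcD c d : extc c -> extc d -> extc (fun i => c i + d i).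
Proof.
move=> [n [k [a [hk hc]]]] [m [l [b [hl hd]]]].
exists (n + m)%N, (fun i => match fintype.split i with inl j => k j | inr j => l j end),
  (fun i => match fintype.split i with inl j => a j | inr j => b j end); split.
  by move=> i; case: fintype.split.
move=> i; rewrite big_split_ord hc hd /=; congr (_ + _); apply: eq_bigr => j _; by rewrite (split_lshift, split_rshift).
Qed.
Lemma extcZ x c : extc c -> extc (fun i => x *: c i).
Proof.
move=> [n [k [a [hk hc]]]]; exists n, k, (fun l => x *: a l); split=> // i.
by rewrite hc scaler_sumr; apply: eq_bigr => l _; rewrite !scalerA mulrC.
Qed.
Lemma extcN c : extc c -> extc (fun i => - c i).
Proof. by move=> /(extcZ (-1)); congr extc; apply/funext => i; rewrite scaleN1r. Qed.
Lemma extc1 k n : K k -> extc (fun i => phi (k 0 i) *: n).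
Proof. by move=> hk; exists 1%N, (fun=> k), (fun=> n); split=> // i; rewrite big_ord1. Qed.
Lemma extc_sum (I : Type) (r : seq I) (F : I -> 'I_s -> N) :
  (forall i, extc (F i)) -> extc (fun j => \sum_(i <- r) F i j).
Proof.
move=> h; elim: r => [|i r IH].
  by rewrite (_ : (fun _ => _) = fun=> 0); [exact: extc0|apply/funext => j; rewrite big_nil].
rewrite (_ : (fun _ => _) = fun j => F i j + \sum_(i <- r) F i j); first exact: extcD.
by apply/funext => j; rewrite big_cons.
Qed.
End Def.

Section MatrixDef.
Variables (s : nat) (K : 'rV[R]_s -> Prop).
Local Notation extc := (@extc A^o s K).
Definition extm q (x : 'M[A]_(s, q)) := forall j, extc (fun i => x i j).
Lemma extm0 q : extm (0 : 'M_(s, q)).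
Proof. by move=> j; have := extc0 A^o K; congr extc; apply/funext => i; rewrite mxE. Qed.
Lemma extmD q (x y : 'M_(s, q)) : extm x -> extm y -> extm (x + y).
Proof.
by move=> hx hy j; have := extcD (hx j) (hy j); congr extc; apply/funext => i; rewrite mxE.
Qed.
Lemma extmN q (x : 'M_(s, q)) : extm x -> extm (- x).
Proof. by move=> hx j; have := extcN (hx j); congr extc; apply/funext => i; rewrite mxE. Qed.
Lemma extmB q (x y : 'M_(s, q)) : extm x -> extm y -> extm (x - y).
Proof. by move=> hx /extmN hy; apply: extmD. Qed.
Lemma extmZ q a (x : 'M_(s, q)) : extm x -> extm (a *: x).
Proof. by move=> hx j; have := extcZ a (hx j); congr extc; apply/funext => i; rewrite mxE. Qed.
Lemma extmM q q' (x : 'M_(s, q)) (B : 'M_(q, q')) : extm x -> extm (x *m B).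
Proof.
move=> hx j; have := @extc_sum A^o s K _ (index_enum _) (fun l i => B l j *: (x i l : A^o)) (fun l => extcZ _ (hx l)).
by congr extc; apply/funext => i; rewrite mxE; apply: eq_bigr => l _; rewrite mulrC.
Qed.
End MatrixDef.

Variable N : lmodType A.
Lemma extc_mono s (K K' : 'rV[R]_s -> Prop) (c : 'I_s -> N) :
  (forall k, K k -> K' k) -> extc K c -> extc K' c.
Proof. by move=> h [n [k [a [hk hc]]]]; exists n, k, a; split=> // l; apply: h. Qed.

Lemma extc_map s r (K : 'rV[R]_s -> Prop) (K1 : 'rV[R]_r -> Prop) (h : 'M[R]_(r, s)) (w : 'I_r -> N) :
  (forall v, K1 v -> K (v *m h)) -> extc K1 w -> extc K (fun i => \sum_j phi (h j i) *: w j).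
Proof.
move=> hK [n [k [a [hk hw]]]]; exists n, (fun l => k l *m h), a; split=> [l|i]; first exact: hK.
under eq_bigr => j _ do rewrite hw scaler_sumr.
rewrite exchange_big; apply: eq_bigr => l _; rewrite mxE rmorph_sum scaler_suml.
by apply: eq_bigr => j _; rewrite rmorphM scalerA mulrC.
Qed.

Hypothesis flat : flat_over phi N.

Section TensorQuotient.
Variables (s : nat) (K : submod_pred 'rV[R]_s).
Definition tval (L : seq (quom K * N)) : 'I_s -> N :=
  fun i => \sum_(p <- L) phi (repr p.1 0 i) *: p.2.
(** Lifting every left entry to [R ^ s] by [repr] turns a formal sum into a vector over [N]. Each
    defining relation of the tensor product changes this vector by an element of [extc K], so
    vanishing in the tensor product can be read off from it. *)
Lemma tval_eq L L' : tens_eq phi L L' -> extc K (fun i => tval L i - tval L' i).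
Proof.
have tc L1 L2 i : tval (L1 ++ L2) i = tval L1 i + tval L2 i by rewrite /tval big_cat.
have t1 m n i : tval [:: (m, n)] i = phi (repr m 0 i) *: n by rewrite /tval big_seq1.
have t2 m n m' n' i : tval [:: (m, n); (m', n')] i = phi (repr m 0 i) *: n + phi (repr m' 0 i) *: n'.
  by rewrite /tval big_cons big_seq1.
have key (k : 'rV[R]_s) a (c : 'I_s -> N) : K k -> (forall i, c i = phi (k 0 i) *: a) -> extc K c.
  by move=> hk hc; have := extc1 a hk; congr extc; apply/funext => i; rewrite hc.
have rp (x : quom K) y : x = qpi K y -> K (repr x - y) by move=> ->; exact: qpi_repr.
elim=> {L L'}.
- move=> L; have := extc0 N K; congr extc; apply/funext => i; rewrite subrr //.
- move=> L L' _ /extcN; congr extc; apply/funext => i; rewrite opprB //.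
- move=> L1 L2 L3 _ h1 _ h2; have := extcD h1 h2; congr extc; apply/funext => i.
  by rewrite addrA subrK.
- move=> L1 L2 L3 L4 _ h1 _ h2; have := extcD h1 h2; congr extc; apply/funext => i.
  by rewrite !tc opprD addrACA.
- move=> L L'; have := extc0 N K; congr extc; apply/funext => i; rewrite !tc [tval L i + _]addrC subrr //.
- move=> n; apply: (key (repr (0 : quom K) - 0) n); first by apply: rp; rewrite linear0.
  by move=> i; rewrite t1 /tval big_nil !subr0.
- move=> m m' n; apply: (key (repr (m + m') - (repr m + repr m')) n).
    by apply: rp; rewrite linearD /= !qreprK.
  by move=> i; rewrite t1 t2 !mxE rmorphB rmorphD scalerBl scalerDl.
- move=> m n n'; have := extc0 N K; congr extc; apply/funext => i.
  by rewrite t1 t2 scalerDr subrr.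
- move=> a m n; apply: (key (repr (a *: m) - a *: repr m) n).
    by apply: rp; rewrite linearZ /= qreprK.
  by move=> i; rewrite !t1 !mxE rmorphB rmorphM scalerBl !scalerA mulrC.
Qed.

Lemma tens_quo0P (c : 'I_s -> N) :
  \sum_i tp phi (qpi K (delta_mx 0 i)) (c i) = 0 <-> extc K c.
Proof.
split=> [h|[n [k [a [hk hc]]]]].
  pose L := [seq (qpi K (delta_mx 0 i), c i) | i <- index_enum 'I_s].
  have : tens_eq phi L [::] by apply/tens_eqP; rewrite !pi_tp big_nil /L big_map.
  move=> /tval_eq e.
  have e2 : extc K (fun i => c i - tval L i).
    have := @extc_sum N s K 'I_s (index_enum _) (fun l i => phi ((delta_mx 0 l - repr (qpi K (delta_mx 0 l))) 0 i) *: c l).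
    case=> [l|]; last first.
      move=> n [k [a [hk hc]]]; exists n, k, a; split=> // i; rewrite -hc /tval /L big_map.
      transitivity (\sum_l (phi ((delta_mx 0 l : 'rV[R]_s) 0 i) *: c l - phi (repr (qpi K (delta_mx 0 l)) 0 i) *: c l)).
        rewrite sumrB; congr (_ - _); rewrite (bigD1 i) //= mxE !eqxx rmorph1 scale1r big1 ?addr0 // => l /negPf li.
        by rewrite mxE [i == l]eq_sym li andbF rmorph0 scale0r.
      by apply: eq_bigr => l _; rewrite !mxE rmorphB scalerBl.
    apply: extc1; rewrite -opprB; apply: submN; first exact: sm_ax.
    exact: qpi_repr.
  have := extcD e e2; congr extc; apply/funext => i.
  by rewrite {2}/tval big_nil subr0 addrC subrK.
rewrite (eq_bigr (fun i => \sum_l tp phi (k l 0 i *: qpi K (delta_mx 0 i)) (a l))).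
  rewrite exchange_big big1 // => l _; rewrite -tp_suml.
  rewrite (_ : \sum_i _ = qpi K (k l)); first by rewrite (qpi0P K _).2 ?tp0l.
  by rewrite [in RHS](row_sum_delta (k l)) linear_sum; apply: eq_bigr => i _; rewrite linearZ.
move=> i _; rewrite hc tp_sumr; apply: eq_bigr => l _; by rewrite tpZ.
Qed.
End TensorQuotient.

(** As [K] is the full preimage of [K'], the matrix [g] induces an injection between the quotients,
    and flatness applies to it; [tens_quo0P] translates both tensor products into vectors. *)
Lemma flat_extc s s' (K : submod_pred 'rV[R]_s) (K' : submod_pred 'rV[R]_s') (g : 'M[R]_(s, s'))
    (c : 'I_s -> N) : (forall v, K v <-> K' (v *m g)) ->
  extc K' (fun j => \sum_i phi (g i j) *: c i) -> extc K c.
Proof.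
move=> hK /tens_quo0P h; apply/tens_quo0P.
have g0 v : K v -> (qpi K' \o mulmxr g) v = 0 by move=> /hK /qpi0P.
pose f : {linear quom K -> quom K'} := quo_lift (P := K) g0.
have fE v : f (qpi K v) = qpi K' (v *m g) := quo_liftE g0 v.
have fi : injective f.
  move=> x y; have [x' ->] := qpi_surj x; have [y' ->] := qpi_surj y.
  rewrite !fE => /qpiP; rewrite -mulmxBl => /hK /qpiP //.
apply: (flat fi); rewrite linear0 linear_sum /= -[RHS]h.
under eq_bigr => i _ do rewrite tens_map_tp fE -rowE [row i g]row_sum_delta linear_sum tp_suml.
rewrite exchange_big; apply: eq_bigr => j _; rewrite tp_sumr; apply: eq_bigr => i _.
by rewrite linearZ /= tpZ mxE.
Qed.
End Extension.

Section SubmodulePredicates.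
Variable R : comUnitRingType.
Fact zero_sub_ax s : submodule (fun v : 'rV[R]_s => v = 0).
Proof. by split=> // a x y -> ->; rewrite scaler0 addr0. Qed.
Definition zero_sub s := SubmodPred (zero_sub_ax s).
Fact preim_sub_ax r s (K : submod_pred 'rV[R]_s) (h : 'M[R]_(r, s)) :
  submodule (fun v : 'rV[R]_r => K (v *m h)).
Proof.
split; first by rewrite mul0mx; apply: subm0; exact: sm_ax.
by move=> a x y hx hy; rewrite mulmxDl -scalemxAl; apply: (sm_ax K).2.
Qed.
Definition preim_sub r s (K : submod_pred 'rV[R]_s) (h : 'M[R]_(r, s)) :=
  SubmodPred (preim_sub_ax K h).
Fact add_sub_ax r s (K : submod_pred 'rV[R]_s) (h : 'M[R]_(r, s)) :
  submodule (fun v : 'rV[R]_s => exists w : 'rV[R]_r, K (v - w *m h)).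
Proof.
split; first by exists 0; rewrite mul0mx subr0; apply: subm0; exact: sm_ax.
move=> a x y [w hw] [w' hw']; exists (a *: w + w').
rewrite mulmxDl -scalemxAl opprD addrACA -scalerBr; exact: (sm_ax K).2.
Qed.
Definition add_sub r s (K : submod_pred 'rV[R]_s) (h : 'M[R]_(r, s)) :=
  SubmodPred (add_sub_ax K h).
Fact max_sub_ax (lR : local_ring R) : submodule (fun v : 'rV[R]_1 => max_ideal (v 0 0)).
Proof.
split; first by rewrite mxE; exact: maxI0.
by move=> a x y hx hy; rewrite !mxE; apply: maxID => //; apply: maxIM.
Qed.
Definition max_sub lR := SubmodPred (max_sub_ax lR).
End SubmodulePredicates.

Definition exq (o : bool) (A : comUnitRingType) (W : fx o A) (a : int) :=
  forall x : 'rV[A]_(rk W a), (forall a', x *m mx W a a' = 0) ->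
  exists y : 'rV[A]_(rk W (nx o a)), x = y *m mx W (nx o a) a.

Lemma exqM (o : bool) (A : comUnitRingType) (W : fx o A) (a : int) : exq W a ->
  forall s (x : 'M[A]_(s, rk W a)), (forall a', x *m mx W a a' = 0) ->
  exists y : 'M[A]_(s, rk W (nx o a)), x = y *m mx W (nx o a) a.
Proof.
move=> ex s x hx.
have h i : exists y : 'rV[A]_(rk W (nx o a)), row i x = y *m mx W (nx o a) a.
  by apply: ex => a'; rewrite -row_mul hx row0.
exists (\matrix_i projT1 (cid (h i))); apply/row_matrixP => i.
by rewrite row_mul rowK; case: (cid (h i)).
Qed.

Section MatrixExtension.
Variables (R A : comUnitRingType) (phi : {rmorphism R -> A}).
Lemma extm_decomp r s (K K2 : submod_pred 'rV[R]_s) (h : 'M[R]_(r, s)) q (x : 'M[A]_(s, q)) :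
  (forall v, K2 v -> exists w : 'rV[R]_r, K (v - w *m h)) -> extm phi K2 x ->
  exists w : 'M[A]_(r, q), extm phi K (x - (map_mx phi h)^T *m w).
Proof.
move=> hK hx.
have H j : exists w : 'I_r -> A, extc phi (N := A^o) K (fun i => x i j - \sum_l phi (h l i) * w l).
  have [n [k [a [hk hc]]]] := hx j.
  pose w l := projT1 (cid (hK _ (hk l))); have wP l := projT2 (cid (hK _ (hk l))).
  exists (fun l => \sum_m phi (w m 0 l) * a m).
  exists n, (fun l => k l - w l *m h), a; split=> // i; rewrite hc.
  under [X in _ - X]eq_bigr => l _ do rewrite mulr_sumr.
  rewrite exchange_big -sumrB; apply: eq_bigr => m _.
  rewrite -[RHS]/(_ * _ : A) !mxE rmorphB mulrBl rmorph_sum mulr_suml; congr (_ - _).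
  by apply: eq_bigr => l _; rewrite rmorphM mulrCA mulrA.
exists (\matrix_(l, j) projT1 (cid (H j)) l) => j.
have := projT2 (cid (H j)); congr extc; apply/funext => i.
by rewrite !mxE; congr (_ - _); apply: eq_bigr => l _; rewrite !mxE.
Qed.

Lemma extm_map r s (K : submod_pred 'rV[R]_s) (K1 : submod_pred 'rV[R]_r) (h : 'M[R]_(r, s))
    q (w : 'M[A]_(r, q)) :
  (forall v, K1 v -> K (v *m h)) -> extm phi K1 w -> extm phi K ((map_mx phi h)^T *m w).
Proof.
move=> hK hw j; have := extc_map hK (hw j); congr extc; apply/funext => i.
by rewrite mxE; apply: eq_bigr => l _; rewrite !mxE.
Qed.

Lemma extm_zero s q (x : 'M[A]_(s, q)) : extm phi (@zero_sub R s) x -> x = 0.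
Proof.
move=> h; apply/matrixP => i j; have [n [k [a [hk ->]]]] := h j.
by rewrite mxE big1 // => l _; rewrite hk mxE rmorph0 scale0r.
Qed.

Lemma extm_mono s (K K' : 'rV[R]_s -> Prop) q (x : 'M[A]_(s, q)) :
  (forall v, K v -> K' v) -> extm phi K x -> extm phi K' x.
Proof. by move=> h hx j; apply: extc_mono (hx j). Qed.

Hypothesis flat : flat_over phi (A^o : lmodType A).
Lemma flat_extm r s (K : submod_pred 'rV[R]_s) (K1 : submod_pred 'rV[R]_r) (h : 'M[R]_(r, s))
    q (w : 'M[A]_(r, q)) :
  (forall v, K1 v <-> K (v *m h)) -> extm phi K ((map_mx phi h)^T *m w) -> extm phi K1 w.
Proof.
move=> hK hw j; apply: (flat_extc flat hK); have := hw j; congr extc; apply/funext => i.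
by rewrite mxE; apply: eq_bigr => l _; rewrite !mxE.
Qed.

Section Exactness.
Variables (o : bool) (Q : fx o A).
(* Exactness at [a] of the complex [Q (x)_R R ^ s / K]. *)
Definition exK (a : int) s (K : submod_pred 'rV[R]_s) :=
  forall x : 'M[A]_(s, rk Q a), (forall a', extm phi K (x *m mx Q a a')) ->
  exists y : 'M[A]_(s, rk Q (nx o a)), extm phi K (x - y *m mx Q (nx o a) a).

(** The quotient by [K] is an extension of the quotient by [K2] by a quotient of [R ^ r], the latter
    embedded through [h]. A cycle is corrected first modulo [K2]; flatness makes the coefficient [w]
    of the remainder a cycle again, to be corrected in the submodule. *)
Lemma exK_ext a r s (K K2 : submod_pred 'rV[R]_s) (h : 'M[R]_(r, s)) :
  (forall v, K v -> K2 v) -> (forall v, K2 v -> exists w : 'rV[R]_r, K (v - w *m h)) ->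
  exK a K2 -> exK a (preim_sub K h) -> exK a K.
Proof.
move=> KK2 hK e2 e1 x hx.
have [|y hy] := e2 x; first by move=> a'; apply: extm_mono (hx a').
have [w hw] := extm_decomp hK hy.
have [|y' hy'] := e1 w.
  move=> a'; apply: (flat_extm (K := K) (h := h)) => //; rewrite mulmxA.
  have := extmB (hx a') (extmM (mx Q a a') hw).
  by rewrite !mulmxBl -!mulmxA mx_mx mulmx0 subr0 opprB addrC subrK.
exists (y + (map_mx phi h)^T *m y').
have := extmD hw (extm_map (K := K) (h := h) _ hy'); rewrite mulmxBr addrA subrK mulmxDl.
by rewrite -!mulmxA opprD addrA; apply.
Qed.

Hypotheses (nR : noetherian R) (lR : local_ring R) (nA : noetherian A) (lA : local_ring A).
Hypothesis lphi : local_hom phi.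

Lemma mulmx11 (B : comUnitRingType) n (v : 'M[B]_1) (w : 'M[B]_(1, n)) : v *m w = v 0 0 *: w.
Proof. by apply/rowP => j; rewrite !mxE big_ord1 (ord1 (Ordinal _)). Qed.

(** Noetherian induction on the ideal [K], below the maximal ideal. Take [v] in the maximal ideal
    but not in [K]. If [v] is a zero divisor on the quotient, both the ideal [K + (v)] and the ideal
    of multipliers of [v] into [K] are larger and [exK_ext] concludes; if [v] is regular, Nakayama
    over [A] does. *)
Lemma exK_cyclic a : exK a (max_sub lR) -> forall K : submod_pred 'rV[R]_1, exK a K.
Proof.
move=> base; apply: fg_noeth_ind => [P|K IH]; first exact: noeth_rV.
have top : K 1%:M -> exK a K.
  move=> K1 x _; exists 0; rewrite mul0mx subr0 => j.
  have := extc1 phi (x 0 j : A^o) K1; congr extc; apply/funext => i.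
  by rewrite !mxE !ord1 eqxx rmorph1 scale1r.
have [K1|nK1] := pselect (K 1%:M); first exact: top.
have Kmax v : K v -> max_ideal (v 0 0).
  move=> hv; apply: contrapT => /negP; rewrite negbK => u; apply: nK1.
  have := submZ (sm_ax K) (v 0 0)^-1 hv; congr (K _); apply/rowP => j.
  by rewrite !mxE !ord1 mulVr.
have [maxK|nmaxK] := pselect (forall v : 'rV[R]_1, max_ideal (v 0 0) -> K v).
  move=> x hx; have [|y hy] := base x.
    by move=> a'; apply: extm_mono (hx a') => v; exact: Kmax.
  by exists y; apply: extm_mono hy => v; exact: maxK.
have [v mv nv] : exists2 v : 'rV[R]_1, max_ideal (v 0 0) & ~ K v.
  by apply: contrapT => h; apply: nmaxK => v mv; apply: contrapT => nv; apply: h; exists v.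
have KK2 w : K w -> add_sub K v w by move=> hw; exists 0; rewrite mul0mx subr0.
have e2 : exK a (add_sub K v).
  apply: IH => //; exists v => //=; exists 1; rewrite mul1mx subrr; apply: subm0; exact: sm_ax.
have KK1 w : K w -> preim_sub K v w.
  move=> hw /=; rewrite (_ : w *m v = v 0 0 *: w); first by apply: submZ => //; exact: sm_ax.
  by apply/rowP => j; rewrite !mxE big_ord1 !ord1 mulrC.
have [[w hw nw]|nK] := pselect (exists2 w, preim_sub K v w & ~ K w).
  by apply: (exK_ext KK2 (fun _ e => e) e2); apply: IH => //; exists w.
have {}nK w : preim_sub K v w -> K w.
  by move=> hw; apply: contrapT => nw; apply: nK; exists w.
(* Now [v] is regular modulo [K]. By exactness modulo [v], every cycle is a boundary plus [phi v]
   times some vector, which flatness shows to be a cycle; as [phi v] is in the maximal ideal of [A],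
   the cycles are all boundaries. *)
pose P (z : 'rV[A]_(rk Q a)) := forall a', extm phi K (z *m mx Q a a').
pose D (z : 'rV[A]_(rk Q a)) := exists y, extm phi K (z - y *m mx Q (nx o a) a).
have sP : submodule P.
  split=> [a'|c x y hx hy a']; first by rewrite mul0mx; exact: extm0.
  by rewrite mulmxDl -scalemxAl; apply: extmD => //; apply: extmZ.
have sD : submodule D.
  split; first by exists 0; rewrite mul0mx subr0; exact: extm0.
  move=> c x y [x' hx] [y' hy]; exists (c *: x' + y').
  rewrite mulmxDl -scalemxAl opprD addrACA -scalerBr; apply: extmD => //; exact: extmZ.
have hT (w : 'rV[A]_(rk Q a)) : (map_mx phi v)^T *m w = phi (v 0 0) *: w.
  by rewrite mulmx11 !mxE.
apply: (nakayama lA sD sP); first exact: noeth_rV.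
move=> z Pz; have [|y hy] := e2 z; first by move=> a'; apply: extm_mono (Pz a').
have [w hw] := extm_decomp (K := K) (K2 := add_sub K v) (h := v) (fun _ h => h) hy.
exists (phi (v 0 0)), w; split.
- exact: lphi.
- move=> a'; apply: (extm_mono (K := preim_sub K v)) => //.
  apply: (flat_extm (K := K) (h := v)) => //; rewrite mulmxA.
  have := extmB (Pz a') (extmM (mx Q a a') hw).
  by rewrite !mulmxBl -!mulmxA mx_mx mulmx0 subr0 opprB addrC subrK.
- by exists y; move: hw; rewrite hT addrAC.
Qed.

(** Adjoining the basis vectors to [K] one at a time filters the quotient of [R ^ s] with cyclic
    subquotients; [k] bounds the indices of the basis vectors still missing from [K]. *)
Lemma exK_all a : exK a (max_sub lR) -> forall s (K : submod_pred 'rV[R]_s), exK a K.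
Proof.
move=> base s K; have cyc := exK_cyclic base.
suff H k : forall K : submod_pred 'rV[R]_s,
    (forall i : 'I_s, (k <= i)%N -> K (delta_mx 0 i)) -> exK a K.
  by apply: (H s) => i; rewrite leqNgt ltn_ord.
elim: k => {K} [|k IH] K hK.
  move=> x _; exists 0; rewrite mul0mx subr0 => j.
  have := @extc_sum _ _ phi A^o s K _ (index_enum 'I_s) (fun l i => phi ((delta_mx 0 l : 'rV[R]_s) 0 i) *: (x l j : A^o)).
  case=> [l|]; first by apply: extc1; exact: hK.
  move=> n [k [b [hk hc]]]; exists n, k, b; split=> // i; rewrite -hc.
  rewrite (bigD1 i) //= mxE !eqxx rmorph1 scale1r big1 ?addr0 // => l /negPf li.
  by rewrite mxE [i == l]eq_sym li andbF rmorph0 scale0r.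
have [ks|sk] := ltnP k s; last first.
  by apply: IH => i ki; apply: hK; have := ltn_ord i; rewrite ltnNge (leq_trans sk).
pose k' : 'I_s := Ordinal ks.
have KK2 w : K w -> add_sub K (delta_mx 0 k' : 'M_(1, s)) w.
  by move=> hw; exists 0; rewrite mul0mx subr0.
apply: (exK_ext KK2 (fun _ e => e)); last exact: cyc.
apply: IH => i; rewrite leq_eqVlt => /orP[/eqP e|ki]; last by apply: KK2; apply: hK.
exists 1; rewrite mul1mx (_ : k' = i) ?subrr; last by apply: val_inj.
by apply: subm0; exact: sm_ax.
Qed.

(* Dimension shifting along 0 -> syzygies of K -> free -> K -> 0. *)
Lemma exK_up a : (forall s (K : submod_pred 'rV[R]_s), exK a K) -> exq Q (nx o a) ->
  forall s (K : submod_pred 'rV[R]_s), exK (nx o a) K.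
Proof.
move=> ea ex s K x hx.
have [r [v [hv gv]]] := noeth_rV nR (sm_ax K).
pose h : 'M[R]_(r, s) := \matrix_i v i.
have decK (k : 'rV[R]_s) : K k -> exists w : 'rV[R]_r, zero_sub R s (k - w *m h).
  move=> /gv[c ->]; exists (\row_i c i); rewrite /= mulmx_sum_row -sumrB big1 // => i _.
  by rewrite rowK mxE subrr.
have [w /extm_zero/eqP] := extm_decomp decK (hx a).
rewrite subr_eq0 => /eqP hw.
have [|y hy] := ea r (preim_sub (zero_sub R s) h) w.
  move=> a'; apply: (flat_extm (K := zero_sub R s) (h := h)) => //.
  by rewrite mulmxA -hw -mulmxA mx_mx mulmx0; exact: extm0.
have /extm_zero := extm_map (K := zero_sub R s) (K1 := preim_sub (zero_sub R s) h) (h := h) (fun _ e => e) hy.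
rewrite mulmxBr -hw => /eqP; rewrite subr_eq0 => /eqP hy'.
have [a'|z hz] := exqM ex (x := x - (map_mx phi h)^T *m y).
  have [e|ne] := pselect (a' = a).
    by subst a'; rewrite mulmxBl hy' mulmxA subrr.
  by rewrite mx_shape ?mulmx0 // dgn_nx => e; apply: ne; move: e; rewrite /dgn; case: (o); lia.
exists z; rewrite -hz opprB addrC subrK.
suff : extm phi K ((map_mx phi h)^T) by move=> /(extmM y).
move=> j; have := extc1 phi (1 : A^o) (hv j); congr extc; apply/funext => i.
by rewrite !mxE -[RHS]mulr1.
Qed.
End Exactness.
End MatrixExtension.

Section ClosedFibre.
Variables (R A F : comUnitRingType) (phi : {rmorphism R -> A}) (pi : {rmorphism A -> F}).
Hypotheses (lR : local_ring R) (piS : forall z, exists y, pi y = z).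
Hypothesis piK : forall y, pi y = 0 <-> max_ideal_ext phi y.
Lemma extc_max (c : 'I_1 -> A) : extc phi (N := A^o) (max_sub lR) c <-> pi (c 0) = 0.
Proof.
split=> [[n [k [a [hk hc]]]]|/piK[s [hs hc]]].
  apply/piK; exists [seq (a l, k l 0 0) | l <- index_enum 'I_n]; split.
    by move=> p /mapP[l _ ->]; exact: hk.
  by rewrite big_map hc; apply: eq_bigr => l _; rewrite mulrC.
exists (size s), (fun l => (nth (0, 0) s l).2%:M), (fun l => (nth (0, 0) s l).1); split.
  by move=> l /=; rewrite mxE eqxx; apply: hs; rewrite mem_nth.
move=> i; rewrite (ord1 i) hc (big_nth (0, 0)) big_mkord; apply: eq_bigr => l _.
by rewrite mxE eqxx mulrC.
Qed.

Lemma lift_mx m n (x : 'M[F]_(m, n)) : exists y : 'M[A]_(m, n), map_mx pi y = x.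
Proof.
exists (\matrix_(i, j) projT1 (cid (piS (x i j)))); apply/matrixP => i j.
by rewrite !mxE; case: cid.
Qed.

Lemma extm_max q (x : 'M[A]_(1, q)) : extm phi (max_sub lR) x <-> map_mx pi x = 0.
Proof.
split=> [h|h j].
  by apply/rowP => j; rewrite !mxE; apply/(extc_max (fun i => x i j)); exact: h.
by apply/extc_max; have := congr1 (fun y : 'M_(_, _) => y 0 j) h; rewrite !mxE.
Qed.

Lemma exK_fibre o (Q : fx o A) a : exK phi Q a (max_sub lR) <-> exq (bc pi Q) a.
Proof.
split=> [h x hx|h x hx].
  have [x' xE] := lift_mx x.
  have [a'|y hy] := h x'; first by apply/extm_max; rewrite map_mxM xE hx.
  exists (map_mx pi y); move/extm_max: hy; rewrite map_mxB xE map_mxM => /eqP.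
  by rewrite subr_eq0 => /eqP.
have [a'|y hy] := h (map_mx pi x).
  by have /extm_max := hx a'; rewrite map_mxM.
have [y' yE] := lift_mx y; exists y'; apply/extm_max.
by rewrite map_mxB map_mxM yE hy subrr.
Qed.
End ClosedFibre.

Lemma exK_zero (R A : comUnitRingType) (phi : {rmorphism R -> A}) o (Q : fx o A) a :
  exK phi Q a (zero_sub R 1) <-> exq Q a.
Proof.
split=> [h x hx|h x hx].
  have [a'|y /extm_zero/eqP] := h x; first by rewrite hx; exact: extm0.
  by rewrite subr_eq0 => /eqP; exists y.
have [a'|y ->] := h x; first by apply: extm_zero (hx a').
by exists y; rewrite subrr; exact: extm0.
Qed.

(** * Injective modules *)

Section Baer.
Variables (A : comUnitRingType) (E : lmodType A).

(** Partial linear maps are handled through their graphs, so that Zorn's lemma can be applied to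
    plain sets ordered by inclusion. *)
Definition graph (M : lmodType A) (G : set (M * E)) := [/\ G (0, 0),
  forall a p q, G p -> G q -> G (a *: p.1 + q.1, a *: p.2 + q.2) &
  forall e, G (0, e) -> e = 0].

Lemma graph_fun (M : lmodType A) (G : set (M * E)) x e e' :
  graph G -> G (x, e) -> G (x, e') -> e = e'.
Proof.
move=> [_ lin fn] h h'; apply/eqP; rewrite -subr_eq0; apply/eqP/fn.
by have := lin (-1) _ _ h' h; rewrite /= !scaleN1r addNr addrC.
Qed.

Lemma zorn_extend (M : lmodType A) (G0 : set (M * E)) : graph G0 ->
  (forall G x, graph G -> (G0 `<=` G)%classic -> (forall e, ~ G (x, e)) ->
     exists e, forall a e', G (a *: x, e') -> e' = a *: e) ->
  exists h : {linear M -> E}, forall x e, G0 (x, e) -> h x = e.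
Proof.
move=> g0 step.
(* The condition bears on the union of [G0] and [G] rather than on a [G] containing [G0], so that
   the union of the empty chain qualifies as well. *)
have [F Fc Ft|G [gG mG]] := @Zorn_bigcup _ [set G : set (M * E) | graph (G0 `|` G)%classic].
  split=> [|a p q|e].
  - by left; case: g0.
  - case=> [hp|[Gp Fp hp]] [hq|[Gq Fq hq]].
    + by left; case: g0 => _ + _; apply.
    + have [_ + _] := Fc _ Fq.
      by move=> /(_ a p q (or_introl hp) (or_intror hq))[?|?]; [left|right; exists Gq].
    + have [_ + _] := Fc _ Fp.
      by move=> /(_ a p q (or_intror hp) (or_introl hq))[?|?]; [left|right; exists Gp].
    + have [s|s] := Ft _ _ Fp Fq.
        have [_ + _] := Fc _ Fq.
        by move=> /(_ a p q (or_intror (s _ hp)) (or_intror hq))[?|?]; [left|right; exists Gq].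
      have [_ + _] := Fc _ Fp.
      by move=> /(_ a p q (or_intror hp) (or_intror (s _ hq)))[?|?]; [left|right; exists Gp].
  - case=> [h|[H FH h]]; first by case: g0 => _ _; apply.
    by have [_ _] := Fc _ FH; apply; right.
set T := (G0 `|` G)%classic in gG.
have tot x : exists e, T (x, e).
  apply: contrapT => nx.
  have [||e he] := step T x gG; [by move=> ? ?; left|by move=> e h; apply: nx; exists e|].
  pose B : set (M * E) := fun p => exists (m : M * E) a, T m /\ p = (m.1 + a *: x, m.2 + a *: e).
  have [t0 tl tf] := gG.
  have TB : (T `<=` B)%classic.
    by move=> m Tm; exists m, 0; split=> //; rewrite !scale0r !addr0; case: (m).
  have Bx : B (x, e) by exists (0, 0), 1; split=> //; rewrite /= !add0r !scale1r.
  apply: (mG B).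
    split; first by move=> p Gp; apply: TB; right.
    by move=> BG; apply: nx; exists e; right; exact: BG.
  rewrite /= (_ : (G0 `|` B)%classic = B); last first.
    by apply/seteqP; split=> [p [h|//]|p h]; [apply: TB; left|right].
  split; first exact: TB.
  - move=> a _ _ [m [c [Tm ->]]] [m' [c' [Tm' ->]]] /=.
    exists (a *: m.1 + m'.1, a *: m.2 + m'.2), (a * c + c'); split; first exact: tl.
    by rewrite /= !scalerDr !scalerDl !scalerA; congr (_, _); rewrite addrACA.
  - move=> f [[m f'] [c [Tm [/esym/eqP e1 ->]]]] /=.
    have Tn : T ((- c) *: x, f').
      by rewrite /= in e1; rewrite scaleNr; move: e1; rewrite addr_eq0 => /eqP <-.
    by rewrite (he _ _ Tn) scaleNr addNr.
pose h x := projT1 (cid (tot x)); have hP x : T (x, h x) := projT2 (cid (tot x)).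
have lh : linear h.
  move=> a x y; apply: (graph_fun gG (hP _)).
  by have [_ tl _] := gG; exact: (tl a (x, h x) (y, h y) (hP x) (hP y)).
pose hL : {linear M -> E} := HB.pack h (GRing.isLinear.Build A _ _ _ h lh).
by exists hL => x e he; apply: (graph_fun gG (hP x)); left.
Qed.

(* Baer's criterion, with partial maps out of A given by their graphs. *)
Definition baer := forall J : A -> E -> Prop, J 0 0 ->
  (forall a b y c z, J b y -> J c z -> J (a * b + c) (a *: y + z)) ->
  (forall y, J 0 y -> y = 0) -> exists e, forall a y, J a y -> y = a *: e.

Lemma baer_injective : baer -> injective_module E.
Proof.
move=> bE M M' f g fi.
have [||h hh] := @zorn_extend M' [set p | exists m, p = (f m, g m)].
- split; first by exists 0; rewrite !linear0.
    by move=> a _ _ [m ->] [m' ->] /=; exists (a *: m + m'); rewrite !linearP.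
  move=> e [m [h ->]]; have -> : m = 0 by apply: fi; rewrite -h linear0.
  by rewrite linear0.
- move=> G x [g0 gl gf] _ _; have [|||e he] := bE (fun a e => G (a *: x, e)).
  + by rewrite scale0r.
  + move=> a b y c z h h'; have := gl a _ _ h h'.
    by rewrite /= scalerA -scalerDl.
  + by rewrite scale0r; exact: gf.
  + by exists e.
by exists h => x; apply: hh; exists x.
Qed.
End Baer.

Section Divisible.
Variable D : lmodType int.
Hypothesis divD : forall (n : nat) (y : D), exists e : D, y = (n.+1%:Z : int) *: e.
(** The domain of the partial map is an ideal of the integers. Division with remainder shows that
    its least positive element generates it, and dividing the value there by that element, by
    divisibility of [D], gives [e]. *)
Lemma divisible_baer : baer D.
Proof.
move=> J J0 Jl Jf.
have JN a y : J a y -> J (- a) (- y).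
  by move=> h; have := Jl (-1) _ _ _ _ h J0; rewrite mulN1r !addr0 scaleN1r.
have [[n hn]|nJ] := pselect (exists n : nat, exists y, J n.+1%:Z y); last first.
  exists 0 => a y h; case: a h => [[|n]|n] h; first by rewrite scale0r; apply: Jf.
    by case: nJ; exists n, y.
  by case: nJ; exists n, (- y); have := JN _ _ h; rewrite NegzE opprK.
have ex : exists n, `[< exists y, J n.+1%:Z y >] by exists n; apply/asboolP.
have [m /asboolP[y hy] mm] := find_ex_minn ex.
have [e ye] := divD m y; exists e => a z h.
pose q := (a %/ m.+1)%Z; pose r := (a %% m.+1)%Z.
have ar : a = q * m.+1%:Z + r by exact: divz_eq.
have hr : J r (z - q *: y).
  have := Jl (- q) _ _ _ _ hy h; rewrite scaleNr [- _ + z]addrC; congr (J _ _).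
  by rewrite ar mulNr addKr.
have r0 : r = 0.
  have rge : 0 <= r by apply: modz_ge0.
  have rlt : r < m.+1%:Z by apply: ltz_pmod.
  case: r rge rlt hr {ar} => [[//|k]|//] _ km hk.
  have : (m <= k)%N by apply: mm; apply/asboolP; exists (z - q *: y).
  by lia.
have := Jf (z - q *: y); rewrite -r0 => /(_ hr) /eqP.
by rewrite subr_eq0 => /eqP ->; rewrite ye scalerA ar r0 addr0.
Qed.
End Divisible.

Definition intr_rm (A : comUnitRingType) : {rmorphism int -> A} := intmul 1.

(** Evaluation at 1 identifies linear maps over [A] into the coextension with linear maps over [Z]
    into [D], and restriction of scalars preserves injective maps. *)
Lemma coext_injective (Z A : comUnitRingType) (psi : {rmorphism Z -> A}) (D : lmodType Z) :
  injective_module D -> injective_module (coext psi D).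
Proof.
move=> iD M M' f g fi.
pose g0 (m : restr psi M) : D := g m 1.
have lg0 : linear g0.
  move=> a x y; rewrite /g0 -[(a *: x + y)]/(psi a *: (x : M) + (y : M)).
  rewrite linearP -[LHS]/(coext_fun _ (1 * _) + _) mul1r; congr (_ + _).
  by rewrite -[psi a]mulr1 coextZ.
pose gL : {linear restr psi M -> D} :=
  HB.pack g0 (GRing.isLinear.Build Z _ _ _ g0 lg0).
have [h0 hh0] := iD (restr psi M) (restr psi M') (@restr_fun _ _ psi M M' f) gL fi.
have hD (m : M') : {morph (fun a : A => h0 (a *: m : restr psi M')) : x y / x + y}.
  by move=> x y; rewrite scalerDl -linearD.
have hZ (m : M') (a : Z) (x : A) :
    h0 (psi a * x *: m : restr psi M') = a *: h0 (x *: m : restr psi M').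
  by rewrite -scalerA; exact: (linearZ_LR h0 a (x *: m : restr psi M')).
pose h (m : M') : coext psi D := Coext (hD m) (hZ m).
have lh : linear h.
  move=> b x y; apply: coext_eq => a /=.
  by rewrite scalerDr scalerA -linearD.
pose hL : {linear M' -> coext psi D} := HB.pack h (GRing.isLinear.Build A _ _ _ h lh).
exists hL => x; apply: coext_eq => a /=.
have -> : a *: f x = f (a *: x) by rewrite linearZ.
transitivity (g0 (a *: x)); first exact: hh0.
by rewrite /g0 linearZ -[LHS]/(coext_fun (g x) (1 * a)) mul1r.
Qed.

Section RationalsModIntegers.
Variable L : Type.
Let V := (L -> rat^o).
Definition ratfun : lmodType int := restr (intr_rm rat) V.
Fact intval_ax : submodule (fun f : ratfun => forall l, exists n : int, (f : L -> rat) l = n%:~R).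
Proof.
split=> [l|a f g hf hg l]; first by exists 0.
have [[n hn] [m hm]] := (hf l, hg l); exists (a * n + m).
rewrite -[LHS]/((a%:~R : rat) * f l + g l) hn hm.
by rewrite intrD intrM.
Qed.
Definition intsub := SubmodPred intval_ax.
Lemma intsubI (f : ratfun) : (forall l, exists n : int, (f : L -> rat) l = n%:~R) -> intsub f.
Proof. by []. Qed.
(** This is the product of [L] copies of Q/Z, presented as one quotient of a function space. *)
Definition qz : lmodType int := quom intsub.
Lemma qz_baer : baer qz.
Proof.
apply: divisible_baer => n y.
have [f ->] := qpi_surj y.
pose g : ratfun := fun l => (f : L -> rat) l / n.+1%:R.
exists (qpi _ g); rewrite -linearZ; congr (qpi _ _); apply/funext => l.
rewrite -[RHS]/((n.+1%:Z)%:~R * ((f : L -> rat) l / n.+1%:R)).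
by rewrite mulrCA -pmulrn divff ?mulr1 // pnatr_eq0.
Qed.
End RationalsModIntegers.

Section EnoughInjectives.
Variables (A : comUnitRingType) (M : lmodType A).
Definition zchar := {linear restr (intr_rm A) M -> qz unit}.
Let V := ratfun zchar.
Definition rep1 (y : qz unit) : rat := (repr y : unit -> rat) tt.
Definition charval (x : M) (l : zchar) : rat := rep1 (l (x : restr (intr_rm A) M)).
Lemma rep1P (a : int) (y z : qz unit) :
  exists n : int, rep1 (a *: y + z) - (a%:~R * rep1 y + rep1 z) = n%:~R.
Proof.
have : intsub unit (repr (a *: y + z) - (a *: repr y + repr z)).
  by apply/qpiP; rewrite linearP /= !qreprK.
by move=> /(_ tt).
Qed.
Lemma rep1_int y : (exists n : int, rep1 y = n%:~R) -> y = 0.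
Proof.
move=> [n h]; rewrite -(qreprK y); apply/qpi0P; apply: intsubI => -[]; exists n; exact: h.
Qed.
Definition emb_val (x : M) : qz zchar := qpi (intsub zchar) (charval x : V).
Lemma emb_valP (x y : M) (n : int) : emb_val ((intr_rm A n) *: x + y) = n *: emb_val x + emb_val y.
Proof.
rewrite -linearP; apply/qpiP; apply: intsubI => l.
have [m hm] := rep1P n (l (x : restr (intr_rm A) M)) (l (y : restr (intr_rm A) M)).
by exists m; rewrite -hm -linearP.
Qed.
Lemma emb_val0 : emb_val 0 = 0.
Proof.
have := emb_valP 0 0 1; rewrite scaler0 addr0 scale1r => /eqP.
by rewrite -subr_eq subrr => /eqP.
Qed.
Lemma emb_D x : {morph (fun a : A => emb_val (a *: x)) : a b / a + b}.
Proof.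
by move=> a b; rewrite scalerDl -[a *: x]scale1r -[1](rmorph1 (intr_rm A)) emb_valP !scale1r.
Qed.
Lemma emb_Z x (n : int) a : emb_val (intr_rm A n * a *: x) = n *: emb_val (a *: x).
Proof. by rewrite -scalerA -[_ *: (a *: x)]addr0 emb_valP emb_val0 addr0. Qed.
(** The classical embedding into Hom_Z(A, (Q/Z)^X), where X is the set of all additive characters of
    [M]: it sends [x] to [a] mapped to the family of all [l (a x)]. The rational representatives in
    [charval] are additive only up to integers, which is what [rep1P] records. *)
Definition emb (x : M) : coext (intr_rm A) (qz zchar) := Coext (emb_D x) (emb_Z x).
Fact emb_linear : linear emb.
Proof.
move=> c x y; apply: coext_eq => a /=; rewrite scalerDr scalerA.
by rewrite -[_ *: x]scale1r -[1](rmorph1 (intr_rm A)) emb_valP !scale1r.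
Qed.
HB.instance Definition _ := GRing.isLinear.Build A _ _ _ emb emb_linear.

Lemma zchar_separate (x : M) : x <> 0 -> exists l : zchar, l (x : restr (intr_rm A) M) <> 0.
Proof.
move=> x0.
(* [k] is the additive order of [x], or 2 if that order is infinite. In both cases [x] may be sent
   to the class of [1 / k], which is nonzero because [k > 1]. *)
have [k k1 hk] : exists2 k : nat, (1 < k)%N &
    forall a : int, a%:~R *: x = 0 -> exists n : int, a = n * k%:Z.
  have [ex|nex] := pselect (exists n : nat, n.+1%:R *: x = 0); last first.
    exists 2%N => // a; case: a => [[|n]|n]; first by exists 0; rewrite mul0r.
      by move=> h; case: nex; exists n.
    move=> h; case: nex; exists n; apply/eqP; rewrite -oppr_eq0 -scaleNr; apply/eqP.
    by rewrite -[RHS]h NegzE; congr (_ *: _); rewrite rmorphN.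
  have ex' : exists n, n.+1%:R *: x == 0 by case: ex => n h; exists n; apply/eqP.
  have [m /eqP hm mm] := find_ex_minn ex'; exists m.+1.
    by case: m hm {mm} => // h; case: x0; rewrite -[x]scale1r.
  move=> a ha; exists (a %/ m.+1)%Z.
  have ar := divz_eq a m.+1; set r := (a %% m.+1)%Z in ar.
  have rge : 0 <= r by apply: modz_ge0.
  have rlt : r < m.+1%:Z by apply: ltz_pmod.
  have hr : r%:~R *: x = 0.
    have -> : r = a - (a %/ m.+1)%Z * m.+1 by rewrite {1}ar addrC addKr.
    rewrite rmorphB rmorphM /= scalerBl ha -scalerA.
    by rewrite [_ *: x]hm scaler0 subrr.
  suff r0 : r = 0 by rewrite {1}ar r0 addr0.
  case: r rge rlt hr {ar} => [[//|l]|//] _ lm hl.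
  have : (m <= l)%N by apply: mm; apply/eqP.
  by lia.
have k0 : (k%:R : rat) != 0 by rewrite pnatr_eq0; lia.
pose c : qz unit := qpi (intsub unit) ((fun=> k%:R^-1) : ratfun unit).
have cE (a : int) : a *: c = 0 <-> exists n : int, a = n * k%:Z.
  rewrite /c -linearZ qpi0P; split=> [/(_ tt)[n]|[n ->]]; last apply: intsubI => l.
    move=> h; exists n; have {}h : (a%:~R : rat) * k%:R^-1 = n%:~R := h.
    have : (a%:~R : rat) = n%:~R * k%:R by rewrite -h divfK.
    by rewrite pmulrn -intrM => /intr_inj.
  exists n; change (((n * k%:Z)%:~R : rat) * k%:R^-1 = n%:~R); by rewrite intrM mulfK.
have [||l hl] := @zorn_extend int (qz unit) (restr (intr_rm A) M)
    (fun p => exists a : int, p = (a%:~R *: x, a *: c)).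
- split; first by exists 0; rewrite !scale0r.
    move=> a _ _ [b ->] [b' ->] /=; exists (a * b + b').
    congr (_, _); last by rewrite scalerDl scalerA.
    change ((a%:~R : A) *: (b%:~R *: x) + b'%:~R *: x = (a * b + b')%:~R *: x).
    by rewrite intrD intrM scalerDl scalerA.
  by move=> e [a [/esym h ->]]; apply/cE/hk.
- move=> G y [G0 Gl Gf] _ _; have [||| e he] := @qz_baer unit (fun a e => G (a *: y, e)).
  + by rewrite scale0r.
  + move=> a b z d w h h'; have := Gl a _ _ h h'.
    by rewrite /= scalerA -scalerDl.
  + by rewrite scale0r; exact: Gf.
  + by exists e.
exists l; rewrite (hl x c); last by exists 1; rewrite !scale1r.
rewrite -[c]scale1r => /cE[n] /eqP; rewrite eq_sym => /eqP h.
have := congr1 absz h; rewrite abszM /= => /eqP; rewrite muln_eq1 => /andP[_ /eqP] e.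
by rewrite e in k1.
Qed.

Lemma emb_inj : injective emb.
Proof.
move=> x y h; apply/eqP; rewrite -subr_eq0; apply/eqP; apply: contrapT => /zchar_separate[l].
apply; apply: rep1_int.
have : emb (x - y) = 0 by rewrite linearB; apply/eqP; rewrite subr_eq0; apply/eqP.
move=> /(congr1 (fun f : coext (intr_rm A) (qz zchar) => f 1)) /=; rewrite scale1r => /qpi0P.
by move=> /(_ l).
Qed.

Lemma enough_injectives : exists E : lmodType A, injective_module E /\
  exists f : {linear M -> E}, injective f.
Proof.
exists (coext (intr_rm A) (qz zchar)); split; last by exists emb; exact: emb_inj.
by apply: coext_injective; apply: baer_injective; exact: qz_baer.
Qed.
End EnoughInjectives.

(** * K-injective complexes *)

Section IntRecDown.
Variables (T : int -> Type) (dflt : forall i, T i) (b : int).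
Variables (Inv : forall i, T i -> Prop) (Rel : forall i j, T i -> T j -> Prop).
Hypothesis inv0 : Inv (dflt b).
Hypothesis step : forall (i j : int) (t : T i), j = i - 1 -> i <= b -> Inv t ->
  exists2 t' : T j, Rel t t' & Inv t'.
Lemma int_rec_down : exists h : forall i, T i,
  [/\ forall i, b <= i -> h i = dflt i,
      forall i, i <= b -> Inv (h i) &
      forall i j : int, j = i - 1 -> i <= b -> Rel (h i) (h j)].
Proof.
have [||h' [h0 hI hR]] := @int_rec (fun k => T (- k)) (fun k => dflt (- k)) (- b)
  (fun k => @Inv (- k)) (fun k l => @Rel (- k) (- l)).
- by rewrite opprK.
- by move=> i j t e bi it; apply: step => //; lia.
pose h i := eq_rect (- - i) T (h' (- i)) i (opprK i).
have hE k : h (- k) = h' k.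
  rewrite /h; move: (opprK (- k)); have := opprK k; move: (- - k) => m em.
  by subst m => p; rewrite (eq_irrelevance p erefl).
have w (i : int) : exists k : int, i = - k by exists (- i); rewrite opprK.
exists h; split=> [i|i|i j].
- by have [k ->] := w i => bi; rewrite hE h0 //; lia.
- by have [k ->] := w i => bi; rewrite hE; apply: hI; lia.
- by have [k ->] := w i; have [l ->] := w j => e bi; rewrite !hE; apply: hR; lia.
Qed.
End IntRecDown.

Definition lfam (A : comUnitRingType) (X Y : cplx A) := forall i j, {linear X i -> Y j}.
Section Families.
Variables (A : comUnitRingType) (X Y : cplx A).
(* Chain maps of degree [n] and null-homotopies for them, as families. *)
Definition cfam n (u : lfam X Y) := forall (i i0 j j0 : int) x,
  i0 = i - 1 -> j = i + n -> j0 = j - 1 ->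
  diff Y j j0 (u i j x) = sg n (u i0 j0 (diff X i i0 x)).
Definition nullfam n (u h : lfam X Y) := forall (i i0 j j1 : int) x,
  i0 = i - 1 -> j = i + n -> j1 = j + 1 ->
  u i j x = diff Y j1 j (h i j1 x) + sg n (h i0 j (diff X i i0 x)).
End Families.

Section KernelPred.
Variables (A : comUnitRingType) (M N : lmodType A) (f : {linear M -> N}).
Fact ker_ax : submodule (fun x => f x = 0).
Proof. by split=> [|a x y hx hy]; rewrite ?linear0 // linearP hx hy scaler0 addr0. Qed.
Definition kerp := SubmodPred ker_ax.
Fact im_ax : submodule (fun y => exists x, f x = y).
Proof.
by split=> [|a _ _ [x <-] [y <-]]; [exists 0; rewrite linear0|exists (a *: x + y); rewrite linearP].
Qed.
Definition imp := SubmodPred im_ax.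
End KernelPred.

Lemma conc_lin (A : comUnitRingType) (M : lmodType A) (Y : int -> lmodType A) j
  (g : {linear M -> Y j}) : exists H : forall j', {linear M -> Y j'}, H j = g.
Proof.
exists (fun j' => match pselect (j = j') with
  | left e => eq_rect j (fun j' => {linear M -> Y j'}) g j' e | right _ => \0 end).
by case: pselect => // e; rewrite (eq_irrelevance e erefl).
Qed.

Lemma injective_factor (A : comUnitRingType) (M N E : lmodType A) (f : {linear M -> N})
  (g : {linear M -> E}) : injective_module E -> (forall x, f x = 0 -> g x = 0) ->
  exists h : {linear N -> E}, forall x, h (f x) = g x.
Proof.
move=> iE fg0; have ff0 (x : M) : kerp f x -> f x = 0 by [].
have gg0 (x : M) : kerp f x -> g x = 0 by exact: fg0.
have fi : injective (quo_lift ff0).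
  move=> x y; have [x' ->] := qpi_surj x; have [y' ->] := qpi_surj y.
  rewrite !quo_liftE => e; apply/qpiP; rewrite /= linearB e subrr //.
have [h hh] := iE _ _ (quo_lift ff0) (quo_lift gg0) fi.
by exists h => x; rewrite -(quo_liftE ff0 x) -(quo_liftE gg0 x); exact: hh.
Qed.

Section Down.
Variables (A : comUnitRingType) (Z I : cplx A) (n c : int) (u : lfam Z I).
Hypothesis cu : cfam n u.
Hypothesis iI : forall j, injective_module (I j).
Hypothesis bI : forall j : int, c < j -> forall x : I j, x = 0.
Hypothesis ex : forall i : int, (forall x : Z i, is_cycle x -> is_boundary x) \/
  (forall x : I (i + n), x = 0).
(** The homotopy is built downwards from a degree above which the target is zero: the part of [u]
    not yet accounted for vanishes on the kernel of the differential, so injectivity factors it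
    through that differential. Exactness of [Z] may fail at a degree whose target is zero; that
    freedom is what later turns a finite injective dimension into a range of degrees. *)
Lemma null_into_injectives : exists h : lfam Z I, nullfam n u h.
Proof.
pose St i := forall j, {linear Z i -> I j}.
pose Inv i (H : St i) := forall (j j1 : int) x, j = i + n -> j1 = j + 1 -> is_cycle x ->
  u i j x = diff I j1 j (H j1 x).
pose Rel i i0 (H : St i) (H' : St i0) := forall (j j1 : int) x, j = i + n -> j1 = j + 1 ->
  u i j x = diff I j1 j (H j1 x) + sg n (H' j (diff Z i i0 x)).
pose b := c - n + 1.
have [||h [h0 hI hR]] := @int_rec_down St (fun i j => \0) b Inv Rel.
- by move=> j j1 x e1 e2 _; rewrite [LHS]bI ?[RHS]bI //; lia.
- move=> i i0 H e _ iH.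
  pose j := i + n; pose j1 := j + 1.
  have key x : diff Z i i0 x = 0 -> u i j x - diff I j1 j (H j1 x) = 0.
    move=> dx; rewrite (iH j j1) ?subrr //.
    by rewrite /is_cycle -e.
  pose g (x : Z i) : I j := sg n (u i j x - diff I j1 j (H j1 x)).
  have lg : linear g.
    by move=> a x y; rewrite /g (linearP (u i j)) (linearP (H j1)) (linearP (diff I j1 j)) opprD addrACA -scalerBr sg_add sg_lin.
  pose gL : {linear Z i -> I j} := HB.pack g (GRing.isLinear.Build A _ _ _ g lg).
  have [|h hh] := @injective_factor A (Z i) (Z i0) (I j) (diff Z i i0) gL (@iI j).
    by move=> x /key e'; rewrite /= /g e' sg_zero.
  have [H' H'E] := conc_lin h.
  have rel : Rel i i0 H H'.
    move=> _ _ x -> ->; rewrite -/j -/j1 H'E hh /= /g sg_inv addrC subrK //.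
  exists H' => // j' j'1 y ej' ej'1 cy; subst j'1.
  have [|triv] := ex i0; last by subst j'; rewrite [LHS]triv [RHS]triv.
  move=> /(_ y cy) by_.
  have [x <-] : exists x : Z i, diff Z i i0 x = y.
    by have e4 : i0 + 1 = i by [lia]; rewrite -e4.
  have ej : j' = j - 1 by rewrite ej' /j; lia.
  have := @cu i i0 j j' x e erefl ej; rewrite (rel j j1) // linearD diff_diff add0r.
  rewrite (raddf_sg (diff I j j')) /= => /(congr1 (sg n)); rewrite !sg_inv.
  by move=> <-; rewrite (_ : j' + 1 = j) //; lia.
exists h => i i0 j j1 x e1 e2 e3.
have [ib|bi] := leP i b; first exact: (hR i i0 e1 ib j j1 x e2 e3).
have [bi' bi0] : b <= i /\ b <= i0 by lia.
rewrite [LHS]bI; last by rewrite /b in bi; lia.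
by rewrite !h0 //= linear0 add0r sg_zero.
Qed.
End Down.

Lemma bounded_injectives (A : comUnitRingType) (I : cplx A) c :
  (forall j, injective_module (I j)) -> (forall j : int, c < j -> forall x : I j, x = 0) ->
  K_injective I.
Proof.
move=> iI bI Z aZ f.
have cst (i j : int) : exists g : {linear Z i -> I j}, forall e : i = j, g = eq_rect i (fun j => {linear Z i -> I j}) (f i) j e.
  have [e|ne] := pselect (i = j); last by exists \0 => e; case: ne.
  by exists (eq_rect i (fun j => {linear Z i -> I j}) (f i) j e) => e'; rewrite (Prop_irrelevance e e').
pose u i j := projT1 (cid (cst i j)).
have uE i : u i i = f i by have := projT2 (cid (cst i i)) erefl.
have cu : cfam 0 u.
  move=> i i0 j j0 x e1 e2 e3; have {}e2 : j = i by lia.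
  by subst j j0 i0; rewrite !uE chain_funP.
have [|h hh] := @null_into_injectives A Z I 0 c u cu iI bI; first by move=> i; left; exact: aZ.
exists h => i x; rewrite -uE.
by rewrite (hh i (i - 1) i (i + 1)) // addr0.
Qed.

(** * Mapping cones and maps into K-injective complexes *)

Section Cone.
Variables (A : comUnitRingType) (X Y : cplx A) (f : chain_map X Y).
(** The chain map spread over all pairs of degrees, zero off the diagonal; the differential of the
    cone can then be given for arbitrary [i] and [j], as [cplx] demands. *)
Definition dfam (i j : int) : {linear X i -> Y j} :=
  match pselect (i = j) with
  | left e => eq_rect i (fun j => {linear X i -> Y j}) (f i) j e | right _ => \0 end.
Lemma dfamE i : dfam i i = f i.
Proof. by rewrite /dfam; case: pselect => // e; rewrite (eq_irrelevance e erefl). Qed.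
Lemma dfam0 i j x : i <> j -> dfam i j x = 0.
Proof. by rewrite /dfam; case: pselect. Qed.
Definition cone_diff (i j : int) (z : (Y i * X (i - 1))%type) : (Y j * X (j - 1))%type :=
  (diff Y i j z.1 + dfam (i - 1) j z.2, - diff X (i - 1) (j - 1) z.2).
Fact cone_diff_linear i j : linear (@cone_diff i j).
Proof.
move=> a z w; rewrite /cone_diff; congr (_, _) => /=.
  by rewrite !linearP scalerDr addrACA.
by rewrite linearP opprD scalerN.
Qed.
HB.instance Definition _ i j := GRing.isLinear.Build A _ _ _ (@cone_diff i j) (@cone_diff_linear i j).
Fact cone_shape (i j : int) (z : (Y i * X (i - 1))%type) : i != j + 1 -> cone_diff j z = 0 :> (Y j * X (j - 1))%type.
Proof.
move=> /eqP h; rewrite /cone_diff diff_shape ?dfam0 ?diff_shape ?oppr0 ?addr0 //; last by lia.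
- by apply/eqP; lia.
- by apply/eqP; lia.
Qed.
Fact cone_dd (i j k : int) (z : (Y i * X (i - 1))%type) : cone_diff k (cone_diff j z) = 0.
Proof.
rewrite /cone_diff /= linearD diff_diff add0r (linearN (dfam (j - 1) k)) (linearN (diff X (j - 1) (k - 1))) diff_diff !oppr0; congr (_, _).
have [e|ne] := pselect (i - 1 = j); last first.
  by rewrite dfam0 // linear0 add0r diff_shape ?linear0 ?oppr0 //; apply/eqP; lia.
subst j; rewrite dfamE.
have [e|ne] := pselect (i - 1 - 1 = k); last first.
  by rewrite diff_shape ?dfam0 ?oppr0 ?addr0 //; apply/eqP; lia.
by subst k; rewrite dfamE chain_funP subrr.
Qed.
Definition cone : cplx A :=
  @Cplx A (fun i => (Y i * X (i - 1))%type) (fun i j => @cone_diff i j) cone_shape cone_dd.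

Lemma cone_acyclic : quasi_iso f -> acyclic cone.
Proof.
move=> qf n [y x] cyx; have e1 : n = n - 1 + 1 by lia.
have := cyx; rewrite /is_cycle /= /cone_diff /= dfamE => -[h1 h2].
have cx : is_cycle x by apply/eqP; rewrite -oppr_eq0 -/(is_cycle _); apply/eqP.
have [|x' [w [hx' hw]]] := qi_cone qf e1 erefl (x := x) (y := - y) cx.
  by apply/eqP; rewrite linearN -subr_eq0 -opprD oppr_eq0; apply/eqP.
have e2 : n + 1 - 1 = n by lia.
have [x2 [hx2 hf2]] : exists x2 : X (n + 1 - 1),
    diff X (n + 1 - 1) (n - 1) x2 = - x /\ dfam (n + 1 - 1) n x2 = - f n x'.
  have : forall m (e : m = n), exists x2 : X m, diff X m (n - 1) x2 = - x /\ dfam m n x2 = - f n x'.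
    by move=> m e; subst m; exists (- x'); rewrite dfamE !linearN hx'.
  by apply.
apply/is_boundaryP; exists (n + 1), (- w, x2).
rewrite /= /cone_diff /= hx2 opprK hf2; congr (_, _).
by rewrite linearN -hw -opprD subrK opprK.
Qed.
End Cone.

Lemma sg_shift (A : comUnitRingType) (n : int) (X : cplx A) (i j : int) (x : shift n X i) :
  diff (shift n X) i j x = sg n (diff X (i - n) (j - n) x).
Proof. by rewrite /= sg_scale. Qed.

Section KInjective.
Variables (A : comUnitRingType) (I : cplx A).
Hypothesis kI : K_injective I.

(** [K_injective] speaks of maps of degree 0 only; a family of degree [n] is such a map out of the
    shift of [Z] by [n], which is again acyclic. *)
Lemma Kinj_null (Z : cplx A) n (u : lfam Z I) : acyclic Z -> cfam n u ->
  exists h : lfam Z I, nullfam n u h.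
Proof.
move=> aZ cu.
have aS : acyclic (shift n Z).
  move=> i x; rewrite /is_cycle sg_shift => /sg_eq0 dx.
  have [|y hy] := aZ (i - n) x.
    by apply/is_cycleP => j; have [e|ne] := pselect (j = i - 1 - n);
      [subst j|apply: diff_shape; apply/eqP; lia].
  apply/is_boundaryP; exists (i + 1); have e : i + 1 - n = i - n + 1 by lia.
  have [y' hy'] : exists y' : Z (i + 1 - n), diff Z (i + 1 - n) (i - n) y' = x.
    by rewrite e; exists y.
  by exists (sg n y'); rewrite sg_shift (raddf_sg (diff Z _ _)) /= sg_inv.
have cf (i j : int) (x : shift n Z i) :
    u (j - n) j (diff (shift n Z) i j x) = diff I i j (u (i - n) i x).
  have [e|ne] := pselect (i = j + 1); last first.
    by rewrite !diff_shape ?linear0 //; apply/eqP.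
  subst i; rewrite sg_shift (raddf_sg (u (j - n) j)) /=; symmetry; apply: cu; lia.
have [h hh] := kI aS (ChainMap cf).
have idc (i k : int) : exists g : {linear Z i -> Z k}, forall e : i = k, g = eq_rect i (fun k => {linear Z i -> Z k}) idfun k e.
  have [e|ne] := pselect (i = k); last by exists \0 => e; case: ne.
  exists (eq_rect i (fun k => {linear Z i -> Z k}) idfun k e) => e'.
  by rewrite (Prop_irrelevance e e').
pose cs i k := projT1 (cid (idc i k)).
have csE i : cs i i = idfun by have := projT2 (cid (idc i i)) erefl.
pose k : lfam Z I := fun i j => h (i + n) j \o cs i (i + n - n).
have kE (l : int) i j x (e : i = l - n) : k i j x = h l j (cs i (l - n) x).
  have {}e : l = i + n by lia.
  by subst l.
exists k => i i0 j j1 x e1 e2 e3.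
have ei : i = j - n by lia.
have ei0 : i0 = j - 1 - n by lia.
have H := hh j (cs i (j - n) x); rewrite /= sg_scale -e3 in H.
rewrite (kE j) // (kE (j - 1)) //.
subst i i0; rewrite !csE /= in H *; rewrite H; congr (_ + _).
rewrite (raddf_sg (h (j - 1) j)); congr (sg n (h (j - 1) j _)).
suff : forall m (e : m = j - 1 - n), diff Z (j - n) (j - 1 - n) x = cs m (j - 1 - n) (diff Z (j - n) m x).
  by apply; lia.
by move=> m e; subst m; rewrite csE.
Qed.

Section Ext.
Variables (X Y : cplx A) (f : chain_map X Y).
Hypothesis qf : quasi_iso f.

Let cst (i k : int) : exists g : {linear X i -> X k}, forall e : i = k, g = eq_rect i (fun k => {linear X i -> X k}) idfun k e.
Proof.
have [e|ne] := pselect (i = k); last by exists \0 => e; case: ne.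
exists (eq_rect i (fun k => {linear X i -> X k}) idfun k e) => e'.
by rewrite (Prop_irrelevance e e').
Qed.
Let cs i k := projT1 (cid (cst i k)).
Let csE i : cs i i = idfun. Proof. by have := projT2 (cid (cst i i)) erefl. Qed.

Let inr_lin i (x : X (i - 1)) : (Y i * X (i - 1))%type := (0, x).
Let inl_lin i (y : Y i) : (Y i * X (i - 1))%type := (y, 0).
Let inr_linear i : linear (@inr_lin i).
Proof. by move=> a x y; rewrite /inr_lin; congr (_, _); rewrite /= scaler0 addr0. Qed.
Let inl_linear i : linear (@inl_lin i).
Proof. by move=> a x y; rewrite /inl_lin; congr (_, _); rewrite /= scaler0 addr0. Qed.
Let inrL i : {linear X (i - 1) -> (Y i * X (i - 1))%type} :=
  HB.pack (@inr_lin i) (GRing.isLinear.Build A _ _ _ (@inr_lin i) (@inr_linear i)).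
Let inlL i : {linear Y i -> (Y i * X (i - 1))%type} :=
  HB.pack (@inl_lin i) (GRing.isLinear.Build A _ _ _ (@inl_lin i) (@inl_linear i)).

Lemma cone_null n (v : lfam Y I) (u : lfam X I) (U : lfam (cone f) I) (h : lfam (cone f) I) :
  (forall i j z, U i j z = v i j z.1 + u (i - 1) j z.2) -> nullfam n U h ->
  exists (w : lfam Y I) (s : lfam X I),
   nullfam n v w /\
   forall (i i0 j j1 : int) (x : X i), i0 = i - 1 -> j = i + n + 1 -> j1 = j + 1 ->
     u i j x = diff I j1 j (s i j1 x) + sg n (w i j (f i x)) - sg n (s i0 j (diff X i i0 x)).
Proof.
move=> UE hh.
pose w : lfam Y I := fun i j => h i j \o inlL i.
pose s : lfam X I := fun i j => h (i + 1) j \o (inrL (i + 1) \o cs i (i + 1 - 1)).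
have sE (k i j : int) x (e : i = k - 1) : s i j x = h k j (0, cs i (k - 1) x).
  have {}e : k = i + 1 by lia.
  by subst k.
exists w, s; split.
  move=> i i0 j j1 y e1 e2 e3; have := hh i i0 j j1 (y, 0) e1 e2 e3.
  rewrite UE /= linear0 addr0 => ->; congr (_ + sg n _).
  congr (h i0 j _); rewrite /inl_lin /cone_diff /=; congr (_, _).
    by rewrite (linear0 (dfam f (i - 1) i0)) addr0.
  by rewrite (linear0 (diff X (i - 1) (i0 - 1))) oppr0.
move=> i i0 j j1 x e1 e2 e3.
have ei : i = i + 1 - 1 by lia.
have := hh (i + 1) i j j1 (0, cs i (i + 1 - 1) x) _ _ e3.
rewrite UE /= linear0 add0r => H.
have {H} : u i j x = diff I j1 j (s i j1 x) + sg n (h i j (cone_diff f i (0, cs i (i + 1 - 1) x))).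
  rewrite -H; [|lia|lia].
  suff : forall m (e : i = m), u i j x = u m j (cs i m x) by apply.
  by move=> m e; subst m; rewrite csE.
move=> ->; rewrite -[RHS]addrA; congr (_ + _); rewrite -sg_sub; congr (sg n _).
have -> : cone_diff f i (0, cs i (i + 1 - 1) x) = inlL i (f i x) - inrL i (cs i0 (i - 1) (diff X i i0 x)).
  rewrite /cone_diff /= /inl_lin /inr_lin linear0 add0r.
  have : forall m (e : i = m), (dfam f m i (cs i m x), - diff X m (i - 1) (cs i m x)) =
     (f i x, 0) - (0, cs i0 (i - 1) (diff X i i0 x)) :> (Y i * X (i - 1))%type.
    move=> m e; subst m; rewrite csE dfamE /=; subst i0; rewrite csE.
    by congr (_, _); rewrite /= ?subr0 ?sub0r.
  by apply.
rewrite linearB; congr (_ - _).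
by rewrite -[RHS]/(s i0 j (diff X i i0 x)) (sE i) // e1.
Qed.

(** Composing [u] with the projection of the cone of [f] to [X] gives a family of degree [n - 1] out
    of an acyclic complex. Its null-homotopy has two components: on [Y] it is, up to sign, the
    extension [v], and on [X] it is the homotopy [s]. *)
Lemma Kinj_ext n (u : lfam X I) : cfam n u -> exists (v : lfam Y I) (s : lfam X I),
  cfam n v /\ forall (i i0 j j1 : int) (x : X i), i0 = i - 1 -> j = i + n -> j1 = j + 1 ->
    u i j x - v i j (f i x) = diff I j1 j (s i j1 x) + sg n (s i0 j (diff X i i0 x)).
Proof.
move=> cu.
pose U : lfam (cone f) I := fun i j => u (i - 1) j \o snd.
have cU : cfam (n - 1) U.
  move=> i i0 j j0 [y x] -> e2 e3; rewrite /U /= (cu (i - 1) (i - 1 - 1) j j0) //; last by lia.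
  by rewrite linearN sg_opp sg_pred opprK.
have [h hh] := Kinj_null (cone_acyclic qf) cU.
have [|w [s [hw hs]]] := @cone_null (n - 1) (fun i j => \0) u U h _ hh.
  by move=> i j z; rewrite /= add0r.
exists (fun i j => (-1) ^+ absz (n - 1) \*: w i j), s; split.
  move=> i i0 j j0 y e1 e2 e3; rewrite /= linearZ /= !sg_scale.
  have := hw i i0 j0 j y e1 _ _; rewrite /= => /(_ _ _)/esym/eqP H.
  have {H} : diff I j j0 (w i j y) + sg (n - 1) (w i0 j0 (diff Y i i0 y)) == 0.
    by apply: H; lia.
  by rewrite addr_eq0 => /eqP ->; rewrite sg_pred opprK sg_opp sg_pred.
move=> i i0 j j1 x e1 e2 e3; rewrite (hs i i0 j j1) //; last by lia.
by rewrite /= sg_scale addrAC addrK sg_pred opprK.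
Qed.

(** The family [v] and the null-homotopy [s] of its composite with [f] assemble into one family out
    of the cone of [f]; restricting the null-homotopy of the latter to [Y] gives [w]. *)
Lemma Kinj_uniq n (v : lfam Y I) (s : lfam X I) : cfam n v ->
  (forall (i i0 j j1 : int) (x : X i), i0 = i - 1 -> j = i + n -> j1 = j + 1 ->
    v i j (f i x) = diff I j1 j (s i j1 x) + sg n (s i0 j (diff X i i0 x))) ->
  exists w : lfam Y I, nullfam n v w.
Proof.
move=> cv hs.
pose U : lfam (cone f) I := fun i j => (v i j \o fst) \+ ((-1) ^+ absz n \*: (s (i - 1) j \o snd)).
have UE i j z : U i j z = v i j z.1 + sg n (s (i - 1) j z.2) by rewrite /U /= sg_scale.
have cU : cfam n U.
  move=> i i0 j j0 [y x] -> e2 e3; rewrite !UE /= (linearD (diff I j j0)) (cv i (i - 1) j j0) //.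
  rewrite (linearD (v (i - 1) j0)) dfamE (hs (i - 1) (i - 1 - 1) j0 j) //; [|lia|lia].
  rewrite (linearN (s (i - 1 - 1) j0)) (raddf_sg (diff I j j0)) /=.
  by rewrite !sg_add !sg_opp !addrA addrK.
have [h hh] := Kinj_null (cone_acyclic qf) cU.
have [|w [s' [hw _]]] := @cone_null n v (fun i j => (-1) ^+ absz n \*: s i j) U h _ hh.
  by move=> i j z; rewrite UE /= sg_scale.
by exists w.
Qed.
End Ext.

Lemma Kinj_chain (X Y : cplx A) (f : chain_map X Y) (g : chain_map X I) : quasi_iso f ->
  exists g' : chain_map Y I, homotopic g (chain_comp g' f).
Proof.
move=> qf; have cu : cfam 0 (dfam g).
  move=> i i0 j j0 x e1 e2 e3; have {}e2 : j = i by lia.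
  by subst j j0 i0; rewrite !dfamE chain_funP.
have [v [s [cv hs]]] := Kinj_ext qf cu.
have cg (i j : int) x : v j j (diff Y i j x) = diff I i j (v i i x).
  have [e|ne] := pselect (i = j + 1); last by rewrite !diff_shape ?linear0 //; apply/eqP.
  by rewrite (cv i j i j) ?addr0 //; lia.
exists (ChainMap cg), s => i i1 i0 x e1 e2; rewrite -dfamE.
by rewrite (hs i i0 i i1) //; lia.
Qed.
End KInjective.

(** Dual to the extension into K-injective complexes: [g], viewed in the cone of [f], is
    null-homotopic, and the two components of the homotopy are the lift and the homotopy between [g]
    and its composite with [f]. *)
Lemma Kproj_lift (A : comUnitRingType) (P Y Z : cplx A) (f : chain_map Y Z) (g : chain_map P Z) :
  K_projective P -> quasi_iso f -> exists g' : chain_map P Y, homotopic g (chain_comp f g').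
Proof.
move=> kP qf.
pose G i (x : P i) : (Z i * Y (i - 1))%type := (g i x, 0).
have lG i : linear (@G i).
  by move=> a x y; rewrite /G; congr (_, _); rewrite /= ?linearP // scaler0 addr0.
pose GL i : {linear P i -> (Z i * Y (i - 1))%type} := HB.pack (@G i) (GRing.isLinear.Build A _ _ _ (@G i) (lG i)).
have cG (i j : int) (x : P i) : GL j (diff P i j x) = diff (cone f) i j (GL i x).
  rewrite /= /G /cone_diff /=; congr (_, _).
    by rewrite (linear0 (dfam f (i - 1) j)) addr0 chain_funP.
  by rewrite (linear0 (diff Y (i - 1) (j - 1))) oppr0.
have [h hh] := kP _ (cone_acyclic qf) (@ChainMap A P (cone f) GL cG).
pose k i j : {linear P i -> Y (j - 1)} := snd \o h i j.
pose s : lfam P Z := fun i j => fst \o h i j.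
have cst (i l : int) : exists c : {linear Y i -> Y l}, forall e : i = l, c = eq_rect i (fun k => {linear Y i -> Y k}) idfun l e.
  have [e|ne] := pselect (i = l); last by exists \0 => e; case: ne.
  exists (eq_rect i (fun k => {linear Y i -> Y k}) idfun l e) => e'.
  by rewrite (Prop_irrelevance e e').
pose cs i l := projT1 (cid (cst i l)).
have csE i : cs i i = idfun by have := projT2 (cid (cst i i)) erefl.
pose g' i : {linear P i -> Y i} := cs (i + 1 - 1) i \o k i (i + 1).
have g'E (i l j : int) x (e : l - 1 = i) (e' : i = j) : cs (l - 1) j (k i l x) = g' j (eq_rect i (fun k => P k : Type) x j e').
  have {}e : l = i + 1 by lia.
  by subst j l.
have h1 i x : g i x = diff Z (i + 1) i (s i (i + 1) x) + f i (g' i x) + s (i - 1) i (diff P i (i - 1) x).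
  have := congr1 fst (hh i x); rewrite /= /G /cone_diff /= => ->; congr (_ + _ + _).
  have : forall m (e : m = i) (y : Y m), dfam f m i y = f i (cs m i y).
    by move=> m e y; subst m; rewrite dfamE csE.
  by apply; lia.
have h2 i x : diff Y (i + 1 - 1) (i - 1) (k i (i + 1) x) = k (i - 1) i (diff P i (i - 1) x).
  have := congr1 snd (hh i x); rewrite /= /G /cone_diff /= => /esym.
  by rewrite [X in X = _]addrC => /eqP; rewrite subr_eq0 => /eqP.
have cg' (i j : int) (x : P i) : g' j (diff P i j x) = diff Y i j (g' i x).
  have [e|ne] := pselect (i = j + 1); last by rewrite !diff_shape ?linear0 //; apply/eqP.
  have {}e : j = i - 1 by lia.
  subst j; rewrite -(g'E (i - 1) i (i - 1) _ erefl erefl) csE; have /= H := h2 i x; rewrite /= -H.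
  have : forall m (e : m = i) (y : Y m), diff Y m (i - 1) y = diff Y i (i - 1) (cs m i y).
    by move=> m e y; subst m; rewrite csE.
  by apply; lia.
exists (ChainMap cg'), s => i i1 i0 x -> e; have {e}-> : i0 = i - 1 by lia.
by rewrite /= h1 addrAC addrK.
Qed.

Section StalkMaps.
Variables (A : comUnitRingType) (M : lmodType A) (Y : cplx A).
Section From.
Variable f : {linear M -> Y 0}.
Hypothesis df : forall j x, diff Y 0 j (f x) = 0.
Definition from_stalk_fun (i : int) : {linear stalk_obj M i -> Y i} :=
  match i return {linear stalk_obj M i -> Y i} with Posz 0 => f | _ => \0 end.
Fact from_stalk_ax (i j : int) (x : stalk M i) :
  from_stalk_fun j (diff (stalk M) i j x) = diff Y i j (from_stalk_fun i x).
Proof. by rewrite linear0; case: i x => [[|n]|n] x /=; rewrite ?df ?linear0. Qed.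
Definition from_stalk : chain_map (stalk M) Y := ChainMap from_stalk_ax.
End From.
Section To.
Variable f : {linear Y 0 -> M}.
Hypothesis fd : forall i x, f (diff Y i 0 x) = 0.
Definition to_stalk_fun (i : int) : {linear Y i -> stalk_obj M i} :=
  match i return {linear Y i -> stalk_obj M i} with Posz 0 => f | _ => \0 end.
Fact to_stalk_ax (i j : int) (x : Y i) :
  to_stalk_fun j (diff Y i j x) = diff (stalk M) i j (to_stalk_fun i x).
Proof. by case: j => [[|n]|n] //=; rewrite fd. Qed.
Definition to_stalk : chain_map Y (stalk M) :=
  @ChainMap A Y (stalk M) to_stalk_fun to_stalk_ax.
End To.
End StalkMaps.

Lemma stalk_triv (A : comUnitRingType) (M : lmodType A) (i : int) (x : stalk M i) : i <> 0 -> x = 0.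
Proof. by case: i x => [[|n]|n] x // _; apply/matrixP => ? []. Qed.

Section InjectiveResolution.
Variable A : comUnitRingType.
Section Hull.
Variable X : lmodType A.
Definition hullE : lmodType A := sval (cid (enough_injectives X)).
Let hullP : injective_module hullE /\ exists f : {linear X -> hullE}, injective f.
Proof. exact: svalP (cid (enough_injectives X)). Qed.
Lemma hullI : injective_module hullE. Proof. exact: hullP.1. Qed.
Definition hullf : {linear X -> hullE} := sval (cid hullP.2).
Lemma hullf_inj : injective hullf. Proof. exact: svalP (cid hullP.2). Qed.
End Hull.

(* A stage of the resolution: an injective module with the image of its
   predecessor in it. *)
Record istage := IStage { ist_mod : lmodType A; ist_im : submod_pred ist_mod }.
Definition ist_diff (s : istage) : {linear ist_mod s -> hullE (quom (ist_im s))} :=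
  hullf (quom (ist_im s)) \o qpi (ist_im s).
Definition ist_next (s : istage) : istage := IStage (imp (ist_diff s)).

Variable M : lmodType A.
Fixpoint ist (n : nat) : istage :=
  if n is n'.+1 then ist_next (ist n') else IStage (imp (hullf M)).
Lemma istI n : injective_module (ist_mod (ist n)).
Proof. by case: n => [|n]; exact: hullI. Qed.
Definition istd n : {linear ist_mod (ist n) -> ist_mod (ist n.+1)} := ist_diff (ist n).
Lemma istd0 n x : istd n x = 0 <-> ist_im (ist n) x.
Proof.
split=> [h|h].
  by apply/qpi0P; apply: (@hullf_inj (quom (ist_im (ist n)))); rewrite linear0.
by rewrite /istd /= (qpi0P _ _).2 // linear0.
Qed.
Definition istdd n m : {linear ist_mod (ist n) -> ist_mod (ist m)} :=
  match pselect (n.+1 = m) with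
  | left e => eq_rect n.+1 (fun m => {linear ist_mod (ist n) -> ist_mod (ist m)}) (istd n) m e
  | right _ => \0 end.
Lemma istddE n : istdd n n.+1 = istd n.
Proof. by rewrite /istdd; case: pselect => // e; rewrite (eq_irrelevance e erefl). Qed.
Lemma istdd0 n m x : n.+1 <> m -> istdd n m x = 0.
Proof. by rewrite /istdd; case: pselect. Qed.
Lemma istdd_dd n m l x : istdd m l (istdd n m x) = 0.
Proof.
have [e|ne] := pselect (n.+1 = m); last by rewrite (istdd0 _ ne) linear0.
have [e'|ne] := pselect (m.+1 = l); last by rewrite istdd0.
by subst l m; rewrite !istddE; apply/istd0; exists x.
Qed.

Definition ires_obj (i : int) : lmodType A :=
  match i with Posz 0 => ist_mod (ist 0) | Posz _ => 'rV[A]_0 | Negz n => ist_mod (ist n.+1) end.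
Definition ires_diff (i j : int) : {linear ires_obj i -> ires_obj j} :=
  match i, j return {linear ires_obj i -> ires_obj j} with
  | Posz 0, Negz m => istdd 0 m.+1 | Negz n, Negz m => istdd n.+1 m.+1 | _, _ => \0 end.
Fact ires_shape (i j : int) x : i != j + 1 -> ires_diff i j x = 0.
Proof.
case: i x => [[|n]|n] x; case: j => [[|m]|m] //= /eqP h; rewrite (@istdd0 _ _ x) //; lia.
Qed.
Fact ires_dd (i j k : int) x : ires_diff j k (ires_diff i j x) = 0.
Proof.
by case: i x => [[|n]|n] x; case: j => [[|m]|m] //=; case: k => [[|l]|l] //=;
  rewrite ?linear0 ?istdd_dd.
Qed.
Definition ires : cplx A := Cplx ires_shape ires_dd.
Lemma ires_inj i : injective_module (ires i).
Proof.
case: i => [[|n]|n]; try exact: (@istI 0); try exact: (@istI n.+1).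
by move=> N N' f g _; exists \0 => x; apply/matrixP => ? [].
Qed.
Lemma ires_bd (j : int) : 0 < j -> forall x : ires j, x = 0.
Proof. by case: j => [[|n]|n] // _ x; apply/matrixP => ? []. Qed.
Lemma ires_Kinj : K_injective ires.
Proof. exact: bounded_injectives ires_inj ires_bd. Qed.
Fact ires_df (j : int) x : ires_diff 0 j (hullf M x) = 0.
Proof.
case: j => [[|m]|m] //=; have [e|ne] := pselect (1%N = m.+1); last by rewrite istdd0.
by case: e => e; subst m; rewrite istddE; apply/(istd0 (n := 0)); exists x.
Qed.
Definition ires_map : chain_map (stalk M) ires := @from_stalk A M ires (hullf M) ires_df.
Lemma ires_qi : quasi_iso ires_map.
Proof.
case=> [[|n]|n]; split.
- move=> x _ [y]; rewrite (ires_bd _ y) // linear0 => /esym hx.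
  suff -> : x = 0 by exact: bnd0.
  by apply: (@hullf_inj M); rewrite linear0.
- move=> y /is_cycleP/(_ (Negz 0)); rewrite /= istddE => /(istd0 (n := 0)) [x hx].
  by exists x => //=; rewrite hx subrr; exact: bnd0.
- by move=> x; rewrite (stalk_triv x) // => *; exact: bnd0.
- by move=> y _; exists 0; [exact: cyc0|rewrite (ires_bd _ (y - _)) //; exact: bnd0].
- by move=> x; rewrite (stalk_triv x) // => *; exact: bnd0.
- move=> y /is_cycleP/(_ (Negz n.+1)); rewrite /= istddE => /(istd0 (n := n.+1)) hy.
  exists 0; first exact: cyc0.
  apply: bndB; last exact: (@chain_bnd A (stalk M) ires ires_map (Negz n) 0 (bnd0 _ _)).
  apply/is_boundaryP.
  have [x hx] : exists x, istd n x = y by [].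
  case: n y hy x hx => [|n] y hy x hx.
    by exists 0, x; rewrite /= istddE.
  by exists (Negz n), x; rewrite /= istddE.
Qed.
End InjectiveResolution.

(** * Minimal free resolutions *)

Definition fgh (A : comUnitRingType) (Y : cplx A) := forall n, exists (r : nat) (z : 'I_r -> Y n),
  (forall l, is_cycle (z l)) /\
  forall x, is_cycle x -> exists c : 'I_r -> A, is_boundary (x - \sum_l c l *: z l).

Section FreeResolution.
Variables (A : comUnitRingType) (nA : noetherian A) (Y : cplx A).
Hypothesis fY : fgh Y.

Section Generators.
Variables (i j : int) (r : nat) (Z : 'rV[A]_r -> Prop) (h : {linear 'rV[A]_r -> Y i}).
Hypothesis ij : j = i + 1.
Hypothesis sZ : submodule Z.
(* Generators of the degree [j] homology of the cone, cycles being the pairs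
   [(x, y)] with [Z x] and [d y = h x]. *)
Definition rgen s (g : 'I_s -> 'rV[A]_r * Y j) :=
  (forall l, Z (g l).1 /\ diff Y j i (g l).2 = h (g l).1) /\
  forall x y, Z x -> diff Y j i y = h x -> exists c : 'I_s -> A,
    x = \sum_l c l *: (g l).1 /\ is_boundary (y - \sum_l c l *: (g l).2).

Lemma rgen_min s (g : 'I_s -> 'rV[A]_r * Y j) : rgen g ->
  exists s' (g' : 'I_s' -> 'rV[A]_r * Y j), rgen g' /\ forall c : 'I_s' -> A,
    \sum_l c l *: (g' l).1 = 0 -> is_boundary (\sum_l c l *: (g' l).2) ->
    forall l, max_ideal (c l).
Proof.
elim: s g => [|s IH] g gg; first by exists 0%N, g; split=> // c _ _ [].
have [h0|] := pselect (forall c : 'I_s.+1 -> A, \sum_l c l *: (g l).1 = 0 ->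
  is_boundary (\sum_l c l *: (g l).2) -> forall l, max_ideal (c l)); first by exists s.+1, g.
move=> /existsNP[c] /not_implyP[c1] /not_implyP[c2] /existsNP[l0 ul0].
have {}ul0 : c l0 \is a GRing.unit by move/negP: ul0; rewrite negbK.
apply: (IH (fun l => g (lift l0 l))); case: gg => g1 g2; split=> [l|x y Zx dy]; first exact: g1.
have [c' [e1 e2]] := g2 x y Zx dy.
pose a := c' l0 / c l0; pose d l := c' l - a * c l.
have d0 : d l0 = 0 by rewrite /d /a divrK // subrr.
have key (M : lmodType A) (G : 'I_s.+1 -> M) :
    \sum_l c' l *: G l - a *: (\sum_l c l *: G l) = \sum_l d (lift l0 l) *: G (lift l0 l).
  rewrite scaler_sumr -sumrB; under eq_bigr => l _ do rewrite scalerA -scalerBl -/(d l).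
  by rewrite (bigD1_ord l0) //= d0 scale0r add0r.
exists (fun l => d (lift l0 l)); split.
  by rewrite -(key _ (fun l => (g l).1)) -e1 c1 scaler0 subr0.
rewrite -(key _ (fun l => (g l).2)) opprB addrA addrAC -addrAC.
by rewrite -addrA addrC -addrA; apply: bndD; [exact: bndZ|rewrite addrC].
Qed.

(** Two kinds of generators: lifts of generators of the part of [Z] whose image under [h] is a
    boundary, and generators of the homology of [Y] in degree [j] with first component zero. *)
Lemma rgen_ex : exists s (g : 'I_s -> 'rV[A]_r * Y j), rgen g.
Proof.
pose K x := Z x /\ is_boundary (h x).
have sK : submodule K.
  split=> [|a x y [Zx bx] [Zy by_]]; first by split; [exact: subm0 sZ|rewrite linear0; exact: bnd0].
  split; first exact: sZ.2.
  by rewrite linearP; apply: bndD => //; exact: bndZ.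
have [a [k [kK kg]]] := noeth_rV nA sK.
have kw l : exists w : Y j, diff Y j i w = h (k l) by rewrite ij; exact: (kK l).2.
have [w wP] := choice kw.
have [b [z [zc zg]]] := fY j.
pose G (l : 'I_(a + b)) : 'rV[A]_r * Y j :=
  match fintype.split l with inl l => (k l, w l) | inr l => (0, z l) end.
exists (a + b)%N, G; split=> [l|x y Zx dy].
  rewrite /G; case: fintype.split => l' /=; first by rewrite wP; split=> //; exact: (kK l').1.
  split; first exact: subm0 sZ.
  by rewrite linear0 ((is_cycleP _).1 (zc l')).
have [|c xc] := kg x; first by split=> //; rewrite -dy; exact: bnd_diff.
have [|d yd] := zg (y - \sum_l c l *: w l).
  apply/is_cycleP => m; have [e|ne] := pselect (m = i); last first.
    by rewrite diff_shape //; apply/eqP; lia.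
  subst m; apply/eqP; rewrite linearB subr_eq0 dy xc (linear_sum h) (linear_sum (diff Y j i)).
  by apply/eqP/eq_bigr => l _; rewrite !linearZ wP.
exists (fun l => match fintype.split l with inl l => c l | inr l => d l end); split.
  rewrite big_split_ord /= [X in _ + X]big1 => [|l _]; last by rewrite /G split_rshift scaler0.
  by rewrite addr0 xc; apply: eq_bigr => l _; rewrite /G split_lshift.
rewrite big_split_ord /= opprD addrA.
congr (is_boundary _): yd; congr (_ - _ - _); apply: eq_bigr => l _.
  by rewrite /G split_lshift.
by rewrite /G split_rshift.
Qed.
End Generators.

(** One stage of the resolution: the rank [fr], the rank [fz] one degree lower, the differential
    [fm] and the images [fv] of the basis in [Y]. Entries are functions of natural numbers, so the
    type of a stage does not mention the rank of the stage before. *)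
Record fst_ (i : int) := FSt { fr : nat; fz : nat; fm : nat -> nat -> A; fv : nat -> Y i }.
Definition fZ i (t : fst_ i) (x : 'rV[A]_(fr t)) :=
  forall q, (q < fz t)%N -> \sum_p x 0 p * fm t p q = 0.
Definition fl i (t : fst_ i) : 'rV[A]_(fr t) -> Y i := linv (fun p : 'I_(fr t) => fv t p).
HB.instance Definition _ i t := GRing.Linear.on (@fl i t).
Arguments fl {i} t x.
Arguments fZ {i} t x.
Definition frow i (t : fst_ i) (m : nat -> nat -> A) (p : nat) : 'rV[A]_(fr t) := \row_q m p q.
(** The last clause carries minimality: the cycles that become boundaries in [Y] are those hit by
    the next differential, so its entries will lie in the maximal ideal. *)
Definition fInv i (t : fst_ i) := [/\ forall x, fZ t x -> is_cycle (fl t x),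
  forall y, is_cycle y -> exists2 x, fZ t x & is_boundary (y - fl t x) &
  forall x, fZ t x -> is_boundary (fl t x) -> forall p, max_ideal (x 0 p)].
Definition fRel i j (t : fst_ i) (t' : fst_ j) := [/\ fz t' = fr t,
  forall p, (p < fr t')%N -> fZ t (frow t (fm t') p) /\ diff Y j i (fv t' p) = fl t (frow t (fm t') p) &
  forall x, fZ t x -> is_boundary (fl t x) -> exists w : 'rV[A]_(fr t'),
    forall q, x 0 q = \sum_p w 0 p * fm t' p q].

Lemma fZ_sub i (t : fst_ i) : submodule (fZ t).
Proof.
split=> [q _|a x y hx hy q lq]; first by apply: big1 => p _; rewrite mxE mul0r.
under eq_bigr => p _ do rewrite !mxE mulrDl -mulrA.
by rewrite big_split /= -mulr_sumr hx // hy // mulr0 addr0.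
Qed.

Lemma fstep i j (t : fst_ i) : j = i + 1 -> fInv t -> exists2 t' : fst_ j, fRel t t' & fInv t'.
Proof.
move=> ij [t1 t2 t3].
have [s0 [g0 gg0]] := @rgen_ex i j _ _ (fl t) ij (fZ_sub t).
have [s [g [[g1 g2] gm]]] := rgen_min gg0.
pose ent (p q : nat) : A := match insub p : option 'I_s, insub q : option 'I_(fr t) with
  | Some p, Some q => (g p).1 0 q | _, _ => 0 end.
pose vl (p : nat) : Y j := if insub p is Some p then (g (p : 'I_s)).2 else 0.
have entE (p : 'I_s) (q : 'I_(fr t)) : ent p q = (g p).1 0 q by rewrite /ent !valK.
have valE (p : 'I_s) : vl p = (g p).2 by rewrite /vl valK.
pose t' := @FSt j s (fr t) ent vl.
have rowE (p : 'I_s) : frow t ent p = (g p).1 by apply/rowP => q; rewrite mxE entE.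
have flE (x : 'rV[A]_s) : fl t' x = \sum_l x 0 l *: (g l).2.
  by rewrite /fl /linv; apply: eq_bigr => l _; congr (_ *: _); exact: valE.
have fZE (x : 'rV[A]_s) : fZ t' x <-> \sum_l x 0 l *: (g l).1 = 0.
  split=> [hx|hx q lq].
    apply/rowP => q; rewrite mxE -[RHS](hx q (ltn_ord q)) summxE.
    by apply: eq_bigr => p _; rewrite mxE -entE.
  move/rowP/(_ (Ordinal lq)): hx; rewrite mxE summxE => e0; rewrite -[RHS]e0.
  by apply: eq_bigr => p _; rewrite mxE -entE.
exists t'; split=> //=.
- by move=> p ps; rewrite -[p]/(val (Ordinal ps)) ; rewrite (rowE (Ordinal ps)) (valE (Ordinal ps)); exact: g1.
- move=> x Zx bx; have [y hy] := bx; rewrite -ij in y hy *.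
  have [c [xc _]] := g2 x y Zx hy; exists (\row_l c l) => q.
  by rewrite [in LHS]xc summxE; apply: eq_bigr => l _; rewrite !mxE -entE.
- move=> x /fZE hx; apply/is_cycleP => m; rewrite flE.
  have [e|ne] := pselect (m = i); last by rewrite diff_shape //; apply/eqP; lia.
  subst m; rewrite linear_sum -[RHS](linear0 (fl t)) -[in RHS]hx linear_sum.
  by apply: eq_bigr => l _; rewrite !linearZ (g1 l).2.
- move=> y cy; have [||c [hc bc]] := g2 0 y.
  + exact: subm0 (fZ_sub t).
  + by rewrite linear0 ((is_cycleP _).1 cy).
  have e l : (\row_k c k) 0 l = c l by rewrite mxE.
  exists (\row_l c l); first by apply/fZE; rewrite [RHS]hc; apply: eq_bigr => l _; rewrite e.
  by rewrite flE; under eq_bigr => l _ do rewrite e.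
- by move=> x /fZE hx; rewrite flE => bx p; exact: (gm (fun l => x 0 l)).
Qed.

Variable b : int.
Hypothesis hb : forall i : int, i < b -> forall x : Y i, is_cycle x -> is_boundary x.
Lemma free_resolution : exists (P : fx false A) (f : chain_map (toc P) Y),
  [/\ forall i : int, i < b -> rk P i = 0%N, quasi_iso f &
      forall i j p q, max_ideal (mx P i j p q) \/ (mx P i j p q = 0)].
Proof.
(* Below [b] the resolution is zero, which is legitimate because [Y] is exact there; the recursion
   therefore starts from the empty stage in degree [b - 1]. *)
pose d i := @FSt i 0 0 (fun _ _ => 0) (fun=> 0).
have [||h [h0 hI hR]] := @int_rec fst_ d (b - 1) fInv fRel.
- split=> [x _|y cy|x _ _ []] //.
    by rewrite /fl /linv big_ord0; exact: cyc0.
  exists 0; first by move=> q.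
  by rewrite linear0 subr0; apply: hb => //; lia.
- by move=> i j t ij _; exact: fstep.
pose r i := fr (h i).
have r0 i : i < b -> r i = 0%N by move=> ib; rewrite /r h0 //; lia.
have rel i j : i = j + 1 -> b <= i -> fRel (h j) (h i) by move=> ij bi; apply: hR => //; lia.
pose m i j : 'M[A]_(r i, r j) := if i == j + 1 then \matrix_(p, q) fm (h i) p q else 0.
have mS (i j : int) : dgn false i <> dgn false j + 1 -> m i j = 0.
  by rewrite /dgn /m => /eqP/negPf ->.
have mm (i j k : int) : m i j *m m j k = 0.
  rewrite /m; case: eqP => ij; last by rewrite mul0mx.
  case: eqP => jk; last by rewrite mulmx0.
  have [jb|bj] := ltP j b.
    by apply/matrixP => p q; rewrite !mxE big1 // => l; case: (no_ord (r0 j jb) l).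
  have [_ R1 _] := rel i j ij ltac:(lia); have [R0 _ _] := rel j k jk bj.
  apply/matrixP => p q; rewrite !mxE.
  have [+ _] := R1 p (ltn_ord p) => /(_ q); rewrite R0 => /(_ (ltn_ord q)) e0.
  by rewrite -[RHS]e0; apply: eq_bigr => l _; rewrite !mxE.
pose P := @Fx false A r m mS mm.
have cf (i j : int) (x : toc P i) : fl (h j) (diff (toc P) i j x) = diff Y i j (fl (h i) x).
  rewrite /= /m; case: eqP => ij; last by rewrite mulmx0 linear0 diff_shape //; apply/eqP.
  have [ib|bi] := ltP i b.
    have -> : x = 0 by apply/rowP => l; case: (no_ord (r0 i ib) l).
    by rewrite mul0mx !linear0.
  have [_ R1 _] := rel i j ij bi.
  rewrite [in RHS]/fl /linv linear_sum mulmx_sum_row linear_sum; apply: eq_bigr => p _.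
  rewrite !linearZ /=; congr (_ *: _); rewrite (R1 p (ltn_ord p)).2; congr (fl _ _).
  by apply/rowP => q; rewrite !mxE.
have ZE n (x : toc P n) : is_cycle x -> b <= n -> fZ (h n) x.
  move=> /is_cycleP/(_ (n - 1)); rewrite /= /m => + bn q lq.
  have e : n == n - 1 + 1 by apply/eqP; lia.
  have [R0 _ _] := rel n (n - 1) (eqP e) bn.
  rewrite e => /rowP; rewrite R0 in lq => /(_ (Ordinal lq)); rewrite !mxE => e0.
  by rewrite -[RHS]e0; apply: eq_bigr => p _; rewrite !mxE.
have CE n (x : toc P n) : b <= n -> fZ (h n) x -> is_cycle x.
  move=> bn hx; apply/is_cycleP => j; rewrite /= /m; case: eqP => e; last by rewrite mulmx0.
  have [R0 _ _] := rel n j e bn.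
  apply/rowP => q; rewrite !mxE -[RHS](hx q); last by rewrite R0.
  by apply: eq_bigr => p _; rewrite !mxE.
exists P, (@ChainMap A (toc P) Y (fun i => fl (h i)) cf); split=> [i ib|n|i j p q].
- exact: r0.
- have [nb|bn] := ltP n b.
    split=> [x _ _|y cy].
      suff -> : x = 0 by exact: bnd0.
      by apply/rowP => l; case: (no_ord (r0 n nb) l).
    by exists 0; [exact: cyc0|rewrite linear0 subr0; exact: hb].
  have [I1 I2 I3] := hI n ltac:(lia).
  split=> [x cx bx|y cy]; last first.
    by have [x hx bx] := I2 y cy; exists x => //; exact: CE.
  have [_ _ R2] := rel (n + 1) n erefl ltac:(lia).
  have [w hw] := R2 x (ZE n x cx bn) bx.
  exists w; rewrite /= /m eqxx; apply/rowP => q; rewrite mxE hw.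
  by apply: eq_bigr => p _; rewrite mxE.
- rewrite /= /m; case: eqP => ij; last by right; rewrite mxE.
  rewrite mxE; have [ib|bi] := ltP i b.
    by case: (no_ord (r0 i ib) p).
  left; have [jb|bj] := ltP j b.
    by case: (no_ord (r0 j jb) q).
  have [_ R1 _] := rel i j ij bi; have [I1 I2 I3] := hI j ltac:(lia).
  have [Z1 D1] := R1 p (ltn_ord p).
  have := I3 _ Z1 _ q; rewrite mxE; apply.
  by rewrite -D1; exact: bnd_diff.
Qed.
End FreeResolution.

(** * Stalk coefficients, families and coextension of scalars *)

Section SingleComponent.
Variables (s : bool) (A : comUnitRingType) (P : fx s A) (Y : cplx A).
Variables (a j : int) (v : 'I_(rk P a) -> Y j).
Definition fsingle_fam : tfam P Y := fun a' j' p =>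
  match pselect (a = a'), pselect (j = j') with
  | left e, left e' => eq_rect j (fun j => Y j : Type)
      (v (eq_rect a' (fun a => 'I_(rk P a)) p a (esym e))) j' e'
  | _, _ => 0 end.
Arguments fsingle_fam : clear implicits.
Lemma fsingleE p : fsingle_fam a j p = v p.
Proof.
rewrite /fsingle_fam; case: pselect => // e; case: pselect => // e'.
by rewrite (eq_irrelevance (esym e) erefl) (eq_irrelevance e' erefl).
Qed.
Lemma fsingle0 a' j' p : a <> a' \/ j <> j' -> fsingle_fam a' j' p = 0.
Proof. by rewrite /fsingle_fam; do 2 case: pselect => //; move=> ? ? []. Qed.
Fact fsingle_supp n (en : dgn s a + j = n) (a' j' : int) p : dgn s a' + j' <> n -> fsingle_fam a' j' p = 0.
Proof.
move=> h; apply: fsingle0; have [e|ne] := pselect (a = a'); last by left.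
by right=> e'; apply: h; rewrite -e -e'.
Qed.
Definition fsingle n (en : dgn s a + j = n) : (P ⊙ Y) n := Ften (fsingle_supp en).
End SingleComponent.

Section StalkCoefficients.
Variables (s : bool) (A : comUnitRingType) (P : fx s A) (M : lmodType A).
Definition exM (a : int) := forall v : 'I_(rk P a) -> M,
  (forall a' p, mact (mx P a a') v p = 0) ->
  exists w : 'I_(rk P (nx s a)) -> M, forall p, v p = mact (mx P (nx s a) a) w p.
Lemma stalk_tdiff (u : tfam P (stalk M)) a p :
  tdiff u a 0 p = mact (mx P (nx s a) a) (u (nx s a) 0) p :> M.
Proof. by rewrite /tdiff /= addr0. Qed.
Lemma stalk_cyc n (u : (P ⊙ stalk M) n) a : dgn s a = n -> is_cycle u <->
  forall a' p, mact (mx P a a') (u a 0 : _ -> M) p = 0.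
Proof.
move=> en; rewrite fte_cycP; split=> [h a' p|h a' j p].
  have [e|ne] := pselect (dgn s a = dgn s a' + 1); last by rewrite (@mx_shape _ _ P _ _ ne) mact0.
  have {}e : a = nx s a' by case: {+}s e; rewrite /dgn /nx; lia.
  by have := h a' 0 p; rewrite stalk_tdiff -e.
have [e|ne] := pselect (j = 0); last exact: (stalk_triv _ ne).
subst j; rewrite stalk_tdiff.
have [e|ne] := pselect (nx s a' = a); first by rewrite e; exact: h.
by apply: mact_eq0 => q; apply: ffP; move: ne en; case: {+}s; rewrite /dgn /nx; lia.
Qed.
Lemma stalk_bnd n (u : (P ⊙ stalk M) n) a : dgn s a = n -> is_boundary u <->
  exists w : 'I_(rk P (nx s a)) -> M, forall p, u a 0 p = mact (mx P (nx s a) a) w p.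
Proof.
move=> en; rewrite fte_bndP; split=> [[v hv]|[w hw]].
  by exists (v (nx s a) 0) => p; rewrite hv stalk_tdiff.
have en' : dgn s (nx s a) + 0 = n + 1 by rewrite dgn_nx; lia.
exists (@fsingle s A P (stalk M) (nx s a) 0 w (n + 1) en') => a' j p.
have [e|ne] := pselect (j = 0); last exact: etrans (stalk_triv _ ne) (esym (stalk_triv _ ne)).
subst j; rewrite stalk_tdiff /=.
have [e|ne] := pselect (a = a').
  by subst a'; rewrite hw; apply: eq_mact => q; rewrite fsingleE.
rewrite mact_eq0; last first.
  move=> q; have ne' : nx s a <> nx s a' by move: ne; case: {+}s; rewrite /nx; lia.
  exact: (@fsingle0 s A P (stalk M) (nx s a) 0 w (nx s a') 0 q (or_introl ne')).
have h : dgn s a' + 0 <> n by move: ne en; case: {+}s; rewrite /dgn; lia.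
exact: (ffP u a' 0 p h).
Qed.
Lemma exM_stalk a n : dgn s a = n ->
  exM a <-> (forall u : (P ⊙ stalk M) n, is_cycle u -> is_boundary u).
Proof.
move=> en; split=> [h u /(stalk_cyc u en) /h hu|h v hv]; first exact/(stalk_bnd u en).
have en' : dgn s a + 0 = n by rewrite addr0.
have /stalk_cyc cu : forall a' p, mact (mx P a a') (@fsingle s A P (stalk M) a 0 v n en' a 0 : _ -> M) p = 0.
  move=> a' p; rewrite -[RHS](hv a' p); apply: eq_mact => q; exact: (@fsingleE s A P (stalk M) a 0 v q).
have /(stalk_bnd _ en) [w hw] := h _ (cu en).
by exists w => p; rewrite -hw /= fsingleE.
Qed.
End StalkCoefficients.

Lemma exM_exq s (A : comUnitRingType) (P : fx s A) a : exM P A^o a <-> exq P a.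
Proof.
have mE m n (x : 'rV[A]_m) (B : 'M[A]_(m, n)) p : (x *m B) 0 p = mact B (x 0 : _ -> A^o) p.
  by rewrite mxE; apply: eq_bigr => q _; rewrite mulrC.
split=> h => [x hx|v hv].
  have [|w hw] := h (x 0); first by move=> a' p; rewrite -mE hx mxE.
  exists (\row_q w q); apply/rowP => p; rewrite mE hw.
  by apply: eq_bigr => q _; rewrite mxE.
have [|y hy] := h (\row_q v q).
  by move=> a'; apply/rowP => p; rewrite mE mxE -[RHS](hv a' p); apply: eq_bigr => q _; rewrite mxE.
exists (y 0) => p; have /rowP/(_ p) := hy; rewrite mE mxE => ->.
by apply: eq_bigr => q _.
Qed.

Lemma exq_stalk s (A : comUnitRingType) (P : fx s A) a n : dgn s a = n ->
  exq P a <-> (forall u : (P ⊙ stalk A^o) n, is_cycle u -> is_boundary u).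
Proof. by move=> en; rewrite -exM_exq; exact: exM_stalk. Qed.

Lemma exq_toc (A : comUnitRingType) (P : fx false A) a :
  exq P a <-> (forall x : toc P a, is_cycle x -> is_boundary x).
Proof.
split=> h x hx.
  by have [|y hy] := h x; [exact: (is_cycleP x).1|exists y].
by have [|y hy] := h x; [exact/is_cycleP|exists y].
Qed.

Section StalkToc.
Variables (A : comUnitRingType) (P : fx false A).
Definition unstalk_fun n (u : (P ⊙ stalk A^o) n) : toc P n := \row_p (u n 0 p : A).
Fact unstalk_linear n : linear (@unstalk_fun n).
Proof. by move=> a u v; apply/rowP => p; rewrite !mxE. Qed.
HB.instance Definition _ n := GRing.isLinear.Build A _ _ _ (@unstalk_fun n) (@unstalk_linear n).
Fact unstalk_ax (n m : int) (u : (P ⊙ stalk A^o) n) :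
  unstalk_fun (diff _ n m u) = diff (toc P) n m (unstalk_fun u).
Proof.
have [e|ne] := pselect (n = m + 1); last by rewrite !diff_shape ?linear0 //; apply/eqP.
subst n; apply/rowP => p; rewrite !mxE ften_diffE eqxx stalk_tdiff.
by apply: eq_bigr => q _; rewrite mxE mulrC.
Qed.
Definition unstalk : chain_map (P ⊙ stalk A^o) (toc P) :=
  @ChainMap A (P ⊙ stalk A^o) (toc P) (fun n => @unstalk_fun n) unstalk_ax.
Lemma unstalk_qi : quasi_iso unstalk.
Proof.
apply: qi_inj_surj => [n u v /rowP h|n x].
  apply: ften_eq => a j p; have [e|ne] := pselect (j = 0).
    subst j; have [e|ne] := pselect (a = n); last by rewrite !ffP // /dgn; lia.
    by subst a; have := h p; rewrite !mxE.
  exact: etrans (stalk_triv _ ne) (esym (stalk_triv _ ne)).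
have en : dgn false n + 0 = n by rewrite addr0.
exists (@fsingle false A P (stalk A^o) n 0 (x 0) n en).
by apply/rowP => p; rewrite mxE /= fsingleE.
Qed.
End StalkToc.

Lemma linv_sg (A : comUnitRingType) (M : lmodType A) r (v : 'I_r -> M) n x :
  sg n (linv v x) = linv (fun p => sg n (v p)) x.
Proof.
rewrite -sg_scale /linv scaler_sumr; apply: eq_bigr => p _.
by rewrite sg_scale sg_lin.
Qed.

Section HomFamilies.
Variables (A : comUnitRingType) (X : fx false A) (Y : cplx A) (n : int).
Lemma ffD0 (u : (X ⋔ Y) n) a j p : j <> a + n -> u a j p = 0.
Proof. by move=> h; apply: ffP; rewrite /dgn /=; lia. Qed.
Definition hfam (u : tfam (dual X) Y) : lfam (toc X) Y := fun i j => linv (u i j).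
Lemma hfam_delta (u : tfam (dual X) Y) i j p : hfam u i j (delta_mx 0 p) = u i j p.
Proof. exact: linv_delta. Qed.
Lemma hfam_cyc (u : (X ⋔ Y) n) : is_cycle u <-> cfam n (hfam u).
Proof.
rewrite fte_cycP; split=> [h i i0 j j0 x -> e1 e2|h a j p].
  rewrite /hfam linear_linv /= linv_mul linv_sg; apply: eq_linv => p.
  have := h i j0 p; rewrite dual_tdiff (_ : j0 + 1 = j); last lia.
  move=> /eqP; rewrite addr_eq0 => /eqP ->; rewrite -sg_succ; apply: sg_par; lia.
have := h a (a - 1) (j + 1) j (delta_mx 0 p) erefl.
rewrite dual_tdiff.
have [e|ne] := pselect (j + 1 = a + n); last first.
  rewrite ffD0 // linear0 add0r big1 ?sg_zero // => q _.
  by rewrite ffD0 ?scaler0 //; lia.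
move=> H; have {H} := H e ltac:(lia).
rewrite hfam_delta => ->.
rewrite /hfam /= linv_mul (linv_delta _ p) (@sg_par _ (a + j) (n - 1)); last lia.
by rewrite sg_pred subrr.
Qed.
Lemma hfam_bnd (u : (X ⋔ Y) n) : is_boundary u <-> exists h, nullfam n (hfam u) h.
Proof.
rewrite fte_bndP; split=> [[v hv]|[h hh]].
  exists (hfam v) => i i0 j j1 x -> e1 ->; rewrite /hfam linear_linv /= linv_mul linv_sg.
  rewrite /linv -big_split; apply: eq_bigr => p _ /=.
  rewrite hv dual_tdiff scalerDr; congr (_ + _ *: _); apply: sg_par; lia.
pose V : tfam (dual X) Y := fun a j p => if -a + j == n + 1 then h a j (delta_mx 0 p) else 0.
have Vs (a j : int) p : dgn true a + j <> n + 1 -> V a j p = 0.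
  by rewrite /dgn /V => /eqP/negPf ->.
exists (@Ften _ _ (dual X) Y (n + 1) V Vs) => a j p; rewrite dual_tdiff /= /V.
have [e|ne] := pselect (j = a + n); last first.
  rewrite ffD0 //.
  have -> : (- a + (j + 1) == n + 1) = false by apply/eqP; lia.
  have -> : (- (a - 1) + j == n + 1) = false by apply/eqP; lia.
  by rewrite linear0 add0r big1 ?sg_zero // => q _; rewrite scaler0.
have -> : (- a + (j + 1) == n + 1) by apply/eqP; lia.
have -> : (- (a - 1) + j == n + 1) by apply/eqP; lia.
rewrite -[u a j p](linv_delta (u a j)) -/(hfam u a j _) (hh a (a - 1) j (j + 1)) //; congr (_ + _).
rewrite (@sg_par _ (a + j) n); last lia.
congr (sg n _); rewrite /= [h _ _ _]linear_row linv_mul linv_delta; apply: eq_bigr => q _ //.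
Qed.
End HomFamilies.

Lemma hfamB (A : comUnitRingType) (X : fx false A) (Y : cplx A) n (u v : (X ⋔ Y) n) i j x :
  hfam (u - v) i j x = hfam u i j x - hfam v i j x.
Proof.
rewrite /hfam /linv -sumrB; apply: eq_bigr => p _.
by rewrite (ftenDE u) ftenNE scalerBr.
Qed.

(* Adjunction Hom_B(X, Hom_A(B, I)) = Hom_A(X, I), composed with a free
   resolution G of X over A. *)
Section HomCoext.
Variables (A B : comUnitRingType) (psi : {rmorphism A -> B}).
Variables (X : fx false B) (G : fx false A) (g : chain_map (toc G) (restr_cplx psi (toc X))).
Variable I : cplx A.
Definition ev1_fun i j (u : tfam (dual X) (coext_cplx psi I)) (x : restr_cplx psi (toc X) i) : I j :=
  (linv (u i j) (x : toc X i) : coext psi (I j)) 1.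
Fact ev1_linear i j u : linear (@ev1_fun i j u).
Proof.
move=> a x y; rewrite /ev1_fun (linearD (linv (u i j))) /= (linearZ_LR (linv (u i j))) /=.
by congr (_ + _); rewrite mul1r -[psi a]mulr1 coextZ.
Qed.
Definition ev1 (u : tfam (dual X) (coext_cplx psi I)) : lfam (restr_cplx psi (toc X)) I := fun i j =>
  HB.pack (@ev1_fun i j u) (GRing.isLinear.Build A _ _ _ (@ev1_fun i j u) (@ev1_linear i j u)).

Section Degree.
Variable n : int.
Definition hce_fam (u : tfam (dual X) (coext_cplx psi I)) : tfam (dual G) I := fun a j p =>
  ev1 u a j (g a (delta_mx 0 p)).
Arguments hce_fam : clear implicits.
Fact hce_supp (u : (X ⋔ coext_cplx psi I) n) (a j : int) p : dgn true a + j <> n -> hce_fam u a j p = 0.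
Proof.
move=> h; rewrite /hce_fam /= /ev1_fun /linv big1 // => q _.
by rewrite (ffP u a j q h) scaler0.
Qed.
Definition hce_fun (u : restr_cplx psi (X ⋔ coext_cplx psi I) n) : (G ⋔ I) n :=
  @Ften _ _ (dual G) I n (hce_fam (ff (u : ften _ _ _))) (@hce_supp u).
Fact hce_linear : linear hce_fun.
Proof.
move=> a u v; apply: ften_eq => b j p; rewrite ftenDE ftenZE /=.
rewrite /hce_fam /= /ev1_fun /linv.
set x := g _ _; set L := \sum_(_ < _) _.
have -> : L = psi a *: (\sum_q (x : toc X b) 0 q *: (u : ften _ _ _) b j q) +
    \sum_q (x : toc X b) 0 q *: (v : ften _ _ _) b j q.
  rewrite scaler_sumr -big_split; apply: eq_bigr => q _.
  by rewrite /= scalerDr !scalerA mulrC.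
by rewrite /= mul1r -[psi a]mulr1 coextZ.
Qed.
HB.instance Definition _ := GRing.isLinear.Build A _ _ _ hce_fun hce_linear.
Lemma hce_hfam (u : tfam (dual X) (coext_cplx psi I)) i j x :
  hfam (hce_fam u : tfam (dual G) I) i j x = ev1 u i j (g i x).
Proof. by rewrite -[RHS]/((ev1 u i j \o g i) x) [RHS]linear_row. Qed.
End Degree.

Lemma ev1_cyc n (u : (X ⋔ coext_cplx psi I) n) : is_cycle u -> cfam n (ev1 u).
Proof.
move=> /hfam_cyc h i i0 j j0 x e1 e2 e3.
have := congr1 (fun f : coext psi (I j0) => f 1) (h i i0 j j0 x e1 e2 e3).
rewrite /= => ->; rewrite /sg; case: odd => //.
Qed.

Fact hce_chain (n m : int) (u : restr_cplx psi (X ⋔ coext_cplx psi I) n) :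
  hce_fun (diff _ n m u) = diff (G ⋔ I) n m (hce_fun u).
Proof.
apply: ften_eq => a j p; rewrite ften_diffE /=; case: eqP => e; last first.
  rewrite /hce_fam /= /ev1_fun /linv big1 // => q _.
  by rewrite scaler0.
rewrite dual_tdiff /hce_fam /= {1}/ev1_fun {1}/linv.
set x := g a _; have -> : \sum_q (x : toc X a) 0 q *: tdiff u a j q =
    diff (coext_cplx psi I) (j + 1) j (linv (u a (j + 1)) (x : toc X a)) +
    sg (a + j) (linv (u (a - 1) j) (diff (toc X) a (a - 1) x)) :> coext psi (I j).
  rewrite linear_linv /= linv_mul linv_sg /linv -big_split; apply: eq_bigr => q _.
  by rewrite dual_tdiff scalerDr.
congr (_ + _); rewrite -[diff _ _ _ x](chain_funP g) /sg.
transitivity (sg (a + j) (ev1 u (a - 1) j (g (a - 1) (diff (toc G) a (a - 1) (delta_mx 0 p))))).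
  by rewrite /sg; case: odd.
congr (sg _ _); rewrite -[LHS]/((ev1 u (a - 1) j \o g (a - 1)) _) linear_row /= linv_mul linv_delta.
by [].
Qed.
Definition hce : chain_map (restr_cplx psi (X ⋔ coext_cplx psi I)) (G ⋔ I) :=
  @ChainMap A (restr_cplx psi (X ⋔ coext_cplx psi I)) (G ⋔ I) (fun n => @hce_fun n) hce_chain.

Section CoextOf.
Variable V : lfam (restr_cplx psi (toc X)) I.
Let ex i (p : 'I_(rk X i)) (b : B) : restr_cplx psi (toc X) i := b *: (delta_mx 0 p : toc X i).
Fact cof_D i j p : {morph (fun b => V i j (@ex i p b)) : b c / b + c}.
Proof. by move=> b c; rewrite /ex scalerDl (linearD (V i j)). Qed.
Fact cof_Z i j p a b : V i j (@ex i p (psi a * b)) = a *: V i j (@ex i p b).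
Proof. by rewrite /ex -scalerA; exact: (linearZ_LR (V i j)). Qed.
Definition cof i j (p : 'I_(rk X i)) : coext psi (I j) := Coext (@cof_D i j p) (@cof_Z i j p).
Arguments cof : clear implicits.
Lemma cof_linv i j (x : toc X i) b : (linv (cof i j) x : coext psi (I j)) b = V i j (b *: x).
Proof.
rewrite {2}(row_sum_delta x) scaler_sumr (linear_sum (V i j)) /linv.
have : forall r : seq 'I_(rk X i), (\sum_(p <- r) x 0 p *: cof i j p : coext psi (I j)) b =
    \sum_(p <- r) V i j (b *: (x 0 p *: delta_mx 0 p : toc X i)).
  elim=> [|p r IH]; first by rewrite !big_nil.
  by rewrite !big_cons /= IH /ex scalerA.
exact.
Qed.
Variable n : int.
Definition cof_fam : tfam (dual X) (coext_cplx psi I) := fun a j p =>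
  if j == a + n then cof a j p else 0.
Arguments cof_fam : clear implicits.
Fact cof_supp (a j : int) p : dgn true a + j <> n -> cof_fam a j p = 0.
Proof. by rewrite /dgn /cof_fam => h; case: eqP => // e; case: h; lia. Qed.
Definition cof_ten : (X ⋔ coext_cplx psi I) n := @Ften _ _ (dual X) (coext_cplx psi I) n cof_fam cof_supp.
Lemma cof_hfam (i j : int) (x : toc X i) b : j = i + n ->
  (hfam cof_ten i j x : coext psi (I j)) b = V i j (b *: x).
Proof. by move=> e; rewrite -cof_linv /hfam /= /cof_fam e eqxx. Qed.
End CoextOf.

Hypotheses (qg : quasi_iso g) (kI : K_injective I).
(** A family out of [X] that is linear over [A] becomes one into the coextension, linear over [B],
    by letting [b] act on the argument first ([cof]). Through this adjunction injectivity on
    homology is [Kinj_uniq] and surjectivity is [Kinj_ext], both for the quasi-isomorphism [g]. *)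
Lemma hce_qi : quasi_iso hce.
Proof.
move=> n; split=> [u cu /hfam_bnd [h hh]|v /hfam_cyc cv].
  have hs (i i0 j j1 : int) (x : toc G i) : i0 = i - 1 -> j = i + n -> j1 = j + 1 ->
      ev1 (ff (u : ften _ _ _)) i j (g i x) = diff I j1 j (h i j1 x) + sg n (h i0 j (diff (toc G) i i0 x)).
    by move=> e1 e2 e3; have := hh i i0 j j1 x e1 e2 e3; rewrite hce_hfam.
  have [w hw] := Kinj_uniq kI qg (ev1_cyc cu) hs.
  apply: (hfam_bnd u).2; exists (hfam (cof_ten w (n + 1))) => i i0 j j1 x e1 e2 e3.
  apply: coext_eq => b /=.
  have -> : (hfam (ff (u : ften _ _ _)) i j x : coext psi (I j)) b = ev1 (ff (u : ften _ _ _)) i j (b *: x).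
    by rewrite /= /ev1_fun (linearZ_LR (linv _)) /= mul1r.
  rewrite (hw i i0 j j1) // cof_hfam; last lia.
  congr (_ + _); transitivity (sg n (w i0 j (b *: diff (toc X) i i0 x))).
    by rewrite -(linearZ_LR (diff (toc X) i i0)).
  rewrite -(cof_hfam w (n := n + 1)); last lia.
  by rewrite /sg; case: odd.
have [V [s [cV hs]]] := @Kinj_ext A I kI _ _ g qg n _ cv.
exists (cof_ten V n).
  apply: (hfam_cyc _).2 => i i0 j j0 x e1 e2 e3; apply: coext_eq => b /=.
  rewrite cof_hfam // (cV i i0 j j0) //.
  transitivity (sg n (V i0 j0 (b *: diff (toc X) i i0 x))).
    by rewrite -(linearZ_LR (diff (toc X) i i0)).
  rewrite -(cof_hfam V (n := n)); last lia.
  by rewrite /sg; case: odd.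
apply/hfam_bnd; exists s => i i0 j j1 x e1 e2 e3.
rewrite hfamB -(hs i i0 j j1) //; congr (_ - _).
rewrite hce_hfam -[g i x in RHS]scale1r -(cof_hfam V (n := n) _ _ e2).
by rewrite rmorph1.
Qed.
End HomCoext.

(** * Gorenstein fibres and biduality *)

(** A cycle of the dual at [a], pushed into [E], sends degree [i] of [G] to degree [i - a] of [E],
    which is zero unless [a - r <= i <= a]. Hence exactness of [G] from [a - r] on is enough for
    [null_into_injectives]. *)
Lemma exq_dual_inj (F : comUnitRingType) (G : fx false F) (E : cplx F) (e : chain_map (stalk F^o) E)
    (r a : int) : (forall i, injective_module (E i)) ->
  (forall i : int, ~~ (- r <= i <= 0) -> trivial_mod (E i)) ->
  quasi_iso (fte_map (dual G) e) -> (forall i : int, exq G i \/ i < a - r) -> exq (dual G) a.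
Proof.
move=> iE bE qe ex; apply/(@exq_stalk _ _ (dual G) a (- a) erefl) => u cu.
apply: (qe _).1 => //; apply/hfam_bnd.
have cu' : cfam (- a) (hfam (fte_map (dual G) e _ u)) by apply/hfam_cyc; exact: chain_cyc.
apply: (null_into_injectives (c := 0) cu' iE).
  by move=> j j0 x; apply: bE; lia.
move=> i; have [/exq_toc|h] := ex i; first by left.
by right=> x; apply: bE; lia.
Qed.

Lemma exq_bc_dual (A F : comUnitRingType) (pi : {rmorphism A -> F}) s (P : fx s A) a :
  exq (bc pi (dual P)) a <-> exq (dual (bc pi P)) a.
Proof.
have mE i j : mx (bc pi (dual P)) i j = mx (dual (bc pi P)) i j.
  by rewrite /= map_mxZ map_trmx rmorphXn rmorphN rmorph1.
split=> h x hx.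
  have [|y hy] := h x; first by move=> a'; rewrite mE; exact: hx.
  by exists y; rewrite -mE.
have [|y hy] := h x; first by move=> a'; rewrite -mE; exact: hx.
by exists y; rewrite mE.
Qed.

Record gor_fibre (R A F : comUnitRingType) (rho : {rmorphism R -> A}) (pi : {rmorphism A -> F}) : Prop :=
  GorFibre { gf_nR : noetherian R; gf_lR : local_ring R; gf_nA : noetherian A; gf_lA : local_ring A;
    gf_local : local_hom rho; gf_flat : flat_over rho (A^o : lmodType A);
    gf_surj : forall z, exists y, pi y = z; gf_ker : forall y, pi y = 0 <-> max_ideal_ext rho y;
    gf_gor : gorenstein_local F }.

Section GorensteinFibre.
Variables (R A F : comUnitRingType) (rho : {rmorphism R -> A}) (pi : {rmorphism A -> F}).
Hypothesis gf : gor_fibre rho pi.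
Definition exall o (W : fx o A) a := forall s (K : submod_pred 'rV[R]_s), exK rho W a K.

(** The local criterion in final form: exactness over the closed fibre, which is exactness with the
    residue field of [R] as coefficients, forces exactness with all finitely generated
    [R]-modules. *)
Lemma exall_fibre o (W : fx o A) a : exall W a <-> exq (bc pi W) a.
Proof.
case: gf => nR lR nA lA lrho flat piS piK _.
split=> [h|/(exK_fibre lR piS piK) h]; first exact/(exK_fibre lR piS piK).
by move=> s K; exact: (exK_all flat nR nA lA lrho h).
Qed.

Lemma exall_exq o (W : fx o A) a : exall W a -> exq W a.
Proof. by move=> h; apply/(exK_zero rho). Qed.

Lemma exall_up o (W : fx o A) a : exall W a -> exq W (nx o a) -> exall W (nx o a).
Proof. by move=> h hq s K; exact: (exK_up (gf_flat gf) (gf_nR gf) h hq). Qed.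

(** [W] has no bound on either side; the injective resolution of [F], being bounded, is what makes
    Hom out of the fibre of [W] respect the quasi-isomorphism from [F] to it. *)
Lemma fibre_dual (W : fx false A) : (forall a, exq (bc pi W) a) -> forall a, exall (dual W) a.
Proof.
move=> h a; apply/exall_fibre/exq_bc_dual.
have [_ [n [E [e [iE bE qe]]]]] := gf_gor gf.
apply: (exq_dual_inj (r := n%:Z) iE bE) => [|i]; last by left.
apply: (@fte_qi_bdb _ _ _ _ _ _ (- n%:Z)) => // j jn x.
  by apply: stalk_triv; lia.
by apply: bE; lia.
Qed.

(** If the fibre of [G] is exact above [f] and [F] has injective dimension at most [n], then
    [exq_dual_inj] applies to every index above [f + n], whence the bound. *)
Lemma fibre_dual_low (G : fx false A) b f : (forall i : int, i < b -> rk G i = 0%N) ->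
  (forall a : int, f < a -> exq (bc pi G) a) -> exists c : int, forall a : int, c < a -> exall (dual G) a.
Proof.
move=> Gb h; have [_ [n [E [e [iE bE qe]]]]] := gf_gor gf.
exists (f + n%:Z) => a ca; apply/exall_fibre/exq_bc_dual.
apply: (exq_dual_inj (r := n%:Z) iE bE) => [|i].
  exact: (fte_qi_bda (bda_dual (X := bc pi G) Gb)).
by have [fi|fi] := ltP f i; [left; exact: h|right; lia].
Qed.
End GorensteinFibre.

Lemma ften_sumE s (A : comUnitRingType) (P : fx s A) (Y : cplx A) n (J : finType)
    (F : J -> A) (u : J -> ften P Y n) a j p :
  (\sum_i F i *: u i) a j p = \sum_i F i *: u i a j p.
Proof.
have : forall r : seq J, (\sum_(i <- r) F i *: u i) a j p = \sum_(i <- r) F i *: u i a j p.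
  by elim=> [|i r IH]; rewrite ?big_nil ?big_cons // ftenDE ftenZE IH.
exact.
Qed.

Lemma hom_of_off (A : comUnitRingType) (X : fx false A) (Y : cplx A) (f : chain_map (toc X) Y) a j p :
  a <> j -> @hom_of_fam A X Y f a j p = 0.
Proof. by rewrite /hom_of_fam; case: pselect. Qed.

Lemma hfam_hom_of (A : comUnitRingType) (X : fx false A) (Y : cplx A) (f : chain_map (toc X) Y) i x :
  hfam (hom_of f) i i x = f i x.
Proof.
rewrite [RHS]linear_row /hfam /linv; apply: eq_bigr => p _; congr (_ *: _).
exact: hom_of_diag.
Qed.

Lemma bnd_homotopic (A : comUnitRingType) (X : fx false A) (Y : cplx A) (f g : chain_map (toc X) Y) :
  homotopic f g -> is_boundary (hom_of f - hom_of g).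
Proof.
move=> [h hh]; apply/hfam_bnd; exists h => i i0 j j1 x e1 e2 e3.
have {}e2 : j = i by lia.
subst j; rewrite hfamB !hfam_hom_of; apply: hh; lia.
Qed.

Lemma homotopic_bnd (A : comUnitRingType) (X : fx false A) (Y : cplx A) (f g : chain_map (toc X) Y) :
  is_boundary (hom_of f - hom_of g) -> homotopic f g.
Proof.
move=> /hfam_bnd [h hh]; exists h => i i1 i0 x e1 e2.
have := hh i i0 i i1 x _ _ _; rewrite hfamB !hfam_hom_of => -> //; lia.
Qed.

Lemma swap_hom_of (A : comUnitRingType) (N X : fx false A) (Y : cplx A)
    (f : chain_map (toc X) (N ⋔ Y)) (n : chain_map (toc N) (X ⋔ Y)) :
  (forall (a b k : int) p q, a = - b + k -> (f a (delta_mx 0 p) : ften _ _ _) b k q =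
     sg (a * b) ((n b (delta_mx 0 q) : ften _ _ _) a k p)) ->
  swap (hom_of f) = hom_of n.
Proof.
move=> h; apply: ften_eq => b l q; apply: ften_eq => a k p; rewrite swapE.
have [e|ne] := pselect (l = - a + k); last first.
  rewrite (introF eqP ne); symmetry; apply: (ffP (hom_of n b l q : ften _ _ _)).
  by rewrite /dgn /=; lia.
rewrite /dgn /= e eqxx -e; have [e'|ne] := pselect (b = l); last first.
  by rewrite (@hom_of_off _ _ _ n) // hom_of_off ?sg_zero //; lia.
subst b; have -> : - l + k = a by lia.
by rewrite !hom_of_diag h ?sg_inv //; lia.
Qed.

(** * Biduality maps, and cones as complexes of matrices *)

Section Adjoint.
Variables (A : comUnitRingType) (N X : fx false A) (Y : cplx A) (n : chain_map (toc N) (X ⋔ Y)).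
Fact adj_cyc : is_cycle (swapc (dual N) (dual X) Y 0 (hom_of n)).
Proof. by apply: chain_cyc; exact: hom_of_cyc. Qed.
(** When [n] is a free resolution of Hom(X, Y), this is the biduality map from [X] to its double
    dual with respect to [Y]. *)
Definition adj : chain_map (toc X) (N ⋔ Y) := chain_of adj_cyc.
Lemma adjE i (x : toc X i) b k q : (adj i x : ften _ _ _) b k q =
  if i == - b + k then sg (b * i) (\sum_p x 0 p *: (n b (delta_mx 0 q) : ften _ _ _) i k p) else 0.
Proof.
rewrite /adj /= /linv.
transitivity (\sum_p x 0 p *: (if i == - b + k then
    sg (b * i) ((hom_of n b (- i + k) q : ften _ _ _) i k p) else 0)).
  exact: ften_sumE.
case: eqP => e; last by rewrite big1 // => p _; rewrite scaler0.
rewrite -sg_scale scaler_sumr; apply: eq_bigr => p _.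
rewrite sg_scale sg_lin; congr (_ *: sg _ _).
have -> : - i + k = b by lia.
by rewrite /= hom_of_diag.
Qed.
End Adjoint.

Lemma swap_adj (A : comUnitRingType) (N X : fx false A) (Y : cplx A) (n : chain_map (toc N) (X ⋔ Y)) :
  swap (hom_of (adj n)) = hom_of n.
Proof.
apply: swap_hom_of => a b k p q e; rewrite adjE (introT eqP e) (bigD1 p) //= big1 => [|r rp].
  by rewrite mxE !eqxx scale1r addr0; apply: sg_par; rewrite mulrC.
by rewrite mxE eqxx (negPf rp) scale0r.
Qed.

Lemma adj_homotopic (A : comUnitRingType) (N X : fx false A) (Y : cplx A)
    (n : chain_map (toc N) (X ⋔ Y)) (f : chain_map (toc X) (N ⋔ Y)) (n' : chain_map (toc N) (X ⋔ Y)) :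
  swap (hom_of f) = hom_of n' -> homotopic n n' -> homotopic f (adj n).
Proof.
move=> e /bnd_homotopic h; apply: homotopic_bnd; apply: bndBC.
have := chain_bnd (swapc (dual N) (dual X) Y) h; rewrite /= linearB /=.
by rewrite -e -(swap_adj n) !swapK.
Qed.

Lemma adj_natural (A : comUnitRingType) (N X : fx false A) (Y Z : cplx A)
    (n : chain_map (toc N) (X ⋔ Y)) (f : chain_map Y Z) :
  swap (hom_of (chain_comp (fte_map (dual N) f) (adj n))) =
  hom_of (chain_comp (fte_map (dual X) f) n).
Proof.
apply: swap_hom_of => a b k p q e /=; rewrite /= adjE (introT eqP e) (bigD1 p) //= big1 => [|r rp].
  rewrite mxE !eqxx scale1r addr0 (raddf_sg (f k)) /=.
  by apply: sg_par; rewrite mulrC.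
by rewrite mxE eqxx (negPf rp) scale0r.
Qed.

Section AdjCoext.
Variables (A B : comUnitRingType) (psi : {rmorphism A -> B}).
Variables (L N : fx false B) (G M : fx false A) (I : cplx A).
Variables (g : chain_map (toc G) (restr_cplx psi (toc L))) (m : chain_map (toc M) (restr_cplx psi (toc N))).
Variable n : chain_map (toc N) (L ⋔ coext_cplx psi I).
(** Biduality over [B] with respect to Hom_A(B, I) and biduality over [A] with respect to [I]
    coincide after passing to resolutions over [A]: on basis elements both evaluate at 1 the same
    double sum of values of [n]. *)
Lemma adj_coext :
  swap (hom_of (chain_comp (hce m I) (chain_comp (restr_map psi (adj n)) g))) =
  hom_of (chain_comp (hce g I) (chain_comp (restr_map psi n) m)).
Proof.
apply: swap_hom_of => a b k p q e; rewrite /= /hce_fam /= /ev1_fun /restr_fun.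
set x : toc L a := g a _; set y : toc N b := m b _.
transitivity ((sg (a * b) (linv ((n b y : ften _ _ _) a k) x) : coext psi (I k)) 1); last first.
  by rewrite /sg; case: odd.
congr (coext_fun _ 1); rewrite {1}/linv.
have nE r : (n b y : ften _ _ _) a k r = \sum_s y 0 s *: (n b (delta_mx 0 s) : ften _ _ _) a k r.
  rewrite [n b y]linear_row /linv.
  exact: ften_sumE.
have aE s : (adj n a x : ften _ _ _) b k s =
    sg (a * b) (\sum_r x 0 r *: (n b (delta_mx 0 s) : ften _ _ _) a k r).
  rewrite adjE; rewrite (introT eqP e); by apply: sg_par; rewrite mulrC.
under eq_bigr => s _ do rewrite aE.
rewrite /linv; under [in RHS]eq_bigr => r _ do rewrite nE scaler_sumr.
rewrite exchange_big -sg_scale scaler_sumr; apply: eq_bigr => s _ /=.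
rewrite -[in LHS]sg_scale scalerA mulrC -scalerA; congr (_ *: _).
by rewrite scaler_sumr; apply: eq_bigr => r _; rewrite !scalerA mulrC.
Qed.
End AdjCoext.

Lemma stalk_diffE s (A : comUnitRingType) (P : fx s A) (M : lmodType A) (n m : int)
    (u : (P ⊙ stalk M) n) a a' p : dgn s a = n -> n = m + 1 ->
  (diff (P ⊙ stalk M) n m u : ften _ _ _) a' 0 p = mact (mx P a a') (u a 0 : _ -> M) p.
Proof.
move=> en nm; rewrite ften_diffE (introT eqP nm) stalk_tdiff.
have [<-//|ne] := pselect (nx s a' = a).
have h : dgn s a <> dgn s a' + 1 by move: ne; case: {+}s; rewrite /nx /dgn; lia.
rewrite (@mx_shape _ _ P _ _ h) mact0; apply: mact_eq0 => q.
by apply: (ffP u (nx s a') 0 q); rewrite dgn_nx; lia.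
Qed.

Lemma mact_row (A : comUnitRingType) m n (x : 'rV[A]_m) (B : 'M[A]_(m, n)) p :
  mact B (x 0 : _ -> A^o) p = (x *m B) 0 p.
Proof. by rewrite mxE; apply: eq_bigr => q _; rewrite mulrC. Qed.

Lemma stalk_ext s (A : comUnitRingType) (P : fx s A) (M : lmodType A) n a (u v : (P ⊙ stalk M) n) :
  dgn s a = n -> (forall p, u a 0 p = v a 0 p) -> u = v.
Proof.
move=> en h; apply: ften_eq => b j p; have [e|ne] := pselect (j = 0); last first.
  exact: etrans (stalk_triv _ ne) (esym (stalk_triv _ ne)).
subst j; have [e|ne] := pselect (a = b); first by subst b; exact: h.
have h' : dgn s b + 0 <> n by move: ne en; case: {+}s; rewrite /dgn; lia.
by rewrite (ffP u b 0 p h') (ffP v b 0 p h').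
Qed.

Lemma sg_mx (A : comUnitRingType) m n k (B : 'M[A]_(m, n)) p q : (sg k B) p q = sg k (B p q).
Proof. by rewrite /sg; case: odd; rewrite // mxE. Qed.

Section ConeMatrices.
Variables (A : comUnitRingType) (G M : fx false A).
Variable c : chain_map (toc M) (G ⋔ stalk A^o).
Definition cmx i a : 'M[A]_(rk M i, rk G a) :=
  \matrix_(q, p) ((c i (delta_mx 0 q) : ften _ _ _) a 0 p : A).
Lemma cmxE i (x : toc M i) a p : (c i x : ften _ _ _) a 0 p = ((x : 'rV_(rk M i)) *m cmx i a) 0 p :> A.
Proof.
rewrite [c i x]linear_row /linv mxE; transitivity (\sum_q (x : 'rV_(rk M i)) 0 q *: (c i (delta_mx 0 q) : ften _ _ _) a 0 p).
  exact: (@ften_sumE _ _ (dual G) (stalk A^o) i _ (fun q => (x : 'rV_(rk M i)) 0 q) (fun q => c i (delta_mx 0 q)) a 0 p).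
by apply: eq_bigr => q _; rewrite mxE.
Qed.
Lemma cmx0 i a : a <> - i -> cmx i a = 0.
Proof.
move=> h; apply/matrixP => q p; rewrite !mxE.
by apply: (ffP (c i (delta_mx 0 q) : ften _ _ _) a 0 p); rewrite /dgn /=; lia.
Qed.
Lemma cmx_chain i j a a' : i = j + 1 -> a = - i ->
  cmx i a *m mx (dual G) a a' = mx M i j *m cmx j a'.
Proof.
move=> ij ai; apply/row_matrixP => q; rewrite !rowE !mulmxA; apply/rowP => p.
rewrite -[RHS](@cmxE j (delta_mx 0 q *m mx M i j)).
have -> : delta_mx 0 q *m mx M i j = diff (toc M) i j (delta_mx 0 q) by [].
rewrite chain_funP (@stalk_diffE _ _ (dual G) A^o i j _ a) //; last by rewrite /dgn /=; lia.
rewrite -mact_row; apply: eq_bigr => r _; congr (_ * _).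
by rewrite -[RHS]/(_ : A) cmxE.
Qed.

Definition cone_rk (i : int) := (rk G (- i) + rk M (i - 1))%N.
Definition cone_mx i j : 'M[A]_(cone_rk i, cone_rk j) :=
  block_mx (mx (dual G) (- i) (- j)) 0 (cmx (i - 1) (- j)) (- mx M (i - 1) (j - 1)).
Fact cone_fx_shape (i j : int) : dgn false i <> dgn false j + 1 -> cone_mx i j = 0.
Proof.
rewrite /dgn => h; rewrite /cone_mx (@mx_shape _ _ (dual G)) ?cmx0 ?(@mx_shape _ _ M) /dgn /= ?oppr0 ?block_mx0 //; lia.
Qed.
Fact cone_fx_mx (i j k : int) : cone_mx i j *m cone_mx j k = 0.
Proof.
rewrite /cone_mx mulmx_block !mul0mx !mulmx0 !addr0 add0r.
rewrite (@mx_mx _ _ (dual G)) !mulNmx mulmxN opprK (@mx_mx _ _ M).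
have -> : cmx (i - 1) (- j) *m mx (dual G) (- j) (- k) = mx M (i - 1) (j - 1) *m cmx (j - 1) (- k).
  have [e|ne] := pselect (i = j + 1); first by apply: cmx_chain; lia.
  rewrite cmx0 ?(@mx_shape _ _ M) ?mul0mx // /dgn; lia.
by rewrite subrr block_mx0.
Qed.
(** The cone of [c] from [M] to the dual of [G], written as a complex of matrices so that it can be
    dualised and base changed. Degree [i] uses index [- i] of [G]. *)
Definition fcone : fx false A := Fx cone_fx_shape cone_fx_mx.

Lemma fcone_exq : quasi_iso c -> forall a, exq fcone a.
Proof.
move=> qc a; rewrite /exq /= => x; rewrite -(hsubmxK (x : 'rV_(rk G (- a) + rk M (a - 1)))).
set x1 := lsubmx _; set x2 := rsubmx _ => hx.
have {hx} hx a' : x1 *m mx (dual G) (- a) (- a') + x2 *m cmx (a - 1) (- a') = 0 /\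
    x2 *m mx M (a - 1) (a' - 1) = 0.
  have := hx a'; rewrite /= /cone_mx mul_row_block mulmx0 add0r -row_mx0 => /eq_row_mx [-> /eqP].
  by rewrite mulmxN oppr_eq0 => /eqP.
have en : dgn true (- a) + 0 = a by rewrite /dgn opprK addr0.
pose u := @fsingle _ _ (dual G) (stalk A^o) (- a) 0 (x1 0) a en.
have ux p : u (- a) 0 p = x1 0 p by exact: (@fsingleE _ _ (dual G) (stalk A^o) (- a) 0 (x1 0) p).
have cx2 : is_cycle (x2 : toc M (a - 1)) by have [_] := hx (a - 1).
have du : diff (G ⋔ stalk A^o) a (a - 1) (- u) = c (a - 1) x2.
  apply: (@stalk_ext _ _ (dual G) A^o _ (- (a - 1))); first by rewrite /dgn /=; lia.
  move=> p; rewrite linearN ftenNE (@stalk_diffE _ _ (dual G) A^o a (a - 1) u (- a)) /dgn /= ?opprK //; last lia.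
  rewrite cmxE; have [/eqP + _] := hx (a - 1); rewrite addr_eq0 => /eqP e.
  rewrite -[x2 *m _]opprK -e mxE; congr (- _); rewrite -mact_row.
  by apply: eq_mact => q; exact: ux.
have [||x' [w [hx' hw]]] := @qi_cone A _ _ c qc (a - 1) a (a + 1) _ _ x2 (- u) cx2 du; try lia.
have en1 : dgn true (- (a + 1)) = a + 1 by rewrite /dgn opprK.
pose wr : 'rV[A]_(rk G (- (a + 1))) := \row_p (w (- (a + 1)) 0 p : A).
have ewr a' p : (diff (G ⋔ stalk A^o) (a + 1) a w : ften _ _ _) a' 0 p = (wr *m mx (dual G) (- (a + 1)) a') 0 p.
  rewrite (@stalk_diffE _ _ (dual G) A^o (a + 1) a w (- (a + 1))) // -mact_row.
  by apply: eq_bigr => q _; congr (_ *: _); rewrite mxE.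
have [y2 [hy1 hy2]] : exists y2 : 'rV[A]_(rk M (a + 1 - 1)),
    y2 *m cmx (a + 1 - 1) (- a) = - ((x' : 'rV_(rk M a)) *m cmx a (- a)) /\
    y2 *m mx M (a + 1 - 1) (a - 1) = - x2.
  suff : forall k, k = a -> exists y2 : 'rV[A]_(rk M k),
    y2 *m cmx k (- a) = - ((x' : 'rV_(rk M a)) *m cmx a (- a)) /\ y2 *m mx M k (a - 1) = - x2.
    by apply; lia.
  by move=> k ek; subst k; exists (- (x' : 'rV_(rk M a))); rewrite !mulNmx -hx'.
exists (row_mx (- wr) y2); rewrite /= /cone_mx mul_row_block mulmx0 add0r mulmxN hy2 opprK hy1.
congr (row_mx _ _); apply/rowP => p.
have := congr1 (fun u : (G ⋔ stalk A^o) a => (u : ften (dual G) (stalk A^o) a) (- a) 0 p) hw.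
rewrite ewr (ftenDE (- u)) !ftenNE (_ : u (- a) 0 p = x1 0 p :> A); last exact: ux.
have mxNB (U V : 'rV[A]_(rk G (- a))) : (- U - V) 0 p = - U 0 p - V 0 p by rewrite !mxE.
by rewrite cmxE mulNmx mxNB => <-; rewrite opprD !opprK addrK.
Qed.

Lemma adjcE i (x : toc G i) b q : b = - i ->
  (adj c i x : ften _ _ _) b 0 q = sg i (((x : 'rV_(rk G i)) *m (cmx b i)^T) 0 q) :> A.
Proof.
move=> bi; rewrite adjE; have -> : i == - b + 0 by apply/eqP; lia.
rewrite (@sg_par _ (b * i) i); last by rewrite bi abszM abszN oddM andbb.
congr (sg _ _); rewrite mxE; apply: eq_bigr => p _.
by rewrite !mxE.
Qed.

Lemma dual_fcone_mul a a' (x1 : 'rV_(rk G (- a))) (x2 : 'rV_(rk M (a - 1))) :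
  (row_mx x1 x2 : 'rV_(cone_rk a)) *m mx (dual fcone) a a' =
  sg a' (row_mx (sg a (x1 *m mx G (- a) (- a')))
    (x1 *m (cmx (a' - 1) (- a))^T - x2 *m (mx M (a' - 1) (a - 1))^T)).
Proof.
rewrite /= /cone_mx -scalemxAr sg_scale tr_block_mx mul_row_block trmx0 mulmx0 addr0.
congr (sg _ (row_mx _ _)); last by rewrite linearN mulmxN.
by rewrite /= linearZ /= trmxK abszN -scalemxAr sg_scale.
Qed.

(** Up to signs and reindexing, the dual of the cone of [c] is the cone of [adj c]. Exactness is
    applied to the pairs of blocks [(x, w)] for injectivity on homology and [(0, v)] for
    surjectivity. *)
Lemma adj_qi : (forall a, exq (dual fcone) a) -> quasi_iso (adj c).
Proof.
move=> ex n; split.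
  have [a ->] : exists a, n = - a by exists (- n); rewrite opprK.
  move=> x cx.
  have ea : dgn true a = - a by [].
  move=> /(@stalk_bnd _ _ (dual M) A^o _ _ a ea) [w hw].
  have [|y] := ex a (row_mx (x : 'rV_(rk G (- a))) (\row_q w q)).
    move=> a'; rewrite dual_fcone_mul; have [e|ne] := pselect (a' = a + 1); last first.
      rewrite (@mx_shape _ _ G) ?(@mx_shape _ _ M) ?cmx0 /dgn; try lia.
      by rewrite trmx0 !mulmx0 sg_zero trmx0 mulmx0 subrr row_mx0 sg_zero.
    have -> : (x : 'rV_(rk G (- a))) *m mx G (- a) (- a') = 0 by exact: (is_cycleP x).1 cx (- a').
    suff -> : (x : 'rV_(rk G (- a))) *m (cmx (a' - 1) (- a))^T = (\row_q w q) *m (mx M (a' - 1) (a - 1))^T.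
      by rewrite subrr sg_zero row_mx0 sg_zero.
    suff : forall k, k = a -> (x : 'rV_(rk G (- a))) *m (cmx k (- a))^T = (\row_q w q) *m (mx M k (a - 1))^T.
      by apply; lia.
    move=> k ek; subst k; apply/rowP => q.
    have := hw q; rewrite adjcE ?opprK // => e0.
    apply: (can_inj (@sg_inv _ (- a))); rewrite e0 -sg_mx.
    rewrite (@eq_mact _ _ _ _ _ _ ((\row_q w q : 'rV[A]__) 0 : _ -> A^o)) => [|r]; last by rewrite mxE.
    by rewrite mact_row /= -scalemxAr sg_scale; congr (fun_of_matrix _ 0 q); apply: sg_par; rewrite abszN.
  rewrite -(hsubmxK (y : 'rV_(rk G (- (a - 1)) + rk M (a - 1 - 1)))) dual_fcone_mul.
  set y1 := lsubmx _; set y2 := rsubmx _ => e.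
  have {e} e : row_mx (x : 'rV_(rk G (- a))) (\row_q w q) =
     row_mx (sg a (sg (a - 1) (y1 *m mx G (- (a - 1)) (- a)))) (sg a (y1 *m (cmx (a - 1) (- (a - 1)))^T - y2 *m (mx M (a - 1) (a - 1 - 1))^T)).
    rewrite e; apply/rowP => p; rewrite !mxE.
    by rewrite /sg; case: odd; rewrite !mxE //; case: fintype.split => ?; rewrite ?mxE.
  have [e1 _] := eq_row_mx e.
  apply/is_boundaryP; exists (- (a - 1)), (sg a (sg (a - 1) y1)).
  by rewrite !(raddf_sg (diff (toc G) (- (a - 1)) (- a))) /= e1.
have [a ->] : exists a, n = - (a - 1) by exists (1 - n); lia.
move=> v cv; have ea : dgn true (a - 1) = - (a - 1) by [].
pose vr : 'rV[A]_(rk M (a - 1)) := \row_q (v (a - 1) 0 q : A).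
have vk k : vr *m (mx M k (a - 1))^T = 0.
  apply/rowP => p; have := (@stalk_cyc _ _ (dual M) A^o _ v _ ea).1 cv k p.
  rewrite (@eq_mact _ _ _ _ _ _ (vr 0 : _ -> A^o)) => [|q]; last by rewrite mxE.
  by rewrite mact_row /= -scalemxAr sg_scale sg_mx => /sg_eq0 ->; rewrite mxE.
have [|y] := ex a (row_mx 0 vr).
  by move=> a'; rewrite dual_fcone_mul !mul0mx vk subrr !sg_zero row_mx0 sg_zero.
rewrite -(hsubmxK (y : 'rV_(rk G (- (a - 1)) + rk M (a - 1 - 1)))) dual_fcone_mul.
set y1 := lsubmx _; set y2 := rsubmx _ => e.
have {e} [/esym/sg_eq0/sg_eq0 e1 e2] : 0 = sg a (sg (a - 1) (y1 *m mx G (- (a - 1)) (- a))) /\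
    vr = sg a (y1 *m (cmx (a - 1) (- (a - 1)))^T - y2 *m (mx M (a - 1) (a - 1 - 1))^T).
  apply: eq_row_mx; rewrite e; apply/rowP => p; rewrite !mxE.
  by rewrite /sg; case: odd; rewrite !mxE //; case: fintype.split => ?; rewrite ?mxE.
exists (- y1).
  apply/cycN/is_cycleP => k; have [ek|ne] := pselect (k = - a); first by rewrite ek; exact: e1.
  by rewrite diff_shape //; apply/eqP; lia.
apply/(@stalk_bnd _ _ (dual M) A^o _ _ _ ea); exists (y2 0) => p.
rewrite (ftenDE v) ftenNE adjcE ?opprK // mact_row.
have -> : v (a - 1) 0 p = vr 0 p :> A by rewrite mxE.
rewrite -sg_mx; set X := (- y1) *m _.
have -> : vr 0 p - (sg (- (a - 1)) X) 0 p = (vr - sg (- (a - 1)) X) 0 p by rewrite !mxE.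
congr (fun_of_matrix _ 0 p); rewrite /= -scalemxAr sg_scale e2 /X mulNmx.
rewrite (@sg_par _ (- (a - 1)) (a - 1)); last by rewrite abszN.
by rewrite !sg_pred opprK -sg_add addrAC subrr add0r sg_opp.
Qed.
End ConeMatrices.

Section FinitelyGeneratedHomology.
Lemma fgh_qi (A : comUnitRingType) (X Y : cplx A) (f : chain_map X Y) : quasi_iso f -> fgh X -> fgh Y.
Proof.
move=> qf fX n; have [r [z [cz gz]]] := fX n.
exists r, (fun l => f n (z l)); split=> [l|y cy]; first exact: chain_cyc.
have [x cx bx] := (qf n).2 y cy; have [c bc] := gz x cx; exists c.
have := bndD bx (chain_bnd f bc); rewrite linearB addrA subrK linear_sum.
by under eq_bigr => l _ do rewrite linearZ.
Qed.
Lemma fgh_iq (A : comUnitRingType) (X Y : cplx A) (f : chain_map X Y) : quasi_iso f -> fgh Y -> fgh X.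
Proof.
move=> qf fY n; have [r [z [cz gz]]] := fY n.
have wex l : exists w, is_cycle w /\ is_boundary (z l - f n w).
  by have [x] := (qf n).2 _ (cz l); exists x.
have [w wP] := choice wex.
exists r, w; split=> [l|x cx]; first exact: (wP l).1.
have [c bc] := gz _ (chain_cyc f cx); exists c.
have cs : is_cycle (x - \sum_l c l *: w l).
  by apply: cycB => //; apply: cyc_sum => l _; apply: cycZ; exact: (wP l).1.
apply: (qf n).1 => //; rewrite linearB linear_sum.
apply: bnd_trans bc _; rewrite -sumrB; apply: bnd_sum => l _.
by rewrite linearZ -scalerBr; apply: bndZ; exact: (wP l).2.
Qed.

Lemma fgh_stalk (A : comUnitRingType) s (P : fx s A) : noetherian A -> fgh (P ⊙ stalk A^o).
Proof.
move=> nA n; pose a := dgn s n.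
have en : dgn s a = n by rewrite /a; case: {+}s; rewrite /dgn ?opprK.
have sZ : submodule (fun x : 'rV[A]_(rk P a) => forall a', x *m mx P a a' = 0).
  split=> [a'|c x y hx hy a']; first by rewrite mul0mx.
  by rewrite mulmxDl -scalemxAl hx hy scaler0 addr0.
have [r [v [vZ vg]]] := noeth_rV nA sZ.
have en' : dgn s a + 0 = n by rewrite addr0.
pose z l := @fsingle _ _ P (stalk A^o) a 0 (v l 0) n en'.
have zE l p : z l a 0 p = v l 0 p by exact: (@fsingleE _ _ P (stalk A^o) a 0 (v l 0) p).
exists r, z; split=> [l|u cu].
  apply/(stalk_cyc _ en) => a' p; rewrite (@eq_mact _ _ _ _ _ _ (v l 0 : _ -> A^o)) //.
  by rewrite mact_row vZ mxE.
have [|c hc] := vg (\row_p (u a 0 p : A)).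
  move=> a'; apply/rowP => p; rewrite -mact_row mxE -[RHS]((@stalk_cyc _ _ P A^o _ u a en).1 cu a' p).
  have -> : ((\row_p (u a 0 p : A)) 0 : _ -> A^o) = (u a 0 : _ -> A^o) by apply/funext => q; rewrite mxE.
  by [].
exists c; have -> : u = \sum_l c l *: z l.
  apply: (stalk_ext en) => p; rewrite ften_sumE.
  have /rowP/(_ p) := hc; rewrite mxE summxE => ->.
  by apply: eq_bigr => l _; rewrite mxE zE.
by rewrite subrr; exact: bnd0.
Qed.

Variables (A B : comUnitRingType) (psi : {rmorphism A -> B}).
Lemma fgh_restr_down (Y : cplx B) : fgh (restr_cplx psi Y) -> fgh Y.
Proof.
move=> h n; have [r [z [cz gz]]] := h n; exists r, z; split=> // x /gz [c bc].
by exists (fun l => psi (c l)).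
Qed.
Lemma fgh_restr_up (Y : cplx B) : module_finite psi -> fgh Y -> fgh (restr_cplx psi Y).
Proof.
move=> [t tP] h n; have [r [z [cz gz]]] := h n.
pose N := #|{: 'I_r * 'I_(size t)}|.
pose e (i : 'I_N) : 'I_r * 'I_(size t) := enum_val i.
exists N, (fun i => t`_(e i).2 *: z (e i).1); split=> [i|x cx].
  by have /= := cycZ t`_(e i).2 (cz (e i).1); exact.
have [c bc] := gz x cx; have [d dP] := choice (fun l => tP (c l)).
exists (fun i => d (e i).1 (e i).2).
suff <- : \sum_l c l *: z l = \sum_(i < N) psi (d (e i).1 (e i).2) *: (t`_(e i).2 *: z (e i).1) by [].
rewrite -(big_enum_val (A := {: 'I_r * 'I_(size t)}) (fun i => psi (d i.1 i.2) *: (t`_i.2 *: z i.1))).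
rewrite -(pair_bigA _ (fun l k => psi (d l k) *: (t`_k *: z l))) /=; apply: eq_bigr => l _.
by rewrite [c l]dP scaler_suml; apply: eq_bigr => k _; rewrite scalerA.
Qed.
End FinitelyGeneratedHomology.

Section FibreCone.
Variables (R A F : comUnitRingType) (rho : {rmorphism R -> A}) (pi : {rmorphism A -> F}).
Hypothesis gf : gor_fibre rho pi.
Variables (G M : fx false A) (c : chain_map (toc M) (G ⋔ stalk A^o)).

Lemma mx_no_col m n (x : 'M[A]_(m, n)) : n = 0%N -> x = 0.
Proof. by move=> n0; apply/matrixP => i j; case: (no_ord n0 j). Qed.

Lemma fcone_low a : rk M (a - 1) = 0%N -> rk M a = 0%N -> exall rho (dual G) (- a) ->
  exall rho (fcone c) a.
Proof.
move=> M0 M1 ex s K x; rewrite -(hsubmxK (x : 'M_(s, rk G (- a) + rk M (a - 1)))).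
set x1 := lsubmx _; set x2 := rsubmx _ => hx.
have x20 : x2 = 0 by exact: mx_no_col.
have [|y hy] := ex s K x1.
  move=> b; have eb : - - b = b by rewrite opprK.
  move=> j; rewrite -eb in j *; have := hx (- b) (lshift _ j).
  by rewrite /= /cone_mx mul_row_block x20 !mul0mx !addr0; under eq_fun => i do rewrite row_mxEl.
have [y1 hy1] : exists y1 : 'M[A]_(s, rk G (- (a + 1))),
    y1 *m mx (dual G) (- (a + 1)) (- a) = y *m mx (dual G) (nx true (- a)) (- a).
  have e : - (a + 1) = nx true (- a) by rewrite /nx; lia.
  by rewrite e; exists y.
exists (row_mx y1 0) => j; rewrite /= /cone_mx mul_row_block !mul0mx mulmx0 !addr0 hy1.
case: (split_ordP (j : 'I_(rk G (- a) + rk M (a - 1)))) => k ->; last by case: (no_ord M0 k).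
set Y := y *m _ in hy *.
suff -> : (fun m => (row_mx x1 x2 - row_mx Y 0) m (lshift (rk M (a - 1)) k)) = (fun m => (x1 - Y) m k) by exact: hy.
by apply/funext => m; rewrite [LHS]mxE [X in _ + X]mxE !row_mxEl [RHS]mxE [X in _ = _ + X]mxE.
Qed.

(** Exactness with coefficients holds in low degrees, where [M] is zero and the cone is just the
    dual of [G]. From there it climbs one degree at a time by [exall_up], because the cone of a
    quasi-isomorphism is exact. *)
Lemma fcone_exall b c0 : (forall i : int, i < b -> rk M i = 0%N) ->
  (forall a : int, c0 < a -> exall rho (dual G) a) -> quasi_iso c ->
  forall a, exall rho (fcone c) a.
Proof.
move=> Mb hG qc; have ex := fcone_exq qc.
(* For [a] up to this bound, [M] vanishes in degrees [a] and [a - 1], and [- a] exceeds [c0]. *)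
pose a0 := Num.min (b - 1) (- c0 - 1).
have low (a : int) : a <= a0 -> exall rho (fcone c) a.
  by move=> ha; apply: fcone_low; [apply: Mb|apply: Mb|apply: hG]; move: ha; rewrite /a0; lia.
have up (k : nat) : exall rho (fcone c) (a0 + k%:Z).
  elim: k => [|k IH]; first by apply: low; lia.
  have -> : a0 + k.+1%:Z = nx false (a0 + k%:Z) by rewrite /nx; lia.
  exact: (exall_up gf).
move=> a; have [ha|ha] := leP a a0; first exact: low.
have -> : a = a0 + (absz (a - a0))%:Z by lia.
exact: up.
Qed.

(** The dual of [G] vanishes above degree [- b], so there the cone is a shifted copy of [M]. This is
    how finiteness of flat dimension passes from a complex to its dual. *)
Lemma fcone_fibre_high b : (forall i : int, i < b -> rk G i = 0%N) ->
  (forall a, exall rho (fcone c) a) -> forall a : int, - b < a -> exq (bc pi M) a.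
Proof.
move=> Gb ex a ha; pose i := a + 1; have ea : a = i - 1 by rewrite /i; lia.
have G0 : rk G (- (i - 1)) = 0%N by apply: Gb; lia.
have exi := (exall_fibre gf (fcone c) i).1 (ex i); rewrite ea => x hx.
have [|y] := exi (row_mx 0 x : 'rV_(cone_rk G M i)).
  move=> a'; rewrite /= /cone_mx map_block_mx mul_row_block !mul0mx !add0r map_mxN mulmxN.
  rewrite [x *m map_mx pi (mx M _ _)]hx oppr0.
  have -> : x *m map_mx pi (cmx c (i - 1) (- a')) = 0.
    have [e|ne] := pselect (a' = i - 1); first by subst a'; apply/matrixP => ? k; case: (no_ord G0 k).
    by rewrite cmx0 ?map_mx0 ?mulmx0 //; lia.
  exact: row_mx0.
rewrite -(hsubmxK (y : 'rV_(rk G (- (i + 1)) + rk M (i + 1 - 1)))) /= /cone_mx map_block_mx mul_row_block.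
move=> /eq_row_mx [_]; rewrite map_mx0 mulmx0 add0r map_mxN mulmxN => e.
have H k : k = i + 1 - 1 -> exists w : 'rV[F]_(rk M k), x = w *m map_mx pi (mx M k (i - 1)).
  by move=> ek; subst k; exists (- rsubmx y); rewrite mulNmx.
by apply: H; rewrite /nx; lia.
Qed.
End FibreCone.

Definition acyc (A : comUnitRingType) (Y : cplx A) (t : int) :=
  forall x : Y t, is_cycle x -> is_boundary x.

Lemma hom_eq_refl (A : comUnitRingType) (X Y : cplx A) (f : chain_map X Y) : hom_eq f f.
Proof. by move=> n x _; rewrite subrr; exact: bnd0. Qed.
Lemma hom_eq_sym (A : comUnitRingType) (X Y : cplx A) (f g : chain_map X Y) : hom_eq f g -> hom_eq g f.
Proof. by move=> h n x cx; apply: bndBC; exact: h. Qed.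
Lemma hom_eq_trans (A : comUnitRingType) (X Y : cplx A) (f g h : chain_map X Y) :
  hom_eq f g -> hom_eq g h -> hom_eq f h.
Proof. by move=> h1 h2 n x cx; apply: bnd_trans (h1 _ _ cx) (h2 _ _ cx). Qed.
Lemma homotopic_refl (A : comUnitRingType) (X Y : cplx A) (f : chain_map X Y) : homotopic f f.
Proof. by exists (fun i j => \0) => i i1 i0 x _ _; rewrite subrr /= linear0 addr0. Qed.
Lemma homotopic_sym (A : comUnitRingType) (X : fx false A) (Y : cplx A) (f g : chain_map (toc X) Y) :
  homotopic f g -> homotopic g f.
Proof. by move=> /bnd_homotopic/bndBC; exact: homotopic_bnd. Qed.

Section Bidual.
Variables (A B : comUnitRingType) (psi : {rmorphism A -> B}) (nA : noetherian A).
Variables (I : cplx A) (iota : chain_map (stalk A^o) I).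
Hypotheses (kI : K_injective I) (qI : quasi_iso iota).
Variables (L : fx false B) (G : fx false A) (b : int).
Variable g : chain_map (toc G) (restr_cplx psi (toc L)).
Hypotheses (Gb : forall i : int, i < b -> rk G i = 0%N) (qg : quasi_iso g).
Let C := coext_cplx psi I.

Lemma dual_iota_qi : quasi_iso (fte_map (dual G) iota).
Proof. exact: fte_qi_bda (bda_dual Gb) qI. Qed.

Lemma dual_fgh : fgh (L ⋔ C).
Proof.
apply: (@fgh_restr_down _ _ psi); apply: (fgh_iq (hce_qi qg kI)).
by apply: (fgh_qi dual_iota_qi); exact: fgh_stalk.
Qed.

Variables (N : fx false B) (n : chain_map (toc N) (L ⋔ C)) (qn : quasi_iso n).
Variables (M : fx false A) (m : chain_map (toc M) (restr_cplx psi (toc N))) (qm : quasi_iso m).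
Variables (bM : int) (Mb : forall i : int, i < bM -> rk M i = 0%N).

Definition dual_comp := chain_comp (hce g I) (chain_comp (restr_map psi n) m).
Lemma dual_comp_qi : quasi_iso dual_comp.
Proof. by apply: qi_comp (hce_qi qg kI); apply: qi_comp qm _; exact: restr_qi. Qed.

Lemma dual_comp_lift : exists c : chain_map (toc M) (G ⋔ stalk A^o),
  homotopic dual_comp (chain_comp (fte_map (dual G) iota) c) /\ quasi_iso c.
Proof.
have [c hc] := lift_chain dual_comp Mb dual_iota_qi; exists c; split=> //.
exact: qi_cancel_left (homotopic_hom_eq hc) dual_iota_qi dual_comp_qi.
Qed.

(** Read over [A], the map [adj n] becomes homotopic to [adj c] followed by [iota], where only free
    complexes over [A] are involved and [adj_qi] applies. Two-out-of-three, through the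
    quasi-isomorphisms [hce] and [g], returns to [adj n]. *)
Lemma bidual_of_cone (c : chain_map (toc M) (G ⋔ stalk A^o)) :
  homotopic dual_comp (chain_comp (fte_map (dual G) iota) c) ->
  (forall a, exq (dual (fcone c)) a) -> quasi_iso (adj n).
Proof.
move=> hc ex; have qac : quasi_iso (adj c) by exact: adj_qi.
pose f1 := chain_comp (hce m I) (chain_comp (restr_map psi (adj n)) g).
pose h2 := chain_comp (fte_map (dual G) iota) c.
have e1 : homotopic f1 (adj h2).
  exact: adj_homotopic (adj_coext g m n) (homotopic_sym hc).
have e2 : homotopic (chain_comp (fte_map (dual M) iota) (adj c)) (adj h2).
  exact: adj_homotopic (adj_natural c iota) (homotopic_refl _).
have qf1 : quasi_iso f1.
  apply: (qi_ext (f := chain_comp (fte_map (dual M) iota) (adj c))).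
    exact: hom_eq_trans (homotopic_hom_eq e2) (hom_eq_sym (homotopic_hom_eq e1)).
  exact: qi_comp qac (fte_qi_bda (bda_dual Mb) qI).
have q1 : quasi_iso (chain_comp (restr_map psi (adj n)) g).
  exact: qi_cancel_left (hom_eq_refl f1) (hce_qi qm kI) qf1.
apply: (@restr_qiP _ _ psi); exact: qi_cancel_right (hom_eq_refl _) qg q1.
Qed.
End Bidual.

Section FiniteFlatDual.
Variables (R A F B : comUnitRingType) (rho : {rmorphism R -> A}) (pi : {rmorphism A -> F}).
Variable psi : {rmorphism A -> B}.
Hypothesis gf : gor_fibre rho pi.
Variables (I : cplx A) (iota : chain_map (stalk A^o) I).
Hypotheses (kI : K_injective I) (qI : quasi_iso iota).
Variables (L : fx false B) (G : fx false A) (b f : int).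
Variable g : chain_map (toc G) (restr_cplx psi (toc L)).
Hypotheses (Gb : forall i : int, i < b -> rk G i = 0%N) (qg : quasi_iso g).
Hypothesis Gf : forall a : int, f < a -> exq (bc pi G) a.
Let C := coext_cplx psi I.

(** This lower bound on homology is what allows the dual of [L] to have a bounded below free
    resolution, and so a second dual. *)
Lemma dual_low : exists c, forall n : int, n < c -> acyc (L ⋔ C) n.
Proof.
have [c0 hc] := fibre_dual_low gf Gb Gf.
exists (- c0) => n hn x cx.
have h : forall u : (G ⋔ stalk A^o) n, is_cycle u -> is_boundary u.
  apply/(@exq_stalk _ _ (dual G) (- n)); first by rewrite /dgn /= opprK.
  by apply: (exall_exq (rho := rho)); apply: hc; lia.
have [h1 _] := hce_qi qg kI n; apply: h1 => //.
have [u cu bu] := (dual_iota_qi qI Gb n).2 _ (chain_cyc (hce g I) (x := (x : restr_cplx psi (L ⋔ C) n)) cx).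
by apply: bnd_sub bu _; apply: chain_bnd; exact: h.
Qed.

Variables (N : fx false B) (n : chain_map (toc N) (L ⋔ C)) (qn : quasi_iso n).
Variables (M : fx false A) (m : chain_map (toc M) (restr_cplx psi (toc N))) (qm : quasi_iso m).
Variables (bM : int) (Mb : forall i : int, i < bM -> rk M i = 0%N).

Lemma biduality_cone : exists c : chain_map (toc M) (G ⋔ stalk A^o),
  [/\ homotopic (dual_comp g n m) (chain_comp (fte_map (dual G) iota) c), quasi_iso c &
      forall a, exall rho (fcone c) a].
Proof.
have [c [hc qc]] := dual_comp_lift kI qI Gb qg qn qm Mb; exists c.
have [c0 low] := fibre_dual_low gf Gb Gf.
by split=> //; exact: (fcone_exall gf Mb low qc).
Qed.

Lemma dual_fibre_high : exists f' : int, forall a : int, f' < a -> exq (bc pi M) a.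
Proof. by have [c [_ _ ex]] := biduality_cone; exists (- b); exact: (fcone_fibre_high gf Gb ex). Qed.

Lemma biduality : quasi_iso (adj n).
Proof.
have [c [hc qc ex]] := biduality_cone.
apply: (bidual_of_cone kI qI qg qm Mb hc) => a; apply: (exall_exq (rho := rho)).
by apply: (fibre_dual gf) => a'; apply/(exall_fibre gf); exact: ex.
Qed.
End FiniteFlatDual.

(** * Finite flat dimension *)

Lemma acyc_qi (A : comUnitRingType) (X Y : cplx A) (f : chain_map X Y) t : quasi_iso f ->
  acyc X t <-> acyc Y t.
Proof.
move=> qf; split=> h x cx.
  have [y cy by_] := (qf t).2 x cx; apply: bnd_sub by_ _; apply: chain_bnd; exact: h.
by apply: (qf t).1 => //; apply: h; exact: chain_cyc.
Qed.

Lemma exM_acyc (A : comUnitRingType) (P : fx false A) (M : lmodType A) t :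
  exM P M t <-> acyc (P ⊙ stalk M) t.
Proof. exact: (@exM_stalk _ _ P M t t). Qed.

Lemma acyc_restr (A B : comUnitRingType) (psi : {rmorphism A -> B}) (Y : cplx B) t :
  acyc (restr_cplx psi Y) t <-> acyc Y t.
Proof. by []. Qed.

Lemma flat_exM (R A : comUnitRingType) (rho : {rmorphism R -> A}) s (P : fx s R) (N : lmodType A) a :
  flat_over rho N -> exq P a -> exM (bc rho P) N a.
Proof.
move=> fN ex v hv; pose a0 := if s then a + 1 else a - 1.
have ea0 : dgn s a = dgn s a0 + 1 by rewrite /a0 /dgn; case: {+}s; lia.
pose K := preim_sub (zero_sub R (rk P a0)) (mx P a a0).
have /(flat_extc fN) : forall x, K x <-> zero_sub R (rk P a0) (x *m mx P a a0) by [].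
move=> /(_ v) [|n [k [w [hk hw]]]].
  have := extc0 rho N (zero_sub R (rk P a0)); congr extc; apply/funext => j.
  by rewrite -[LHS](hv a0 j); apply: eq_bigr => i _; rewrite mxE.
have hy l : exists y, k l = y *m mx P (nx s a) a.
  apply: ex => a'; have [e|ne] := pselect (a' = a0); first by subst a'; exact: hk.
  rewrite (@mx_shape _ _ P) ?mulmx0 //; move: ne ea0; rewrite /a0 /dgn; case: {+}s; lia.
have [y yE] := choice hy.
exists (fun q => \sum_l rho (y l 0 q) *: w l) => p; rewrite hw /mact.
under [RHS]eq_bigr => q _ do rewrite scaler_sumr.
rewrite exchange_big; apply: eq_bigr => l _; rewrite yE mxE rmorph_sum scaler_suml.
by apply: eq_bigr => q _; rewrite mxE scalerA rmorphM mulrC.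
Qed.

Lemma exM_restr (R A : comUnitRingType) (rho : {rmorphism R -> A}) s (P : fx s R) (N : lmodType A) a :
  exM P (restr rho N) a <-> exM (bc rho P) N a.
Proof.
have e m n (B : 'M[R]_(m, n)) (v : 'I_m -> N) p : mact (map_mx rho B) v p = mact B (v : _ -> restr rho N) p.
  by apply: eq_bigr => q _; rewrite mxE.
split=> h v hv.
  have [a' p|w hw] := h v; first by rewrite -e; exact: hv.
  by exists w => p; rewrite e; exact: hw.
have [a' p|w hw] := h v; first by rewrite e; exact: hv.
by exists w => p; rewrite -e; exact: hw.
Qed.

Lemma exM_id (R : comUnitRingType) s (P : fx s R) (N : lmodType R) a :
  exM (bc idfun P) N a -> exM P N a.
Proof.
have e m n (B : 'M[R]_(m, n)) (v : 'I_m -> N) p : mact (map_mx idfun B) v p = mact B v p.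
  by apply: eq_bigr => q _; rewrite mxE.
move=> h v hv; have [a' p|w hw] := h v; first by rewrite e; exact: hv.
by exists w => p; rewrite -e; exact: hw.
Qed.

(* Killing the components of a cycle from the top degree of [Y] downwards. *)
Lemma row_exact (R : comUnitRingType) (P : fx false R) (Y : cplx R) (t n : int) :
  (forall j, ~~ (0 <= j <= n) -> forall x : Y j, x = 0) ->
  (forall a j : int, 0 < a -> exM P (Y j) a) -> n < t -> acyc (P ⊙ Y) t.
Proof.
move=> Y0 ex nt; have key : forall (m : nat) (u : (P ⊙ Y) t), (m%:Z <= n + 1) ->
    (forall (a j : int) p, m%:Z <= j -> u a j p = 0) -> is_cycle u -> is_boundary u.
  elim=> [|m IH] u mn um cu.
    have -> : u = 0; last exact: bnd0.
    apply: ften_eq => a j p; rewrite ften0E; have [j0|j0] := leP 0 j; first exact: um.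
    by apply: Y0; lia.
  have [||w hw] := ex (t - m%:Z) m%:Z _ (u (t - m%:Z) m%:Z); first by lia.
    move=> a' p; have [e|ne] := pselect (t - m%:Z = a' + 1); last first.
      by rewrite (@mx_shape _ _ P) ?mact0.
    have := (fte_cycP u).1 cu a' m%:Z p; rewrite /tdiff um ?linear0 ?addr0; last lia.
    by rewrite e => /sg_eq0.
  have ez : dgn false (t - m%:Z + 1) + m%:Z = t + 1 by rewrite /dgn; lia.
  pose z := @fsingle _ _ P Y (t - m%:Z + 1) m%:Z (fun q => sg m%:Z (w q)) (t + 1) ez.
  apply: (bnd_sub (y := diff (P ⊙ Y) (t + 1) t z)); last exact: bnd_diff.
  apply: IH; [lia| |apply: cycB => //; exact: cyc_diff].
  move=> a j p mj; rewrite ftenDE ftenNE ften_diffE eqxx /tdiff.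
  have -> : z a (j + 1) p = 0.
    by apply: (@fsingle0 _ _ P Y (t - m%:Z + 1) m%:Z); right; lia.
  rewrite linear0 addr0; have [e|ne] := pselect (j = m%:Z); last first.
    rewrite um ?sub0r; last by lia.
    rewrite mact_eq0 ?sg_zero ?oppr0 // => q.
    by apply: (@fsingle0 _ _ P Y (t - m%:Z + 1) m%:Z); right; lia.
  subst j; have [e|ne] := pselect (a = t - m%:Z); last first.
    rewrite (ffP u) ?sub0r /dgn; last by lia.
    rewrite mact_eq0 ?sg_zero ?oppr0 // => q.
    by apply: (@fsingle0 _ _ P Y (t - m%:Z + 1) m%:Z); left; rewrite /nx; lia.
  subst a; rewrite hw [X in _ - sg _ X](@eq_mact _ _ _ _ _ _ (fun q => sg m%:Z (w q))) => [|q]; last by rewrite /z /= /nx fsingleE.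
  by rewrite mact_sg sg_inv subrr.
move=> u cu; have [n0|n0] := leP 0 n.
  apply: (key (absz (n + 1))) => //; first lia.
  by move=> a j p hj; apply: Y0; lia.
have -> : u = 0; last exact: bnd0.
by apply: ften_eq => a j p; rewrite ften0E; apply: Y0; lia.
Qed.

Definition fone (A : comUnitRingType) (d : int) : fx false A :=
  @Fx false A (fun i => (i == d : nat)) (fun i j => 0) (fun i j _ => erefl) (fun i j k => mul0mx _ _).

Section RankOne.
Variables (s : bool) (A : comUnitRingType) (D : fx s A) (d : int).
Hypotheses (rk1 : rk D d = 1%N) (rk0 : forall a, a <> d -> rk D a = 0%N).
Let o : 'I_(rk D d) := Ordinal (eq_leq (esym rk1)).
Lemma one_ord (p : 'I_(rk D d)) : p = o.
Proof. by case: p => m hm; apply: ord_inj => /=; move: (hm); rewrite rk1; case: m {hm}. Qed.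
Lemma one_mx0 i j : mx D i j = 0.
Proof.
have [e|ne] := pselect (i = d); last by apply/matrixP => p; case: (no_ord (rk0 ne) p).
have [e'|ne] := pselect (j = d); last by apply/matrixP => ? p; case: (no_ord (rk0 ne) p).
by apply: mx_shape; rewrite e e'; lia.
Qed.
Variable Z : cplx A.
Let e := dgn s d.
(** The sign makes the identification compatible with the differential of the shift, which carries
    the factor [(-1)^e]. *)
Definition one_fun n (u : (D ⊙ Z) n) : shift e Z n := sg (d * n) (u d (n - e) o).
Fact one_linear n : linear (@one_fun n).
Proof. by move=> a u v; rewrite /one_fun (ftenDE (a *: u)) ftenZE sg_add sg_lin. Qed.
HB.instance Definition _ n := GRing.isLinear.Build A _ _ _ (@one_fun n) (@one_linear n).
Fact one_ax (n m : int) (u : (D ⊙ Z) n) :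
  one_fun (diff _ n m u) = diff (shift e Z) n m (one_fun u).
Proof.
have [en|ne] := pselect (n = m + 1); last by rewrite !diff_shape ?linear0 //; apply/eqP.
subst n; rewrite /one_fun sg_shift ften_diffE eqxx /tdiff one_mx0 mact0 sg_zero add0r.
rewrite (raddf_sg (diff Z (m + 1 - e) (m - e))) /= -sg_deg.
have -> : m - e + 1 = m + 1 - e by lia.
apply: sg_par; rewrite mulrDr mulr1 addrCA /e /dgn; case: {+}s; last by rewrite -[d + d]mulr2n; lia.
by rewrite addNr addr0.
Qed.
Definition one_map : chain_map (D ⊙ Z) (shift e Z) :=
  @ChainMap A (D ⊙ Z) (shift e Z) (fun n => @one_fun n) one_ax.
Lemma one_qi : quasi_iso one_map.
Proof.
apply: qi_inj_surj => [n u v /= h|n x].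
  apply: ften_eq => a j p; have [ea|ne] := pselect (a = d); last by case: (no_ord (rk0 ne) p).
  subst a; rewrite (one_ord p); have [ej|ne] := pselect (j = n - e); last first.
    by rewrite !ffP //; rewrite -/e; lia.
  by subst j; apply: (can_inj (@sg_inv _ (d * n))).
have en : dgn s d + (n - e) = n by rewrite -/e; lia.
exists (@fsingle _ _ D Z d (n - e) (fun=> sg (d * n) x) n en).
by rewrite /= /one_fun /= fsingleE sg_inv.
Qed.
End RankOne.

Lemma restr_comp_qi (R A B : comUnitRingType) (rho : {rmorphism R -> A}) (psi : {rmorphism A -> B})
    (phi : {rmorphism R -> B}) (Z : cplx B) : (forall x, phi x = psi (rho x)) ->
  exists f : chain_map (restr_cplx rho (restr_cplx psi Z)) (restr_cplx phi Z), quasi_iso f.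
Proof.
move=> e; have l i : linear (fun x : restr rho (restr psi (Z i)) => (x : restr phi (Z i))).
  by move=> a x y; congr (_ + _); rewrite -[RHS]/(phi a *: (x : Z i)) e.
pose f i : {linear restr rho (restr psi (Z i)) -> restr phi (Z i)} :=
  HB.pack (fun x : restr rho (restr psi (Z i)) => (x : restr phi (Z i))) (GRing.isLinear.Build R _ _ _ _ (l i)).
exists (@ChainMap R (restr_cplx rho (restr_cplx psi Z)) (restr_cplx phi Z) f (fun _ _ _ => erefl)).
by apply: qi_inj_surj => [n x y|n y]; [exact|exists y].
Qed.

(* [P] is a free resolution of the residue field, the augmentation being
   given modulo the maximal ideal by the entries of [r]. *)
Record res_field_res (R : comUnitRingType) (P : fx false R) (r : 'cV[R]_(rk P 0)) : Prop := ResFieldRes {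
  rf_neg : forall i : int, i < 0 -> rk P i = 0%N;
  rf_pos : forall i : int, 0 < i -> exq P i;
  rf_zero : forall x : 'rV[R]_(rk P 0), max_ideal ((x *m r) 0 0) <-> exists y, x = y *m mx P 1 0;
  rf_unit : exists p, r p 0 \is a GRing.unit }.

Section FibreResolution.
Variables (R A F : comUnitRingType) (rho : {rmorphism R -> A}) (pi : {rmorphism A -> F}).
Hypothesis gf : gor_fibre rho pi.
Variables (P : fx false R) (r : 'cV[R]_(rk P 0)).
Hypothesis Pr : res_field_res r.
Definition faug : 'rV[A]_(rk P 0) -> restr pi F^o := linv (fun p => pi (rho (r p 0)) : restr pi F^o).
HB.instance Definition _ := GRing.Linear.on faug.
Lemma faugE x : faug x = pi ((x *m map_mx rho r) 0 0).
Proof.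
rewrite /faug /linv mxE rmorph_sum; apply: eq_bigr => p _.
by rewrite -[LHS]/(_ * _ : F) mxE rmorphM.
Qed.
Lemma faug0 (x : 'rV[A]_(rk P 0)) : faug x = 0 <-> exists y, x = y *m map_mx rho (mx P 1 0).
Proof.
have lR := gf_lR gf; have [_ _ z _] := Pr; split=> [|[y ->]]; last first.
  rewrite faugE -mulmxA -map_mxM.
  have [y' hy'] : exists y' : 'rV[A]_(rk P 1), y' = y by exists y.
  apply/(extc_max lR (gf_ker gf) (fun i => (y *m map_mx rho (mx P 1 0 *m r)) 0 i)).
  have := @extc_sum _ _ rho A^o 1 (max_sub lR) _ (index_enum _) (fun q i => rho ((mx P 1 0 *m r) q i) *: (y 0 q : A^o)).
  case=> [q|n [k [a [hk hc]]]].
    have := @extc1 _ _ rho A^o 1 (max_sub lR) (row q (mx P 1 0 *m r)) (y 0 q : A^o).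
    case=> [|n [k [a [hk hc]]]].
      by rewrite /= row_mul; apply/z; exists (delta_mx 0 q); rewrite -rowE.
    by exists n, k, a; split=> // i; rewrite -hc [row _ _ _ _]mxE.
  exists n, k, a; split=> // i; rewrite -hc mxE; apply: eq_bigr => q _.
  by rewrite mxE mulrC.
rewrite faugE => /(extc_max lR (gf_ker gf) (fun i => (x *m map_mx rho r) 0 i)) h.
have : extc rho (N := A^o) (preim_sub (max_sub lR) r) (x 0).
  apply: (flat_extc (gf_flat gf) (K' := max_sub lR) (g := r)) => //.
  by congr extc: h; apply/funext => j; rewrite mxE; apply: eq_bigr => i _; rewrite mxE mulrC.
move=> [n [k [a [hk hx]]]]; have [y yE] := choice (fun l => (z (k l)).1 (hk l)).
exists (\row_q \sum_l rho (y l 0 q) * a l); apply/rowP => p; rewrite hx mxE.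
under [RHS]eq_bigr => q _ do rewrite mxE mulr_suml.
rewrite exchange_big; apply: eq_bigr => l _; rewrite [in LHS]yE mxE rmorph_sum scaler_suml.
by apply: eq_bigr => q _; rewrite mxE rmorphM -[_ *: _]/(_ * _) mulrAC.
Qed.

Let Q := bc rho P.
Fact faug_d (i : int) (x : toc Q i) : faug (diff (toc Q) i 0 x) = 0.
Proof.
have [e|ne] := pselect (i = 1); last by rewrite diff_shape ?linear0 //; apply/eqP; lia.
by subst i; apply/faug0; exists x.
Qed.
Definition faug_map : chain_map (toc Q) (stalk (restr pi F^o)) :=
  @to_stalk A (restr pi F^o) (toc Q) faug faug_d.
(** By flatness the base change of a resolution of the residue field of [R] resolves its base
    change, which is the closed fibre; a unit among the entries of [r] gives surjectivity of the
    augmentation. *)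
Lemma faug_qi : quasi_iso faug_map.
Proof.
have [neg pos _ [p0 u0]] := Pr.
have ex i : 0 < i -> acyc (toc Q) i.
  by move=> i0; apply/exq_toc/exM_exq; apply: flat_exM (gf_flat gf) _; exact: pos.
case=> [[|n]|n]; split.
- by move=> x _ [y hy]; apply/is_boundaryP; exists 1; have [w ->] := (faug0 x).1 (esym hy); exists w.
- move=> z _; have [y yz] := gf_surj gf z.
  exists ((y / rho (r p0 0)) *: delta_mx 0 p0 : toc Q 0).
    by rewrite /is_cycle; apply: mx_no_col; apply: neg; lia.
  suff -> : faug_map 0 ((y / rho (r p0 0)) *: delta_mx 0 p0) = z by rewrite subrr; exact: bnd0.
  rewrite [LHS]faugE -scalemxAl -rowE !mxE divrK ?yz //.
  exact: rmorph_unit.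
- by move=> x cx _; exact: ex.
- by move=> y _; exists 0; [exact: cyc0|rewrite (stalk_triv (y - _)) //; exact: bnd0].
- by move=> x _ _; rewrite (mx_no_col x) ?neg //; exact: bnd0.
- by move=> y _; exists 0; [exact: cyc0|rewrite (stalk_triv (y - _)) //; exact: bnd0].
Qed.
End FibreResolution.

Section FibreTor.
Variables (R A F B : comUnitRingType) (rho : {rmorphism R -> A}) (pi : {rmorphism A -> F}).
Variables (psi : {rmorphism A -> B}) (phi : {rmorphism R -> B}).
Hypotheses (gf : gor_fibre rho pi) (ephi : forall x, phi x = psi (rho x)).
Variables (P : fx false R) (r : 'cV[R]_(rk P 0)).
Hypothesis Pr : res_field_res r.

Lemma toc_bdb (X : comUnitRingType) (Q : fx false X) b : (forall i : int, i < b -> rk Q i = 0%N) ->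
  bdb (toc Q) b.
Proof. by move=> Qb j jb x; apply: mx_no_col; exact: Qb. Qed.

(* Tor over R of the residue field computed with free resolutions over A. *)
Lemma fibre_tor (L : fx false B) (G : fx false A) (b bL : int)
    (g : chain_map (toc G) (restr_cplx psi (toc L))) (t : int) :
  (forall i : int, i < b -> rk G i = 0%N) -> (forall i : int, i < bL -> rk L i = 0%N) ->
  quasi_iso g ->
  acyc (P ⊙ restr_cplx phi (toc L)) t <-> exq (bc pi G) t.
Proof.
(* The complex is rewritten in the order P (x)_R L, Q (x)_A L, Q (x)_A G, G (x)_A Q, G (x)_A F.
   Every factor is bounded below, which each replacement uses. *)
move=> Gb Lb qg; pose Q := bc rho P; have [neg _ _ _] := Pr.
have Q0 : bdb (toc Q) 0 by exact: toc_bdb.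
have [i qi] := restr_comp_qi (toc L) ephi.
have Lbd : bdb (restr_cplx psi (toc L)) bL by exact: (toc_bdb Lb).
rewrite -(acyc_qi t (fte_qi_bdb P (b := bL) _ _ qi)); [|exact: Lbd|exact: (toc_bdb Lb)].
rewrite -(acyc_qi t (bc_restr_qi rho P (restr_cplx psi (toc L)))) acyc_restr.
pose bm := Num.min b bL.
rewrite -(acyc_qi t (fte_qi_bdb Q (b := bm) _ _ qg)); last first.
- by move=> j jb x; apply: Lbd; move: jb; rewrite /bm; lia.
- by move=> j jb x; apply: (toc_bdb Gb); move: jb; rewrite /bm; lia.
have stk : bdb (stalk A^o) 0 by move=> j jb x; apply: stalk_triv; lia.
have bfte s (X : fx s A) (Y : cplx A) c d : (forall i : int, dgn s i < c -> rk X i = 0%N) -> bdb Y d -> bdb (X ⊙ Y) (c + d).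
  move=> Xc Yd j jcd x; apply: ften_eq => a k p; rewrite ften0E.
  have [e|ne] := pselect (dgn s a + k = j); last exact: ffP.
  have [kd|dk] := ltP k d; first exact: Yd.
  by case: (no_ord (Xc a _) p); lia.
rewrite -(acyc_qi t (fte_qi_bdb Q (b := b) _ _ (unstalk_qi G))); last first.
- exact: toc_bdb.
- by rewrite -[b]addr0; apply: bfte.
rewrite -(acyc_qi t (swap_qi G Q (stalk A^o))).
rewrite (acyc_qi t (fte_qi_bdb G (b := 0) _ _ (unstalk_qi Q))); last first.
- exact: Q0.
- by rewrite -[0]addr0; apply: bfte.
rewrite (acyc_qi t (fte_qi_bdb G (b := 0) Q0 _ (faug_qi gf Pr))); last first.
  by move=> j jb x; apply: stalk_triv; lia.
rewrite -(@exM_acyc _ G (restr pi F^o) t) exM_restr; exact: exM_exq.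
Qed.
End FibreTor.

(** Finite flat dimension in the only form that is used: [P] being a resolution of the residue field
    of [R], Tor of that field with [Y] vanishes in large degrees. The test is over [R], hence
    independent of any factorization. *)
Definition fdfin (R B : comUnitRingType) (phi : {rmorphism R -> B}) (P : fx false R) (Y : cplx B) :=
  exists f : int, forall t : int, f < t -> acyc (P ⊙ restr_cplx phi Y) t.

Lemma fdfin_ring (R B : comUnitRingType) (phi : {rmorphism R -> B}) (P : fx false R) (r : 'cV[R]_(rk P 0)) :
  res_field_res r -> finite_fd phi -> fdfin phi P (stalk B^o).
Proof.
move=> [neg pos _ _] [n [Fl [e [fl bd qe]]]]; exists n%:Z => t nt.
rewrite -(acyc_qi t (bc_restr_qi phi P (stalk B^o))) acyc_restr.
rewrite -exM_acyc -exM_restr exM_acyc.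
rewrite -(acyc_qi t (fte_qi_bdb P (b := 0) _ _ qe)); last first.
- by move=> j jb x; apply: stalk_triv; lia.
- by move=> j jb x; apply: bd; lia.
apply: (row_exact (n := n%:Z)) => // a j a0.
by apply: exM_id; apply: flat_exM; [exact: fl|exact: pos].
Qed.

Lemma fdfin_qi (R B : comUnitRingType) (phi : {rmorphism R -> B}) (P : fx false R) (Y Z : cplx B) b
    (f : chain_map Y Z) : quasi_iso f -> bdb Y b -> bdb Z b -> fdfin phi P Y <-> fdfin phi P Z.
Proof.
move=> qf Yb Zb; have q := fte_qi_bdb P (f := restr_map phi f) Yb Zb (restr_qi phi qf).
by split=> -[c hc]; exists c => t /hc; rewrite (acyc_qi t q).
Qed.

(** * The residue field, and coextension as a functor on complexes *)

Section ResidueField.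
Variables (R : comUnitRingType) (lR : local_ring R).
Fact maxid_ax : submodule (fun x : R^o => max_ideal (x : R)).
Proof. by split=> [|a x y hx hy]; [exact: maxI0|apply: maxID => //; exact: maxIM]. Qed.
Definition maxid : submod_pred R^o := SubmodPred maxid_ax.
Definition resf := quom maxid.
HB.instance Definition _ := GRing.Zmodule.on resf.
Definition res_one : resf := qpi maxid (1 : R^o).
Definition res_mul (x y : resf) : resf := qpi maxid ((repr x : R) * (repr y : R) : R^o).
Definition res_inv (x : resf) : resf := qpi maxid ((if x == 0 then 0 else (repr x : R)^-1) : R^o).
Lemma res_mulE (x y : R) : res_mul (qpi maxid (x : R^o)) (qpi maxid (y : R^o)) = qpi maxid (x * y : R^o).
Proof.
apply/qpiP; have hx := qpi_repr maxid (x : R^o); have hy := qpi_repr maxid (y : R^o).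
rewrite /=; set x' : R := repr _ in hx *; set y' : R := repr _ in hy *.
have -> : x' * y' - x * y = x' * (y' - y) + y * (x' - x) :> R.
  by rewrite !mulrBr [y * x']mulrC [y * x]mulrC addrA subrK.
by apply: maxID => //; apply: maxIM.
Qed.
Fact res_mulA : associative res_mul.
Proof.
move=> x y z; have [x' ->] := qpi_surj x; have [y' ->] := qpi_surj y; have [z' ->] := qpi_surj z.
by rewrite !res_mulE mulrA.
Qed.
Fact res_mulC : commutative res_mul.
Proof. by move=> x y; rewrite /res_mul mulrC. Qed.
Fact res_mul1 : left_id res_one res_mul.
Proof. by move=> x; have [x' ->] := qpi_surj x; rewrite res_mulE mul1r. Qed.
Fact res_mulDl : left_distributive res_mul +%R.
Proof.
move=> x y z; have [x' ->] := qpi_surj x; have [y' ->] := qpi_surj y; have [z' ->] := qpi_surj z.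
by rewrite -linearD !res_mulE -linearD mulrDl.
Qed.
Fact res_one_neq0 : res_one != 0.
Proof.
apply/eqP => /(qpi0P maxid (1 : R^o)) /=; exact: unit_max (unitr1 R).
Qed.
HB.instance Definition _ := GRing.Zmodule_isComNzRing.Build resf
  res_mulA res_mulC res_mul1 res_mulDl res_one_neq0.
Fact res_mulVf (x : resf) : x != 0 -> res_inv x * x = 1.
Proof.
move=> x0; rewrite /res_inv (negPf x0) -{2}(qreprK x); apply: etrans (res_mulE _ _) _.
rewrite mulVr //; apply: contraT => h; case/negP: x0; apply/eqP.
by rewrite -(qreprK x); apply/qpi0P.
Qed.
Fact res_inv0 : res_inv 0 = 0.
Proof. by rewrite /res_inv eqxx; apply/qpi0P; exact: maxI0. Qed.
HB.instance Definition _ := GRing.ComNzRing_isField.Build resf res_mulVf res_inv0.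

Definition res_pi_fun (x : R) : resf := qpi maxid (x : R^o).
Fact res_pi_add : zmod_morphism res_pi_fun.
Proof. by move=> x y; rewrite /res_pi_fun linearB. Qed.
Fact res_pi_mul : monoid_morphism res_pi_fun.
Proof. by split=> // x y; rewrite /res_pi_fun -res_mulE. Qed.
HB.instance Definition _ := GRing.isZmodMorphism.Build R resf res_pi_fun res_pi_add.
HB.instance Definition _ := GRing.isMonoidMorphism.Build R resf res_pi_fun res_pi_mul.
Definition res_pi : {rmorphism R -> resf} := res_pi_fun.
Lemma res_piP : residue_field res_pi.
Proof.
by split=> [y|x]; [have [x ->] := qpi_surj y; exists x|exact: (qpi0P maxid (x : R^o))].
Qed.
End ResidueField.

Lemma fte_injective s (A : comUnitRingType) (P : fx s A) (Y : cplx A) n :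
  (forall j, injective_module (Y j)) -> injective_module ((P ⊙ Y) n).
Proof.
move=> iY M M' f g fi.
pose ga a j p (m : M) : Y j := (g m : ften P Y n) a j p.
have lga a j p : linear (@ga a j p) by move=> c x y; rewrite /ga linearP (ftenDE (c *: g x)) ftenZE.
pose gL a j p : {linear M -> Y j} := HB.pack (@ga a j p) (GRing.isLinear.Build A _ _ _ (@ga a j p) (lga a j p)).
have hex a j p : exists h : {linear M' -> Y j}, forall x, h (f x) = gL a j p x by exact: iY.
pose h a j p := projT1 (cid (hex a j p)); have hE a j p : forall x, h a j p (f x) = gL a j p x := projT2 (cid (hex a j p)).
pose H (m : M') : tfam P Y := fun a j p => if dgn s a + j == n then h a j p m else 0.
have Hs m (a j : int) p : dgn s a + j <> n -> H m a j p = 0 by rewrite /H => /eqP/negPf ->.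
pose HF m : (P ⊙ Y) n := Ften (Hs m).
have lH : linear HF.
  move=> c x y; apply: ften_eq => a j p; rewrite ftenDE ftenZE /= /H.
  by case: eqP => _; rewrite ?linearP ?scaler0 ?addr0.
pose HL : {linear M' -> (P ⊙ Y) n} := HB.pack HF (GRing.isLinear.Build A _ _ _ HF lH).
exists HL => x; apply: ften_eq => a j p /=.
by rewrite /H; case: eqP => e; [rewrite hE|rewrite ffP].
Qed.

Section CoextMaps.
Variables (A B : comUnitRingType) (psi : {rmorphism A -> B}).
Fact coext_cmap_ax (X Y : cplx A) (f : chain_map X Y) (i j : int) (x : coext_cplx psi X i) :
  coext_map (f j) (diff (coext_cplx psi X) i j x) = diff (coext_cplx psi Y) i j (coext_map (f i) x).
Proof. by apply: coext_eq => b /=; rewrite chain_funP. Qed.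
Definition coext_cmap (X Y : cplx A) (f : chain_map X Y) : chain_map (coext_cplx psi X) (coext_cplx psi Y) :=
  @ChainMap B (coext_cplx psi X) (coext_cplx psi Y) (fun i => coext_map (f i)) (coext_cmap_ax f).
Lemma coext_homotopic (X Y : cplx A) (f g : chain_map X Y) :
  homotopic f g -> homotopic (coext_cmap f) (coext_cmap g).
Proof.
move=> [h hh]; exists (fun i j => coext_map (h i j)) => i i1 i0 x e1 e2.
by apply: coext_eq => b /=; exact: hh.
Qed.

(* A quasi-isomorphism of K-injective complexes is a homotopy equivalence. *)
Lemma coext_qi (X Y : cplx A) (f : chain_map X Y) : K_injective X -> K_injective Y ->
  quasi_iso f -> quasi_iso (coext_cmap f).
Proof.
move=> kX kY qf.
have [g hg] := Kinj_chain kX (chain_id X) qf.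
have qg : quasi_iso g by exact: qi_cancel_right (homotopic_hom_eq hg) qf (qi_id X).
have [h hh] := Kinj_chain kY (chain_id Y) qg.
have e1 := homotopic_hom_eq (coext_homotopic hg).
have e2 := homotopic_hom_eq (coext_homotopic hh).
have one Z n (x : coext_cplx psi Z n) : coext_map (chain_id Z n) x = x by exact: coext_eq.
have {}e1 n (x : coext_cplx psi X n) : is_cycle x -> is_boundary (x - coext_cmap g n (coext_cmap f n x)).
  move=> cx; have := e1 n x cx; rewrite /= one; congr (is_boundary (_ - _)); exact: coext_eq.
have {}e2 n (x : coext_cplx psi Y n) : is_cycle x -> is_boundary (x - coext_cmap h n (coext_cmap g n x)).
  move=> cx; have := e2 n x cx; rewrite /= one; congr (is_boundary (_ - _)); exact: coext_eq.
move=> n; split=> [x cx bx|y cy].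
  by apply: bnd_sub (e1 n x cx) _; apply: chain_bnd.
exists (coext_cmap g n y); first exact: chain_cyc.
have cd : is_cycle (y - coext_cmap f n (coext_cmap g n y)).
  by apply: cycB => //; do 2 apply: chain_cyc.
apply: bnd_sub (e2 _ _ cd) _; apply: chain_bnd; rewrite linearB.
exact: e1 (chain_cyc _ cy).
Qed.

Section Tensor.
Variables (s : bool) (P : fx s A) (I : cplx A).
Fact cfte_D n (f : coext_cplx psi (P ⊙ I) n) a j p :
  {morph (fun b => (coext_fun f b : ften P I n) a j p) : x y / x + y}.
Proof. by move=> x y; rewrite coextD ftenDE. Qed.
Fact cfte_Z n (f : coext_cplx psi (P ⊙ I) n) a j p c x :
  (coext_fun f (psi c * x) : ften P I n) a j p = c *: (coext_fun f x : ften P I n) a j p.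
Proof. by rewrite coextZ ftenZE. Qed.
Definition cfte_fam n (f : coext_cplx psi (P ⊙ I) n) : tfam (bc psi P) (coext_cplx psi I) :=
  fun a j p => Coext (@cfte_D n f a j p) (@cfte_Z n f a j p).
Arguments cfte_fam : clear implicits.
Fact cfte_supp n f (a j : int) p : dgn s a + j <> n -> cfte_fam n f a j p = 0.
Proof. by move=> h; apply: coext_eq => b /=; rewrite ffP. Qed.
Definition cfte_fun n (f : coext_cplx psi (P ⊙ I) n) : (bc psi P ⊙ coext_cplx psi I) n :=
  @Ften _ _ (bc psi P) (coext_cplx psi I) n (cfte_fam n f) (@cfte_supp n f).
Fact cfte_linear n : linear (@cfte_fun n).
Proof.
move=> c f g; apply: ften_eq => a j p; rewrite (ftenDE (c *: cfte_fun f)) ftenZE.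
by apply: coext_eq => b /=.
Qed.
HB.instance Definition _ n := GRing.isLinear.Build B _ _ _ (@cfte_fun n) (@cfte_linear n).
Lemma coext_sumE (M : lmodType A) (J : finType) (F : J -> coext psi M) b : (\sum_i F i) b = \sum_i F i b.
Proof.
have : forall r : seq J, (\sum_(i <- r) F i) b = \sum_(i <- r) F i b.
  by elim=> [|i r IH]; rewrite ?big_nil ?big_cons //= IH.
exact.
Qed.
Fact cfte_ax (n m : int) (f : coext_cplx psi (P ⊙ I) n) :
  cfte_fun (diff _ n m f) = diff (bc psi P ⊙ coext_cplx psi I) n m (cfte_fun f).
Proof.
apply: ften_eq => a j p; apply: coext_eq => b; rewrite (ften_diffE m (cfte_fun f)) /=.
case: eqP => // e; rewrite /tdiff /=; congr (_ + _).
transitivity (sg j (mact (map_mx psi (mx P (nx s a) a)) (cfte_fam n f (nx s a) j) p b)); last first.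
  by rewrite /sg; case: odd.
congr (sg j _); rewrite /mact coext_sumE; apply: eq_bigr => q _ /=.
by rewrite mxE mulrC coextZ ftenZE.
Qed.
(** An isomorphism from Hom_A(B, P (x) I) to (P (x)_A B) (x)_B Hom_A(B, I): the terms of [P] are
    finite free, and Hom commutes with the product that forms the total complex. *)
Definition cfte : chain_map (coext_cplx psi (P ⊙ I)) (bc psi P ⊙ coext_cplx psi I) :=
  @ChainMap B (coext_cplx psi (P ⊙ I)) (bc psi P ⊙ coext_cplx psi I) (fun n => @cfte_fun n) cfte_ax.
Lemma cfte_qi : quasi_iso cfte.
Proof.
apply: qi_inj_surj => [n f g h|n u].
  apply: coext_eq => b; apply: ften_eq => a j p.
  by have := congr1 (fun v : ften (bc psi P) (coext_cplx psi I) n => (v a j p : coext psi (I j)) b) h.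
pose U b : tfam P I := fun a j p => (u a j p : coext psi (I j)) b.
have Us b (a j : int) p : dgn s a + j <> n -> U b a j p = 0 by move=> h; rewrite /U ffP.
have UD : {morph (fun b => Ften (Us b) : (P ⊙ I) n) : x y / x + y}.
  by move=> x y; apply: ften_eq => a j p; rewrite ftenDE /= /U coextD.
have UZ c x : (Ften (Us (psi c * x)) : (P ⊙ I) n) = c *: (Ften (Us x) : (P ⊙ I) n).
  by apply: ften_eq => a j p; rewrite ftenZE /= /U coextZ.
by exists (Coext UD UZ); apply: ften_eq => a j p; apply: coext_eq.
Qed.
End Tensor.
End CoextMaps.

Section CoextComp.
Variables (A B C : comUnitRingType) (psi : {rmorphism A -> B}) (sigma : {rmorphism B -> C}).
Variables (tau : {rmorphism A -> C}) (e : forall x, tau x = sigma (psi x)).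
Variable I : cplx A.
(* Hom_B(C, Hom_A(B, I)) -> Hom_A(C, I) is evaluation at 1. *)
Fact ccomp_D n (f : coext_cplx sigma (coext_cplx psi I) n) :
  {morph (fun c => (coext_fun f c : coext psi (I n)) 1) : x y / x + y}.
Proof. by move=> x y; rewrite coextD. Qed.
Fact ccomp_Z n (f : coext_cplx sigma (coext_cplx psi I) n) a x :
  (coext_fun f (tau a * x) : coext psi (I n)) 1 = a *: (coext_fun f x : coext psi (I n)) 1.
Proof. by rewrite e coextZ /= mul1r -[psi a]mulr1 coextZ. Qed.
Definition ccomp_fun n (f : coext_cplx sigma (coext_cplx psi I) n) : coext_cplx tau I n :=
  Coext (ccomp_D f) (ccomp_Z f).
Fact ccomp_linear n : linear (@ccomp_fun n).
Proof. by move=> c f g; apply: coext_eq. Qed.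
HB.instance Definition _ n := GRing.isLinear.Build C _ _ _ (@ccomp_fun n) (@ccomp_linear n).
Fact ccomp_ax (n m : int) (f : coext_cplx sigma (coext_cplx psi I) n) :
  ccomp_fun (diff _ n m f) = diff (coext_cplx tau I) n m (ccomp_fun f).
Proof. exact: coext_eq. Qed.
Definition ccomp : chain_map (coext_cplx sigma (coext_cplx psi I)) (coext_cplx tau I) :=
  @ChainMap C (coext_cplx sigma (coext_cplx psi I)) (coext_cplx tau I) (fun n => @ccomp_fun n) ccomp_ax.
Lemma ccomp_qi : quasi_iso ccomp.
Proof.
apply: qi_inj_surj => [n f g h|n u].
  apply: coext_eq => c; apply: coext_eq => b.
  have key (k : coext sigma (coext psi (I n))) : (k c : coext psi (I n)) b = (k (sigma b * c) : coext psi (I n)) 1.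
    by rewrite coextZ /= mul1r.
  rewrite (key f) (key g).
  by have := congr1 (fun v : coext tau (I n) => v (sigma b * c)) h.
have D1 c : {morph (fun b => u (sigma b * c)) : x y / x + y}.
  by move=> x y; rewrite rmorphD mulrDl coextD.
have Z1 c a x : u (sigma (psi a * x) * c) = a *: u (sigma x * c).
  by rewrite rmorphM -mulrA -e coextZ.
pose F c : coext psi (I n) := Coext (D1 c) (Z1 c).
have FD : {morph F : x y / x + y}.
  by move=> x y; apply: coext_eq => b /=; rewrite mulrDr coextD.
have FZ b x : F (sigma b * x) = b *: F x.
  by apply: coext_eq => b' /=; rewrite rmorphM mulrA.
exists (Coext FD FZ); apply: coext_eq => c /=.
by rewrite rmorph1 mul1r.
Qed.
End CoextComp.

(** * Bass numbers *)

Section HomologyRank.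
Variable A : comUnitRingType.
(* H_t(Z) is free of rank r over A / J. *)
Definition grank (J : A -> Prop) (Z : cplx A) (t : int) (r : nat) := exists z : 'I_r -> Z t,
  [/\ forall l, is_cycle (z l),
      forall x, is_cycle x -> exists c : 'I_r -> A, is_boundary (x - \sum_l c l *: z l) &
      forall c : 'I_r -> A, is_boundary (\sum_l c l *: z l) <-> forall l, J (c l)].
Definition hrank := grank (@max_ideal A).

Lemma grank_qi (J : A -> Prop) (X Y : cplx A) (f : chain_map X Y) t r :
  quasi_iso f -> grank J X t r <-> grank J Y t r.
Proof.
move=> qf; split=> [[z [cz gz rz]]|[z [cz gz rz]]].
  have sE c : f t (\sum_l c l *: z l) = \sum_l c l *: f t (z l).
    by rewrite linear_sum; apply: eq_bigr => l _; rewrite linearZ.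
  exists (fun l => f t (z l)); split=> [l|y cy|c]; first exact: chain_cyc.
    have [x cx bx] := (qf t).2 y cy; have [c bc] := gz x cx; exists c; rewrite -sE.
    by apply: bnd_trans bx _; rewrite -linearB; exact: chain_bnd.
  rewrite -sE -rz; split; last exact: chain_bnd.
  by apply: (qf t).1; apply: cyc_sum => l _; apply: cycZ.
have wex l : exists w, is_cycle w /\ is_boundary (z l - f t w).
  by have [x] := (qf t).2 _ (cz l); exists x.
have [w wP] := choice wex.
have cs c : is_cycle (\sum_l c l *: w l) by apply: cyc_sum => l _; apply: cycZ; exact: (wP l).1.
have sE c : is_boundary (\sum_l c l *: z l - f t (\sum_l c l *: w l)).
  rewrite linear_sum -sumrB; apply: bnd_sum => l _; rewrite linearZ -scalerBr.
  by apply: bndZ; exact: (wP l).2.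
exists w; split=> [l|x cx|c]; first exact: (wP l).1.
  have [c bc] := gz _ (chain_cyc f cx); exists c.
  apply: (qf t).1; first by apply: cycB.
  by rewrite linearB; apply: bnd_trans bc (sE c).
rewrite -rz; split=> h; first by apply: bnd_sub (sE c) _; exact: chain_bnd.
apply: (qf t).1 => //; apply: bnd_sub (bndBC (sE c)) h.
Qed.

Hypothesis lA : local_ring A.
(** Expressing the classes [w] in the generators [z] gives a matrix over the residue field;
    independence of the [w] modulo the maximal ideal says that its rows are independent, so there
    are at most [r] of them. *)
Lemma hrank_le (Z : cplx A) t r m (w : 'I_m -> Z t) : hrank Z t r -> (forall l, is_cycle (w l)) ->
  (forall c : 'I_m -> A, is_boundary (\sum_l c l *: w l) -> forall l, max_ideal (c l)) -> (m <= r)%N.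
Proof.
move=> [z [cz gz rz]] cw iw; have [d dP] := choice (fun l => gz _ (cw l)).
pose p := res_pi lA; have [pS pK] := res_piP lA.
pose D : 'M[resf lA]_(m, r) := \matrix_(i, j) p (d i j).
suff : row_free D by rewrite /row_free => /eqP <-; exact: rank_leq_col.
apply: inj_row_free => v vD; have [c cP] := choice (fun i => pS (v 0 i)).
have cm l : max_ideal (c l).
  apply: iw; apply: (bnd_sub (y := \sum_j (\sum_i c i * d i j) *: z j)); last first.
    apply/rz => j; apply/pK; rewrite rmorph_sum.
    have /rowP/(_ j) := vD; rewrite !mxE => e; rewrite -[RHS]e; apply: eq_bigr => i _.
    by rewrite rmorphM -/p cP mxE.
  under [X in _ - X]eq_bigr => j _ do rewrite scaler_suml.
  rewrite exchange_big -sumrB; apply: bnd_sum => i _.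
  under [X in _ - X]eq_bigr => j _ do rewrite -scalerA.
  by rewrite -scaler_sumr -scalerBr; apply: bndZ.
by apply/rowP => i; rewrite mxE -cP; apply/pK.
Qed.

Lemma hrank_uniq (Z : cplx A) t r r' : hrank Z t r -> hrank Z t r' -> r = r'.
Proof.
move=> h h'; apply/eqP; rewrite eqn_leq; apply/andP; split.
  by have [z [cz _ rz]] := h; apply: (hrank_le h' cz) => c /rz.
by have [z [cz _ rz]] := h'; apply: (hrank_le h cz) => c /rz.
Qed.

Lemma hrank0 (Z : cplx A) t : hrank Z t 0 <-> acyc Z t.
Proof.
split=> [[z [cz gz _]] x cx|h]; first by have [c] := gz x cx; rewrite big_ord0 subr0.
exists (fun i => 0); split=> [[]//|x cx|c]; first by exists (fun=> 0); rewrite big_ord0 subr0; exact: h.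
by split=> [_ []//|_]; rewrite big_ord0; exact: bnd0.
Qed.

Section ZeroMatrices.
Variables (s : bool) (D : fx s A) (V : cplx A).
Hypothesis D0 : forall i j, mx D i j = 0.
Lemma zmx_tdiff (u : tfam D V) a j p : tdiff u a j p = diff V (j + 1) j (u a (j + 1) p).
Proof. by rewrite /tdiff D0 mact0 sg_zero add0r. Qed.
Section Point.
Variables (t a j : int) (e : dgn s a + j = t) (p0 : 'I_(rk D a)).
Definition fpt (v : V j) : (D ⊙ V) t := fsingle (fun p => if p == p0 then v else 0) e.
Lemma fptE v : fpt v a j p0 = v.
Proof. by rewrite /= fsingleE eqxx. Qed.
Lemma fpt_off v a' j' (p : 'I_(rk D a')) : ~ (a = a' /\ p0 = p :> nat) -> fpt v a' j' p = 0.
Proof.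
move=> h; have [ea|ne] := pselect (a = a'); last by apply: fsingle0; left.
subst a'; have [ej|ne] := pselect (j = j'); last by apply: fsingle0; right.
subst j'; rewrite /= fsingleE; case: eqP => // ep; by case: h; rewrite ep.
Qed.
Lemma fpt_cyc v : is_cycle v -> is_cycle (fpt v).
Proof.
move=> cv; apply/fte_cycP => a' j' p; rewrite zmx_tdiff.
have [[ea ep]|ne] := pselect (a = a' /\ p0 = p :> nat); last by rewrite fpt_off ?linear0.
subst a'; have -> : p = p0 by exact: ord_inj.
have [ej|ne] := pselect (j = j' + 1); last by rewrite [fpt v _ _ _]fsingle0 ?linear0 //; right.
suff h j2 : j = j2 -> diff V j2 j' (fpt v a j2 p0) = 0 by exact: h.
by move=> <-; rewrite fptE; exact: (is_cycleP v).1.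
Qed.
End Point.

Lemma zmx_acyc t : (forall a (p : 'I_(rk D a)), acyc V (t - dgn s a)) -> acyc (D ⊙ V) t.
Proof.
move=> ac u cu.
have H a j (p : 'I_(rk D a)) : exists y : V j, (dgn s a + j <> t + 1 -> y = 0) /\
    forall j0, j = j0 + 1 -> diff V j j0 y = u a j0 p.
  have [e|ne] := pselect (dgn s a + j = t + 1); last first.
    exists 0; split=> // j0 ej; rewrite linear0 ffP //; lia.
  have ej : j - 1 = t - dgn s a by lia.
  have [|y hy] := ac a p (eq_rect (j - 1) (fun j => V j : Type) (u a (j - 1) p) _ ej).
    apply/is_cycleP => k; move: (ej); rewrite -ej => e'; rewrite (eq_irrelevance e' erefl) /=.
    have [ek|nk] := pselect (j - 1 = k + 1); last by rewrite diff_shape //; apply/eqP.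
    by have := (fte_cycP u).1 cu a k p; rewrite zmx_tdiff -ek.
  move: (ej) y hy; rewrite -ej => e' y; rewrite (eq_irrelevance e' erefl) /= => hy.
  have [y' hy'] : exists y' : V j, diff V j (j - 1) y' = u a (j - 1) p.
    suff h k : k = j - 1 + 1 -> exists y' : V k, diff V k (j - 1) y' = u a (j - 1) p by apply: h; lia.
    by move=> ->; exists y.
  exists y'; split=> // j0 ej0; have -> : j0 = j - 1 by lia.
  exact: hy'.
pose w a j p := projT1 (cid (H a j p)); have wP a j p := projT2 (cid (H a j p)).
have ws (a j : int) p : dgn s a + j <> t + 1 -> w a j p = 0 by exact: (wP a j p).1.
apply/fte_bndP; exists (Ften ws) => a j p; rewrite zmx_tdiff /=.
by rewrite ((wP a (j + 1) p).2 j).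
Qed.

Lemma zmx_rank2 t r a0 j0 r0 a1 j1 r1 (p0 : 'I_(rk D a0)) (p1 : 'I_(rk D a1)) :
  dgn s a0 + j0 = t -> dgn s a1 + j1 = t -> ~ (a0 = a1 /\ p0 = p1 :> nat) ->
  hrank V j0 r0 -> hrank V j1 r1 -> hrank (D ⊙ V) t r -> (r0 + r1 <= r)%N.
Proof.
move=> e0 e1 ne [z0 [c0 _ i0]] [z1 [c1 _ i1]] hr.
pose w (i : 'I_(r0 + r1)) : (D ⊙ V) t := match fintype.split i with
  inl i => fpt e0 p0 (z0 i) | inr i => fpt e1 p1 (z1 i) end.
apply: (hrank_le hr (w := w)) => [l|c].
  by rewrite /w; case: fintype.split => i; apply: fpt_cyc.
have sE a j p : (\sum_l c l *: w l : ften _ _ _) a j p =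
    \sum_i c (lshift r1 i) *: fpt e0 p0 (z0 i) a j p + \sum_i c (rshift r0 i) *: fpt e1 p1 (z1 i) a j p.
  rewrite ften_sumE big_split_ord; congr (_ + _); apply: eq_bigr => i _.
    by rewrite /w split_lshift.
  by rewrite /w split_rshift.
move=> /fte_bndP [v hv].
have b0 : is_boundary (\sum_i c (lshift r1 i) *: z0 i).
  have := hv a0 j0 p0; rewrite sE zmx_tdiff [X in _ + X]big1 ?addr0 => [e|i _]; last first.
    by rewrite fpt_off ?scaler0 // => -[ea ep]; apply: ne.
  under eq_bigr => i _ do rewrite -(fptE e0 p0 (z0 i)).
  by rewrite e; exact: bnd_diff.
have b1 : is_boundary (\sum_i c (rshift r0 i) *: z1 i).
  have := hv a1 j1 p1; rewrite sE zmx_tdiff [X in X + _]big1 ?add0r => [e|i _]; last first.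
    by rewrite fpt_off ?scaler0.
  under eq_bigr => i _ do rewrite -(fptE e1 p1 (z1 i)).
  by rewrite e; exact: bnd_diff.
move=> l; case: (split_ordP l) => i ->.
  exact: (i0 (fun i => c (lshift r1 i))).1 b0 i.
exact: (i1 (fun i => c (rshift r0 i))).1 b1 i.
Qed.

Lemma zmx_rank1 t r a0 j0 r0 (p0 : 'I_(rk D a0)) :
  dgn s a0 + j0 = t -> hrank V j0 r0 -> hrank (D ⊙ V) t r -> (r0 <= r)%N.
Proof.
move=> e0 [z0 [c0 _ i0]] hr.
apply: (hrank_le hr (w := fun i => fpt e0 p0 (z0 i))) => [l|c /fte_bndP [v hv]]; first exact: fpt_cyc.
apply/i0; have := hv a0 j0 p0; rewrite ften_sumE zmx_tdiff => e.
under eq_bigr => i _ do rewrite -(fptE e0 p0 (z0 i)).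
by rewrite e; exact: bnd_diff.
Qed.
End ZeroMatrices.

Lemma int_max (Q : int -> Prop) (t0 c : int) : Q t0 -> (forall t : int, c < t -> ~ Q t) ->
  exists t1, Q t1 /\ forall t : int, t1 < t -> ~ Q t.
Proof.
move=> q0 qc; have : forall (n : nat) t, Q t -> c - t < n%:Z -> exists t1, Q t1 /\ forall t : int, t1 < t -> ~ Q t.
  elim=> [|n IH] t qt ct; first by case: (qc t) => //; lia.
  have [[t' [tt' qt']]|h] := pselect (exists t' : int, t < t' /\ Q t').
    by apply: (IH t' qt'); lia.
  by exists t; split=> // t' tt' qt'; apply: h; exists t'.
by move=> H; apply: (H (absz (c - t0)).+1 t0 q0); lia.
Qed.

(** An argument at extreme degrees. Let [t1] be the top of [mu] and [a0] the least index where [D]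
    is nonzero. The nonzero rank [mu t1] of the tensor product in degree [t1 + e] gives [a0 <= - e];
    the contribution of a basis vector at [a0] in degree [t1 - a0] gives [- e <= a0]. A second basis
    vector at [a'] would add [mu t1] to the rank [mu (t - e)] in degree [t = t1 - a'], which the
    first one already fills. *)
Lemma zmx_shift (D : fx true A) (V : cplx A) (mu : int -> nat) (b c e : int) :
  (forall i j, mx D i j = 0) -> (forall a : int, a < b -> rk D a = 0%N) ->
  (exists t, mu t <> 0%N) -> (forall t : int, c < t -> mu t = 0%N) ->
  (forall t, hrank V t (mu t)) -> (forall t, hrank (D ⊙ V) t (mu (t - e))) ->
  rk D (- e) = 1%N /\ forall a, a <> - e -> rk D a = 0%N.
Proof.
move=> D0 Db [t0 mt0] muc hV hD.
have [||t1 [m1 mx1]] := @int_max (fun t => mu t <> 0%N) t0 c; first exact: mt0.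
  by move=> t ct; rewrite muc.
have pairs t : mu (t - e) <> 0%N -> exists (a : int) (p : 'I_(rk D a)), mu (t + a) <> 0%N.
  move=> mt; apply: contrapT => h.
  have /hrank0 h0 : acyc (D ⊙ V) t.
    apply: (zmx_acyc D0) => a p; apply/hrank0; have := hV (t - dgn true a).
    have -> : t - dgn true a = t + a by rewrite /dgn opprK.
    suff -> : mu (t + a) = 0%N by [].
    by apply: contrapT => h'; apply: h; exists a, p.
  by apply: mt; apply: (hrank_uniq (hD t) h0).
have [a [p hp]] : exists (a : int) (p : 'I_(rk D a)), mu (t1 + e + a) <> 0%N.
  by apply: pairs; rewrite addrK.
(* [int_max] finds greatest elements, so the least index of [D] is sought through its negative. *)
have [||a0' [q0 mn0]] := @int_max (fun a => rk D (- a) <> 0%N) (- a) (- b).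
- by rewrite opprK => h; exact: no_ord h p.
- by move=> t bt; rewrite Db //; lia.
pose a0 := - a0'; have {}q0 : rk D a0 <> 0%N by [].
have mn (a' : int) : a' < a0 -> rk D a' = 0%N.
  by move=> ha; apply: contrapT => h; apply: (mn0 (- a')); [rewrite /a0 in ha; lia|rewrite opprK].
have [p0] : exists p0 : 'I_(rk D a0), True.
  by case: (rk D a0) q0 => // n _; exists ord0.
move=> _; have ha0 : a0 <= a.
  by rewrite leNgt; apply/negP => /mn h; exact: no_ord h p.
have ha : a <= - e.
  by rewrite leNgt; apply/negP => h; apply: (mx1 (t1 + e + a)) => //; lia.
have de (x y : int) : dgn true x + (y + x) = y by rewrite /dgn; lia.
have k1 := zmx_rank1 D0 p0 (de a0 (t1 - a0)) (hV _) (hD (t1 - a0)).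
have ea0 : a0 = - e.
  apply/eqP; rewrite eq_le; apply/andP; split; first exact: le_trans ha0 ha.
  rewrite leNgt; apply/negP => h; apply: (mx1 (t1 - a0 - e)); first by lia.
  move=> m0; move: k1; rewrite m0 leqn0 subrK => /eqP; exact: m1.
have two (a' : int) (p' : 'I_(rk D a')) : a0 = a' /\ p0 = p' :> nat.
  apply: contrapT => ne; pose t := t1 - a'.
  have := zmx_rank2 D0 (de a0 t) (de a' t) ne (hV _) (hV _) (hD t).
  have -> : t + a0 = t - e by rewrite ea0.
  by rewrite {2}/t subrK -{2}[mu (t - e)]addn0 leq_add2l leqn0 => /eqP; exact: m1.
rewrite -ea0; split=> [|a' ne].
  case er : (rk D a0) => [|[|n]] //.
  have h0 : (0 < rk D a0)%N by rewrite er.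
  have h1 : (1 < rk D a0)%N by rewrite er.
  have [_ /= e0] := two a0 (Ordinal h0); have [_ /= e1] := two a0 (Ordinal h1).
  by rewrite e0 in e1.
case er : (rk D a') => [//|n]; have h0 : (0 < rk D a')%N by rewrite er.
by have [h _] := two a' (Ordinal h0); case: ne.
Qed.

(** A basis vector of [D] at [a] is paired with the homology of [V] in degree [a], nonzero since its
    rank is that of [D] at [a]. Every basis vector thus contributes to degree 0, where there is room
    for one only. *)
Lemma zmx_self (D : fx true A) (V : cplx A) :
  (forall i j, mx D i j = 0) -> (forall t, hrank V t (rk D t)) ->
  (forall t, hrank (D ⊙ V) t (t == 0)) ->
  exists a0, rk D a0 = 1%N /\ forall a, a <> a0 -> rk D a = 0%N.
Proof.
move=> D0 hV hD.
have [a0 [p0 _]] : exists (a : int) (p : 'I_(rk D a)), True.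
  apply: contrapT => h; have /hrank0 h0 : acyc (D ⊙ V) 0.
    by apply: (zmx_acyc D0) => a p; case: h; exists a, p.
  by have := hrank_uniq (hD 0) h0.
have two (a' : int) (p' : 'I_(rk D a')) : a0 = a' /\ p0 = p' :> nat.
  apply: contrapT => ne; have de (x : int) : dgn true x + x = 0 by rewrite /dgn addNr.
  have := zmx_rank2 D0 (de a0) (de a') ne (hV _) (hV _) (hD 0).
  by have := ltn_ord p0; have := ltn_ord p'; rewrite eqxx; lia.
exists a0; split=> [|a' ne].
  have h0 := leq_ltn_trans (leq0n p0) (ltn_ord p0).
  case er : (rk D a0) => [|[|n]] //; first by rewrite er in h0.
  have h1 : (1 < rk D a0)%N by rewrite er.
  have [_ /= e0] := two a0 (Ordinal h0); have [_ /= e1] := two a0 (Ordinal h1).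
  by rewrite e0 in e1.
case er : (rk D a') => [//|n]; have h0 : (0 < rk D a')%N by rewrite er.
by have [h _] := two a' (Ordinal h0); case: ne.
Qed.
End HomologyRank.

Section Shift.
Variables (A : comUnitRingType) (d : int) (Z : cplx A) (t : int) (x : shift d Z t).
Lemma shift_cyc : is_cycle x <-> is_cycle (x : Z (t - d)).
Proof.
split=> [/is_cycleP h|h]; apply/is_cycleP => j.
  have hk : diff Z (t - d) (j + d - d) x = 0.
    by have := h (j + d); rewrite sg_shift => /sg_eq0.
  by move: hk; have -> : j + d - d = j by lia.
rewrite sg_shift; have [e|ne] := pselect (t - d = j - d + 1); last first.
  by rewrite diff_shape ?sg_zero //; apply/eqP.
by rewrite ((is_cycleP (x : Z (t - d))).1 h) sg_zero.
Qed.
Lemma shift_bnd : is_boundary x <-> is_boundary (x : Z (t - d)).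
Proof.
split=> [[y hy]|[y hy]].
  apply/is_boundaryP; exists (t + 1 - d), (sg d y).
  by rewrite -hy sg_shift (raddf_sg (diff Z _ _)).
apply/is_boundaryP; exists (t + 1).
suff h k : k = t - d + 1 -> exists y : Z k, sg d (diff Z k (t - d) y) = x.
  by have [|y' hy'] := h (t + 1 - d); [lia|exists y'; rewrite sg_shift].
by move=> ->; exists (sg d y); rewrite (raddf_sg (diff Z _ _)) /= sg_inv.
Qed.
End Shift.

Lemma grank_shift (A : comUnitRingType) (J : A -> Prop) d (Z : cplx A) t r :
  grank J (shift d Z) t r <-> grank J Z (t - d) r.
Proof.
split=> -[z [cz gz rz]]; exists z; split.
- by move=> l; apply/shift_cyc; exact: cz.
- by move=> x /shift_cyc /gz [c /shift_bnd bc]; exists c.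
- by move=> c; rewrite -rz; split=> /shift_bnd.
- by move=> l; apply/shift_cyc; exact: cz.
- by move=> x /shift_cyc /gz [c bc]; exists c; apply/shift_bnd.
- by move=> c; rewrite -rz; split=> /shift_bnd.
Qed.

Lemma fx_same s (A : comUnitRingType) (P : fx s A) (Y : cplx A) (m : forall i j, 'M[A]_(rk P i, rk P j)) h1 h2 :
  (forall i j, m i j = mx P i j) -> exists f : chain_map (@Fx s A (rk P) m h1 h2 ⊙ Y) (P ⊙ Y), quasi_iso f.
Proof.
move=> em; set P' := Fx h1 h2.
pose f n (u : (P' ⊙ Y) n) : (P ⊙ Y) n := @Ften s A P Y n (ff (u : ften _ _ _)) (ffP (u : ften _ _ _)).
have lf n : linear (@f n) by move=> a u v; apply: ften_eq.
pose fL n : {linear (P' ⊙ Y) n -> (P ⊙ Y) n} := HB.pack (@f n) (GRing.isLinear.Build A _ _ _ (@f n) (lf n)).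
have cf (i j : int) (u : (P' ⊙ Y) i) : fL j (diff _ i j u) = diff (P ⊙ Y) i j (fL i u).
  apply: ften_eq => a k p; rewrite (ften_diffE j (f i u)) /=.
  by case: eqP => // _; rewrite /tdiff /= em.
exists (@ChainMap A (P' ⊙ Y) (P ⊙ Y) fL cf); apply: qi_inj_surj => [n u v h|n u].
  by apply: ften_eq => a j p; have := congr1 (fun w : ften P Y n => w a j p) h.
exists (@Ften s A P' Y n (ff (u : ften _ _ _)) (ffP (u : ften _ _ _))).
exact: ften_eq.
Qed.

Lemma bc_id_qi s (A : comUnitRingType) (P : fx s A) (Y : cplx A) :
  exists f : chain_map (bc idfun P ⊙ Y) (P ⊙ Y), quasi_iso f.
Proof. by apply: fx_same => i j; apply/matrixP => p q; rewrite mxE. Qed.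

Lemma bc_id_dual_qi s (A : comUnitRingType) (P : fx s A) (Y : cplx A) :
  exists f : chain_map (bc idfun P ⋔ Y) (P ⋔ Y), quasi_iso f.
Proof. by apply: (@fx_same _ _ (dual P)) => i j; apply/matrixP => p q; rewrite !mxE. Qed.

Lemma stalk_fone (A B : comUnitRingType) (psi : {rmorphism A -> B}) :
  exists f : chain_map (stalk (restr psi B^o)) (restr_cplx psi (toc (fone B 0))), quasi_iso f.
Proof.
pose f (x : restr psi B^o) : restr_cplx psi (toc (fone B 0)) 0 := (\row_(_ < 1) (x : B)) : 'rV[B]_1.
have lf : linear f by move=> a x y; apply/rowP => p; rewrite !mxE.
pose fL : {linear restr psi B^o -> restr_cplx psi (toc (fone B 0)) 0} :=
  HB.pack f (GRing.isLinear.Build A _ _ _ f lf).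
have df (j : int) x : diff (restr_cplx psi (toc (fone B 0))) 0 j (fL x) = 0 by exact: mulmx0.
exists (from_stalk df); apply: qi_inj_surj => [n|n y].
  case: n => [[|n]|n] x y h; try by apply: etrans (stalk_triv _ _) (esym (stalk_triv _ _)).
  by have /rowP/(_ 0) := h; rewrite !mxE.
case: n y => [[|n]|n] y.
- by exists ((y : 'rV[B]_1) 0 0); apply/rowP => p; rewrite mxE ord1.
- by exists 0; rewrite linear0; apply/rowP => -[].
- by exists 0; rewrite linear0; apply/rowP => -[].
Qed.

Lemma fone_triv (B : comUnitRingType) n (ne : n <> 0) (x : toc (fone B 0) n) : x = 0.
Proof. by apply: mx_no_col; rewrite /=; case: eqP. Qed.

(** * Fields, and the identity map as a factorization *)

Section Fields.
Variable k : fieldType.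
Lemma field_max (x : k) : max_ideal x <-> x = 0.
Proof. by split=> [/negP|->]; [rewrite unitfE => /negP; rewrite negbK => /eqP|apply/negP; rewrite unitr0]. Qed.
Lemma field_injective (E : lmodType k) : injective_module E.
Proof.
apply: baer_injective => J J0 JD Jf.
have [[a [y [a0 Ja]]]|h] := pselect (exists a y, a <> 0 /\ J a y).
  exists (a^-1 *: y) => b z Jb; have := JD (- (b / a)) a y b z Ja Jb.
  rewrite mulNr divfK ?addNr; last exact/eqP.
  by move=> /Jf /eqP; rewrite scaleNr addrC subr_eq0 scalerA => /eqP.
exists 0 => a y Ja; rewrite scaler0; have [a0|a0] := pselect (a = 0); first by subst a; exact: Jf.
by case: h; exists a, y.
Qed.
Lemma field_local : local_ring k.
Proof.
split=> [|x y /field_max -> /field_max ->|a x /field_max ->]; apply/field_max => //.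
  by rewrite addr0.
by rewrite mulr0.
Qed.
Lemma field_noetherian : noetherian k.
Proof.
move=> I [I0 ID IM]; have [[x Ix x0]|h] := pselect (exists2 x, I x & x <> 0).
  exists [:: 1]; apply/seteqP; split=> y /=; first by move=> _; exists (fun=> y); rewrite big_ord1 mulr1.
  by move=> _; have := IM (y / x) _ Ix; rewrite divfK //; exact/eqP.
exists [::]; apply/seteqP; split=> y /=.
  move=> Iy; exists (fun=> 0); rewrite big_ord0; apply: contrapT => y0; apply: h; by exists y.
by move=> [c ->]; rewrite big_ord0.
Qed.
Lemma field_gorenstein : gorenstein_local k.
Proof.
split; first by split; [exact: field_noetherian|exact: field_local].
exists 0%N, (stalk k^o), (chain_id _); split=> [i|i hi x|]; last exact: qi_id.
  exact: field_injective.
by apply: stalk_triv; lia.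
Qed.
End Fields.

Lemma flat_self (A : comUnitRingType) : flat_over (idfun : {rmorphism A -> A}) (A^o : lmodType A).
Proof.
pose val (M : lmodType A) (L : seq (M * A^o)) : M := \sum_(p <- L) (p.2 : A) *: p.1.
have vE (M : lmodType A) (L L' : seq (M * A^o)) : tens_eq idfun L L' -> val M L = val M L'.
  rewrite /val; elim=> {L L'} //.
  - by move=> L1 L2 L3 _ -> _ ->.
  - by move=> L1 L2 L3 L4 _ e1 _ e2; rewrite !big_cat /= e1 e2.
  - by move=> L1 L2; rewrite !big_cat /= addrC.
  - by move=> n; rewrite big_seq1 big_nil scaler0.
  - by move=> m m' n; rewrite big_seq1 big_cons big_seq1 scalerDr.
  - by move=> m n n'; rewrite big_seq1 big_cons big_seq1 scalerDl.
  - by move=> a m n; rewrite !big_seq1 /= scalerA mulrC.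
have one (M : lmodType A) (x : tens idfun M A^o) : exists m, x = tp idfun m (1 : A^o).
  have [s ->] := tens_span x; exists (\sum_(p <- s) (p.2 : A) *: p.1); rewrite tp_suml.
  by apply: eq_bigr => p _; rewrite tpZ /= -[_ *: _]/(_ * _) mulr1.
move=> M M' f fi x y; have [m ->] := one _ x; have [n ->] := one _ y.
rewrite !tens_map_tp => /tens_eqP /vE; rewrite /val !big_seq1 /= !scale1r => /fi -> //.
Qed.

(** The identity of [R], with its residue field as closed fibre, is a flat map with Gorenstein
    fibre; this lets a module-finite map be treated on the same footing as the surjection of a
    factorization. *)
Lemma gor_fibre_id (R : comUnitRingType) (k : fieldType) (pi : {rmorphism R -> k}) :
  noetherian_local R -> residue_field pi -> gor_fibre idfun pi.
Proof.
move=> [nR lR] [pS pK]; split=> //.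
- exact: flat_self.
- move=> y; rewrite pK; split=> [my|[s [hs ->]]].
    by exists [:: (1, y)]; split=> [p|]; [rewrite inE => /eqP ->|rewrite big_seq1 mul1r].
  by rewrite big_seq; apply: maxI_sum => // p ps; apply: maxIM => //; exact: hs.
- exact: field_gorenstein.
Qed.

Section FibreRes.
Variables (R A F : comUnitRingType) (rho : {rmorphism R -> A}) (pi : {rmorphism A -> F}).
Hypothesis gf : gor_fibre rho pi.
Variables (P : fx false R) (r : 'cV[R]_(rk P 0)).
Hypothesis Pr : res_field_res r.
Lemma fibre_resolution : exists g : chain_map (toc (bc rho P)) (restr_cplx pi (toc (fone F 0))), quasi_iso g.
Proof.
have [f qf] := stalk_fone pi; exists (chain_comp f (faug_map gf Pr)).
exact: qi_comp (faug_qi gf Pr) qf.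
Qed.
End FibreRes.

Lemma res_field_res_ex (R : comUnitRingType) : noetherian_local R ->
  exists (P : fx false R) (r : 'cV[R]_(rk P 0)), res_field_res r.
Proof.
move=> [nR lR]; pose p := res_pi lR; have [pS pK] := res_piP lR.
have fY : fgh (restr_cplx p (toc (fone (resf lR) 0))).
  move=> n; exists 1%N, (fun=> const_mx 1); split=> [l|x _]; first by apply/is_cycleP => j; exact: mulmx0.
  have [e|ne] := pselect (n = 0); last first.
    have z0 (y : restr_cplx p (toc (fone (resf lR) 0)) n) : y = 0 by exact: (@fone_triv (resf lR) n ne y).
    by exists (fun=> 0); rewrite (z0 (_ - _)); exact: bnd0.
  subst n; have [c hc] := pS ((x : 'rV_1) 0 0); exists (fun=> c); rewrite big_ord1.
  suff -> : x - c *: (const_mx 1 : restr_cplx p (toc (fone (resf lR) 0)) 0) = 0 by exact: bnd0.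
  apply/rowP => i; rewrite [LHS]mxE [X in _ + X]mxE -[X in _ - X]/((p c *: (const_mx 1 : 'rV__)) 0 i) !mxE.
  by rewrite mulr1 hc (ord1 i) subrr.
have [|P [g [P0 qg _]]] := @free_resolution R nR _ fY 0.
  move=> i i0 x _; have -> : x = 0 by apply: (@fone_triv (resf lR) i _ x); lia.
  exact: bnd0.
have cyc (x : toc P 0) : is_cycle x.
  by rewrite /is_cycle; apply: mx_no_col; apply: P0; lia.
have bnd0P (y : restr_cplx p (toc (fone (resf lR) 0)) 0) : is_boundary y -> y = 0.
  by move=> [z <-]; exact: mulmx0.
have wr q : exists c : R, p c = ((g 0 (delta_mx 0 q) : 'rV_1) 0 0) by exact: pS.
have [c cP] := choice wr; pose r : 'cV[R]_(rk P 0) := \col_q c q.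
have gE (x : 'rV[R]_(rk P 0)) : (g 0 x : 'rV_1) 0 0 = p ((x *m r) 0 0).
  rewrite [g 0 x]linear_row /linv mxE rmorph_sum.
  have : forall s : seq 'I_(rk P 0), ((\sum_(q <- s) x 0 q *: g 0 (delta_mx 0 q) : restr_cplx p (toc (fone (resf lR) 0)) 0) : 'rV_1) 0 0 = \sum_(q <- s) p (x 0 q * r q 0).
    elim=> [|q s IH]; first by rewrite !big_nil mxE.
    by rewrite !big_cons [LHS]mxE IH -[X in X + _]/((p (x 0 q) *: (g 0 (delta_mx 0 q) : 'rV_1)) 0 0) mxE -cP !mxE rmorphM.
  exact.
exists P, r; split.
- exact: P0.
- move=> i i0; apply/exq_toc => x cx; apply: (qg i).1 => //.
  have -> : g i x = 0 by apply: (@fone_triv (resf lR) i _ (g i x)); lia.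
  exact: bnd0.
- move=> x; split=> [mx0|[y ->]].
    have [|y <-] := (qg 0).1 x (cyc x); last by exists y.
    suff -> : g 0 x = 0 by exact: bnd0.
    by apply/rowP => q; rewrite (ord1 q) [RHS]mxE gE; apply/pK.
  apply/pK; rewrite -/p -gE.
  have -> : y *m mx P 1 0 = diff (toc P) 1 0 y by [].
  by rewrite chain_funP (bnd0P _ (bnd_diff _ _)) mxE.
- apply: contrapT => h; have [x _ /bnd0P e] := (qg 0).2 (const_mx 1) (mulmx0 _ _).
  have := congr1 (fun y : 'rV_1 => y 0 0) e; rewrite !mxE gE.
  have -> : p ((x *m r) 0 0) = 0.
    apply/pK; rewrite mxE; apply: maxI_sum => // q _; apply: maxIM => //.
    by apply/negP => u; apply: h; exists q.
  by rewrite subr0 => /eqP; rewrite oner_eq0.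
Qed.

Lemma grank_ext (A : comUnitRingType) (J K : A -> Prop) (Z : cplx A) t r :
  (forall x, J x <-> K x) -> grank J Z t r <-> grank K Z t r.
Proof.
move=> e; split=> -[z [cz gz rz]]; exists z; split=> // c; rewrite rz.
  by split=> h l; apply/e.
by split=> h l; apply/e.
Qed.

Lemma grank_restr (A F : comUnitRingType) (pi : {rmorphism A -> F}) (J : F -> Prop) (Z : cplx F) t r :
  (forall z, exists y, pi y = z) ->
  grank (fun c => J (pi c)) (restr_cplx pi Z) t r <-> grank J Z t r.
Proof.
move=> pS; split=> -[z [cz gz rz]]; exists z; split=> //.
- by move=> x /gz [c bc]; exists (fun l => pi (c l)).
- move=> c; have [d dP] := choice (fun l => pS (c l)).
  have -> : \sum_l c l *: z l = \sum_l pi (d l) *: z l by apply: eq_bigr => l _; rewrite dP.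
  by split=> [/(rz d) h l|h]; [rewrite -dP; exact: h|apply: (rz d).2 => l; rewrite dP].
- move=> x /gz [c bc]; have [d dP] := choice (fun l => pS (c l)); exists d.
  suff <- : \sum_l c l *: z l = \sum_l pi (d l) *: z l by [].
  by apply: eq_bigr => l _; rewrite dP.
- by move=> c; exact: (rz (fun l => pi (c l))).
Qed.

Lemma field_hrank (k : fieldType) (Z : cplx k) : fgh Z -> forall t, exists r, hrank Z t r.
Proof.
move=> fZ t; have [n [z [cz gz]]] := fZ t; elim: n z cz gz => [|n IH] z cz gz.
  by exists 0%N, z; split=> // c; split=> [_ []//|_]; rewrite big_ord0; exact: bnd0.
have [h|] := pselect (forall c : 'I_n.+1 -> k, is_boundary (\sum_l c l *: z l) -> forall l, max_ideal (c l)).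
  exists n.+1, z; split=> // c; split=> [|c0]; first exact: h.
  rewrite big1 => [|l _]; first exact: bnd0.
  by have /field_max -> := c0 l; rewrite scale0r.
move=> /existsNP[c] /not_implyP[bc] /existsNP[l0 ul0].
have {}ul0 : c l0 != 0 by apply/eqP => h; apply: ul0; apply/field_max.
apply: (IH (fun l => z (lift l0 l))) => [l|x /gz [d bd]]; first exact: cz.
exists (fun l => d (lift l0 l) - d l0 / c l0 * c (lift l0 l)).
have -> : \sum_l (d (lift l0 l) - d l0 / c l0 * c (lift l0 l)) *: z (lift l0 l) =
    \sum_l d l *: z l - (d l0 / c l0) *: \sum_l c l *: z l.
  rewrite scaler_sumr -sumrB [RHS](bigD1_ord l0) //= scalerA divfK // subrr add0r.
  by apply: eq_bigr => l _; rewrite scalerA -scalerBl.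
by rewrite opprB addrCA addrC; apply: bndD => //; exact: bndZ.
Qed.

Lemma mact_rowv (A : comUnitRingType) m n (w : 'I_m -> A^o) (B : 'M[A]_(m, n)) p :
  mact B w p = ((\row_q (w q : A)) *m B) 0 p.
Proof. by rewrite -mact_row; apply: eq_mact => q; rewrite mxE. Qed.

Section FibreBass.
Variables (R A F : comUnitRingType) (rho : {rmorphism R -> A}) (pi : {rmorphism A -> F}).
Hypothesis gf : gor_fibre rho pi.
Variables (P : fx false R) (r : 'cV[R]_(rk P 0)).
Hypothesis Pr : res_field_res r.
Variables (I : cplx A) (iota : chain_map (stalk A^o) I).
Hypotheses (kI : K_injective I) (qI : quasi_iso iota).

Lemma bass_fone t n : grank (fun c => pi c = 0) (bc rho P ⋔ stalk A^o) t n <->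
  grank (fun c => c = 0) (fone F 0 ⋔ coext_cplx pi I) t n.
Proof.
have [g qg] := fibre_resolution gf Pr; have [neg _ _ _] := Pr.
have q1 := @dual_iota_qi A I iota qI (bc rho P) 0 neg.
rewrite (grank_qi _ t n q1) -(grank_qi _ t n (hce_qi qg kI)).
exact: (grank_restr (fun c => c = 0)) (gf_surj gf).
Qed.

Lemma bass_coext t n : grank (fun c => pi c = 0) (bc rho P ⋔ stalk A^o) t n <->
  grank (fun c => c = 0) (coext_cplx pi I) t n.
Proof.
rewrite bass_fone.
have rk1 : rk (dual (fone F 0)) 0 = 1%N by [].
have rk0 a : a <> 0 -> rk (dual (fone F 0)) a = 0%N by move=> h /=; case: eqP.
rewrite (grank_qi _ t n (one_qi rk1 rk0 _)) grank_shift.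
by have -> : t - dgn (~~ false) 0 = t by rewrite /dgn /=; lia.
Qed.

(** Flat base change: Ext over [R] of the residue field and [R] is a vector space of rank [n], so
    Ext over [A] of the fibre and [A] is free of rank [n] over the fibre, on the images of the same
    classes. *)
Lemma bass_flat t n : grank (@max_ideal R) (P ⋔ stalk R^o) t n ->
  grank (fun c => pi c = 0) (bc rho P ⋔ stalk A^o) t n.
Proof.
move=> [z [cz gz rz]]; pose a := - t.
have ea : dgn true a = t by rewrite /dgn /a opprK.
have ea0 : dgn true a + 0 = t by rewrite addr0.
have lR := gf_lR gf.
pose zr : 'M[R]_(n, rk P a) := \matrix_(i, j) (z i a 0 j : R).
pose Q := dual P; pose QA := dual (bc rho P).
have mxE' i j : mx QA i j = map_mx rho (mx Q i j).
  by rewrite /= map_mxZ map_trmx rmorphXn rmorphN rmorph1.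
have rowE' (u : (P ⋔ stalk R^o) t) p : (\row_q (u a 0 q : R)) 0 p = u a 0 p :> R by rewrite mxE.
have zrE (c : 'I_n -> R) p : (\sum_l c l *: z l : ften _ _ _) a 0 p = ((\row_l c l) *m zr) 0 p :> R.
  by rewrite ften_sumE mxE; apply: eq_bigr => l _; rewrite !mxE.
have cycR (x : 'rV[R]_(rk P a)) : (forall a', x *m mx Q a a' = 0) ->
    exists c y, x = c *m zr + y *m mx Q (nx true a) a.
  move=> hx; pose u := @fsingle _ _ Q (stalk R^o) a 0 (x 0) t ea0.
  have uE p : u a 0 p = x 0 p by exact: (@fsingleE _ _ Q (stalk R^o) a 0 (x 0) p).
  have [|c] := gz u.
    apply/(@stalk_cyc _ _ Q R^o _ u a ea) => a' p; rewrite (@eq_mact _ _ _ _ _ _ (x 0 : _ -> R^o)) //.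
    by rewrite mact_row hx mxE.
  move=> /(@stalk_bnd _ _ Q R^o _ _ a ea) [w hw]; exists (\row_l c l), (\row_q (w q : R)).
  apply/rowP => p; have := hw p; rewrite (ftenDE u) ftenNE zrE uE => /eqP.
  rewrite subr_eq => /eqP ->; rewrite [RHS]mxE addrC; congr (_ + _).
  exact: mact_rowv.
have relR (c : 'rV[R]_n) : (forall i, max_ideal (c 0 i)) <-> exists y, c *m zr = y *m mx Q (nx true a) a.
  rewrite -(rz (c 0)) (@stalk_bnd _ _ Q R^o _ _ a ea).
  have ec : (\row_l c 0 l) = c by apply/rowP => l; rewrite mxE.
  split=> [[w hw]|[y hy]].
    exists (\row_q (w q : R)); apply/rowP => p; rewrite -{1}ec -zrE hw.
    exact: mact_rowv.
  by exists (y 0) => p; rewrite zrE ec hy -mact_row.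
pose zA i := @fsingle _ _ QA (stalk A^o) a 0 (fun j => rho (zr i j) : A^o) t ea0.
have zAE i p : zA i a 0 p = rho (zr i p) by exact: (@fsingleE _ _ QA (stalk A^o) a 0 (fun j => rho (zr i j) : A^o) p).
have zrc i a' : row i zr *m mx Q a a' = 0.
  apply/rowP => p; have := (@stalk_cyc _ _ Q R^o _ (z i) a ea).1 (cz i) a' p.
  rewrite (@eq_mact _ _ _ _ _ _ (row i zr 0 : _ -> R^o)) => [|q]; last by rewrite !mxE.
  by rewrite mact_row => ->; rewrite mxE.
have sA (c : 'I_n -> A) p : (\sum_l c l *: zA l : ften _ _ _) a 0 p = ((\row_l c l) *m map_mx rho zr) 0 p :> A.
  rewrite ften_sumE mxE; apply: eq_bigr => l _; rewrite zAE !mxE; by [].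
exists zA; split=> [i|u cu|c].
- apply/(@stalk_cyc _ _ QA A^o _ _ a ea) => a' p.
  rewrite (@eq_mact _ _ _ _ _ _ (map_mx rho (row i zr) 0 : _ -> A^o)) => [|q]; last by rewrite zAE !mxE.
  by rewrite mact_row mxE' -map_mxM zrc map_mx0 mxE.
- have a1 : dgn true a = dgn true (a + 1) + 1 by rewrite /dgn; lia.
  (* By flatness a cycle over [A] is an [A]-combination of cycles over [R], and each of these is a
     combination of the [z] up to a boundary. *)
  have : extc rho (N := A^o) (preim_sub (zero_sub R (rk P (a + 1))) (mx Q a (a + 1))) (fun j => u a 0 j).
    apply: (flat_extc (gf_flat gf) (K' := zero_sub R _) (g := mx Q a (a + 1))) => //.
    have := extc0 rho A^o (zero_sub R (rk P (a + 1))); congr extc; apply/funext => j.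
    rewrite -[LHS]((@stalk_cyc _ _ QA A^o _ u a ea).1 cu (a + 1) j) mxE'.
    by apply: eq_bigr => i _; congr (_ *: _); rewrite mxE.
  move=> [m [k [b [hk hu]]]].
  have hk' l : exists cy : 'rV[R]_n * 'rV[R]_(rk P (nx true a)), k l = cy.1 *m zr + cy.2 *m mx Q (nx true a) a.
    have [|c [y e]] := cycR (k l); last by exists (c, y).
    move=> a'; have [e|ne] := pselect (a' = a + 1); first by subst a'; exact: hk.
    by rewrite (@mx_shape _ _ Q) ?mulmx0 // /dgn /=; lia.
  have [cy cyE] := choice hk'.
  exists (fun i => \sum_l rho ((cy l).1 0 i) * b l).
  apply/(@stalk_bnd _ _ QA A^o _ _ a ea); exists (fun q => \sum_l rho ((cy l).2 0 q) * b l : A^o) => p.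
  rewrite (ftenDE u) ftenNE sA; have -> : u a 0 p = \sum_l rho (k l 0 p) * b l :> A by exact: hu.
  apply/eqP; rewrite subr_eq; apply/eqP; rewrite mxE /mact.
  under [X in _ = _ + X]eq_bigr => i _ do rewrite !mxE mulr_suml.
  under [X in _ = X + _]eq_bigr => q _ do rewrite mxE' mxE -[_ *: _]/(_ * _) mulr_sumr.
  rewrite exchange_big [X in _ = _ + X]exchange_big -big_split; apply: eq_bigr => l _ /=.
  rewrite cyE !mxE rmorphD mulrDl addrC !rmorph_sum !mulr_suml; congr (_ + _).
    by apply: eq_bigr => i _; rewrite mxE rmorphM mulrAC.
  by apply: eq_bigr => q _; rewrite rmorphM -mulrA; exact: mulrCA.
- rewrite (@stalk_bnd _ _ QA A^o _ _ a ea); split=> [[w hw] i|hc].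
    have sKx : submodule (fun v : 'rV[R]_n => forall i, max_ideal (v 0 i)).
      split=> [j|x v y hv hy j]; first by rewrite mxE; exact: maxI0.
      by rewrite !mxE; apply: maxID => //; exact: maxIM.
    have sKy : submodule (fun v : 'rV[R]_(rk P a) => exists y, v = y *m mx Q (nx true a) a).
      split=> [|x v y [v' ->] [y' ->]]; first by exists 0; rewrite mul0mx.
      by exists (x *: v' + y'); rewrite mulmxDl scalemxAl.
    (* By [relR] the matrix [zr] embeds a power of the residue field into the cochains modulo
       boundaries; flatness preserves this injection, so the coefficients vanish on the fibre. *)
    have : extc rho (N := A^o) (SubmodPred sKx) (c : 'I_n -> A^o).
      apply: (flat_extc (gf_flat gf) (K' := SubmodPred sKy) (g := zr)); first exact: relR.
      exists (rk P (nx true a)), (fun q => row q (mx Q (nx true a) a)), w; split=> [q|p].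
        by exists (delta_mx 0 q); rewrite -rowE.
      have := hw p; rewrite sA mxE /mact => e.
      transitivity (\sum_j (\row_l c l) 0 j * (map_mx rho zr) j p : A).
        by apply: eq_bigr => j _; rewrite !mxE mulrC.
      by rewrite e; apply: eq_bigr => q _; rewrite mxE' !mxE.
    move=> [m [k [b [hk hcE]]]]; apply/(extc_max lR (gf_ker gf) (fun _ : 'I_1 => c i)).
    exists m, (fun l => (k l 0 i)%:M), b; split=> [l|j]; first by rewrite /= mxE eqxx; exact: hk.
    by rewrite hcE; apply: eq_bigr => l _; rewrite (ord1 j) mxE eqxx.
  have hm i : exists y : 'rV[A]_(rk P (nx true a)), c i *: map_mx rho (row i zr) = y *m mx QA (nx true a) a.
    have [m [k [b [hk hci]]]] := (extc_max lR (gf_ker gf) (fun _ : 'I_1 => c i)).2 (hc i).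
    have hy l : exists y, (k l 0 0) *: row i zr = y *m mx Q (nx true a) a.
      have [h _] := relR ((k l 0 0) *: delta_mx 0 i).
      have [|y e] := h; first by move=> j; rewrite !mxE mulrC; apply: maxIM => //; exact: hk.
      by exists y; rewrite -e -scalemxAl -rowE.
    have [y yE] := choice hy; exists (\sum_l b l *: map_mx rho (y l)).
    rewrite mulmx_suml (hci 0) scaler_suml; apply: eq_bigr => l _.
    by rewrite mxE' -scalemxAl -map_mxM -yE map_mxZ scalerA; congr (_ *: _); exact: mulrC.
  have [y yE] := choice hm; exists ((\sum_i y i) 0) => p; rewrite sA mact_row mulmx_suml.
  congr (fun_of_matrix _ 0 p); rewrite mulmx_sum_row; apply: eq_bigr => i _.
  by rewrite mxE -yE map_row.
Qed.
End FibreBass.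

Lemma zmx_cyc s (A : comUnitRingType) (D : fx s A) (V : cplx A) t (u : (D ⊙ V) t) :
  (forall i j, mx D i j = 0) -> is_cycle u <-> forall a j p, is_cycle (u a j p).
Proof.
move=> D0; split=> [/fte_cycP h a j p|h].
  apply/is_cycleP => k; have [ej|ne] := pselect (j = k + 1); last by rewrite diff_shape //; apply/eqP.
  by subst j; have := h a k p; rewrite zmx_tdiff.
by apply/fte_cycP => a j p; rewrite zmx_tdiff //; exact: (is_cycleP _).1 (h a (j + 1) p) j.
Qed.

Lemma zmx_bnd s (A : comUnitRingType) (D : fx s A) (V : cplx A) t (u : (D ⊙ V) t) :
  (forall i j, mx D i j = 0) -> is_boundary u <-> forall a j p, is_boundary (u a j p).
Proof.
move=> D0; split=> [/fte_bndP[v hv] a j p|h].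
  by rewrite hv zmx_tdiff //; exact: bnd_diff.
have H a j (p : 'I_(rk D a)) : exists y : V j, (dgn s a + j <> t + 1 -> y = 0) /\
    forall j0, j = j0 + 1 -> diff V j j0 y = u a j0 p.
  have [e|ne] := pselect (dgn s a + j = t + 1); last first.
    by exists 0; split=> // j0 ej; rewrite linear0 ffP //; lia.
  have [y hy] := h a (j - 1) p.
  have ej : j - 1 + 1 = j by lia.
  move: y hy; rewrite ej => y hy; exists y; split=> // j0 ej0.
  have -> : j0 = j - 1 by lia.
  by [].
pose w a j p := projT1 (cid (H a j p)); have wP a j p := projT2 (cid (H a j p)).
have ws (a j : int) p : dgn s a + j <> t + 1 -> w a j p = 0 by exact: (wP a j p).1.
apply/fte_bndP; exists (Ften ws) => a j p; rewrite zmx_tdiff //=.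
by rewrite ((wP a (j + 1) p).2 j).
Qed.

Lemma zmx_line s (A : comUnitRingType) (D : fx s A) (V : cplx A) g0 : local_ring A ->
  (forall i j, mx D i j = 0) -> (forall t, hrank V t (t == g0)) ->
  forall a, hrank (D ⊙ V) (dgn s a + g0) (rk D a).
Proof.
move=> lA D0 hV a; have := hV g0; rewrite eqxx => -[v1 [cv gv iv]]; pose v0 := v1 ord0.
pose e := erefl (dgn s a + g0); pose Z (c : 'I_(rk D a) -> A) := @fsingle _ _ D V a g0 (fun p => c p *: v0) _ e.
have ZE c p : Z c a g0 p = c p *: v0 by exact: fsingleE.
have sE (c : 'I_(rk D a) -> A) : \sum_p c p *: fpt e p v0 = Z c.
  apply: ften_eq => a' j' p; rewrite ften_sumE.
  have [ea|ne] := pselect (a = a'); last first.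
    rewrite big1 => [|q _]; first by rewrite [RHS]fsingle0 //; left.
    by rewrite fpt_off ?scaler0 // => -[].
  subst a'; have [ej|ne] := pselect (g0 = j'); last first.
    rewrite big1 => [|q _]; first by rewrite [RHS]fsingle0 //; right.
    by rewrite [fpt _ _ _ _ _ _]fsingle0 ?scaler0 //; right.
  subst j'; rewrite ZE (bigD1 p) //= fsingleE eqxx big1 ?addr0 // => q /negbTE nq.
  by rewrite fsingleE eq_sym nq scaler0.
have s1 (d : 'I_1 -> A) : \sum_l d l *: v1 l = d ord0 *: v0 by rewrite big_ord1.
exists (fun p => fpt e p v0); split=> [p|u cu|c].
- by apply: fpt_cyc => //; exact: cv.
- have cu' := (zmx_cyc u D0).1 cu.
  have H p : exists c, is_boundary (u a g0 p - c *: v0).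
    by have [d hd] := gv _ (cu' a g0 p); exists (d ord0); rewrite -s1.
  have [c hc] := choice H; exists c; rewrite sE; apply/zmx_bnd => // a' j' p.
  rewrite ftenDE ftenNE; have [ea|ne] := pselect (dgn s a' + j' = dgn s a + g0); last first.
    by rewrite !ffP // subr0; exact: bnd0.
  have [ej|nej] := pselect (g0 = j').
    have ea' : a = a' by move: ea; rewrite /dgn; case: (s) => /=; lia.
    by subst a' j'; rewrite ZE; exact: hc.
  rewrite [Z c _ _ _]fsingle0; last by right.
  rewrite subr0; have := hV j'; case: eqP => [ee|_]; first by case: nej.
  by move=> /hrank0 h; apply: h; exact: cu'.
rewrite sE zmx_bnd //; split=> [h l|h a' j' p].
  have := h a g0 l; rewrite ZE => bl.
  by apply: (iv (fun _ => c l)).1 ord0; rewrite s1.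
have [ea|ne] := pselect (a = a'); last by rewrite [Z c _ _ _]fsingle0; [exact: bnd0|left].
subst a'; have [ej|ne] := pselect (g0 = j'); last by rewrite [Z c _ _ _]fsingle0; [exact: bnd0|right].
by subst j'; rewrite ZE -(s1 (fun _ => c p)); apply/iv.
Qed.

Definition zfx s (A : comUnitRingType) (mu : int -> nat) : fx s A :=
  @Fx s A mu (fun i j => 0) (fun i j _ => erefl) (fun i j k => mul0mx _ _).

(** Free homology splits: sending basis vectors to cycles that represent a basis of the homology
    already is a chain map from a complex with zero differential. *)
Lemma zfx_res (A : comUnitRingType) (W : cplx A) (mu : int -> nat) :
  (forall t, grank (fun c => c = 0) W t (mu t)) ->
  exists f : chain_map (toc (zfx false A mu)) W, quasi_iso f.
Proof.
move=> h; pose z t := projT1 (cid (h t)); have zP t := projT2 (cid (h t)).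
have ax (i j : int) (x : toc (zfx false A mu) i) :
    linv (z j) (diff (toc (zfx false A mu)) i j x) = diff W i j (linv (z i) x).
  have -> : diff (toc (zfx false A mu)) i j x = 0 by exact: mulmx0.
  rewrite linear0 linear_linv /linv big1 // => p _.
  by have [/(_ p) /is_cycleP ->] := zP i; rewrite scaler0.
exists (@ChainMap A (toc (zfx false A mu)) W (fun i => linv (z i)) ax) => n; split=> [x _ bx|y cy].
  have [_ _ /(_ (x 0)) [/(_ bx) x0 _]] := zP n.
  have -> : x = 0 :> 'rV[A]_(mu n) by apply/rowP => p; rewrite mxE; exact: x0.
  exact: bnd0.
have [_ /(_ y cy) [c bc] _] := zP n; exists (\row_p c p); first exact: mulmx0.
rewrite /= /linv (eq_bigr (fun p => c p *: z n p)) // => p _; by rewrite mxE.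
Qed.

Lemma field_grank (k : fieldType) (Z : cplx k) t r : grank (fun c => c = 0) Z t r <-> hrank Z t r.
Proof. by apply: grank_ext => x; split=> /field_max. Qed.

Lemma toc_hrank (k : fieldType) (N : fx false k) t : (forall i j, mx N i j = 0) -> hrank (toc N) t (rk N t).
Proof.
move=> N0; have d0 i j (x : toc N i) : diff (toc N) i j x = 0 by rewrite /= N0 mulmx0.
have sE (c : 'I_(rk N t) -> k) : \sum_l c l *: (delta_mx 0 l : toc N t) = (\row_l c l : 'rV_(rk N t)).
  by rewrite [RHS]row_sum_delta; apply: eq_bigr => l _; rewrite mxE.
have b0 (x : toc N t) : is_boundary x -> x = 0 by move=> [y <-]; rewrite d0.
exists (fun l => delta_mx 0 l : toc N t); split=> [l|x _|c]; first exact: d0.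
  exists (x 0); rewrite sE; have -> : (\row_l x 0 l : 'rV_(rk N t)) = x by apply/rowP => l; rewrite mxE.
  by rewrite subrr; exact: bnd0.
rewrite sE; split=> [/b0 /rowP h l|h]; first by apply/field_max; have := h l; rewrite !mxE.
have -> : (\row_l c l : 'rV_(rk N t)) = 0 by apply/rowP => l; rewrite !mxE; apply/field_max.
exact: bnd0.
Qed.

Lemma fone_hrank (k : fieldType) t : hrank (toc (fone k 0)) t (t == 0).
Proof. exact: toc_hrank. Qed.

Lemma fone_grank (A : comUnitRingType) (J : A -> Prop) (Z : cplx A) t r :
  grank J (fone A 0 ⋔ Z) t r <-> grank J Z t r.
Proof.
have rk1 : rk (dual (fone A 0)) 0 = 1%N by [].
have rk0 a : a <> 0 -> rk (dual (fone A 0)) a = 0%N by move=> h /=; case: eqP.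
rewrite (grank_qi _ t r (one_qi rk1 rk0 _)) grank_shift.
by have -> : t - dgn (~~ false) 0 = t by rewrite /dgn /=; lia.
Qed.

Lemma fone_bound (A : comUnitRingType) d (i : int) : i < d -> rk (fone A d) i = 0%N.
Proof. by move=> h /=; case: eqP => // e; move: h; rewrite e ltxx. Qed.

Lemma restr_free_resolution (A B : comUnitRingType) (psi : {rmorphism A -> B}) (L : fx false B) b :
  noetherian A -> module_finite psi -> fgh (toc L) -> (forall i : int, i < b -> rk L i = 0%N) ->
  exists (G : fx false A) (g : chain_map (toc G) (restr_cplx psi (toc L))),
    (forall i : int, i < b -> rk G i = 0%N) /\ quasi_iso g.
Proof.
move=> nA mf fL Lb; have [||G [g [Gb qg _]]] := @free_resolution A nA (restr_cplx psi (toc L)) _ b _.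
- exact: fgh_restr_up.
- by move=> i ib x _; have -> : x = 0 :> toc L i; [exact: mx_no_col (Lb i ib)|exact: bnd0].
by exists G, g.
Qed.

Lemma fgh_toc (A : comUnitRingType) (L : fx false A) : noetherian A -> fgh (toc L).
Proof. by move=> nA; apply: fgh_qi (unstalk_qi L) _; exact: fgh_stalk. Qed.

(* Ext_F(l, F) is one-dimensional for F Gorenstein with residue field in l. *)
Lemma gorenstein_ext (F : comUnitRingType) (l : fieldType) (sigma : {rmorphism F -> l}) r
    (E : cplx F) (e : chain_map (stalk F^o) E) : noetherian F -> module_finite sigma ->
  (forall i, injective_module (E i)) -> (forall i : int, ~~ (- r <= i <= 0) -> trivial_mod (E i)) ->
  quasi_iso e -> exists g0, forall t, hrank (coext_cplx sigma E) t (t == g0).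
Proof.
move=> nF mf iE bE qe; pose V := coext_cplx sigma E; pose L := fone l 0.
have kE : K_injective E by apply: (@bounded_injectives _ _ 0) => // j h; apply: bE; lia.
have [G [g [Gb qg]]] := restr_free_resolution nF mf (fgh_toc _ (@field_noetherian l)) (@fone_bound l 0).
have fLV : fgh (L ⋔ V) by exact: (dual_fgh nF kE qe Gb qg).
have lowLV (i : int) : i < - r -> forall x : (L ⋔ V) i, is_cycle x -> is_boundary x.
  move=> h x _; have -> : x = 0; last exact: bnd0.
  apply: ften_eq => a j p; have [ea|/ffP->//] := pselect (dgn true a + j = i).
  have a0 : a = 0 by apply: contrapT => ne; apply: (@no_ord _ _ p) => /=; case: eqP.
  apply: coext_eq => b; apply: bE; move: ea h; rewrite a0 /dgn; lia.
have [N [n [Nb qn Nmin]]] := free_resolution (@field_noetherian l) fLV lowLV.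
have N0 i j : mx N i j = 0.
  by apply/matrixP => p q; rewrite mxE; case: (Nmin i j p q) => // /field_max.
have [M [m [Mb qm]]] := restr_free_resolution nF mf (fgh_toc N (@field_noetherian l)) Nb.
have [c [hc qc]] := dual_comp_lift kE qe Gb qg qn qm Mb.
(* As [F] has finite injective dimension over itself, the dual of an exact complex of finite free
   modules is exact; biduality with respect to [F] then holds for the field [l]. *)
have ecl : forall a, exq (dual (fcone c)) a.
  move=> a; apply: (exq_dual_inj (e := e) (r := r)) => //.
    apply: (@fte_qi_bdb _ _ _ _ _ _ (- `|r|)) => // j hj x; first by apply: stalk_triv; lia.
    by apply: bE; lia.
  by move=> i; left; exact: fcone_exq.
have qa := bidual_of_cone kE qe qg qm Mb hc ecl.
(* [N] appears twice: being minimal over a field it has zero differential, so its ranks are those of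
   the homology of [V]; and by biduality Hom(N, V) has the homology of [l]. [zmx_self] then leaves a
   single degree. *)
have hV t : hrank V t (rk N t).
  by apply/fone_grank/(grank_qi _ t _ qn); exact: toc_hrank.
have [||a0 [r1 r0]] := @zmx_self l (@field_local l) (dual N) V _ hV.
- by move=> i j; rewrite /= N0 trmx0 scaler0.
- by move=> t; apply/(grank_qi _ t _ qa); exact: fone_hrank.
by exists a0 => t; have := hV t; case: eqP => [->|/r0 /= ->] //; move: r1 => /= ->.
Qed.

Section BaseChange.
Variables (R A F : comUnitRingType) (rho : {rmorphism R -> A}) (pi : {rmorphism A -> F}).
Hypothesis gf : gor_fibre rho pi.
Variables (P : fx false R) (r : 'cV[R]_(rk P 0)).
Hypothesis Pr : res_field_res r.
Variables (l : fieldType) (sigma : {rmorphism F -> l}) (tau : {rmorphism A -> l}).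
Hypotheses (etau : forall x, tau x = sigma (pi x)) (mf : module_finite sigma).

(** By adjunction RHom_A(l, A) is RHom_F(l, RHom_A(F, A)), where the inner complex is a sum of
    shifts of [F] counted by [mu], and RHom_F(l, F) is one-dimensional in degree [g0]. The shift is
    chosen before [mu] and [I], as it depends on [F] and [sigma] only; it is 0 when [F] is injective
    over itself. *)
Lemma bass_base_change : exists g0 : int, (injective_module (F^o : lmodType F) -> g0 = 0) /\ forall (mu : int -> nat) (I : cplx A) (iota : chain_map (stalk A^o) I) c,
  (forall t, grank (@max_ideal R) (P ⋔ stalk R^o) t (mu t)) ->
  (forall i, injective_module (I i)) -> (forall j : int, c < j -> forall x : I j, x = 0) ->
  quasi_iso iota -> forall t, hrank (coext_cplx tau I) t (mu (t - g0)).
Proof.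
have [[nF lF] [r0 [E [e [iE bE qe]]]]] := gf_gor gf.
have kE : K_injective E by apply: (@bounded_injectives _ _ 0) => // j h; apply: bE; lia.
have [g0 hV] := gorenstein_ext nF mf iE bE qe; exists g0; split=> [iF|mu I iota c hmu iI bI qI t].
  apply: contrapT => ne; have kF : K_injective (stalk F^o).
    apply: (@bounded_injectives _ _ 0) => [j|j hj x]; last by apply: stalk_triv; lia.
    have [-> //|nj] := pselect (j = 0).
    move=> M M' f g _; exists \0 => x; exact/esym/(stalk_triv _ nj).
  have := (grank_qi _ g0 _ (coext_qi sigma kF kE qe)).2 (hV g0); rewrite eqxx => h1.
  suff h0 : hrank (coext_cplx sigma (stalk F^o)) g0 0 by have := hrank_uniq (@field_local l) h1 h0.
  apply/hrank0 => x _; have -> : x = 0; last exact: bnd0.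
  by apply: coext_eq => b; exact: (stalk_triv _ ne).
have kI := bounded_injectives iI bI.
pose W := coext_cplx pi I.
have hW t' : grank (fun c => c = 0) W t' (mu t').
  by apply/(bass_coext gf Pr kI qI); apply: bass_flat.
have kW : K_injective W.
  apply: (@bounded_injectives _ _ c) => j; first exact: coext_injective.
  by move=> h x; apply: coext_eq => b; exact: bI.
(* The homology of [W] is free over [F], hence [W] is a sum of shifts of [F]. Replacing [F] by [E]
   gives the K-injective model [G ⊙ E], to which Hom_F(l, -) may be applied. *)
have [w qw] := zfx_res hW; pose G := zfx false F mu.
have q1 : quasi_iso (fte_map G e).
  apply: (@fte_qi_bdb _ _ _ _ _ _ (- r0%:Z)) => // j hj x; first by apply: stalk_triv; lia.
  by apply: bE; lia.
have [h hh] := Kinj_chain kW (chain_comp w (unstalk G)) q1.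
have qh : quasi_iso h.
  apply: (qi_cancel_right (homotopic_hom_eq hh) q1).
  exact: qi_comp (unstalk_qi G) qw.
have mu0 (a : int) : 0 < a -> mu a = 0%N.
  move=> h0; apply: (hrank_uniq (gf_lR gf) (hmu a)); apply/hrank0 => x _.
  have -> : x = 0; last exact: bnd0.
  apply: ften_eq => b j p; have [eb|/ffP->//] := pselect (dgn true b + j = a).
  have [j0|jn] := pselect (j = 0); last exact: stalk_triv.
  by apply: (False_ind _ (no_ord _ p)); apply: (rf_neg Pr); move: eb; rewrite j0 /dgn; lia.
have kGE : K_injective (G ⊙ E).
  apply: (@bounded_injectives _ _ 0) => j; first exact: fte_injective.
  move=> j0 x; apply: ften_eq => a k p; have [ea|/ffP->//] := pselect (dgn false a + k = j).
  have [k0|k0] := pselect (0 < k); first by apply: bE; lia.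
  by apply: (False_ind _ (no_ord _ p)); apply: mu0; move: ea; rewrite /dgn; lia.
apply: (grank_qi _ t _ (ccomp_qi etau I)).1; apply: (grank_qi _ t _ (coext_qi sigma kGE kW qh)).1.
apply: (grank_qi _ t _ (cfte_qi sigma G E)).2.
have -> : t = dgn false (t - g0) + g0 by rewrite /dgn; lia.
have := @zmx_line false l (bc sigma G) _ g0 (@field_local l) _ hV (t - g0).
have -> : dgn false (t - g0) + g0 - g0 = t - g0 by rewrite /dgn; lia.
by apply=> i j; rewrite /= map_mx0.
Qed.
End BaseChange.

(** * Depth *)

Lemma ideal_fg (A : comUnitRingType) (nA : noetherian A) (P : A^o -> Prop) : submodule P -> fg P.
Proof.
move=> sP; have [|s hs] := nA P.
  split; first exact: subm0 sP.
    by move=> x y; exact: (submD sP).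
  by move=> a x; exact: (submZ sP).
have E x : P x <-> ideal_gen s x by rewrite -hs.
exists (size s), (fun i => s`_i); split=> [i|x /E [c ->]]; last by exists c.
apply/E; exists (fun j => (j == i)%:R); rewrite (bigD1 i) //= eqxx mul1r big1 ?addr0 // => j /negbTE ->.
by rewrite mul0r.
Qed.

Lemma ideal_ind (A : comUnitRingType) (nA : noetherian A) (Q : submod_pred A^o -> Prop) :
  (forall K : submod_pred A^o, (forall K' : submod_pred A^o, (forall x, K x -> K' x) ->
     (exists2 x, K' x & ~ K x) -> Q K') -> Q K) -> forall K, Q K.
Proof. by apply: fg_noeth_ind => P; exact: ideal_fg. Qed.

(* Prime avoidance without primes: an element [f] regular on [E] but killing
   [e], with maximal annihilator, is corrected by some [g] that kills [E] and
   not [e], so that [f + g] is regular on [E + A e]. *)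
Section Socle.
Variables (A : comUnitRingType) (nA : noetherian A) (lA : local_ring A) (I : submod_pred A^o).
Let sI := sm_ax I.
Let IM (a x : A) : I x -> I (a * x). Proof. exact: (submZ sI). Qed.
Let ID (x y : A) : I x -> I y -> I (x + y). Proof. exact: (submD sI). Qed.
(** A class outside [I] whose annihilator modulo [I] is maximal among such annihilators; it stands
    in for an associated prime. *)
Definition maxann (e : A) := ~ I e /\ forall e', ~ I e' ->
  (forall a, I (a * e) -> I (a * e')) -> forall a, I (a * e') -> I (a * e).

Fact ann_ax (e : A) : submodule (fun a : A^o => I ((a : A) * e)).
Proof.
split=> [|a x y hx hy]; first by rewrite mul0r; exact: (subm0 sI).
by rewrite [(a *: x : A^o)]/(a * x) mulrDl -mulrA; apply: ID => //; exact: IM.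
Qed.
Lemma maxann_above (e : A) : ~ I e -> exists2 e', maxann e' & forall a, I (a * e) -> I (a * e').
Proof.
suff H (K : submod_pred A^o) : forall e : A, ~ I e -> (forall a, K a <-> I (a * e)) ->
    exists2 e', maxann e' & forall a, I (a * e) -> I (a * e').
  by move=> ne; apply: (H (SubmodPred (ann_ax e))).
move: K; apply: (ideal_ind nA) => K IH {}e ne hK.
have [me|] := pselect (maxann e); first by exists e.
move=> nm; have [e' [ne' le' [a [ha na]]]] : exists e', [/\ ~ I e', forall a, I (a * e) -> I (a * e') &
    exists a, I (a * e') /\ ~ I (a * e)].
  apply: contrapT => h; apply: nm; split=> // e' ne' le' a ha; apply: contrapT => na.
  by apply: h; exists e'; split=> //; exists a.
have [|||e2 m2 l2] := IH (SubmodPred (ann_ax e')) _ _ e' ne' _ => //.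
- by move=> x /hK /le'.
- by exists a => // /hK.
by exists e2 => // b /le' /l2.
Qed.

Lemma socle : (forall x, max_ideal x -> exists y, I (x * y) /\ ~ I y) ->
  exists e, ~ I e /\ forall x, max_ideal x -> I (x * e).
Proof.
move=> zd; apply: contrapT => ns.
have ns' e : ~ I e -> exists2 h, max_ideal h & ~ I (h * e).
  move=> ne; apply: contrapT => h; apply: ns; exists e; split=> // x mx; apply: contrapT => nx.
  by apply: h; exists x.
(* [J E] is the property that survives the enlargement of [E]: every class of maximal annihilator,
   killed by some [f] regular on [E], is separated from [E] by a scalar that kills [E] but not the
   class. For [E = I] the scalar 1 will do, so the induction starts at [f = 0]. *)
pose reg (f : A) (E : A -> Prop) := forall y, E y -> I (f * y) -> I y.
pose J (E : A -> Prop) := forall f e, max_ideal f -> reg f E -> maxann e -> I (f * e) ->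
  exists b, ~ I (b * e) /\ forall y, E y -> I (b * y).
suff H (E : submod_pred A^o) : (forall y, I y -> E y) -> J E -> forall f, max_ideal f -> reg f E -> False.
  apply: (H I) (0 : A) _ _ => //; last exact: maxI0.
  by move=> f e _ _ [ne _] _; exists 1; rewrite mul1r; split=> // y; rewrite mul1r.
move: E; apply: (ideal_ind nA) => E IH IE JE f mf rf.
have [e1 [fe1 /maxann_above[e me le]]] := zd f mf.
have fe : I (f * e) by exact: le.
have [b [nb bE]] := JE f e mf rf me fe.
have [h mh nh] := ns' _ nb; pose g := h * b.
have mg : max_ideal g by rewrite /g mulrC; exact: maxIM.
have gE y : E y -> I (g * y) by move=> /bE hy; rewrite /g -mulrA; exact: IM.
have ge : ~ I (g * e) by rewrite /g -mulrA.
have sE' : submodule (fun y : A^o => exists (y0 a : A), E y0 /\ y = y0 + a * e).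
  split=> [|c _ _ [y [a [hy ->]]] [z [d [hz ->]]]].
    by exists 0, 0; split; [exact: (subm0 (sm_ax E))|rewrite mul0r addr0].
  exists (c * y + z), (c * a + d); split; first exact: (sm_ax E).2.
  by rewrite -[c *: _]/(c * _) mulrDr mulrDl mulrA addrACA.
have eE : ~ E e by move=> /rf /(_ fe); case: me.
apply: (IH (SubmodPred sE') _ _ _ _ (f + g)) => /=.
- by move=> x hx; exists x, 0; rewrite mul0r addr0.
- by exists e => //; exists 0, 1; split; [exact: (subm0 (sm_ax E))|rewrite mul1r add0r].
- by move=> y /IE hy; exists y, 0; rewrite mul0r addr0.
- move=> f2 e2 m2 r2 me2 fe2.
  (* The separating scalar for the larger submodule is a product: [b1] kills [E] and not [e2], while
     [b2] kills [e] and not [e2]. Maximality of the annihilator of [e2] prevents the product from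
     killing [e2]. *)
  have [|b1 [nb1 b1E]] := JE f2 e2 m2 _ me2 fe2.
    by move=> y hy; apply: r2; exists y, 0; rewrite mul0r addr0.
  have [b2 hb2 nb2] : exists2 b2, I (b2 * e) & ~ I (b2 * e2).
    apply: contrapT => hh; case: (me) => ne hm.
    have f2e : I (f2 * e).
      apply: (hm e2 me2.1) => // a ha; apply: contrapT => na; apply: hh; by exists a.
    by apply: ne; apply: r2 f2e; exists 0, 1; split; [exact: (subm0 (sm_ax E))|rewrite mul1r add0r].
  exists (b1 * b2); split=> [|_ [y [a [hy ->]]]].
    move=> hb; apply: nb1; apply: (me2.2 (b2 * e2) nb2) => [a ha|]; last by rewrite mulrA.
    by rewrite mulrCA; exact: IM.
  rewrite mulrDr; apply: ID; first by rewrite mulrAC mulrC; apply/IM/b1E.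
  have -> : b1 * b2 * (a * e) = b1 * a * (b2 * e) by ring.
  exact: IM.
- exact: maxID.
(* Regularity of [f + g]: since [g] kills [y] and [f] kills [e], the hypothesis reduces to
   [f y + a g e] in [I]. Multiplying by [f] leaves [f f y], so [y] is in [I]; then [a g e] is, and
   maximality of the annihilator of [e] gives [a e]. *)
move=> _ [y [a [hy ->]]] hI.
have hga : I (f * y + a * (g * e)).
  have -> : f * y + a * (g * e) = (f + g) * (y + a * e) - (g * y + a * (f * e)) by ring.
  apply: (submB sI) => //; apply: ID; [exact: gE|exact: IM].
have hy' : I y.
  apply: (rf _ hy); apply: (rf (f * y)); first exact: ((submZ (sm_ax E)) f).
  have -> : f * (f * y) = f * (f * y + a * (g * e)) - (a * g) * (f * e) by ring.
  by apply: (submB sI); apply: IM.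
apply: ID => //; apply: (me.2 (g * e) ge) => [c hc|]; first by rewrite mulrCA; exact: IM.
have -> : a * (g * e) = f * y + a * (g * e) - f * y by ring.
by apply: (submB sI) => //; exact: IM.
Qed.
End Socle.

Fact zero_ideal (A : comUnitRingType) : submodule (fun z : A^o => z = 0).
Proof. by split=> // a x y -> ->; rewrite scaler0 addr0. Qed.

(** * Regular sequences and Ext from the residue field *)

Section Rees.
Variables (A : comUnitRingType) (nA : noetherian A) (lA : local_ring A).
Variables (P : fx false A) (r : 'cV[A]_(rk P 0)).
Hypothesis Pr : res_field_res r.

(** Multiplication by [x] is zero on the residue field, so it lifts to a null-homotopic endomorphism
    of the resolution; the homotopy is built degree by degree from 0, where [x] sends everything
    into the image of the differential. *)
Lemma mul_homotopic (x : A) : max_ideal x -> exists s : forall i j : int, 'M[A]_(rk P i, rk P j),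
  forall n n0 n1 : int, n = n0 + 1 -> n1 = n + 1 ->
    x%:M = s n n1 *m mx P n1 n + mx P n n0 *m s n0 n.
Proof.
move=> mx_; pose T i := forall j : int, 'M[A]_(rk P i, rk P j).
have conc (j k : int) (y : 'M[A]_(rk P j, rk P k)) : exists t : T j, t k = y.
  exists (fun k' => match pselect (k = k') with
    left e => eq_rect k (fun k => 'M[A]_(rk P j, rk P k)) y k' e | right _ => 0 end).
  by case: pselect => // e; rewrite (Prop_irrelevance e erefl).
have [t0 t0E] : exists t : T 0, x%:M = t 1 *m mx P 1 0.
  have H p : exists y, x *: (delta_mx 0 p : 'rV_(rk P 0)) = y *m mx P 1 0.
    by apply/(rf_zero Pr); rewrite -scalemxAl mxE mulrC; exact: maxIM.
  have [y yE] := choice H; have [t tE] := conc 0 1 (\matrix_(p, q) y p 0 q); exists t.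
  rewrite tE; apply/row_matrixP => p; rewrite row_mul.
  have -> : row p (\matrix_(p, q) y p 0 q) = y p by apply/rowP => q; rewrite !mxE.
  by rewrite -yE rowE mul_mx_scalar.
pose Inv i (t : T i) := forall i1, i1 = i + 1 -> mx P i1 i *m (x%:M - t i1 *m mx P i1 i) = 0.
pose Rel i j (t : T i) (t' : T j) := forall j1, j1 = j + 1 -> x%:M = t' j1 *m mx P j1 j + mx P j i *m t j.
have [dflt dE] : exists dflt : forall i, T i, dflt 0 = t0.
  exists (fun i => match pselect (0 = i) with left e => eq_rect 0 T t0 i e | right _ => fun=> 0 end).
  by case: pselect => // e; rewrite (Prop_irrelevance e erefl).
have [||s [s0 _ sR]] := @int_rec T dflt 0 Inv Rel.
- by move=> i1 ->; rewrite dE -t0E subrr mulmx0.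
- move=> i j t ej i0 hI.
  have j0 : 0 < j by lia.
  have [|y yE] := @exqM _ _ P j (rf_pos Pr j0) _ (x%:M - mx P j i *m t j).
    move=> a'; have [ea|ne] := pselect (j = a' + 1); last first.
      have -> : mx P j a' = 0 by exact: mx_shape.
      exact: mulmx0.
    have -> : a' = i by lia.
    rewrite mulmxBl mul_scalar_mx -mulmxA -[x *: _]mul_mx_scalar -mulmxBr; exact: hI.
  have [t' tE] := conc j (j + 1) y; exists t'.
    by move=> j1 ->; rewrite tE -yE subrK.
  by move=> j1 ->; rewrite tE -yE subKr mulmxA mx_mx mul0mx.
exists s => n n0 n1 en en1; have [n0'|nn] := pselect (n < 0).
  by apply/matrixP => p; case: (no_ord (rf_neg Pr n0') p).
have [n00|nn0] := pselect (n = 0).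
  have e1 : n1 = 1 by lia.
  rewrite n00 e1; have -> : s 0 = t0 by rewrite -dE; exact: s0.
  by rewrite -t0E (mx_no_col (mx P 0 n0)) ?mul0mx ?addr0 //; apply: (rf_neg Pr); lia.
by apply: sR; lia.
Qed.

Let E i j : 'M[A]_(rk P i, rk P j) := (mx P j i)^T.
Let EE i j k : E i j *m E j k = 0. Proof. by rewrite /E -trmx_mul mx_mx trmx0. Qed.

Section Ideal.
Variable I : A -> Prop.
Definition rowI m (v : 'rV[A]_m) := forall p, I (v 0 p).
(* Vanishing of Ext^n(k, A / I), k being the residue field. *)
Definition hvan (n : int) := forall n0, n = n0 + 1 -> forall u : 'rV[A]_(rk P n),
  (forall n1, rowI (u *m E n n1)) -> exists y : 'rV[A]_(rk P n0), rowI (u - y *m E n0 n).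
Hypothesis sI : is_ideal I.
Let I0 : I 0. Proof. by case: sI. Qed.
Let ID (x y : A) : I x -> I y -> I (x + y). Proof. by case: sI => _ h _; exact: h. Qed.
Let IM (a x : A) : I x -> I (a * x). Proof. by case: sI => _ _ h; exact: h. Qed.
Let IN (x : A) : I x -> I (- x). Proof. by rewrite -mulN1r; exact: IM. Qed.
Lemma rowI0 m : rowI (0 : 'rV_m). Proof. by move=> p; rewrite mxE. Qed.
Lemma rowID m (u v : 'rV_m) : rowI u -> rowI v -> rowI (u + v).
Proof. by move=> hu hv p; rewrite mxE; exact: ID. Qed.
Lemma rowIN m (u : 'rV_m) : rowI u -> rowI (- u).
Proof. by move=> hu p; rewrite mxE; exact: IN. Qed.
Lemma rowIB m (u v : 'rV_m) : rowI u -> rowI v -> rowI (u - v).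
Proof. by move=> hu /rowIN; exact: rowID. Qed.
Lemma rowIZ m a (u : 'rV_m) : rowI u -> rowI (a *: u).
Proof. by move=> hu p; rewrite mxE; exact: IM. Qed.
Lemma rowIM m k (u : 'rV_m) (B : 'M_(m, k)) : rowI u -> rowI (u *m B).
Proof.
move=> hu p; rewrite mxE; apply: (big_ind I) => // i _.
by rewrite mulrC; exact: IM.
Qed.

Lemma ext_killed (x : A) : max_ideal x -> forall n n0, n = n0 + 1 -> forall u : 'rV[A]_(rk P n),
  (forall n1, rowI (u *m E n n1)) -> exists y : 'rV[A]_(rk P n0), rowI (x *: u - y *m E n0 n).
Proof.
move=> mx_ n n0 en u hu; have [s sE] := mul_homotopic mx_.
exists (u *m (s n0 n)^T).
have -> : x *: u - u *m (s n0 n)^T *m E n0 n = u *m E n (n + 1) *m (s n (n + 1))^T.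
  rewrite -mul_mx_scalar -tr_scalar_mx (sE n n0 (n + 1) en erefl) linearD /= !trmx_mul mulmxDr !mulmxA.
  by rewrite addrK.
exact/rowIM.
Qed.

Lemma hvan_neg n : n < 0 -> hvan n.
Proof.
move=> n0 m _ u _; exists 0; rewrite mul0mx subr0 => p.
by case: (no_ord (rf_neg Pr n0) p).
Qed.

Lemma not_hvan0 (e : A) : ~ I e -> (forall x, max_ideal x -> I (x * e)) -> ~ hvan 0.
Proof.
move=> ne me /(_ (-1) erefl (e *: r^T)) [n1 p|y].
  rewrite -scalemxAl mxE mulrC; apply: me; rewrite -trmx_mul mxE.
  have [e1|ne1] := pselect (n1 = 1); last first.
    by rewrite mx_shape ?mul0mx ?mxE; [exact: maxI0|rewrite /dgn => h; apply: ne1; lia].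
  subst n1; have -> : (mx P 1 0 *m r) p 0 = ((delta_mx 0 p : 'rV_(rk P 1)) *m mx P 1 0 *m r) 0 0.
    by rewrite -mulmxA -rowE [RHS]mxE.
  by apply/(rf_zero Pr); exists (delta_mx 0 p).
rewrite (_ : y = 0) ?mul0mx ?subr0; last by apply: mx_no_col; exact: (rf_neg Pr).
have [p up] := rf_unit Pr; move=> /(_ p); rewrite !mxE => h; apply: ne.
by rewrite -(mulrK up e) mulrC; exact: IM.
Qed.

Variables (J : A -> Prop) (x : A).
Hypotheses (mx_ : max_ideal x) (rx : forall y, I (x * y) -> I y).
Hypothesis JE : forall z, J z <-> exists w, I (z - x * w).
Lemma rowJ m (v : 'rV_m) : (forall p, J (v 0 p)) -> exists w, rowI (v - x *: w).
Proof.
move=> h; have [w hw] := choice (fun p => (JE _).1 (h p)); exists (\row_p w p) => p.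
by rewrite !mxE.
Qed.
Lemma rowJI m (v w : 'rV_m) : rowI (v - x *: w) -> forall p, J (v 0 p).
Proof. by move=> h p; apply/JE; exists (w 0 p); have := h p; rewrite !mxE. Qed.
Lemma rowI_reg m (v : 'rV_m) : rowI (x *: v) -> rowI v.
Proof. by move=> h p; apply: rx; have := h p; rewrite mxE. Qed.
End Ideal.

(** The long exact sequence of multiplication by [x] on the quotient by [I]. As [x] acts as zero on
    Ext from the residue field ([ext_killed]), it breaks up: Ext in degree [n] for [J] is an
    extension of Ext in degree [n + 1] for [I] by Ext in degree [n]. *)
Lemma hvan_regular (I J : A -> Prop) (x : A) n : is_ideal I -> max_ideal x ->
  (forall y, I (x * y) -> I y) -> (forall z, J z <-> exists w, I (z - x * w)) ->
  hvan J n <-> hvan I n /\ hvan I (n + 1).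
Proof.
move=> sI mx_ rx JE; have toJ m (v : 'rV_m) : rowI I v -> rowI J v.
  by move=> h; apply: (rowJI JE (w := 0)); rewrite scaler0 subr0.
split=> [hJ|[h0 h1] n0 en u hu].
  split=> [n0 en u hu|n0 en w hw].
    have [y hy] := hJ n0 en u (fun n1 => toJ _ _ (hu n1)).
    have [v hv] := rowJ JE hy.
    have cv n1 : rowI I (v *m E n n1).
      apply: (rowI_reg rx); have -> : x *: (v *m E n n1) = u *m E n n1 - (u - y *m E n0 n - x *: v) *m E n n1.
        by rewrite !mulmxBl -(mulmxA y) EE mulmx0 subr0 opprB addrC subrK -scalemxAl.
      by apply: (rowIB sI) => //; exact: (rowIM sI).
    have [y' hy'] := ext_killed sI mx_ en cv; exists (y + y').
    have -> : u - (y + y') *m E n0 n = (u - y *m E n0 n - x *: v) + (x *: v - y' *m E n0 n).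
      by rewrite mulmxDl opprD !addrA subrK.
    exact: (rowID sI).
  have e : n0 = n by lia.
  subst n0; have [y hy] := ext_killed sI mx_ en hw.
  have [|y2 hy2] := hJ (n - 1) (esym (subrK _ _)) y.
    move=> n1; have [en1|ne] := pselect (n1 = n + 1); last first.
      rewrite /E mx_shape ?trmx0 ?mulmx0; first by apply: toJ; exact: (rowI0 sI).
      by rewrite /dgn => h; apply: ne.
    subst n1; apply: (rowJI JE (w := w)).
    by rewrite -opprB; exact: (rowIN sI).
  have [v hv] := rowJ JE hy2; exists v.
  apply: (rowI_reg rx).
  have -> : x *: (w - v *m E n (n + 1)) = (x *: w - y *m E n (n + 1)) + (y - y2 *m E (n - 1) n - x *: v) *m E n (n + 1).
    by rewrite !mulmxBl -(mulmxA y2) EE mulmx0 subr0 addrA subrK scalerBr scalemxAl.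
  by apply: (rowID sI) => //; exact: (rowIM sI).
have [w hw] := rowJ JE (hu (n + 1)).
have cw n2 : rowI I (w *m E (n + 1) n2).
  apply: (rowI_reg rx).
  have -> : x *: (w *m E (n + 1) n2) = - ((u *m E n (n + 1) - x *: w) *m E (n + 1) n2).
    by rewrite mulmxBl -(mulmxA u) EE mulmx0 sub0r opprK scalemxAl.
  by apply: (rowIN sI); exact: (rowIM sI).
have [v hv] := h1 n erefl w cw.
have [|y hy] := h0 n0 en (u - x *: v).
  move=> n1; have [en1|ne] := pselect (n1 = n + 1); last first.
    rewrite /E mx_shape ?trmx0 ?mulmx0; first exact: (rowI0 sI).
    by rewrite /dgn => h; apply: ne.
  subst n1; have -> : (u - x *: v) *m E n (n + 1) = (u *m E n (n + 1) - x *: w) + x *: (w - v *m E n (n + 1)).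
    by rewrite mulmxBl scalerBr addrA subrK scalemxAl.
  by apply: (rowID sI) => //; exact: (rowIZ sI).
exists y; apply: (rowJI JE (w := v)); by rewrite addrAC.
Qed.

Lemma hvan_exq (n : int) : hvan (fun z => z = 0) n <-> exq (dual P) n.
Proof.
have E0 m (v : 'rV[A]_m) : rowI (fun z => z = 0) v <-> v = 0.
  by split=> [h|-> p]; [apply/rowP => p; rewrite mxE; exact: h|rewrite mxE].
have dE i j : mx (dual P) i j = (-1) ^+ `|j|%N *: E i j by [].
have sK (m k : nat) (i : int) (B : 'M[A]_(m, k)) : (-1) ^+ `|i|%N *: ((-1) ^+ `|i|%N *: B) = B.
  by rewrite scalerA -expr2 sqrr_sign scale1r.
split=> [h u hu|h n0 en u hu].
  have [|y /E0/eqP] := h (n - 1) (esym (subrK _ _)) u.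
    by move=> n1; apply/E0; rewrite -(sK _ _ n1 (E n n1)) -dE -scalemxAr hu scaler0.
  by rewrite subr_eq0 => /eqP ->; exists ((-1) ^+ `|n|%N *: y); rewrite dE -scalemxAl -scalemxAr sK.
have [|y ->] := h u; first by move=> n1; rewrite dE -scalemxAr ((E0 _ _).1 (hu n1)) scaler0.
move: y; have -> : nx true n = n0 by rewrite /nx; lia.
move=> y; exists ((-1) ^+ `|n|%N *: y); apply/E0; apply/eqP; rewrite subr_eq0.
by rewrite -scalemxAl dE -scalemxAr.
Qed.

Lemma ideal_gen_ideal (s : seq A) : is_ideal (ideal_gen s).
Proof.
split=> [|x y [c ->] [d ->]|a x [c ->]].
- by exists (fun=> 0); rewrite big1 // => i _; rewrite mul0r.
- by exists (fun i => c i + d i); rewrite -big_split; apply: eq_bigr => i _; rewrite mulrDl.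
by exists (fun i => a * c i); rewrite mulr_sumr; apply: eq_bigr => i _; rewrite mulrA.
Qed.

Lemma ideal_gen_nil (z : A) : ideal_gen [::] z <-> z = 0.
Proof. by split=> [[c ->]|->]; [rewrite big_ord0|case: (ideal_gen_ideal [::])]. Qed.

Lemma ideal_gen_rcons (s : seq A) x (z : A) : ideal_gen (rcons s x) z <-> exists w, ideal_gen s (z - x * w).
Proof.
split=> [[c ->]|[w [c e]]].
  move: c; rewrite size_rcons => c; exists (c ord_max).
  rewrite big_ord_recr /= nth_rcons ltnn eqxx [c _ * x]mulrC addrK.
  exists (fun i => c (widen_ord (leqnSn _) i)); apply: eq_bigr => i _ /=.
  by rewrite nth_rcons ltn_ord.
rewrite /ideal_gen /= size_rcons.
exists (fun i => if (i < size s)%N then oapp c 0 (insub (i : nat)) else w).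
rewrite -[LHS](subrK (x * w) z) e big_ord_recr /= nth_rcons ltnn eqxx [w * x]mulrC; congr (_ + _).
by apply: eq_bigr => i _; rewrite nth_rcons /= ltn_ord (valK i).
Qed.

Lemma regular_seq_max (s : seq A) : regular_seq s -> forall z, ideal_gen s z -> max_ideal z.
Proof.
move=> rs z [c ->]; apply: maxI_sum => // i _; apply: maxIM => //; exact: (rs i (ltn_ord i)).1.
Qed.

Lemma regular_seq_rcons (s : seq A) x : regular_seq s -> max_ideal x ->
  (forall y, ideal_gen s (x * y) -> ideal_gen s y) -> regular_seq (rcons s x).
Proof.
move=> rs mx_ rx i; rewrite size_rcons ltnS leq_eqVlt => /orP[/eqP ->|lt].
  by rewrite nth_rcons ltnn eqxx -cats1 take_size_cat.
by rewrite nth_rcons lt -cats1 takel_cat ?(ltnW lt) //; exact: rs.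
Qed.

(* Rees: Ext(k, A / (x_1, ..., x_k)) is Ext(k, A) shifted by k. *)
Lemma hvan_seq (s : seq A) : regular_seq s -> forall k, (k <= size s)%N -> forall n : int,
  hvan (ideal_gen (take k s)) n <-> forall i : int, n <= i <= n + k%:Z -> hvan (fun z => z = 0) i.
Proof.
move=> rs; elim=> [|k IH] ks n.
  rewrite take0; have -> : ideal_gen [::] = (fun z : A => z = 0).
    by apply/funext => z; apply/propext; exact: ideal_gen_nil.
  by split=> [h i hi|h]; [have -> : i = n by lia|apply: h; lia].
have [mk rk_] := rs k ks.
have JE z : ideal_gen (take k.+1 s) z <-> exists w, ideal_gen (take k s) (z - s`_k * w).
  by rewrite (take_nth 0) //; exact: ideal_gen_rcons.
rewrite (hvan_regular n (ideal_gen_ideal _) mk rk_ JE) !IH ?(ltnW ks) //.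
split=> [[h1 h2] i hi|h].
  by have [/h1//|h'] := pselect (n <= i <= n + k%:Z); apply: h2; lia.
by split=> i hi; apply: h; lia.
Qed.

(** Noetherian induction on the ideal generated so far: either a further regular element strictly
    enlarges it, or every element of the maximal ideal is a zero divisor and [socle] provides
    [e]. *)
Lemma regular_seq_maximal : exists s : seq A, regular_seq s /\ exists e, ~ ideal_gen s e /\
  forall x, max_ideal x -> ideal_gen s (x * e).
Proof.
suff H (K : submod_pred A^o) : forall s : seq A, regular_seq s -> (forall z : A, K z <-> ideal_gen s z) ->
    exists s : seq A, regular_seq s /\ exists e, ~ ideal_gen s e /\
    forall x, max_ideal x -> ideal_gen s (x * e).
  by apply: (H (SubmodPred (zero_ideal A)) [::]) => // z; rewrite ideal_gen_nil.
move: K; apply: (ideal_ind nA) => K IH s rs sK.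
have [zd|] := pselect (forall x, max_ideal x -> exists y, K (x * y) /\ ~ K y).
  have [e [ne me]] := socle nA lA zd; exists s; split=> //; exists e.
  by split=> [/sK|x /me /sK].
move=> /existsNP[x] /not_implyP[mx_ nx_].
have rx y : ideal_gen s (x * y) -> ideal_gen s y.
  by move=> /sK h; apply/sK; apply: contrapT => ny; apply: nx_; exists y.
have sJ : submodule (ideal_gen (rcons s x) : A^o -> Prop).
  have [h0 hD hM] := ideal_gen_ideal (rcons s x); split=> // a y z hy hz; apply: hD => //; exact: hM.
have inJ z : ideal_gen s z -> ideal_gen (rcons s x) z.
  by move=> h; apply/ideal_gen_rcons; exists 0; rewrite mulr0 subr0.
apply: (IH (SubmodPred sJ) _ _ (rcons s x)) => //; first by move=> z /sK /inJ.
  exists x; first by apply/ideal_gen_rcons; exists 1; rewrite mulr1 subrr; case: (ideal_gen_ideal s).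
  move=> /sK h; have : ideal_gen s (1 : A) by apply: rx; rewrite mulr1.
  by move=> /(regular_seq_max rs); apply: unit_max => //; exact: unitr1.
exact: regular_seq_rcons.
Qed.

Lemma depth_ext : (forall i : int, i < (depth A)%:Z -> exq (dual P) i) /\ ~ exq (dual P) (depth A)%:Z.
Proof.
have [s [rs [e [ne me]]]] := regular_seq_maximal.
have low (t : seq A) : regular_seq t -> forall i : int, i < (size t)%:Z -> hvan (fun z => z = 0) i.
  (* Rees is applied in degree -1, where vanishing for the quotient is automatic; it yields
     vanishing for [A] itself in degrees -1 to [size t - 1]. *)
  move=> rt i hi; have := (hvan_seq rt (leqnn _) (-1)).1 (@hvan_neg (ideal_gen (take (size t) t)) (-1) (ltrN10 _)) i.
  have [i0 _|ni h] := pselect (i < 0); first exact: hvan_neg.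
  by apply: h => //; lia.
have nh : ~ hvan (fun z => z = 0) (size s)%:Z.
  move=> h; apply: (not_hvan0 (ideal_gen_ideal s) ne me).
  have := (hvan_seq rs (leqnn _) 0).2; rewrite take_size; apply=> i hi.
  by have [->//|ni] := pselect (i = (size s)%:Z); apply: (low s rs); lia.
have up (t : seq A) : regular_seq t -> (size t <= size s)%N.
  by move=> rt; rewrite leqNgt; apply/negP => h; apply: nh; apply: (low t rt); lia.
have -> : depth A = size s.
  rewrite /depth; case: xgetP => [m _ [[t rt <-] hm]|/(_ (size s)) []]; last by split=> //; exists s.
  by apply/eqP; rewrite eqn_leq up //=; exact: hm.
by split=> [i hi|/hvan_exq//]; apply/hvan_exq; exact: (low s rs).
Qed.
End Rees.

(** * Comparison of factorizations *)

Section Transport.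
Variables (A : comUnitRingType) (Z : cplx A).
Definition zc (i k : int) : {linear Z i -> Z k} := dfam (chain_id Z) i k.
Lemma zcE i x : zc i i x = x. Proof. by rewrite /zc dfamE. Qed.
Lemma zc_diff (i k i' k' : int) x : i = k -> i' = k' -> diff Z k k' (zc i k x) = zc i' k' (diff Z i i' x).
Proof. by move=> e e'; subst k k'; rewrite !zcE. Qed.
Lemma zc_comp (i k m : int) x : i = k -> zc k m (zc i k x) = zc i m x.
Proof. by move=> e; subst k; rewrite zcE. Qed.
Lemma zc_inj (i k : int) : i = k -> injective (zc i k).
Proof. by move=> e; subst k => x y; rewrite !zcE. Qed.
End Transport.

Lemma shift_shift (A : comUnitRingType) (Z : cplx A) (d e g : int) : d + e = g ->
  exists f : chain_map (shift d (shift e Z)) (shift g Z), quasi_iso f.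
Proof.
move=> h; have eq i : i - d - e = i - g by lia.
have ax (i j : int) (x : shift d (shift e Z) i) : zc Z (j - d - e) (j - g) (diff (shift d (shift e Z)) i j x) =
    diff (shift g Z) i j (zc Z (i - d - e) (i - g) x).
  rewrite !sg_shift (raddf_sg (zc Z _ _)) (raddf_sg (zc Z _ _)) -sg_deg h; congr (sg g _).
  by symmetry; apply: zc_diff.
exists (@ChainMap A (shift d (shift e Z)) (shift g Z) (fun i => zc Z (i - d - e) (i - g)) ax).
apply: qi_inj_surj => n /=.
  by apply: zc_inj.
by move=> y; exists (zc Z (n - g) (n - d - e) y); rewrite zc_comp ?zcE // eq.
Qed.

Lemma shift0_qi (A : comUnitRingType) (Z : cplx A) (d : int) : d = 0 ->
  exists f : chain_map (shift d Z) Z, quasi_iso f.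
Proof.
move=> h; have eq i : i - d = i by lia.
have ax (i j : int) (x : shift d Z i) : zc Z (j - d) j (diff (shift d Z) i j x) = diff Z i j (zc Z (i - d) i x).
  have sd (V : zmodType) (y : V) : sg d y = y by rewrite h.
  rewrite sg_shift sd.
  by symmetry; apply: zc_diff.
exists (@ChainMap A (shift d Z) Z (fun i => zc Z (i - d) i) ax).
apply: qi_inj_surj => n /=.
  by apply: zc_inj.
by move=> y; exists (zc Z n (n - d) y); rewrite zc_comp ?zcE // eq.
Qed.

Lemma shift_map_qi (A : comUnitRingType) (X Y : cplx A) (f : chain_map X Y) d : quasi_iso f ->
  exists g : chain_map (shift d X) (shift d Y), quasi_iso g.
Proof.
move=> qf; have ax (i j : int) (x : shift d X i) : f (j - d) (diff (shift d X) i j x) = diff (shift d Y) i j (f (i - d) x).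
  by rewrite !sg_shift (raddf_sg (f _)); congr (sg _ _); exact: chain_funP.
exists (@ChainMap A (shift d X) (shift d Y) (fun i => f (i - d)) ax) => n; have [inj sur] := qf (n - d).
split=> [x /shift_cyc cx /shift_bnd bx|y /shift_cyc cy]; first by apply/shift_bnd; exact: inj.
by have [x cx bx] := sur y cy; exists x; [exact/shift_cyc|exact/shift_bnd].
Qed.

Lemma diso_shift (A : comUnitRingType) (X Y : cplx A) d : diso X Y -> diso (shift d X) (shift d Y).
Proof.
elim=> {X Y} [X Y [f qf]|X|X Y _ |X Y Z _ h1 _ h2].
- by have [g qg] := shift_map_qi d qf; exact: diso_qi qg.
- exact: diso_refl.
- exact: diso_sym.
exact: diso_trans h1 h2.
Qed.

Lemma fte_shift s (A : comUnitRingType) (P : fx s A) (Y : cplx A) (e : int) :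
  exists f : chain_map (P ⊙ shift e Y) (shift e (P ⊙ Y)), quasi_iso f.
Proof.
pose F n (u : (P ⊙ shift e Y) n) : tfam P Y := fun a k p => zc Y (k + e - e) k (u a (k + e) p).
have Fs n u (a k : int) p : dgn s a + k <> n - e -> F n u a k p = 0.
  by move=> h; rewrite /F ffP ?linear0 //; lia.
pose G n u : shift e (P ⊙ Y) n := @Ften _ _ P Y (n - e) (F n u) (Fs n u).
have Gl n : linear (@G n).
  by move=> c u v; apply: ften_eq => a k p; rewrite ftenDE ftenZE /= /F ftenDE ftenZE linearP.
pose GL n : {linear (P ⊙ shift e Y) n -> shift e (P ⊙ Y) n} := HB.pack (@G n) (GRing.isLinear.Build A _ _ _ (@G n) (@Gl n)).
have ax (n m : int) u : GL m (diff _ n m u) = diff (shift e (P ⊙ Y)) n m (GL n u).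
  rewrite sg_shift; apply: ften_eq => a k p; rewrite /= /F.
  have sgE (v : (P ⊙ Y) (m - e)) : (sg e v : ften P Y _) a k p = sg e (v a k p) by rewrite /sg; case: odd.
  rewrite sgE !ften_diffE; have -> : (n - e == m - e + 1) = (n == m + 1).
    by apply/eqP/eqP; lia.
  case: eqP => _; last by rewrite sg_zero linear0.
  rewrite /tdiff linearD /= sg_add; congr (_ + _).
    rewrite (raddf_sg (zc Y _ _)) -sg_deg (@sg_par _ (k + e) (e + k)); last by rewrite addrC.
    by congr (sg _ _); exact: linear_mact.
  rewrite sg_scale (raddf_sg (zc Y _ _)); congr sg.
  suff H m' : m' = k + e + 1 -> diff Y (k + 1) k (zc Y (m' - e) (k + 1) (u a m' p)) =
      zc Y (k + e - e) k (diff Y (k + e + 1 - e) (k + e - e) (u a (k + e + 1) p)).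
    by symmetry; apply: (H (k + 1 + e)); lia.
  by move=> ->; apply: zc_diff; lia.
exists (@ChainMap A (P ⊙ shift e Y) (shift e (P ⊙ Y)) GL ax).
apply: qi_inj_surj => n.
  move=> u v /= h; apply: ften_eq => a j p.
  suff H m : j = m + e -> u a j p = v a j p by apply: (H (j - e)); lia.
  move=> ej; subst j; have em : m + e - e = m by lia.
  apply: (zc_inj (Z := Y) em); exact: (congr1 (fun w : shift e (P ⊙ Y) n => (w : ften P Y _) a m p) h).
move=> w; pose v : tfam P (shift e Y) := fun a j p => (w : ften P Y _) a (j - e) p.
have vs (a j : int) p : dgn s a + j <> n -> v a j p = 0 by move=> h; rewrite /v ffP //; lia.
exists (@Ften _ _ P (shift e Y) n v vs); apply: ften_eq => a k p; rewrite /= /F /= /v.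
suff H m : m = k -> zc Y m k ((w : ften P Y _) a m p) = (w : ften P Y _) a k p by apply: H; lia.
by move=> em; subst m; rewrite zcE.
Qed.

Section OneDegree.
Variables (S : comUnitRingType) (l : fieldType) (sigma : {rmorphism S -> l}).
Hypothesis sK : forall x, max_ideal x -> sigma x = 0.
(* Matching Bass numbers force a minimal complex [N] with [J] isomorphic to
   Hom(N, C) to have rank one, in a single degree. *)
Lemma one_degree (J C T : cplx S) (N : fx false S) (f : chain_map T J) (h : chain_map T (N ⋔ C))
    (b c c' e cm : int) (mu : int -> nat) :
  (forall i, injective_module (J i)) -> (forall j : int, c' < j -> forall x : J j, x = 0) ->
  (forall i, injective_module (C i)) -> (forall j : int, c < j -> forall x : C j, x = 0) ->
  (forall i : int, i < b -> rk N i = 0%N) ->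
  (forall i j p q, max_ideal (mx N i j p q) \/ (mx N i j p q = 0)) ->
  quasi_iso f -> quasi_iso h ->
  (exists t, mu t <> 0%N) -> (forall t : int, cm < t -> mu t = 0%N) ->
  (forall t, hrank (coext_cplx sigma C) t (mu t)) ->
  (forall t, hrank (coext_cplx sigma J) t (mu (t - e))) ->
  rk N (- e) = 1%N /\ forall a, a <> - e -> rk N a = 0%N.
Proof.
move=> iJ bJ iC bC Nb Nmin qf qh mu0 muc hC hJ.
have kJ := bounded_injectives iJ bJ.
have kNC : K_injective (N ⋔ C).
  apply: (@bounded_injectives _ _ (c - b)) => j; first exact: fte_injective.
  move=> cj x; apply: ften_eq => a k p; have [ea|/ffP->//] := pselect (dgn true a + k = j).
  have [ab|ab] := pselect (a < b); first by apply: (False_ind _ (no_ord _ p)); exact: Nb.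
  by apply: bC; move: ea; rewrite /dgn; lia.
have [h' hh'] := Kinj_chain kNC h qf.
have qh' : quasi_iso h' by apply: (qi_cancel_right (homotopic_hom_eq hh') qf).
apply: (@zmx_shift l (@field_local l) (bc sigma (dual N)) (coext_cplx sigma C) mu b cm e) => //.
- move=> i j; apply/matrixP => p q; rewrite !mxE rmorphM.
  by case: (Nmin j i q p) => [/sK ->|->]; rewrite ?rmorph0 mulr0.
move=> t; apply/(grank_qi _ t _ (cfte_qi sigma (dual N) C)).
by apply: (grank_qi _ t _ (coext_qi sigma kJ kNC qh')).1; exact: hJ.
Qed.
End OneDegree.

Lemma rmorph_factor (A F l : comUnitRingType) (pi : {rmorphism A -> F}) (tau : {rmorphism A -> l}) :
  (forall z, exists y, pi y = z) -> (forall y, pi y = 0 -> tau y = 0) ->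
  exists sigma : {rmorphism F -> l}, forall x, tau x = sigma (pi x).
Proof.
move=> pS pK; have [g gK] := choice pS.
have gE x : tau (g (pi x)) = tau x.
  by apply/eqP; rewrite -subr_eq0 -rmorphB; apply/eqP/pK; rewrite rmorphB /= gK subrr.
pose sg_ z := tau (g z).
have sB : zmod_morphism sg_.
  by move=> x y; rewrite /sg_ -rmorphB /= -[RHS]gE rmorphB /= !gK.
have sM : monoid_morphism sg_.
  split; first by rewrite /sg_ -(rmorph1 pi) gE rmorph1.
  by move=> x y; rewrite /sg_ -rmorphM /= -[RHS]gE rmorphM /= !gK.
pose sig : {rmorphism F -> l} := HB.pack sg_ (GRing.isZmodMorphism.Build F l sg_ sB)
  (GRing.isMonoidMorphism.Build F l sg_ sM).
by exists sig => x; rewrite /= /sg_ gE.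
Qed.

Lemma module_finite_comp (A B C : comUnitRingType) (psi : {rmorphism A -> B}) (sigma : {rmorphism B -> C})
    (tau : {rmorphism A -> C}) : (forall x, tau x = sigma (psi x)) -> (forall z, exists y, sigma y = z) ->
  module_finite psi -> module_finite tau.
Proof.
move=> e sS [s sP]; exists (map sigma s) => z; have [y <-] := sS z; have [c ->] := sP y.
rewrite size_map; exists c; rewrite rmorph_sum; apply: eq_bigr => i _.
by rewrite rmorphM -e (nth_map 0).
Qed.

Lemma module_finite_factor (A F l : comUnitRingType) (pi : {rmorphism A -> F}) (sigma : {rmorphism F -> l})
    (tau : {rmorphism A -> l}) : (forall x, tau x = sigma (pi x)) -> module_finite tau -> module_finite sigma.
Proof.
by move=> e [s sP]; exists s => z; have [c ->] := sP z; exists (fun i => pi (c i)); apply: eq_bigr => i _; rewrite e.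
Qed.

Lemma local_ext_zero (R A l : comUnitRingType) (rho : {rmorphism R -> A}) (tau : {rmorphism A -> l}) :
  local_hom rho -> (forall x, max_ideal x -> tau x = 0) -> forall y, max_ideal_ext rho y -> tau y = 0.
Proof.
move=> lrho tK y [s [sm ->]]; rewrite rmorph_sum big_seq big1 // => p ps.
by rewrite rmorphM (tK (rho p.2)) ?mulr0 //; apply: lrho; exact: sm.
Qed.

Section Depth.
Variables (A : comUnitRingType) (nlA : noetherian_local A).
Variables (P : fx false A) (r : 'cV[A]_(rk P 0)).
Hypothesis Pr : res_field_res r.
Lemma bass_depth (nu : int -> nat) : (forall t, hrank (P ⋔ stalk A^o) t (nu t)) ->
  nu (- (depth A)%:Z) <> 0%N /\ forall t : int, - (depth A)%:Z < t -> nu t = 0%N.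
Proof.
have [nA lA] := nlA => hnu; have [lo hi] := depth_ext nA lA Pr.
have E t : nu t = 0%N <-> exq (dual P) (- t).
  have et : dgn true (- t) = t by rewrite /dgn opprK.
  rewrite (exq_stalk _ et) -/(acyc _ t) -hrank0; split=> [<-//|h].
  exact: (hrank_uniq lA (hnu t) h).
split=> [/E|t ht]; first by rewrite opprK.
by apply/E/lo; lia.
Qed.

(** Only finiteness is at stake: Hom(k, I) is a complex of vector spaces over the residue field with
    finitely generated homology, so each homology space has a finite basis. *)
Lemma bass_numbers : exists mu : int -> nat, forall t, hrank (P ⋔ stalk A^o) t (mu t).
Proof.
have [nA lA] := nlA; have gf := gor_fibre_id nlA (res_piP lA).
have [g qg] := fibre_resolution gf Pr; have Gb := rf_neg Pr.
pose I := ires A^o; have fC := @dual_fgh _ _ (res_pi lA) nA I _ (@ires_Kinj A A^o) (@ires_qi A A^o) (fone _ 0) (bc idfun P) 0 g Gb qg.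
suff H t : exists n, hrank (P ⋔ stalk A^o) t n by have [mu hmu] := choice H; exists mu.
have [n hn] := field_hrank fC t; exists n.
move: hn => /field_grank /(bass_fone gf Pr (@ires_Kinj A A^o) (@ires_qi A A^o)) h.
have [q qq] := bc_id_dual_qi P (stalk A^o).
apply: (grank_qi _ t n qq).1; apply: (grank_ext _ _ _ _).1 h => x; exact: (res_piP lA).2.
Qed.

Lemma bass_residue (l : fieldType) (tau : {rmorphism A -> l}) (I : cplx A) (iota : chain_map (stalk A^o) I) t n :
  residue_field tau -> K_injective I -> quasi_iso iota ->
  hrank (coext_cplx tau I) t n <-> hrank (P ⋔ stalk A^o) t n.
Proof.
move=> rt kI qI; have gf := gor_fibre_id nlA rt.
rewrite -field_grank -(bass_coext gf Pr kI qI).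
have [q qq] := bc_id_dual_qi P (stalk A^o); rewrite (grank_qi _ t n qq).
by apply: grank_ext => x; exact: rt.2.
Qed.
End Depth.

Lemma lift_qi (A : comUnitRingType) (X : fx false A) (b : int) (Y Z : cplx A)
    (f : chain_map Y Z) (g : chain_map (toc X) Z) :
  (forall i : int, i < b -> rk X i = 0%N) -> quasi_iso f -> quasi_iso g ->
  exists g' : chain_map (toc X) Y, quasi_iso g'.
Proof.
move=> Xb qf qg; have [g' h] := lift_chain g Xb qf; exists g'.
exact: (qi_cancel_left (homotopic_hom_eq h) qf qg).
Qed.

Lemma stalk_toc_fone (A : comUnitRingType) : exists f : chain_map (stalk A^o) (toc (fone A 0)), quasi_iso f.
Proof.
pose f (x : A^o) : toc (fone A 0) 0 := (\row_(q < 1) (x : A) : 'rV[A]_1).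
have fl : linear f by move=> a x y; apply/rowP => q; rewrite !mxE.
pose fL : {linear A^o -> toc (fone A 0) 0} := HB.pack f (GRing.isLinear.Build A _ _ _ f fl).
have d0 n m (x : toc (fone A 0) n) : diff _ n m x = 0 by exact: mulmx0.
exists (@from_stalk A A^o (toc (fone A 0)) fL (fun j x => d0 _ j (fL x))).
apply: qi_inj_surj => n; have [->|nz] := pselect (n = 0).
- by move=> x y /= /rowP /(_ 0); rewrite !mxE.
- by move=> x y _; rewrite (stalk_triv x nz) (stalk_triv y nz).
- by move=> y; exists ((y : 'rV[A]_1) 0 0); apply/rowP => q; rewrite mxE ord1.
by move=> y; exists 0; rewrite linear0 (fone_triv nz y).
Qed.

Section Factor.
Variables (R A F S : comUnitRingType) (rho : {rmorphism R -> A}) (pi : {rmorphism A -> F}).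
Variables (psi : {rmorphism A -> S}) (phi : {rmorphism R -> S}).
Hypotheses (gf : gor_fibre rho pi) (ephi : forall x, phi x = psi (rho x)) (mf : module_finite psi).
Hypothesis nS : noetherian_local S.
Variables (P : fx false R) (r : 'cV[R]_(rk P 0)).
Hypothesis Pr : res_field_res r.
Let C := coext_cplx psi (ires A^o).
Let kI := @ires_Kinj A A^o.
Let qI := @ires_qi A A^o.

Lemma dualizing_inj i : injective_module (C i).
Proof. by apply: coext_injective; exact: ires_inj. Qed.
Lemma dualizing_bd (j : int) : 0 < j -> forall x : C j, x = 0.
Proof. by move=> h x; apply: coext_eq => b; exact: ires_bd. Qed.

(** By [fibre_tor] the hypothesis on [L] says that the fibre of its resolution over [A] is exact in
    high degrees, which is what biduality asks for; the same translation backwards gives the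
    conclusion for [N]. As [fdfin] is tested over [R], a complex obtained from one factorization is
    a valid input for another. *)
Lemma factor_bidual (L : fx false S) b :
  (forall i : int, i < b -> rk L i = 0%N) -> fdfin phi P (toc L) ->
  exists (N : fx false S) (b' : int) (n : chain_map (toc N) (L ⋔ C)) (f : chain_map (toc L) (N ⋔ C)),
    [/\ forall i : int, i < b' -> rk N i = 0%N, quasi_iso n, quasi_iso f,
        forall i j p q, max_ideal (mx N i j p q) \/ (mx N i j p q = 0) & fdfin phi P (toc N)].
Proof.
move=> Lb [t0 ht0]; have [nS' _] := nS.
have [G [g [Gb qg]]] := restr_free_resolution (gf_nA gf) mf (fgh_toc L nS') Lb.
have Gf a : t0 < a -> exq (bc pi G) a.
  by move=> /ht0 /(fibre_tor gf ephi Pr a Gb Lb qg).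
have [c lo] := dual_low gf kI qI Gb qg Gf.
have fLC := dual_fgh (gf_nA gf) kI qI Gb qg.
have [N [n [Nb qn Nmin]]] := free_resolution nS' fLC lo.
have [M [m [Mb qm]]] := restr_free_resolution (gf_nA gf) mf (fgh_toc N nS') Nb.
have qa := biduality gf kI qI Gb qg Gf qn qm Mb.
have [f' hf'] := dual_fibre_high gf kI qI Gb qg Gf qn qm Mb.
exists N, c, n, (adj n); split=> //; exists f' => t ht.
by apply/(fibre_tor gf ephi Pr t Mb Nb qm); exact: hf'.
Qed.

Lemma fdfin_fone : finite_fd phi -> fdfin phi P (toc (fone S 0)).
Proof.
move=> hfd; have [f qf] := stalk_toc_fone S.
apply/(fdfin_qi phi P (b := 0) qf); last exact: fdfin_ring Pr hfd.
  by move=> j j0 x; apply: stalk_triv; lia.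
by move=> j j0 x; apply: mx_no_col; exact: fone_bound.
Qed.

(** Dualising [L = S] in [factor_bidual]: Hom(S, C) is [C], so its resolution [N] is a bounded below
    free resolution of [C] that inherits finite flat dimension from [S]. *)
Lemma dualizing_resolution : finite_fd phi -> exists (L : fx false S) (b : int) (q : chain_map (toc L) C),
  [/\ forall i : int, i < b -> rk L i = 0%N, quasi_iso q & fdfin phi P (toc L)].
Proof.
move=> /fdfin_fone hfd.
have [L [b [n [f [Lb qn _ _ fdL]]]]] := factor_bidual (@fone_bound S 0) hfd.
have rk1 : rk (dual (fone S 0)) 0 = 1%N by [].
have rk0 a : a <> 0 -> rk (dual (fone S 0)) a = 0%N by move=> h /=; case: eqP.
have [s qs] := @shift0_qi S C (dgn (~~ false) 0) erefl.
exists L, b, (chain_comp s (chain_comp (one_map rk1 rk0 C) n)); split=> //.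
by apply: qi_comp qs; apply: qi_comp qn _; exact: one_qi rk1 rk0 C.
Qed.

Variables (l : fieldType) (sigma : {rmorphism S -> l}).
Hypotheses (rs : residue_field sigma) (psil : local_hom psi).

Lemma factor_bass : exists g0 : int, (injective_module (F^o : lmodType F) -> g0 = 0) /\
  forall mu : int -> nat, (forall t, hrank (P ⋔ stalk R^o) t (mu t)) ->
    forall t, hrank (coext_cplx sigma C) t (mu (t - g0)).
Proof.
pose tau : {rmorphism A -> l} := sigma \o psi.
have tK x : max_ideal x -> tau x = 0 by move=> /psil /rs.2.
have [sF etau] : exists sF : {rmorphism F -> l}, forall x, tau x = sF (pi x).
  apply: rmorph_factor (gf_surj gf) _ => y /(gf_ker gf).
  exact: (local_ext_zero (gf_local gf) tK).
have mft : module_finite tau by apply: module_finite_comp rs.1 mf.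
have [g0 [g00 hg]] := bass_base_change gf Pr etau (module_finite_factor etau mft).
exists g0; split=> // mu hmu t.
have e x : tau x = sigma (psi x) by [].
apply/(grank_qi _ t _ (ccomp_qi e (ires A^o))).
exact: (hg mu (ires A^o) (ires_map A^o) 0 hmu (@ires_inj A A^o) (@ires_bd A A^o) qI).
Qed.

(* J plays the role of RHom(S, A') for another factorization through A'. *)
Lemma factor_compare (mu : int -> nat) (g1 g2 : int) (L : fx false S) b (T J : cplx S)
    (j : chain_map T J) (q : chain_map T (toc L)) (c' cm : int) :
  (forall t, hrank (coext_cplx sigma C) t (mu (t - g2))) ->
  (forall t, hrank (coext_cplx sigma J) t (mu (t - g1))) ->
  (exists t, mu t <> 0%N) -> (forall t : int, cm < t -> mu t = 0%N) ->
  (forall i, injective_module (J i)) -> (forall j : int, c' < j -> forall x : J j, x = 0) ->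
  quasi_iso j -> quasi_iso q ->
  (forall i : int, i < b -> rk L i = 0%N) -> fdfin phi P (toc L) ->
  exists f : chain_map (toc L) (shift (g1 - g2) C), quasi_iso f.
Proof.
move=> hC hJ [t0 mu0] muc iJ bJ qj qq Lb fdL.
have [N [b' [n [f [Nb qn qf Nmin _]]]]] := factor_bidual Lb fdL.
have sK x : max_ideal x -> sigma x = 0 by move/rs.2.
(* The Bass numbers of [C], that is [mu] shifted by [g2], serve as the reference sequence; relative
   to it those of [J] are shifted by [g1 - g2]. *)
have [||||rk1 rk0] := one_degree sK (e := g1 - g2) (cm := cm + g2) (mu := fun t => mu (t - g2))
  iJ bJ dualizing_inj dualizing_bd Nb Nmin qj (qi_comp qq qf).
- by exists (t0 + g2); rewrite addrK.
- by move=> t ht; apply: muc; lia.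
- exact: hC.
- by move=> t; have -> : t - (g1 - g2) - g2 = t - g1 by lia.
have ed : dgn (~~ false) (- (g1 - g2)) = g1 - g2 by rewrite /dgn /= opprK.
rewrite -[X in shift X]ed; exists (chain_comp (@one_map _ _ (dual N) (- (g1 - g2)) rk1 rk0 C) f).
by apply: qi_comp qf _; exact: one_qi.
Qed.
End Factor.

(** * Tensoring with a free resolution of X *)

Section TensorCone.
Variables (R A F : comUnitRingType) (rho : {rmorphism R -> A}) (pi : {rmorphism A -> F}).
Hypothesis gf : gor_fibre rho pi.
Variables (PX : fx false R) (b s : int).
Hypotheses (Pb : forall i : int, i < b -> rk PX i = 0%N) (Ps : forall a : int, s < a -> exq PX a).
Let P := bc rho PX.
Let H a a0 : 'M[A]_(rk PX a0, rk PX a) := (map_mx rho (mx PX a a0))^T.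

Fact full_ax n : submodule (fun _ : 'rV[R]_n => True). Proof. by []. Qed.
Lemma extm_im m n (K : submod_pred 'rV[R]_n) (h : 'M[R]_(m, n)) q (w : 'M[A]_(m, q)) :
  (forall v, K (v *m h)) -> extm rho K ((map_mx rho h)^T *m w).
Proof.
move=> hK; apply: (extm_map (K1 := SubmodPred (full_ax m))) => [v _|j]; first exact: hK.
exists m, (fun l => delta_mx 0 l), (fun l => w l j); split=> // i.
rewrite (bigD1 i) //= mxE !eqxx rmorph1 scale1r big1 ?addr0 // => k /negbTE ki.
by rewrite mxE eqxx eq_sym ki rmorph0 scale0r.
Qed.

Lemma extm_exact a q (x : 'M[A]_(rk PX a, q)) : s < a ->
  extm rho (preim_sub (zero_sub R _) (mx PX a (a - 1))) x -> exists z, x = H (a + 1) a *m z.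
Proof.
move=> sa hx; have [|w hw] := extm_decomp (K := zero_sub R _) (h := mx PX (a + 1) a) _ hx.
  move=> v hv; have [|y ->] := @Ps _ sa v.
    move=> a'; have [e|ne] := pselect (a = a' + 1); last by rewrite mx_shape ?mulmx0.
    by have -> : a' = a - 1 by lia.
  by exists y; rewrite /= subrr.
by exists w; apply/eqP; rewrite -subr_eq0; apply/eqP; exact: extm_zero hw.
Qed.

Lemma flat_cols a q (x : 'M[A]_(rk PX a, q)) : s < a -> H a (a - 1) *m x = 0 -> exists z, x = H (a + 1) a *m z.
Proof.
move=> sa hx; apply: extm_exact => //.
apply: (flat_extm (gf_flat gf) (K := zero_sub R _) (h := mx PX a (a - 1))) => //.
rewrite -/(H a (a - 1)) hx; exact: extm0.
Qed.

Variable W : fx false A.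
Hypothesis exW : forall a, exall rho W a.

Lemma tens_finite n m (u : (P ⊙ toc W) n) : is_cycle u ->
  (forall (a j : int) p, b + m%:Z <= a -> u a j p = 0) -> is_boundary u.
Proof.
elim: m u => [|m IH] u cu u0.
  have -> : u = 0; last exact: bnd0.
  apply: ften_eq => a j p; have [h|h] := pselect (a < b); last by apply: u0; lia.
  by case: (no_ord (Pb h) p).
pose a0 := b + m%:Z; pose j0 := n - a0.
have up (a j : int) p : a0 < a -> u a j p = 0 by move=> h; apply: u0; rewrite /a0 in h; lia.
have H1 p : exists y : 'rV[A]_(rk W (nx false j0)), (u a0 j0 p : 'rV_(rk W j0)) = y *m mx W (nx false j0) j0.
  have hq : exq W j0 by apply/(exK_zero rho); exact: exW.
  apply: (@hq (u a0 j0 p : 'rV_(rk W j0))) => j'; have [e|ne] := pselect (j0 = j' + 1); last by rewrite mx_shape ?mulmx0.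
  have := (fte_cycP u).1 cu a0 j' p; rewrite /tdiff mact_eq0 ?sg_zero ?add0r; last first.
    by move=> q; apply: up; rewrite /nx; lia.
  by rewrite e.
have [y yE] := choice H1.
have ej : dgn false a0 + (j0 + 1) = n + 1 by rewrite /dgn /j0; lia.
pose v := @fsingle _ _ P (toc W) a0 (j0 + 1) (y : _ -> toc W (j0 + 1)) _ ej.
have vE p : v a0 (j0 + 1) p = y p by exact: (@fsingleE _ _ P (toc W) a0 (j0 + 1) (y : _ -> toc W (j0 + 1)) p).
apply: (bnd_sub (y := diff _ (n + 1) n v)); last exact: bnd_diff.
apply: IH => [|a j p ha]; first by apply: cycB => //; exact: cyc_diff.
rewrite ftenDE ftenNE fte_diffE eqxx /tdiff mact_eq0 ?sg_zero ?add0r; last first.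
  by move=> q; apply: fsingle0; left; rewrite /a0 /nx; lia.
have [ea|nea] := pselect (a0 = a); last first.
  rewrite up; last by rewrite /a0 in nea *; lia.
  have -> : v a (j + 1) p = 0 by apply: fsingle0; left.
  by rewrite linear0 subr0.
subst a; have [ejj|ne] := pselect (j0 = j); last first.
  rewrite (ffP u) ?sub0r; last by rewrite /dgn; rewrite /j0 in ne; lia.
  have -> : v a0 (j + 1) p = 0 by apply: fsingle0; right => e; apply: ne; lia.
  by rewrite linear0 oppr0.
by subst j; rewrite vE yE subrr.
Qed.

Lemma mact_mx a a0 j (x : 'M[A]_(rk PX a, rk W j)) p :
  mact (mx P a a0) (fun q => row q x : toc W j) p = row p (H a a0 *m x).
Proof.
rewrite row_mul; apply/rowP => k; rewrite /mact summxE !mxE; apply: eq_bigr => q _.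
by rewrite !mxE.
Qed.

(** From column [s0] on, a cycle is a boundary thanks to exactness of [PX] there, once the first of
    these columns has been dealt with; what is left lives in the finitely many columns from [b] to
    [s0] and is removed from the right by exactness of [W] ([tens_finite]). *)
Lemma tens_acyclic : acyclic (P ⊙ toc W).
Proof.
move=> n u cu; pose s0 := s + 1.
pose U a j : 'M[A]_(rk PX a, rk W j) := \matrix_(p, q) (u a j p : 'rV_(rk W j)) 0 q.
have Urow a j p : u a j p = row p (U a j) by apply/rowP => q; rewrite !mxE.
have Uc a j : sg j (H (a + 1) a *m U (a + 1) j) + U a (j + 1) *m mx W (j + 1) j = 0.
  apply/row_matrixP => p; rewrite linearD /= (raddf_sg (row p)) /= -mact_mx row_mul -Urow row0.
  have := (fte_cycP u).1 cu a j p; rewrite /tdiff.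
  by rewrite (_ : u (nx false a) j = (fun q => row q (U (a + 1) j))) //; apply/funext => q; exact: Urow.
pose T a := forall j : int, 'M[A]_(rk PX a, rk W j).
pose Inv a (t : T a) := forall j, a + j = n -> exists z, U a j - t (j + 1) *m mx W (j + 1) j = H (a + 1) a *m z.
pose Rel a a' (t : T a) (t' : T a') := forall j, a + j = n ->
  U a j - t (j + 1) *m mx W (j + 1) j = sg j (H a' a *m t' j).
have conc (a k : int) (y : 'M[A]_(rk PX a, rk W k)) : exists t : T a, t k = y.
  exists (fun k' => match pselect (k = k') with
    left e => eq_rect k (fun k => 'M[A]_(rk PX a, rk W k)) y k' e | right _ => 0 end).
  by case: pselect => // e; rewrite (Prop_irrelevance e erefl).
(* Column [s0] of the cycle is a cycle of [W] only modulo the cycles [K] of [PX], so exactness of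
   [W] is needed with coefficients in the quotient by [K]. The error then lies in the extension of
   [K], which by exactness of [PX] is the image of the next column. *)
have [t0 t0P] : exists t0 : T s0, Inv s0 t0.
  pose j := n - s0; pose K := preim_sub (zero_sub R _) (mx PX s0 (s0 - 1)).
  have [|y hy] := @exW j _ K (U s0 j).
    move=> a'; have [e|ne] := pselect (j = a' + 1); last first.
      by rewrite mx_shape ?mulmx0; [exact: extm0|].
    have := Uc s0 a'; rewrite -e addrC => /eqP; rewrite addr_eq0 => /eqP ->.
    apply: extmN; have hK : forall v, K (v *m mx PX (s0 + 1) s0) by move=> v /=; rewrite -mulmxA mx_mx mulmx0.
    have := extm_im (K := K) (U (s0 + 1) a') hK; rewrite -/(H (s0 + 1) s0) /sg.
    by case: odd => // h; exact: extmN.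
  have [t tE] := conc s0 (j + 1) y; exists t => j' ej'.
  have -> : j' = j by rewrite /j; lia.
  by rewrite tE; apply: extm_exact hy; rewrite /s0; lia.
have [dflt dE] : exists dflt : forall a, T a, dflt s0 = t0.
  exists (fun a => match pselect (s0 = a) with left e => eq_rect s0 T t0 a e | right _ => fun=> 0 end).
  by case: pselect => // e; rewrite (Prop_irrelevance e erefl).
have [||h [_ _ hR]] := @int_rec T dflt s0 Inv Rel.
- by rewrite dE.
- move=> a a' t ea sa hI; pose j := n - a; have ej : a + j = n by rewrite /j; lia.
  have := hI j ej; rewrite -ea => -[z hz]; have [t' tE] := conc a' j (sg j z); exists t'.
    move=> j1 e1; have -> : j1 = j by rewrite /j; lia.
    by rewrite tE hz -!raddf_sg sg_inv.
  move=> j' ej'; apply: flat_cols; first by rewrite ea; rewrite /s0 in sa; lia.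
  have ej1 : j' + 1 = j by rewrite /j; lia.
  rewrite ej1 tE mulmxBr.
  have -> : a' - 1 = a by rewrite ea; lia.
  have := Uc a j'; rewrite -ea ej1 => hc.
  have hU : U a j *m mx W j j' = H a' a *m z *m mx W j j'.
    by rewrite -hz mulmxBl -mulmxA mx_mx mulmx0 subr0.
  have sj (V : zmodType) (x : V) : sg j x = - sg j' x by rewrite -ej1 sg_succ.
  move: hc; rewrite hU sj mulNmx mulmxN opprK /sg; case: odd; rewrite ?mulNmx ?mulmxN mulmxA // => /eqP.
  by rewrite addrC subr_eq0 => /eqP ->; rewrite subrr.
pose y (a j : int) (p : 'I_(rk P a)) : toc W j :=
  if (s0 <= a) && (a + j == n + 1) then row p (h a j) else 0.
have ys (a j : int) p : dgn false a + j <> n + 1 -> y a j p = 0.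
  by move=> ne; rewrite /y; case: eqP => [e|_]; [case: ne|rewrite andbF].
pose Y : (P ⊙ toc W) (n + 1) := @Ften _ _ P (toc W) (n + 1) y ys.
apply: (bnd_sub (y := diff (P ⊙ toc W) (n + 1) n Y)); last exact: bnd_diff.
(* After subtracting the boundary of [Y] nothing is left in columns [s0] and beyond, so the number
   of columns to clear is [s0 - b]. *)
apply: (@tens_finite n (absz (s0 - b))); first by apply: cycB => //; exact: cyc_diff.
move=> a j p ha; have sa : s0 <= a by lia.
have [ej|ne] := pselect (a + j = n); last by rewrite ffP.
rewrite ftenDE ftenNE fte_diffE eqxx /tdiff; apply/eqP; rewrite subr_eq0; apply/eqP.
have yE a' j' p' : s0 <= a' -> a' + j' = n + 1 -> Y a' j' p' = row p' (h a' j').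
  by move=> sa' e'; rewrite -[LHS]/(y a' j' p') /y sa' e' eqxx.
have e1 : Y (nx false a) j = (fun q => row q (h (a + 1) j) : toc W j).
  by apply/funext => q; apply: (yE (a + 1)); lia.
have e2 : Y a (j + 1) p = row p (h a (j + 1)) by apply: yE; lia.
have := congr1 (row p) (hR a (a + 1) erefl sa j ej); rewrite (linearB (row p)) (raddf_sg (row p)) => /eqP.
rewrite subr_eq => /eqP e3; rewrite e1 e2 mact_mx Urow e3; congr (_ + _); exact: row_mul.
Qed.
End TensorCone.

Section ConeTensor.
Variables (A : comUnitRingType) (G M P : fx false A) (c : chain_map (toc M) (G ⋔ stalk A^o)).
Let W := fcone c.
Let N := G ⋔ stalk A^o.
Definition zfam (v : tfam P N) (u : tfam P (toc M)) : tfam P (toc W) := fun a j p =>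
  row_mx (\row_q ((v a j p : ften _ _ _) (- j) 0 q : A)) (u a (j - 1) p) : 'rV_(cone_rk G M j).

Arguments zfam v u a j p : clear implicits.

Lemma zfam_diff v u a j p : tdiff (zfam v (fun a j p => - u a j p)) a j p =
  row_mx (\row_q (((tdiff v a j p - c j (u a j p)) : ften _ _ _) (- j) 0 q : A)) (tdiff u a (j - 1) p) :> 'rV_(cone_rk G M j).
Proof.
have ej : j + 1 - 1 = j by lia.
have ej' : j - 1 + 1 = j by lia.
have tr i i' (w : tfam P (toc M)) k : i = i' -> (w a i p : 'rV_(rk M i)) *m mx M i k = (w a i' p : 'rV_(rk M i')) *m mx M i' k by move=> ->.
have tc i i' k : i = i' -> ((u a i p : 'rV_(rk M i)) *m cmx c i k) = ((u a i' p : 'rV_(rk M i')) *m cmx c i' k) by move=> ->.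
rewrite {1}/tdiff /= /cone_mx /zfam mul_row_block mulmx0 add0r !mulNmx mulmxN opprK.
rewrite (tr _ _ u _ ej) (tc _ _ _ ej).
have -> : mact (mx P (nx false a) a) (fun q => row_mx (\row_q0 ((v (nx false a) j q : ften _ _ _) (- j) 0 q0 : A))
    (- u (nx false a) (j - 1) q) : toc W j) p =
  row_mx (mact (mx P (nx false a) a) (fun q => (\row_q0 ((v (nx false a) j q : ften _ _ _) (- j) 0 q0 : A) : 'rV[A]_(rk G (- j)))) p)
    (- mact (mx P (nx false a) a) (u (nx false a) (j - 1)) p) :> 'rV_(cone_rk G M j).
  rewrite -(mactN (M := toc M (j - 1))) /mact.
  elim/big_rec3: _ => [|q x y z _ ->]; first by rewrite row_mx0.
  by rewrite scale_row_mx add_row_mx.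
have sr m n k (x : 'rV[A]_m) (y : 'rV[A]_n) : sg k (row_mx x y) = row_mx (sg k x) (sg k y).
  by rewrite /sg; case: odd => //; rewrite opp_row_mx.
rewrite sr add_row_mx; congr row_mx; last first.
  rewrite /tdiff sg_opp -sg_pred; congr (_ + _).
  exact: (tr _ _ u _ (esym ej')).
have d1 q : (tdiff v a j p : ften _ _ _) (- j) 0 q =
    sg j (mact (mx P (nx false a) a) (fun r => (v (nx false a) j r : ften _ _ _) (- j) 0 q : A^o) p) +
    mact (mx (dual G) (- (j + 1)) (- j)) ((v a (j + 1) p : ften _ _ _) (- (j + 1)) 0 : _ -> A^o) q :> A.
  rewrite tdiff_ev; congr (_ + _); rewrite stalk_tdiff.
  by rewrite (_ : nx (~~ false) (- j) = - (j + 1)) // /nx /=; lia.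
have sE m k (x : 'rV[A]_m) q : (sg k x) 0 q = sg k (x 0 q) by rewrite /sg; case: odd; rewrite ?mxE.
apply/rowP => q; rewrite [RHS]mxE [LHS]mxE sE.
transitivity ((tdiff v a j p : ften _ _ _) (- j) 0 q - ((c j (u a j p)) : ften _ _ _) (- j) 0 q : A); last by [].
have mD m (x y : 'rV[A]_m) k : (x - y) 0 k = x 0 k - y 0 k by rewrite !mxE.
rewrite cmxE d1 -addrA mD; congr (_ + (_ - _)); last by rewrite mact_rowv.
congr sg; rewrite /mact summxE; apply: eq_bigr => r _; by rewrite !mxE.
Qed.

Lemma zfam_rows (w : tfam P (toc W)) : exists (v : tfam P N) (u : tfam P (toc M)),
  (forall a j p, w a j p = zfam v (fun a j p => - u a j p) a j p) /\
  forall n, (forall (a j : int) p, dgn false a + j <> n + 1 -> w a j p = 0) ->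
    (forall (a j : int) p, dgn false a + j <> n + 1 -> v a j p = 0) /\
  (forall (a j : int) p, dgn false a + j <> n -> u a j p = 0).
Proof.
have ej j : dgn true (- j) + 0 = j by rewrite /dgn opprK addr0.
pose v a j p : N j := @fsingle _ _ (dual G) (stalk A^o) (- j) 0
  (fun q => (lsubmx (w a j p : 'rV_(cone_rk G M j))) 0 q : A^o) j (ej j).
pose u a j p : toc M j := - zc (toc M) (j + 1 - 1) j (rsubmx (w a (j + 1) p : 'rV_(cone_rk G M (j + 1)))).
have vE a j p q : (v a j p : ften _ _ _) (- j) 0 q = (lsubmx (w a j p : 'rV_(cone_rk G M j))) 0 q :> A.
  exact: (@fsingleE _ _ (dual G) (stalk A^o) (- j) 0 (fun q => (lsubmx (w a j p : 'rV_(cone_rk G M j))) 0 q : A^o) q).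
exists v, u; split=> [a j p|n w0].
  rewrite /zfam -[LHS](hsubmxK (w a j p : 'rV_(cone_rk G M j))); congr row_mx.
    by apply/rowP => q; rewrite [RHS]mxE; exact/esym/vE.
  rewrite /u opprK; suff H k : k = j -> rsubmx (w a j p : 'rV_(cone_rk G M j)) =
      zc (toc M) (k - 1) (j - 1) (rsubmx (w a k p : 'rV_(cone_rk G M k))) by apply: H; lia.
  by move=> ->; rewrite zcE.
split=> a j p ne.
  apply: (stalk_ext (a := - j)) => [|q]; first by rewrite /dgn opprK.
  by apply: etrans (vE a j p q) _; rewrite w0 // mxE mxE.
rewrite /u w0; first by rewrite (_ : rsubmx _ = 0) ?linear0 ?oppr0 //; apply/rowP => q; rewrite !mxE.
by rewrite /dgn in ne *; lia.
Qed.

(** An element of P (x) cone is a pair of families [v] and [u] ([zfam]); a pair with [d v = c u] and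
    [d u = 0] becomes a cycle after negating [u], and bounding it gives both halves of the
    quasi-isomorphism. *)
Lemma cone_tensor_qi : acyclic (P ⊙ toc W) -> quasi_iso (fte_map P c).
Proof.
move=> acW n.
have zb (v : tfam P N) (u : tfam P (toc M)) (m m1 : int) : m1 = m + 1 ->
    (forall (a j : int) p, dgn false a + j <> m1 -> v a j p = 0) ->
    (forall (a j : int) p, dgn false a + j <> m -> u a j p = 0) ->
    (forall a j p, tdiff u a j p = 0) -> (forall a j p, tdiff v a j p = c j (u a j p)) ->
  exists (v2 : (P ⊙ N) (m1 + 1)) (u2 : (P ⊙ toc M) m1),
    (forall a j p, v a j p = tdiff v2 a j p - c j (u2 a j p)) /\ (forall a j p, - u a j p = tdiff u2 a j p).
  move=> em v0 u0 du dv; pose z := zfam v (fun a j p => - u a j p).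
  have zs (a j : int) p : dgn false a + j <> m1 -> z a j p = 0.
    move=> ne; rewrite /z /zfam u0 ?v0 ?oppr0; last by rewrite /dgn in ne *; lia.
      by rewrite -[RHS]row_mx0; congr row_mx; apply/rowP => q; rewrite !mxE.
    by [].
  have [|w wz] := acW _ (@Ften _ _ P (toc W) m1 z zs).
    apply/fte_cycP => a j p; rewrite [LHS]zfam_diff dv subrr du.
    by rewrite -[RHS]row_mx0; congr row_mx; apply/rowP => q; rewrite !mxE.
  have [v2 [u2 [wE /(_ m1 (ffP w)) [v20 u20]]]] := zfam_rows w.
  exists (Ften v20), (Ften u20).
  have H a j p : z a j p = tdiff (zfam v2 (fun a j p => - u2 a j p)) a j p.
    rewrite -[LHS]/(@Ften _ _ P (toc W) m1 z zs a j p) -wz fte_diffE eqxx.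
    by congr (tdiff _ a j p); apply: tfam_eq.
  have H2 a j p : row_mx (\row_q ((v a j p : ften _ _ _) (- j) 0 q : A)) (- u a (j - 1) p) =
     row_mx (\row_q (((tdiff v2 a j p - c j (u2 a j p)) : ften _ _ _) (- j) 0 q : A)) (tdiff u2 a (j - 1) p)
     :> 'rV_(cone_rk G M j) by rewrite -zfam_diff -H.
  split=> a j p.
    apply: (stalk_ext (a := - j)) => [|q]; first by rewrite /dgn opprK.
    by have [/rowP /(_ q)] := eq_row_mx (H2 a j p); rewrite !mxE.
  suff K k : k = j + 1 -> - u a (k - 1) p = tdiff u2 a (k - 1) p.
    by have := K (j + 1) erefl; rewrite addrK.
  by move=> _; have [_] := eq_row_mx (H2 a k p).
split=> [u cu [v hv]|y cy].
  have [||||v2 [u2 [_ hu]]] := zb v u n (n + 1) erefl; try exact: ffP.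
  - exact: (fte_cycP u).1.
  - move=> a j p; have := congr1 (fun w : (P ⊙ N) n => w a j p) hv.
    by rewrite fte_diffE eqxx.
  rewrite -[u]opprK; apply: bndN; apply/fte_bndP; exists u2 => a j p; rewrite ftenNE; exact: hu.
have [||||v2 [u2 [hv hu]]] := zb y (fun _ _ _ => 0) (n - 1) n (esym (subrK _ _)).
- by move=> a j p ne; rewrite ffP.
- by [].
- by move=> a j p; rewrite /tdiff mactr0 sg_zero linear0 addr0.
- by move=> a j p; rewrite linear0; exact: (fte_cycP y).1.
exists (- u2); first by apply: cycN; apply/fte_cycP => a j p; rewrite -hu oppr0.
by apply/fte_bndP; exists v2 => a j p; rewrite linearN opprK ftenDE hv subrK.
Qed.
End ConeTensor.

Lemma fone_ord (S : comUnitRingType) (p : 'I_(rk (dual (fone S 0)) 0)) : p = (ord0 : 'I_1).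
Proof. exact: ord1. Qed.

Lemma fone_off (S : comUnitRingType) a (p : 'I_(rk (dual (fone S 0)) a)) : a = 0.
Proof. by apply: contrapT => ne; apply: (no_ord _ p) => /=; case: eqP. Qed.

Section FoneIn.
Variables (S : comUnitRingType) (V : cplx S).
Let e n : dgn true 0 + n = n. Proof. by rewrite /dgn oppr0 add0r. Qed.
Definition fone_in_fun n (v : V n) : (fone S 0 ⋔ V) n := @fsingle _ _ (dual (fone S 0)) V 0 n (fun=> v) n (e n).
Lemma fone_inE n (v : V n) p : fone_in_fun v 0 n p = v.
Proof. exact: fsingleE. Qed.
Lemma fone_in0 n (v : V n) a j p : a <> 0 \/ j <> n -> fone_in_fun v a j p = 0.
Proof. by move=> h; apply: fsingle0; case: h => h; [left|right] => e'; apply: h. Qed.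
Fact fone_in_linear n : linear (@fone_in_fun n).
Proof.
move=> c v w; apply: ften_eq => a j p; rewrite ftenDE ftenZE.
have [ea|ne] := pselect (a = 0); last by rewrite !fone_in0 ?scaler0 ?addr0 //; left.
subst a; have [ej|ne] := pselect (j = n); last by rewrite !fone_in0 ?scaler0 ?addr0 //; right.
by subst j; rewrite !fone_inE.
Qed.
HB.instance Definition _ n := GRing.isLinear.Build S _ _ _ (@fone_in_fun n) (@fone_in_linear n).
Fact fone_in_ax (n m : int) (v : V n) :
  fone_in_fun (diff V n m v) = diff (fone S 0 ⋔ V) n m (fone_in_fun v).
Proof.
have D0 i j : mx (dual (fone S 0)) i j = 0 by rewrite /= trmx0 scaler0.
have [en|ne] := pselect (n = m + 1); last first.
  rewrite (diff_shape (i := n) (j := m)) ?(diff_shape (i := n) (j := m) (fone_in_fun v)) ?linear0 //; by apply/eqP.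
subst n; apply: ften_eq => a j p; rewrite fte_diffE eqxx zmx_tdiff //.
have [ea|ne] := pselect (a = 0); last by rewrite !fone_in0 ?linear0 //; left.
subst a; have [ej|ne] := pselect (j = m); first by subst j; rewrite !fone_inE.
by rewrite !fone_in0 ?linear0 //; right => // h; apply: ne; lia.
Qed.
Definition fone_in : chain_map V (fone S 0 ⋔ V) :=
  @ChainMap S V (fone S 0 ⋔ V) (fun n => @fone_in_fun n) fone_in_ax.
Lemma fone_in_qi : quasi_iso fone_in.
Proof.
apply: qi_inj_surj => n.
  move=> v w /(congr1 (fun u : (fone S 0 ⋔ V) n => u 0 n (ord0 : 'I_1))).
  by rewrite [LHS]fone_inE [RHS]fone_inE.
move=> y; exists (y 0 n (ord0 : 'I_1)); apply: ften_eq => a j p.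
have ea := fone_off p; subst a; have [ej|ne] := pselect (j = n); last first.
  by rewrite [LHS]fone_in0 ?ffP //; [rewrite /dgn oppr0 add0r|right].
by subst j; rewrite [LHS]fone_inE (fone_ord p).
Qed.
End FoneIn.

(* Hom_A(S, Z) -> Hom_A(G, Z), for a free resolution G of S. *)
Section Augmentation.
Variables (A S : comUnitRingType) (psi : {rmorphism A -> S}).
Variables (G : fx false A) (g : chain_map (toc G) (restr_cplx psi (toc (fone S 0)))).
Definition aug (Z : cplx A) : chain_map (restr_cplx psi (coext_cplx psi Z)) (G ⋔ Z) :=
  chain_comp (hce g Z) (restr_map psi (fone_in (coext_cplx psi Z))).
Let e (p : 'I_(rk G 0)) : S := (g 0 (delta_mx 0 p) : 'rV[S]_1) 0 0.
Lemma aug0 Z n (f : restr_cplx psi (coext_cplx psi Z) n) a j p : a <> 0 -> (aug Z n f : ften _ _ _) a j p = 0.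
Proof.
move=> ne; rewrite /= /hce_fam /= /ev1_fun /linv big1 // => q _.
by case: ne; exact: fone_off q.
Qed.
Lemma augE Z n (f : restr_cplx psi (coext_cplx psi Z) n) p :
  (aug Z n f : ften _ _ _) 0 n p = (f : coext psi (Z n)) (e p).
Proof.
rewrite /= /hce_fam /= /ev1_fun /linv (big_ord1 _ (fun q : 'I_1 => _)).
rewrite [X in _ *: X](fone_inE (V := coext_cplx psi Z)).
by rewrite -[LHS]/((f : coext psi (Z n)) (1 * e p)) mul1r.
Qed.

Lemma aug_natural (Y Z : cplx A) (f : chain_map Y Z) n x :
  fte_map (dual G) f n (aug Y n x) = aug Z n (restr_map psi (coext_cmap psi f) n x).
Proof.
apply: ften_eq => a j p; transitivity (f j ((aug Y n x : ften _ _ _) a j p)); first by [].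
have [ea|ne] := pselect (a = 0); last by rewrite (aug0 x) // linear0 [RHS]aug0.
subst a; have [ej|ne] := pselect (j = n); first by subst j; rewrite (augE x) [RHS]augE.
have h : dgn (~~ false) 0 + j <> n by rewrite /dgn oppr0 add0r.
by rewrite (ffP (aug Y n x)) // linear0 [RHS]ffP.
Qed.

(** Compatibility of the augmentation with tensoring by [P]: it lets the statement for [P ⊙ Y] be
    deduced from the one for [Y] tensored with [P]. No sign appears since the augmentation lives at
    index 0 of [G]. *)
Lemma aug_swap (P : fx false A) (Y : cplx A) n (x : restr_cplx psi (coext_cplx psi (P ⊙ Y)) n) :
  swap (aug (P ⊙ Y) n x) = fte_map P (aug Y) n (bc_restr psi P (coext_cplx psi Y) n (restr_map psi (cfte psi P Y) n x)).
Proof.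
apply: ften_eq => b l q; apply: ften_eq => a k p; rewrite swapE.
rewrite -[RHS]/((aug Y l (@cfte_fam A S psi false P Y n x b l q) : ften _ _ _) a k p).
have [ea|ne] := pselect (a = 0); last by rewrite !aug0 // sg_zero if_same.
subst a; have [el|ne] := pselect (l = k); last first.
  rewrite [RHS]ffP; last by rewrite /dgn oppr0 add0r => h; apply: ne.
  by case: eqP => // h; case: ne; rewrite h /dgn oppr0 add0r.
subst l; rewrite (_ : k == dgn true 0 + k); last by rewrite /dgn oppr0 add0r.
rewrite mul0r sg_idx0 augE; have [en|ne] := pselect (dgn false b + k = n).
  by subst n; rewrite augE.
rewrite (ffP (aug (P ⊙ Y) n x)) /=; last by rewrite /dgn oppr0 add0r; exact: ne.
by rewrite (ffP ((x : coext psi ((P ⊙ Y) n)) (e p) : ften _ _ _)).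
Qed.

Hypothesis qg : quasi_iso g.
Lemma aug_qi Z : K_injective Z -> quasi_iso (aug Z).
Proof. by move=> kZ; apply: qi_comp (hce_qi qg kZ); apply: restr_qi; exact: fone_in_qi. Qed.
End Augmentation.

Section Truncation.
Variables (A : comUnitRingType) (Y : cplx A) (N0 : int).
(** The canonical truncation as a subcomplex: everything above [N0], cycles in degree [N0], zero
    below. *)
Definition tr_pred (j : int) (x : Y j) := (j <= N0 -> is_cycle x) /\ (j < N0 -> x = 0).
Fact tr_ax j : submodule (@tr_pred j).
Proof.
split=> [|a x y [cx x0] [cy y0]]; first by split=> // _; exact: cyc0.
split=> h; first by apply: cycD; [apply/cycZ/cx|exact: cy].
by rewrite x0 // y0 // scaler0 addr0.
Qed.
Definition tr_sub j := SubmodPred (tr_ax j).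
Fact tr_diff (i j : int) (x : Y i) : tr_sub i x -> tr_sub j (diff Y i j x).
Proof.
move=> [cx x0]; split=> h; first exact: cyc_diff.
have [e|ne] := pselect (i = j + 1); last by rewrite diff_shape //; apply/eqP.
by apply: (is_cycleP x).1; apply: cx; lia.
Qed.
Fact tr_shape (i j : int) (x : subm (tr_sub i)) : i != j + 1 -> subm_map (@tr_diff i j) x = 0.
Proof. by move=> h; apply: subm_eq; exact: diff_shape. Qed.
Fact tr_dd (i j k : int) (x : subm (tr_sub i)) : subm_map (@tr_diff j k) (subm_map (@tr_diff i j) x) = 0.
Proof. by apply: subm_eq; exact: diff_diff. Qed.
Definition trunc : cplx A := @Cplx A (fun j => subm (tr_sub j)) (fun i j => subm_map (@tr_diff i j)) tr_shape tr_dd.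
Definition tinc : chain_map trunc Y :=
  @ChainMap A trunc Y (fun j => @smval A (Y j) (tr_sub j)) (fun i j x => erefl).
Lemma trunc_bdb : bdb trunc N0.
Proof. by move=> j h x; apply: subm_eq; exact: (smvalP x).2. Qed.

Lemma tlift (X : cplx A) (f : chain_map X Y) : (forall j : int, j <= N0 -> forall x : X j, x = 0) ->
  exists f' : chain_map X trunc, forall i x, tinc i (f' i x) = f i x.
Proof.
move=> X0; have fP j (x : X j) : tr_sub j (f j x).
  by split=> h; [rewrite (X0 j h x) linear0; exact: cyc0|rewrite (X0 j (ltW h) x) linear0].
pose F j (x : X j) : trunc j := Subm (fP j x).
have Fl j : linear (@F j) by move=> a x y; apply: subm_eq; exact: (linearP (f j)).
pose FL j : {linear X j -> trunc j} := HB.pack (@F j) (GRing.isLinear.Build A _ _ _ (@F j) (@Fl j)).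
have ax (i j : int) x : FL j (diff X i j x) = diff trunc i j (FL i x) by apply: subm_eq; exact: chain_funP.
by exists (@ChainMap A X trunc FL ax).
Qed.

Lemma tinc_qi : (forall j : int, j < N0 -> acyc Y j) -> quasi_iso tinc.
Proof.
move=> ac n; split=> [x cx [y hy]|y cy].
  have [h|h] := pselect (N0 < n + 1); last by rewrite (trunc_bdb (_ : n < N0) x); [exact: bnd0|lia].
  have yP : tr_sub (n + 1) y by split=> h'; lia.
  by exists (Subm yP); apply: subm_eq.
have [h|h] := pselect (n < N0).
  by exists 0; [exact: cyc0|rewrite (linear0 (tinc n)) subr0; exact: ac].
have yP : tr_sub n y by split=> // h'.
by exists (Subm yP); [apply: subm_eq|rewrite /= subrr; exact: bnd0].
Qed.

(** Hom_A(B, -) is left exact and so turns cycles into cycles: it carries the truncation of [Y] to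
    the truncation of its own value, and the hypothesis on homology is needed for that value
    only. *)
Lemma coext_tinc_qi (B : comUnitRingType) (psi : {rmorphism A -> B}) :
  (forall j : int, j < N0 -> acyc (coext_cplx psi Y) j) -> quasi_iso (coext_cmap psi tinc).
Proof.
have clift n (y : coext psi (Y n)) : (forall b, tr_sub n (y b)) ->
    exists y' : coext psi (trunc n), forall b, smval (y' b) = y b.
  move=> yP; pose F b : trunc n := Subm (yP b).
  have FD : {morph F : a b / a + b} by move=> a b; apply: subm_eq; exact: coextD.
  have FZ a b : F (psi a * b) = a *: F b by apply: subm_eq; exact: coextZ.
  by exists (Coext FD FZ).
move=> ac n; split=> [x cx [y hy]|y cy].
  have [h|h] := pselect (N0 < n + 1); last first.
    rewrite (_ : x = 0); first exact: bnd0.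
    by apply: coext_eq => b; apply: trunc_bdb; lia.
  have [b|y' yE] := clift (n + 1) y; first by split=> h'; lia.
  exists y'; apply: coext_eq => b; apply: subm_eq; rewrite -[LHS]/(diff Y (n + 1) n (smval (y' b))) yE.
  exact: (congr1 (fun z : coext psi (Y n) => z b) hy).
have [h|h] := pselect (n < N0).
  by exists 0; [exact: cyc0|rewrite linear0 subr0; exact: ac].
have [b|y' yE] := clift n y.
  split=> // _; exact: (congr1 (fun z : coext psi (Y (n - 1)) => z b) cy).
exists y'.
  apply: coext_eq => b; apply: subm_eq; rewrite -[LHS]/(diff Y n (n - 1) (smval (y' b))) yE.
  exact: (congr1 (fun z : coext psi (Y (n - 1)) => z b) cy).
rewrite (_ : y - _ = 0); first exact: bnd0.
by apply/eqP; rewrite subr_eq0; apply/eqP/coext_eq => b; rewrite /= yE.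
Qed.
End Truncation.

Lemma fte_map_comp s (A : comUnitRingType) (P : fx s A) (X Y Z : cplx A) (g : chain_map Y Z) (f : chain_map X Y) n u :
  fte_map P (chain_comp g f) n u = chain_comp (fte_map P g) (fte_map P f) n u.
Proof. exact: ften_eq. Qed.

Lemma hom_eq_pt (A : comUnitRingType) (X Y : cplx A) (f g : chain_map X Y) :
  (forall n x, f n x = g n x) -> hom_eq f g.
Proof. by move=> h n x _; rewrite h subrr; exact: bnd0. Qed.

Section Theta.
Variables (R A F S : comUnitRingType) (rho : {rmorphism R -> A}) (pi : {rmorphism A -> F}).
Variables (psi : {rmorphism A -> S}) (phi : {rmorphism R -> S}).
Hypotheses (gf : gor_fibre rho pi) (ephi : forall x, phi x = psi (rho x)) (mf : module_finite psi).
Hypothesis nS : noetherian_local S.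
Variables (P0 : fx false R) (r : 'cV[R]_(rk P0 0)).
Hypotheses (Pr : res_field_res r) (hfd : finite_fd phi).
Let C := coext_cplx psi (ires A^o).
Variables (L : fx false S) (bL : int) (lq : chain_map (toc L) C).
Hypotheses (Lb : forall i : int, i < bL -> rk L i = 0%N) (qlq : quasi_iso lq).
Variables (PX : fx false R) (b s : int).
Hypotheses (Pb : forall i : int, i < b -> rk PX i = 0%N) (Ps : forall a : int, s < a -> exq PX a).
Variables (J : cplx A) (j0 : chain_map (toc (bc rho PX)) J).
Hypotheses (kJ : K_injective J) (qj0 : quasi_iso j0).

(* For K-injective J with P (x)_R A -> J, Hom_A(S, J) is P (x)_R L. The ring A
   is resolved by the bounded complex I', so that P (x) I' makes sense as a
   model of J compatible with Hom_A(S, -); that the latter is preserved follows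
   from the acyclicity of P (x) W, for the cone W of M -> Hom(G, A). *)
Lemma theta_diso : diso (coext_cplx psi J) (bc psi (bc rho PX) ⊙ toc L).
Proof.
(* [N0] lies below 0 and below [bL], so truncating there loses homology neither of [I], which sits
   in degree 0, nor of [C], which has the resolution [L]. *)
have [nS' _] := nS; pose I := ires A^o; pose N0 : int := - `|bL| - 1.
have lowC j : j < N0 -> acyc C j.
  move=> hj; apply/(acyc_qi j qlq) => x _; have -> : x = 0; last exact: bnd0.
  by apply: (mx_no_col (x : 'rV_(rk L j))); apply: Lb; rewrite /N0 in hj; lia.
pose I' := trunc I N0; pose inc := tinc I N0; pose C' := coext_cplx psi I'.
have qinc : quasi_iso inc.
  apply: tinc_qi => j hj; apply/(acyc_qi j (@ires_qi A A^o)) => x _.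
  by rewrite (stalk_triv x); [exact: bnd0|rewrite /N0 in hj; lia].
have qcinc : quasi_iso (coext_cmap psi inc) by exact: coext_tinc_qi.
have [|io ioE] := @tlift A I N0 (stalk A^o) (ires_map A^o).
  by move=> j hj x; apply: stalk_triv; rewrite /N0 in hj; lia.
have qio : quasi_iso io.
  apply: (qi_cancel_left (g := inc) (h := ires_map A^o)) qinc (@ires_qi A A^o).
  by apply: hom_eq_pt => n x; rewrite -ioE.
have C'b : bdb C' N0 by move=> j hj x; apply: coext_eq => y; exact: trunc_bdb.
have [l' ql'] := lift_qi Lb qcinc qlq.
pose P := bc rho PX.
have stb : bdb (stalk A^o) N0 by move=> j hj x; apply: stalk_triv; rewrite /N0 in hj; lia.
have q1 : quasi_iso (fte_map P io) by apply: (fte_qi_bdb P stb _ qio); exact: trunc_bdb.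
(* Both [P ⊙ I'] and [J] receive quasi-isomorphisms from P (x) A, so K-injectivity of [J] yields a
   comparison [th]. The aim from here on is that Hom_A(S, -) preserves it, although [P ⊙ I'] need
   not be K-injective. *)
have [th hth] := Kinj_chain kJ (chain_comp j0 (unstalk P)) q1.
have qth : quasi_iso th.
  by apply: (qi_cancel_right (homotopic_hom_eq hth) q1); exact: qi_comp (unstalk_qi P) qj0.
have [G [g [Gb qg]]] := restr_free_resolution (gf_nA gf) mf (fgh_toc _ nS') (@fone_bound S 0).
have [f0 hf0] := fdfin_fone Pr hfd.
have Gf a : f0 < a -> exq (bc pi G) a by move=> /hf0 /(fibre_tor gf ephi Pr a Gb (@fone_bound S 0) qg).
(* The truncation [I'] need not be K-injective, so [aug_qi] does not apply to it directly; the
   result is transferred from [I] along the inclusion [inc], which both Hom(G, -) and Hom_A(S, -)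
   respect. *)
have bdG := bda_dual Gb.
have qaugI : quasi_iso (aug g I') .
  apply: (qi_cancel_left (g := fte_map (dual G) inc) (h := chain_comp (aug g I) (restr_map psi (coext_cmap psi inc)))).
  - by apply: hom_eq_pt => n x; rewrite [RHS]aug_natural.
  - exact: fte_qi_bda bdG qinc.
  by apply: qi_comp (aug_qi qg (@ires_Kinj A A^o)); exact: restr_qi.
have fC' : fgh (restr_cplx psi C') by apply: (fgh_restr_up mf); apply: fgh_qi ql' _; exact: fgh_toc.
have [|M [m [Mb qm _]]] := free_resolution (gf_nA gf) fC' (b := N0).
  by move=> i hi x _; rewrite (_ : x = 0); [exact: bnd0|exact: C'b].
have qGio : quasi_iso (fte_map (dual G) io) by exact: fte_qi_bda bdG qio.
have [c hc] := lift_chain (chain_comp (aug g I') m) Mb qGio.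
have qc : quasi_iso c.
  by apply: (qi_cancel_left (homotopic_hom_eq hc) qGio); exact: qi_comp qm qaugI.
have [c0 hc0] := fibre_dual_low gf Gb Gf.
have exW := fcone_exall gf Mb hc0 qc.
have qPc : quasi_iso (fte_map P c).
  by apply: cone_tensor_qi; exact: (tens_acyclic gf Pb Ps exW).
have qPGio : quasi_iso (fte_map P (fte_map (dual G) io)).
  apply: (qi_cancel_right (f := swapc (dual G) P (stalk A^o))
    (h := chain_comp (swapc (dual G) P I') (fte_map (dual G) (fte_map P io)))).
  - by apply: hom_eq_pt => n x; exact: swap_natural.
  - exact: swap_qi.
  by apply: qi_comp (swap_qi _ _ _); exact: fte_qi_bda bdG q1.
(* Up to the resolutions [m] and [io], the augmentation of [I'] is the map [c]; tensored with [P] it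
   stays a quasi-isomorphism because the cone of [c] becomes acyclic. *)
have qPaug : quasi_iso (fte_map P (aug g I')).
  apply: (qi_cancel_right (f := fte_map P m) (h := chain_comp (fte_map P (fte_map (dual G) io)) (fte_map P c))).
  - move=> n x cx; apply: bndBC; have := @homotopic_fte A false P _ _ _ _ hc n x cx.
    by rewrite !fte_map_comp.
  - by apply: (fte_qi_bdb P (b := N0)) => //; exact: toc_bdb.
  exact: qi_comp qPc qPGio.
have qaugP : quasi_iso (aug g (P ⊙ I')).
  apply: (qi_cancel_left (g := swapc (dual G) P I') (h := chain_comp (fte_map P (aug g I'))
    (chain_comp (bc_restr psi P C') (restr_map psi (cfte psi P I'))))).
  - by apply: hom_eq_pt => n x; rewrite [RHS]aug_swap.
  - exact: swap_qi.
  by apply: qi_comp qPaug; apply: qi_comp (bc_restr_qi _ _ _); apply: restr_qi; exact: cfte_qi.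
have qcth : quasi_iso (coext_cmap psi th).
  apply: (@restr_qiP _ _ psi); apply: (qi_cancel_left (g := aug g J)
    (h := chain_comp (fte_map (dual G) th) (aug g (P ⊙ I')))) (aug_qi qg kJ) _.
    by apply: hom_eq_pt => n x; exact: aug_natural.
  by apply: qi_comp qaugP _; exact: fte_qi_bda bdG qth.
apply: diso_trans (diso_sym (diso_qi qcth)) _; apply: diso_trans (diso_qi (cfte_qi psi P I')) _.
apply/diso_sym/(@diso_qi _ _ _ (fte_map (bc psi P) l')).
by apply: (fte_qi_bdb _ (b := N0)) => //; apply: toc_bdb => i hi; apply: Lb; rewrite /N0 in hi; lia.
Qed.
End Theta.

(** Maps into a K-injective complex extend along quasi-isomorphisms, so a zigzag ending in [J]
    collapses, arrow by arrow, to a single quasi-isomorphism. *)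
Lemma Kinj_diso (A : comUnitRingType) (J X Y : cplx A) : K_injective J -> diso X Y ->
  (exists f : chain_map X J, quasi_iso f) <-> (exists f : chain_map Y J, quasi_iso f).
Proof.
move=> kJ; elim=> {X Y} [X Y [f qf]|X|X Y _ h|X Y Z _ h1 _ h2]; last by rewrite h1.
- split=> -[a qa]; last by exists (chain_comp a f); exact: qi_comp qf qa.
  have [a' ha] := Kinj_chain kJ a qf; exists a'; exact: (qi_cancel_right (homotopic_hom_eq ha) qf qa).
- by [].
by rewrite h.
Qed.

(** * Derived tensor products through free resolutions *)

Section TensorMaps.
Variables (A B : comUnitRingType) (phi : {rmorphism A -> B}).
Lemma tens_ext (M : lmodType A) (V : lmodType B) (f g : {linear tens phi M B^o -> V}) :
  (forall m n, f (tp phi m n) = g (tp phi m n)) -> forall x, f x = g x.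
Proof.
move=> h x; have [s ->] := tens_span x; rewrite !linear_sum; apply: eq_bigr => p _; exact: h.
Qed.

Fact tens_cmap_ax (X Y : cplx A) (f : chain_map X Y) (i j : int) (x : tens_cplx phi X i) :
  tens_map (f j) (diff (tens_cplx phi X) i j x) = diff (tens_cplx phi Y) i j (tens_map (f i) x).
Proof.
have := @tens_ext (X i) (tens phi (Y j) B^o) (tens_map (N := B^o) (f j) \o tens_map (diff X i j))
  (tens_map (diff Y i j) \o tens_map (f i)); apply=> m n.
by rewrite /= !tens_map_tp chain_funP.
Qed.
Definition tens_cmap (X Y : cplx A) (f : chain_map X Y) : chain_map (tens_cplx phi X) (tens_cplx phi Y) :=
  @ChainMap B (tens_cplx phi X) (tens_cplx phi Y) (fun i => tens_map (f i)) (tens_cmap_ax f).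

Lemma tens_homotopic (X Y : cplx A) (f g : chain_map X Y) : homotopic f g -> homotopic (tens_cmap f) (tens_cmap g).
Proof.
move=> [h hE]; exists (fun i j => tens_map (h i j)) => i i1 i0 x e1 e0.
have := @tens_ext (X i) (tens phi (Y i) B^o) (tens_map (N := B^o) (f i) \- tens_map (g i))
  ((tens_map (diff Y i1 i) \o tens_map (h i i1)) \+ (tens_map (h i0 i) \o tens_map (diff X i i0))); apply=> m n.
rewrite /= !tens_map_tp -tpDl -(hE i i1 i0 m e1 e0); apply/eqP; rewrite subr_eq -tpDl.
by rewrite subrK.
Qed.

Lemma tens_toc (P : fx false A) : exists f : chain_map (toc (bc phi P)) (tens_cplx phi (toc P)), quasi_iso f.
Proof.
pose F i : 'rV[B]_(rk P i) -> tens_cplx phi (toc P) i := linv (fun p => tp phi (delta_mx 0 p : toc P i) (1 : B^o) : tens_cplx phi (toc P) i).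
have FE i (x : 'rV[B]_(rk P i)) : F i x = \sum_p tp phi (delta_mx 0 p : toc P i) (x 0 p : B^o).
  by apply: eq_bigr => p _; rewrite scale_tp; congr tp; exact: mulr1.
have tpE i (m : toc P i) (n : B^o) : tp phi m n = \sum_p tp phi (delta_mx 0 p : toc P i) (phi ((m : 'rV_(rk P i)) 0 p) * n : B^o).
  rewrite {1}[m]row_sum_delta tp_suml; apply: eq_bigr => p _; exact: tpZ.
have ax (i j : int) (x : toc (bc phi P) i) : (linv (fun p => tp phi (delta_mx 0 p : toc P j) (1 : B^o) : tens_cplx phi (toc P) j))
    (diff (toc (bc phi P)) i j x) = diff (tens_cplx phi (toc P)) i j (F i x).
  rewrite -/(F j _) !FE linear_sum.
  under [RHS]eq_bigr => p _ do rewrite /= tens_map_tp tpE.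
  rewrite exchange_big; apply: eq_bigr => q _; rewrite -tp_sumr; congr tp.
  rewrite mxE; apply: eq_bigr => p _; rewrite !mxE [LHS]mulrC; congr (phi _ * _).
  rewrite (bigD1 p) //= mxE !eqxx mul1r big1 ?addr0 // => k /negbTE nk.
  by rewrite mxE eqxx nk mul0r.
exists (@ChainMap B (toc (bc phi P)) (tens_cplx phi (toc P)) (fun i => linv _) ax) => n; move: n; apply: qi_inj_surj => n.
  apply: raddf_inj => x h0; have : F n x = 0 by exact: h0.
  rewrite FE => h; apply/rowP => q; rewrite mxE.
  have := congr1 (tens_map (N := B^o) (qpi (zero_sub A (rk P n)))) h; rewrite linear_sum linear0.
  under eq_bigr => p _ do rewrite /= tens_map_tp.
  move=> /(tens_quo0P phi (zero_sub A (rk P n)) (x 0 : _ -> B^o)).1 [m [k [a [k0 ->]]]].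
  by rewrite big1 // => l _; rewrite k0 mxE rmorph0 scale0r.
move=> y; have [s ->] := tens_span y.
exists (\sum_(m <- s) (\row_p (phi ((m.1 : 'rV[A]_(rk P n)) 0 p) * (m.2 : B)) : 'rV[B]_(rk P n))).
rewrite linear_sum; apply: eq_bigr => m _; apply: etrans (FE n _) _; rewrite tpE.
by apply: eq_bigr => p _; rewrite mxE.
Qed.

(** The comparison [k] from [P] to [Q] has the left inverse [h] and the right inverse [m] up to
    homotopy. Tensoring preserves homotopies, so it carries [k] to a quasi-isomorphism without any
    flatness argument. *)
Lemma tens_resolution (X Q : cplx A) (P : fx false A) b (f : chain_map Q X) (q : chain_map (toc P) X) :
  K_projective Q -> quasi_iso f -> (forall i : int, i < b -> rk P i = 0%N) -> quasi_iso q ->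
  diso (tens_cplx phi Q) (toc (bc phi P)).
Proof.
move=> kQ qf Pb qq; have [h hh] := Kproj_lift f kQ qq.
have qh : quasi_iso h := qi_cancel_left (homotopic_hom_eq hh) qq qf.
have [k hk] := lift_chain (chain_id (toc P)) Pb qh.
have qk : quasi_iso k := qi_cancel_left (homotopic_hom_eq hk) qh (qi_id _).
have [m hm] := Kproj_lift (chain_id Q) kQ qk.
have tid Y n (x : tens_cplx phi Y n) : tens_cmap (chain_id Y) n x = x.
  by apply: (@tens_ext (Y n) _ (tens_cmap (chain_id Y) n) idfun) => u v; exact: tens_map_tp.
have tcomp Y Z V (a : chain_map Y Z) (c : chain_map Z V) n x :
    tens_cmap (chain_comp c a) n x = tens_cmap c n (tens_cmap a n x).
  apply: (@tens_ext (Y n) _ (tens_cmap (chain_comp c a) n) (tens_cmap c n \o tens_cmap a n)) => u v.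
  by rewrite /= !tens_map_tp.
have qtk : quasi_iso (tens_cmap k).
  move=> n; split=> [x cx bx|y cy].
    have := homotopic_hom_eq (tens_homotopic hk) cx; rewrite tid tcomp => h1.
    by apply: bnd_sub h1 _; exact: chain_bnd.
  have := homotopic_hom_eq (tens_homotopic hm) cy; rewrite tid tcomp => h1.
  by exists (tens_cmap m n y) => //; exact: chain_cyc.
have [t qt] := tens_toc P.
exact: diso_trans (diso_sym (diso_qi qtk)) (diso_sym (diso_qi qt)).
Qed.
End TensorMaps.

(** * The theorem *)

Lemma homologically_finite_fgh (A : comUnitRingType) (X : cplx A) : homologically_finite X ->
  fgh X /\ exists c : int, forall n : int, c < `|n| -> acyc X n.
Proof.
move=> [N [g [cg gg]]]; pose z n l : X n := untag 0 (fun y : X n => y) (g l).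
have zE n (l : 'I_N) (c : A) : untag 0 (fun y : X n => c *: y) (g l) = c *: z n l.
  by rewrite /z /untag; case: eqP => // _; rewrite scaler0.
split=> [n|].
  exists N, (z n); split=> [l|x cx].
    rewrite /z; have := cg l; case: (g l) => m y /= cy; rewrite /untag; case: eqP => [e|_]; last exact: cyc0.
    by case: n / e.
  have [c bc] := gg n x cx; exists c; move: bc.
  by rewrite (eq_bigr (fun l => c l *: z n l)) // => l _; exact: zE.
exists (\sum_l `|tag (g l)|) => n hn x cx; have [c] := gg n x cx.
rewrite big1 ?subr0 // => l _; rewrite zE /z /untag; case: eqP => [e|_]; last by rewrite scaler0.
have : `|tag (g l)| <= \sum_l `|tag (g l)| by rewrite (bigD1 l) //= lerDl; apply: sumr_ge0.
by rewrite e leNgt hn.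
Qed.

Lemma homology_rank_hrank (k : fieldType) (Z : cplx k) n r : homology_rank Z n r -> hrank Z n r.
Proof.
move=> [z [cz hz]]; exists z; split=> // [x cx|c].
  by have [c [bc _]] := hz x cx; exists (c 0).
split=> [bc l|c0]; last first.
  by rewrite big1 => [|l _]; [exact: bnd0|have /field_max -> := c0 l; rewrite scale0r].
have cc : is_cycle (\sum_l c l *: z l) by exact: bnd_cyc.
have [d [_ du]] := hz _ cc; apply/field_max.
have e1 : d = \row_l c l.
  apply: du; have -> : \sum_k0 (\row_l0 c l0) 0 k0 *: z k0 = \sum_l c l *: z l.
    by apply: eq_bigr => l' _; rewrite mxE.
  by rewrite subrr; exact: bnd0.
have e2 : d = 0.
  apply: du; have -> : \sum_k0 (0 : 'rV[k]_r) 0 k0 *: z k0 = 0.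
    by rewrite big1 // => l' _; rewrite mxE scale0r.
  by rewrite subr0.
by have := congr1 (fun v : 'rV_r => v 0 l) e1; rewrite e2 !mxE.
Qed.

Lemma diso_grank (A : comUnitRingType) (J : A -> Prop) (X Y : cplx A) t r : diso X Y ->
  grank J X t r <-> grank J Y t r.
Proof.
elim=> {X Y} [X Y [f qf]|X|X Y _ h|X Y Z _ h1 _ h2]; first exact: grank_qi.
- by [].
- by rewrite h.
by rewrite h1.
Qed.

Lemma monomial_mul (b : int -> nat) (e n : int) : laurent_mul b (laurent_monomial e) n = b (n - e).
Proof.
rewrite /laurent_mul -(fsbig_widen [set n - e]%classic) ?fsbig_set1 //.
  have -> : n - (n - e) = e by lia.
  by rewrite /laurent_monomial eqxx muln1.
move=> i /= [_ ne]; rewrite /laurent_monomial; case: eqP => [h|_]; last by rewrite muln0.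
by case: ne; rewrite -h /=; lia.
Qed.

Lemma factorization_fibre (R A S : comUnitRingType) (phi : {rmorphism R -> S}) (rho : {rmorphism R -> A})
    (psi : {rmorphism A -> S}) : noetherian_local R -> gorenstein_factorization phi rho psi ->
  exists (F : comUnitRingType) (pi : {rmorphism A -> F}), gor_fibre rho pi.
Proof.
by move=> [nR lR] [[nA lA] [lr _] _ _ [fl [F [pi [pS pK gF]]]]]; exists F, pi; split.
Qed.

Lemma surj_module_finite (A S : comUnitRingType) (psi : {rmorphism A -> S}) :
  (forall y, exists x, psi x = y) -> module_finite psi.
Proof. by move=> h; exists [:: 1] => y; have [x <-] := h y; exists (fun=> x); rewrite big_ord1 mulr1. Qed.

Lemma toc_bc_id (A : comUnitRingType) (P : fx false A) : diso (toc (bc idfun P)) (toc P).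
Proof.
apply: diso_trans (diso_sym (diso_qi (unstalk_qi _))) _.
have [f qf] := bc_id_qi P (stalk A^o); apply: diso_trans (diso_qi qf) _.
exact: diso_qi (unstalk_qi P).
Qed.

Section Main.
Variables (R S : comUnitRingType) (phi : {rmorphism R -> S}).
Hypotheses (nR : noetherian_local R) (nS : noetherian_local S) (phi_fd : finite_fd phi).
Variables (P0 : fx false R) (r : 'cV[R]_(rk P0 0)).
Hypothesis Pr : res_field_res r.
Variables (mu : int -> nat).
Hypothesis hmu : forall t, hrank (P0 ⋔ stalk R^o) t (mu t).
Variables (X : cplx R) (PX : fx false R) (qX : chain_map (toc PX) X) (b s : int).
Hypotheses (Pb : forall i : int, i < b -> rk PX i = 0%N) (Ps : forall a : int, s < a -> exq PX a).
Hypothesis qqX : quasi_iso qX.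
Variables (l : fieldType) (sigma : {rmorphism S -> l}).
Hypothesis rs : residue_field sigma.

(** By [bass_depth] the sequence [mu] has its top nonzero value at minus the depth of [R]; shifting
    by [g] must move that top to the top [- c] of [nu]. *)
Lemma top_bass (nu : int -> nat) (c g : int) : (forall t, nu t = mu (t - g)) ->
  nu (- c) <> 0%N -> (forall t : int, - c < t -> nu t = 0%N) -> c = (depth R)%:Z - g.
Proof.
move=> e n0 nt; have [m0 mt] := bass_depth nR Pr hmu.
have h1 : - c - g <= - (depth R)%:Z by rewrite leNgt; apply/negP => /mt; rewrite -e.
have h2 : - (depth R)%:Z + g <= - c.
  by rewrite leNgt; apply/negP => /nt; rewrite e addrK.
lia.
Qed.

Lemma fte_shift_diso (L L' : fx false S) (e : int) (bL bL' : int) (Y Y' : cplx S)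
    (f : chain_map (toc L) (shift e (toc L'))) :
  (forall i : int, i < bL -> rk L i = 0%N) -> (forall i : int, i < bL' -> rk L' i = 0%N) ->
  quasi_iso f -> diso Y (bc phi PX ⊙ toc L) -> diso Y' (bc phi PX ⊙ toc L') -> diso Y (shift e Y').
Proof.
move=> Lb Lb' qf dY dY'; apply: diso_trans dY _; apply: diso_trans (diso_sym (diso_shift e dY')).
pose N0 : int := - `|bL| - `|bL'| - `|e|.
have q : quasi_iso (fte_map (bc phi PX) f).
  apply: (fte_qi_bdb _ (b := N0)) qf => [|j hj x].
    by apply: toc_bdb => i hi; apply: Lb; rewrite /N0 in hi; lia.
  by apply: (mx_no_col (x : 'rV_(rk L' (j - e)))); apply: Lb'; rewrite /N0 in hj; lia.
have [h qh] := fte_shift (bc phi PX) (toc L') e.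
exact: diso_trans (diso_qi q) (diso_qi qh).
Qed.

Section OneFactor.
Variables (A F : comUnitRingType) (rho : {rmorphism R -> A}) (pi : {rmorphism A -> F}).
Variables (psi : {rmorphism A -> S}).
Hypotheses (gf : gor_fibre rho pi) (ephi : forall x, phi x = psi (rho x)) (mf : module_finite psi).
Hypothesis psil : local_hom psi.

(* [L] is a free resolution of RHom_A(S, A), whose Bass numbers are those of R
   shifted by [g0]; RHom_A(S, X (x)_R A) is then X (x)_R L. *)
Definition dualizing_data (g0 : int) (L : fx false S) (bL : int) (q : chain_map (toc L) (coext_cplx psi (ires A^o))) :=
  [/\ forall t, hrank (coext_cplx sigma (coext_cplx psi (ires A^o))) t (mu (t - g0)),
      forall i : int, i < bL -> rk L i = 0%N, quasi_iso q & fdfin phi P0 (toc L)].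

Lemma dualizing_ex : exists g0 L bL q, [/\ injective_module (F^o : lmodType F) -> g0 = 0,
  @dualizing_data g0 L bL q & forall T Y, diso (toc (bc rho PX)) T -> is_RHom psi T Y ->
    diso Y (bc phi PX ⊙ toc L)].
Proof.
have [g0 [g00 hg]] := factor_bass gf mf Pr rs psil.
have [L [bL [q [Lb qq fdL]]]] := dualizing_resolution gf ephi mf nS Pr phi_fd.
exists g0, L, bL, q; split=> //; first by split=> //; exact: hg.
move=> T Y dT [J [f [kJ qf dJ]]].
have [j0 qj0] := (Kinj_diso kJ dT).2 (ex_intro _ f qf).
apply: diso_trans (diso_sym dJ) _.
apply: diso_trans (theta_diso gf ephi mf nS Pr phi_fd Lb qq Pb Ps kJ qj0) _.
have [h qh] : exists h : chain_map (bc psi (bc rho PX) ⊙ toc L) (bc phi PX ⊙ toc L), quasi_iso h.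
  by apply: (@fx_same _ _ (bc phi PX)) => i k; apply/matrixP => p p'; rewrite !mxE -ephi.
exact: diso_qi qh.
Qed.

(** As [psi] is surjective and local, the residue field of [S] is also that of [A], so the Bass
    numbers in [dualizing_data] are those of [A]. They are [mu] shifted by [g0], with top at minus
    the depth of [A]. *)
Lemma dualizing_depth g0 L bL q : (forall y, exists x, psi x = y) -> @dualizing_data g0 L bL q ->
  g0 = - depth_hom rho.
Proof.
move=> psiS [hC _ _ _]; have nA : noetherian_local A by split; [exact: gf_nA gf|exact: gf_lA gf].
have [PA [rA PrA]] := res_field_res_ex nA.
pose tau : {rmorphism A -> l} := sigma \o psi.
have rt : residue_field tau.
  split=> [y|x]; first by have [z <-] := rs.1 y; have [x <-] := psiS z; exists x.
  split=> [/rs.2 h|/psil h]; last by apply/rs.2.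
  by apply/negP => ux; move/negP: h; apply; exact: rmorph_unit.
have e x : tau x = sigma (psi x) by [].
have hA t : hrank (PA ⋔ stalk A^o) t (mu (t - g0)).
  apply/(bass_residue nA PrA t _ rt (@ires_Kinj A A^o) (@ires_qi A A^o)).
  by apply: (grank_qi _ t _ (ccomp_qi e (ires A^o))).1; exact: hC.
have [h1 h2] := bass_depth nA PrA hA.
by rewrite /depth_hom (top_bass (g := g0) _ h1 h2) //; lia.
Qed.

Lemma compare g0 L bL q g1 (L' : fx false S) bL' (T J : cplx S) (j : chain_map T J) (q' : chain_map T (toc L')) (c' : int) :
  @dualizing_data g0 L bL q -> (forall t, hrank (coext_cplx sigma J) t (mu (t - g1))) ->
  (forall i, injective_module (J i)) -> (forall j : int, c' < j -> forall x : J j, x = 0) ->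
  quasi_iso j -> quasi_iso q' ->
  (forall i : int, i < bL' -> rk L' i = 0%N) -> fdfin phi P0 (toc L') ->
  exists f : chain_map (toc L') (shift (g1 - g0) (toc L)), quasi_iso f.
Proof.
move=> [hC Lb qq fdL] hJ iJ bJ qj qq' Lb' fdL'; have [m0 mt] := bass_depth nR Pr hmu.
have [f qf] := factor_compare gf ephi mf nS Pr rs hC hJ (ex_intro (fun t => mu t <> 0%N) _ m0) mt iJ bJ qj qq' Lb' fdL'.
have [h qh] := shift_map_qi (g1 - g0) qq.
exact: (lift_qi Lb' qh qf).
Qed.
End OneFactor.
End Main.

Theorem theorem6p5 (R S : comUnitRingType) (phi : {rmorphism R -> S})
  (R_local : noetherian_local R) (S_local : noetherian_local S)
  (phi_local : local_hom phi) (phi_fd : finite_fd phi)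
  (X : cplx R) (X_finite : homologically_finite X)
  (R1 : comUnitRingType) (phid1 : {rmorphism R -> R1})
  (phi1' : {rmorphism R1 -> S})
  (fact1 : gorenstein_factorization phi phid1 phi1')
  (R2 : comUnitRingType) (phid2 : {rmorphism R -> R2})
  (phi2' : {rmorphism R2 -> S})
  (fact2 : gorenstein_factorization phi phid2 phi2')
  (* T_i = X (x)^L_R R_i and Y_i = RHom_(R_i)(S, T_i) *)
  (T1 : cplx R1) (T1P : is_LTensor phid1 X T1)
  (T2 : cplx R2) (T2P : is_LTensor phid2 X T2)
  (Y1 : cplx S) (Y1P : is_RHom phi1' T1 Y1)
  (Y2 : cplx S) (Y2P : is_RHom phi2' T2 Y2) :
  let d := depth_hom phi in
  let d1 := depth_hom phid1 in
  let d2 := depth_hom phid2 in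
  [/\ diso (shift d1 Y1) (shift d2 Y2),
      gorenstein_at phi ->
        forall U : cplx S, is_LTensor phi X U ->
          diso (shift d1 Y1) (shift d U) /\ diso (shift d2 Y2) (shift d U)
    & module_finite phi ->
        forall V : cplx S, is_RHom phi X V ->
          diso (shift d1 Y1) V /\ diso (shift d2 Y2) V].
Proof.
move=> d d1 d2; have [nR lR] := R_local; have [nS lS] := S_local.
have [P0 [r Pr]] := res_field_res_ex R_local.
have [mu hmu] := bass_numbers R_local Pr.
have rs := res_piP lS.
have [fX [c0 hX]] := homologically_finite_fgh X_finite.
have [|PX [qX [Pb qqX _]]] := free_resolution nR fX (b := - `|c0|).
  by move=> i hi; apply: hX; lia.
have Ps a : `|c0| < a -> exq PX a.
  by move=> ha; apply/exq_toc; apply/(acyc_qi a qqX); apply: hX; lia.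
have [F1 [pi1 gf1]] := factorization_fibre R_local fact1.
have [F2 [pi2 gf2]] := factorization_fibre R_local fact2.
have [_ [_ psil1] ephi1 psiS1 _] := fact1; have [_ [_ psil2] ephi2 psiS2 _] := fact2.
have ltens (B : comUnitRingType) (rho : {rmorphism R -> B}) T : is_LTensor rho X T -> diso (toc (bc rho PX)) T.
  move=> [Q [f [kQ qf dQ]]].
  exact: diso_trans (diso_sym (tens_resolution rho kQ qf Pb qqX)) dQ.
have [g1 [L1 [b1 [q1 [_ D1 H1]]]]] :=
  dualizing_ex S_local phi_fd Pr hmu Pb Ps rs gf1 ephi1 (surj_module_finite psiS1) psil1.
have [g2 [L2 [b2 [q2 [_ D2 H2]]]]] :=
  dualizing_ex S_local phi_fd Pr hmu Pb Ps rs gf2 ephi2 (surj_module_finite psiS2) psil2.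
have e1 : g1 = - d1 := dualizing_depth R_local Pr hmu rs gf1 psil1 psiS1 D1.
have e2 : g2 = - d2 := dualizing_depth R_local Pr hmu rs gf2 psil2 psiS2 D2.
have dY1 := H1 _ _ (ltens _ _ _ T1P) Y1P; have dY2 := H2 _ _ (ltens _ _ _ T2P) Y2P.
have shifts (Y Y' : cplx S) (a a' e : int) : a + e = a' -> diso Y (shift e Y') -> diso (shift a Y) (shift a' Y').
  move=> ea dY; apply: diso_trans (diso_shift a dY) _.
  by have [f qf] := @shift_shift S Y' a e a' ea; exact: diso_qi qf.
have [hC1 Lb1 qq1 fd1] := D1.
split.
(* The complex RHom(S, R_1) of the first factorization, with its resolution [L1], is compared with
   the dualizing complex of the second; by [e1] and [e2] the shift [g1 - g2] equals [d2 - d1]. *)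
- have [f qf] := compare R_local S_local Pr hmu rs gf2 ephi2 (surj_module_finite psiS2) D2 hC1
    (@dualizing_inj _ _ phi1') (@dualizing_bd _ _ phi1') qq1 (qi_id _) Lb1 fd1.
  have [_ Lb2 _ _] := D2.
  apply: (shifts _ _ _ _ (g1 - g2)); first by rewrite e1 e2; lia.
  exact: fte_shift_diso Lb1 Lb2 qf dY1 dY2.
- move=> [e [_ [bR [bS [[k [pk [Z [rk_ [J [j [kJ qj dJ]]] hZ]]]] [k' [pk' [Z' [rk' [J' [j' [kJ' qj' dJ']]] hZ']]]] hb]]]]] U UP.
  have [PS [rS PrS]] := res_field_res_ex S_local.
  have hbR i : bR i = mu (- i).
    apply: (hrank_uniq lR _ (hmu (- i))); apply/(bass_residue R_local Pr _ _ rk_ kJ qj).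
    by apply/(diso_grank _ _ _ dJ); exact: homology_rank_hrank.
  have hbS t : hrank (PS ⋔ stalk S^o) t (mu (t + e)).
    have := homology_rank_hrank (hZ' (- t)); rewrite opprK hb monomial_mul hbR => h.
    apply/(bass_residue S_local PrS _ _ rk' kJ' qj'); apply/(diso_grank _ _ _ dJ').
    by have -> : t + e = - (- t - e) by lia.
  (* The Bass numbers of [S] are [mu] shifted by [- e]; comparing the top nonzero degrees expresses
     [e] by the depths of [R] and [S]. *)
  have ed : d = e.
    have [h1 h2] := bass_depth S_local PrS hbS.
    have := top_bass R_local Pr hmu (g := - e) (nu := fun t => mu (t + e)) _ h1 h2.
    move=> /(_ (fun t => congr1 (fun u => mu (t + u)) (esym (opprK e)))).
    by rewrite /d /depth_hom; lia.
  (* Here an injective resolution of [S] itself takes the place of the complex coming from a second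
     factorization, with [S] in degree 0 as its free resolution. *)
  have hJ t : hrank (coext_cplx (res_pi lS) (ires S^o)) t (mu (t - - e)).
    rewrite opprK; apply/(bass_residue S_local PrS _ _ rs (@ires_Kinj S S^o) (@ires_qi S S^o)); exact: hbS.
  have [st qst] := stalk_toc_fone S.
  have dU : diso U (bc phi PX ⊙ toc (fone S 0)).
    apply: diso_trans (diso_sym (ltens _ _ _ UP)) _.
    apply: diso_trans (diso_sym (diso_qi (unstalk_qi (bc phi PX)))) _.
    apply: (@diso_qi _ _ _ (fte_map (bc phi PX) st)); apply: (fte_qi_bdb _ (b := 0)) => // i hi x.
      by apply: stalk_triv; lia.
    by apply: mx_no_col; exact: fone_bound hi.
  have cmp (A F : comUnitRingType) (rho : {rmorphism R -> A}) (pi : {rmorphism A -> F}) (psi : {rmorphism A -> S})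
      g L bL q Y : gor_fibre rho pi -> (forall x, phi x = psi (rho x)) -> (forall y, exists x, psi x = y) ->
      @dualizing_data R S phi P0 mu _ (res_pi lS) A psi g L bL q -> g = - depth_hom rho ->
      diso Y (bc phi PX ⊙ toc L) -> diso (shift (depth_hom rho) Y) (shift d U).
    move=> gf ephi psiS D eg dY.
    have [f qf] := compare R_local S_local Pr hmu rs gf ephi (surj_module_finite psiS) D hJ
      (@ires_inj S S^o) (@ires_bd S S^o) (@ires_qi S S^o) qst (@fone_bound S 0) (fdfin_fone Pr phi_fd).
    have [_ Lb _ _] := D; apply: diso_sym; apply: (shifts _ _ _ _ (- e - g)); first by rewrite eg ed; lia.
    exact: fte_shift_diso (@fone_bound S 0) Lb qf dU dY.
  split; [exact: cmp gf1 ephi1 psiS1 D1 e1 dY1|exact: cmp gf2 ephi2 psiS2 D2 e2 dY2].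
move=> phi_mf V VP.
(* The factorization through [R] itself has [phi] as second map, which is module-finite and local.
   As [dualizing_depth] asks for a surjection, the shift is read off the fibre instead: a field is
   injective over itself, so [g3] is 0. *)
have gf3 := gor_fibre_id R_local (res_piP lR).
have [g3 [L3 [b3 [q3 [z3 D3 H3]]]]] :=
  dualizing_ex S_local phi_fd Pr hmu Pb Ps rs gf3 (fun x => erefl) phi_mf phi_local.
have g30 : g3 = 0 by apply: z3; exact: field_injective.
have [hC3 Lb3 qq3 fd3] := D3.
have dV : diso V (bc phi PX ⊙ toc L3).
  by apply: H3 VP; exact: diso_trans (toc_bc_id PX) (diso_qi qqX).
have cmp (A F : comUnitRingType) (rho : {rmorphism R -> A}) (pi : {rmorphism A -> F}) (psi : {rmorphism A -> S})
    g L bL q Y : gor_fibre rho pi -> (forall x, phi x = psi (rho x)) -> (forall y, exists x, psi x = y) ->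
    @dualizing_data R S phi P0 mu _ (res_pi lS) A psi g L bL q -> g = - depth_hom rho ->
    diso Y (bc phi PX ⊙ toc L) -> diso (shift (depth_hom rho) Y) V.
  move=> gf ephi psiS D eg dY.
  have [f qf] := compare R_local S_local Pr hmu rs gf ephi (surj_module_finite psiS) D hC3
    (@dualizing_inj _ _ phi) (@dualizing_bd _ _ phi) qq3 (qi_id _) Lb3 fd3.
  have [_ Lb _ _] := D; apply: diso_sym.
  have -> : depth_hom rho = g3 - g by rewrite g30 eg; lia.
  exact: fte_shift_diso Lb3 Lb qf dV dY.
split; [exact: cmp gf1 ephi1 psiS1 D1 e1 dY1|exact: cmp gf2 ephi2 psiS2 D2 e2 dY2].
Qed.
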